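(* Let $X$ be a non-degenerate real random variable such that $\varphi(t):=\log \mathbb{E}[e^{tX}]$ is finite for all $t\ge 0$, and assume that the distribution of $X$ is non-lattice. Let $c_1:=\varphi'(1)-\varphi(1)$ and $c_2:=2\varphi'(2)-\varphi(2)$, and let $c\in(0,c_2)$. Let $\{X_{i,j}:(i,j)\in\mathbb{N}^2\}$ be independent copies of $X$, let $\{N_n\}_{n\in\mathbb{N}}$ be a sequence of natural numbers with $\lim_{n\to\infty}e^{-cn}N_n=1$, and let $Z_n=\sum_{i=1}^{N_n}\prod_{j=1}^n e^{X_{i,j}}$. Let $\alpha\in(0,2)$ be the unique solution of $I(\varphi'(\alpha))=c$, and let $\beta=\varphi'(\alpha)$. Set $$B_n=e^{b_n},\qquad b_n=\beta n-\alpha^{-1}\log\left(\alpha\sqrt{2\pi\varphi''(\alpha)n}\right),$$ $$A_n=\begin{cases}\mathbb{E}Z_n=N_ne^{\varphi(1)n}, & c\in(c_1,c_2),\\ N_n\mathbb{E}[e^{S_n}1_{S_n\le b_n}]\ \text{ with } S_n=\sum_{j=1}^nX_{1,j}, & c=c_1,\\ 0, & c\in(0,c_1).\end{cases}$$ Then, as $n\to\infty$, $$\frac{Z_n-A_n}{B_n}\to\mathcal{F}_\alpha\quad\text{in distribution,}$$ where $\mathcal{F}_\alpha$ is the $\alpha$-stable distribution with skewness parameter $+1$ whose characteristic function $\phi_\alpha$ is given by $$\log\phi_\alpha(u)=\begin{cases}-\Gamma(1-\alpha)|u|^\alpha\exp\left(-i\frac{\pi}{2}\alpha\operatorname{sgn}(u)\right),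 & \alpha\ne1,\\ iu(1-\gamma)-|u|\left(\frac{\pi}{2}+i\operatorname{sgn}(u)\log|u|\right), & \alpha=1,\end{cases}$$ where $\gamma$ is the Euler constant.
   Context: Non-degenerate means not almost surely constant. A random variable $X$ is called lattice if there exist $h,a\in\mathbb{R}$ such that the values of $X$ are a.s. of the form $hn+a$, $n\in\mathbb{Z}$; otherwise it is non-lattice. Under the hypothesis on $\varphi$, $\varphi$ is infinitely differentiable and strictly convex on $(0,\infty)$. With $\beta_0:=\lim_{t\to0+}\varphi'(t)=\mathbb{E}X\in[-\infty,\infty)$, the function $I:(\beta_0,+\infty)\to(0,+\infty]$ is defined by $I(\beta)=\sup_{t\ge0}(\beta t-\varphi(t))$. For every $\alpha>0$ one has $I(\varphi'(\alpha))=\alpha\varphi'(\alpha)-\varphi(\alpha)$; the function $\alpha\mapsto I(\varphi'(\alpha))$, $\alpha>0$, is continuous, strictly increasing and tends to $0$ as $\alpha\to0+$. In particular $c_1=I(\varphi'(1))$, $c_2=I(\varphi'(2))$ and $0<c_1<c_2<\infty$. At $u=0$ the expression $|u|\log|u|$ is read as $0$. *)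

(* Defs.v *)
From HB Require Import structures.
From mathcomp Require Import all_boot all_order all_algebra archimedean.
From mathcomp Require Import all_classical all_reals all_analysis.
From mathcomp.real_closed Require Import complex.
Set Implicit Arguments.
Unset Strict Implicit.
Unset Printing Implicit Defensive.
Import Order.TTheory GRing.Theory Num.Theory.
Import numFieldNormedType.Exports.
Local Open Scope classical_set_scope.
Local Open Scope ring_scope.

Section RandomVariables.
Context d (T : measurableType d) (R : realType) (P : probability T R).

Definition degenerate (X : {RV P >-> R}) : Prop :=
  exists a : R, {ae P, forall w, X w = a}.

Definition lattice (X : {RV P >-> R}) : Prop :=
  exists h a : R, {ae P, forall w, exists n : int, X w = h * n%:~R + a}.

Definition independent (I : eqType) (Y : I -> {RV P >-> R}) : Prop :=
  forall (s : seq I) (B : I -> set R), uniq s -> (forall k, measurable (B k)) ->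
    P (\bigcap_(k in [set` s]) (Y k @^-1` B k)) =
    (\prod_(k <- s) P (Y k @^-1` B k))%E.

(* Convergence of the distribution functions at every continuity point of the
   limiting one. *)
Definition cvg_in_distribution (W : nat -> T -> R)
    (mu : probability (measurableTypeR R) R) : Prop :=
  forall x : R, {for x, continuous (fun y : R => fine (mu `]-oo, y]%classic))} ->
    P (W n @^-1` `]-oo, x]%classic) @[n --> \oo] --> mu `]-oo, x]%classic.

(* 'M_P X t is positive, so the only junk value is at t with 'M_P X t = +oo. *)
Definition log_mgf (X : {RV P >-> R}) (t : R) : R := ln (fine ('M_P X t)).

End RandomVariables.

Section Functions.
Context (R : realType).

(* The function I associated with phi; it may take the value +oo. *)
Definition rate (phi : R -> R) (b : R) : \bar R :=
  ereal_sup [set (b * t - phi t)%:E | t in `[0, +oo[%classic].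

Definition gamma_integral (s : R) : R :=
  \int[lebesgue_measure]_(x in `]0, +oo[%classic) (x `^ (s - 1) * expR (- x)).

(* Gamma at every real s that is not a pole: the integral for s > 0, extended
   by Gamma(s) = Gamma(s + m) / (s (s + 1) ... (s + m - 1)), where m is the
   least natural number with s + m > 0. *)
Definition Gamma (s : R) : R :=
  let m := if 0 < s then 0%N else (Num.truncn (- s)).+1 in
  gamma_integral (s + m%:R) / \prod_(k < m) (s + k%:R).

Definition euler_gamma : R :=
  lim ((\sum_(1 <= k < n.+1) k%:R^-1 - ln n%:R : R) @[n --> \oo]).

Definition cexp (z : R[i]) : R[i] :=
  Complex (expR (complex.Re z) * cos (complex.Im z)) (expR (complex.Re z) * sin (complex.Im z)).

Definition charfun (mu : probability (measurableTypeR R) R) (u : R) : R[i] :=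
  Complex (\int[mu]_x cos (u * x)) (\int[mu]_x sin (u * x)).

(* For alpha = 1 and u = 0 the term |u| log |u| is 0. *)
Definition stable_log_charfun (alpha u : R) : R[i] :=
  if alpha != 1 then
    - (Gamma (1 - alpha) * `|u| `^ alpha)%:C%C
      * cexp (- 'i%C * (pi / 2 * alpha * Num.sg u)%:C%C)
  else
    'i%C * (u * (1 - euler_gamma))%:C%C
      - `|u|%:C%C * ((pi / 2)%:C%C + 'i%C * (Num.sg u * ln `|u|)%:C%C).

(* The totally skewed alpha-stable law F_alpha, which is determined by its
   characteristic function. *)
Definition is_stable_law (alpha : R) (mu : probability (measurableTypeR R) R) :
  Prop := forall u : R, charfun mu u = cexp (stable_log_charfun alpha u).

End Functions.

(* Row and column indices start at 0. *)
Section PartitionFunction.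
Context d (T : measurableType d) (R : realType) (P : probability T R).
Context (X : nat -> nat -> {RV P >-> R}) (N : nat -> nat).

Definition Zsum (n : nat) (w : T) : R :=
  \sum_(i < N n) \prod_(j < n) expR (X i j w).

Definition Ssum (n : nat) (w : T) : R := \sum_(j < n) X 0%N j w.

Definition scale_exponent (phi : R -> R) (alpha : R) (n : nat) : R :=
  derive1 phi alpha * n%:R
    - alpha^-1 * ln (alpha * Num.sqrt (2 * pi * derive1n 2 phi alpha * n%:R)).

Definition centering (phi : R -> R) (c alpha : R) (n : nat) : R :=
  let c1 := derive1 phi 1 - phi 1 in
  let b := scale_exponent phi alpha n in
  if c1 < c then fine 'E_P[Zsum n]
  else if c == c1 then
    (N n)%:R *
      fine 'E_P[fun w => expR (Ssum n w) * \1_[set w' | Ssum n w' <= b] w]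
  else 0.

End PartitionFunction.

(* Main.v *)
Require Import Defs.
From HB Require Import structures.
From mathcomp Require Import all_boot all_order all_algebra archimedean.
From mathcomp Require Import all_classical all_reals all_analysis.
From mathcomp.real_closed Require Import complex.
From mathcomp Require Import measurable_realfun.
From mathcomp Require Import ring lra zify.
Set Implicit Arguments.
Unset Strict Implicit.
Unset Printing Implicit Defensive.
Import Order.TTheory GRing.Theory Num.Theory.
Import numFieldNormedType.Exports.
Local Open Scope classical_set_scope.
Local Open Scope ring_scope.

(* Put W_n = S_n - b_n. By independence the characteristic function of
   (Z_n - A_n) / B_n at u is the N_n-th power of E exp (iu (e^(W_n) - a_n)) with
   a_n = E[e^(W_n) h(W_n)], where h is 0, the indicator of ]-oo, 0], or 1
   according to whether alpha < 1, alpha = 1 or alpha > 1.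

   Tilting X by e^(alpha X) moves its mean to beta. A local limit theorem for
   the tilted walk, which holds because X is non-lattice, together with the
   choice of b_n and N_n ~ e^(cn), gives
     N_n E g(W_n) -> alpha \int g(x) e^(- alpha x) dx
   for every g, continuous off one point, such that g(x) e^(- alpha x) decays
   exponentially. With g(x) = cos (u e^x) - 1 and
   g(x) = sin (u e^x) - u e^x h(x), and since N_n a_n^2 -> 0, the N_n-th power
   converges to exp of the Levy-Khintchine integral
     alpha \int (exp (iu e^x) - 1 - iu e^x h(x)) e^(- alpha x) dx,
   which is evaluated by rotating the line of integration by i pi / 2 towards
   Euler's integral. The limit is integrable in u, so Fourier inversion yields
   the density of F_alpha and the convergence of the distribution functions.
   The local limit theorem itself follows from the same continuity argument,
   applied to the weights N_n e^(alpha W_n) ker (W_n), where ker is positive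
   and has a compactly supported Fourier transform. *)

(** * Real integrals and derivatives *)

(** The weights N_n e^(alpha W_n) alone have no limit: under the tilt W_n spreads over the scale
    sqrt n, and their mass grows like sqrt n. The factor [ker] localises W_n. As its Fourier
    transform vanishes outside a bounded window, the tilted characteristic function matters only at
    bounded frequencies, where non-latticeness and compactness keep its modulus below 1 away from 0;
    its behaviour at infinity never enters. Positivity of [ker] lets the factor be divided out
    again.

    The logarithm in b_n cancels the local factor 1 / sqrt (2 pi phi''(alpha) n); the alpha inside
    it gives the limiting jump measure the density alpha e^(- alpha x), whose tail is exactly e^(-
    alpha x).

    Comparing c with c_1 is comparing alpha with 1, because s phi'(s) - phi(s) increases; one
    compensator h thus covers the three centerings. For alpha >= 1 the function e^x h(x) e^(- alpha
    x) is not integrable at minus infinity, so N_n a_n is out of reach of the local limit. Hence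
    each row is centred before the power is taken, and only N_n a_n^2 has to vanish.

    Holomorphy enters through Cauchy-Riemann equations between real functions. *)

Section RealIntegral.
Context d (T : measurableType d) (R : realType) (m : {measure set T -> \bar R}).
Implicit Types (f g : T -> R).

Definition intble f := m.-integrable setT (EFin \o f).

Lemma intble_measurable f : intble f -> measurable_fun setT f.
Proof. by move=> /integrableP[/measurable_EFinP]. Qed.

Lemma intble_le f g : measurable_fun setT f -> (forall x, `|f x| <= g x) ->
  intble g -> intble f.
Proof.
move=> mf fg; apply: le_integrable => //; first exact/measurable_EFinP.
by move=> x _ /=; rewrite lee_fin (le_trans (fg x))// ler_norm.
Qed.

Lemma intble_norm f : intble f -> intble (fun x => `|f x|).
Proof.
move=> /[dup] /intble_measurable mf; apply: le_integrable => //.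
  by apply/measurable_EFinP; apply: measurableT_comp.
by move=> x _ /=; rewrite normr_id.
Qed.

Lemma intble_le_norm f g : measurable_fun setT f ->
  (forall x, `|f x| <= `|g x|) -> intble g -> intble f.
Proof. by move=> mf fg /intble_norm; exact: intble_le. Qed.

Lemma intbleD f g : intble f -> intble g -> intble (fun x => f x + g x).
Proof. by move=> hf hg; exact: (integrableD measurableT hf hg). Qed.

Lemma intbleB f g : intble f -> intble g -> intble (fun x => f x - g x).
Proof. by move=> hf hg; exact: (integrableB measurableT hf hg). Qed.

Lemma intbleZ f (r : R) : intble f -> intble (fun x => r * f x).
Proof. by move=> hf; exact: (integrableZl measurableT r hf). Qed.

Lemma intbleN f : intble f -> intble (fun x => - f x).
Proof.
move=> /(intbleZ (-1)); congr intble; apply/funext => x; exact: mulN1r.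
Qed.

Lemma intbleM f g (M : R) : measurable_fun setT f -> (forall x, `|f x| <= M) ->
  intble g -> intble (fun x => f x * g x).
Proof.
move=> mf fM hg; have mg := intble_measurable hg.
apply: (@intble_le_norm _ (fun x => M * g x)); last exact: intbleZ.
  exact: measurable_funM.
move=> x; rewrite !normrM ler_wpM2r//.
exact: le_trans (fM x) (ler_norm _).
Qed.

Lemma intble_sum (I : Type) (s : seq I) (F : I -> T -> R) :
  (forall i, intble (F i)) -> intble (fun x => \sum_(i <- s) F i x).
Proof.
move=> hF; elim: s => [|i s ih].
  by under eq_fun do rewrite big_nil; exact: integrable0.
by under eq_fun do rewrite big_cons; exact: intbleD.
Qed.

Lemma Rint_ge0 f : (forall x, 0 <= f x) -> 0 <= \int[m]_x f x.
Proof. by move=> f0; exact: Rintegral_ge0. Qed.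

Lemma Rint_le f g : intble f -> intble g -> (forall x, f x <= g x) ->
  \int[m]_x f x <= \int[m]_x g x.
Proof. by move=> hf hg fg; apply: le_Rintegral. Qed.

Lemma Rint_norm f : intble f -> `|\int[m]_x f x| <= \int[m]_x `|f x|.
Proof. exact: le_normr_Rintegral. Qed.

Lemma RintD f g : intble f -> intble g ->
  \int[m]_x (f x + g x) = \int[m]_x f x + \int[m]_x g x.
Proof. exact: RintegralD. Qed.

Lemma RintB f g : intble f -> intble g ->
  \int[m]_x (f x - g x) = \int[m]_x f x - \int[m]_x g x.
Proof. exact: RintegralB. Qed.

Lemma RintZ f (r : R) : intble f -> \int[m]_x (r * f x) = r * \int[m]_x f x.
Proof. by move=> hf; exact: RintegralZl. Qed.

Lemma RintZr f (r : R) : intble f -> \int[m]_x (f x * r) = (\int[m]_x f x) * r.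
Proof. by move=> hf; exact: RintegralZr. Qed.

Lemma RintN f : intble f -> \int[m]_x (- f x) = - \int[m]_x f x.
Proof.
move=> hf; rewrite -mulN1r -RintZ//; apply: eq_Rintegral => x _.
by rewrite mulN1r.
Qed.

Lemma eq_Rint f g : f =1 g -> \int[m]_x f x = \int[m]_x g x.
Proof. by move=> fg; apply: eq_Rintegral => x _. Qed.

Lemma Rint_fin f : intble f -> (\int[m]_x (f x)%:E = (\int[m]_x f x)%:E)%E.
Proof. by move=> hf; rewrite /Rintegral fineK//; exact: integrable_fin_num. Qed.

Lemma Rint0 : \int[m]_x (0 : R) = 0.
Proof. by rewrite /Rintegral integral0. Qed.

Lemma Rint_bound f g (M : R) : measurable_fun setT f -> intble g ->
  (forall x, 0 <= g x) -> (forall x, `|f x| <= M) ->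
  `|\int[m]_x (f x * g x)| <= M * \int[m]_x g x.
Proof.
move=> mf hg g0 fM; have hfg := intbleM mf fM hg.
rewrite -RintZ// (le_trans (Rint_norm hfg))//.
apply: Rint_le; [exact: intble_norm|exact: intbleZ|] => x.
by rewrite normrM (ger0_norm (g0 x)) ler_wpM2r.
Qed.

Lemma Rint_dominated (f_ : nat -> T -> R) f g :
  (forall n, measurable_fun setT (f_ n)) ->
  (forall x, f_ n x @[n --> \oo] --> f x) -> intble g ->
  (forall n x, `|f_ n x| <= g x) ->
  intble f /\ \int[m]_x f_ n x @[n --> \oo] --> \int[m]_x f x.
Proof.
move=> mf cf hg fg.
have mlim : measurable_fun setT f.
  by apply: (measurable_fun_cvg mf) => x _; exact: cf.
have hf : intble f.
  apply: (intble_le mlim _ hg) => x.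
  have /cvg_norm cfx := cf x.
  rewrite -(cvg_lim _ cfx)//; apply: limr_le; first exact: cvgP cfx.
  by apply: nearW => n; exact: fg.
split => //.
have [_ _ cI] : [/\ m.-integrable setT (EFin \o f),
    [sequence (\int[m]_(x in setT) (fun n x => `|(f_ n x)%:E - (f x)%:E|)%E n x)%E]_n
      x @[x --> \oo] --> 0%E
  & [sequence (\int[m]_(x in setT) (f_ n x)%:E)%E]_n x @[x --> \oo] -->
(\int[m]_(x in setT) (f x)%:E)%E].
  apply: (@dominated_convergence _ _ _ m setT measurableT
    (fun n x => (f_ n x)%:E) (EFin \o f) (EFin \o g)) => //.
  - by move=> n; exact/measurable_EFinP.
  - exact/measurable_EFinP.
  - by apply: aeW => x _ /=; apply: cvg_EFin; [exact: nearW|exact: cf].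
  - by apply: aeW => x n _ /=; rewrite lee_fin.
by apply: fine_cvg; rewrite fineK//; exact: integrable_fin_num.
Qed.

Lemma Rint_dominated_cvg (f_ : nat -> T -> R) f g :
  (forall n, measurable_fun setT (f_ n)) ->
  (forall x, f_ n x @[n --> \oo] --> f x) -> intble g ->
  (forall n x, `|f_ n x| <= g x) ->
  \int[m]_x f_ n x @[n --> \oo] --> \int[m]_x f x.
Proof. by move=> mf cf hg fg; have [] := Rint_dominated mf cf hg fg. Qed.

(** The finite limit of the integrals is what yields integrability of [f], so no dominating function
    has to be known beforehand. *)
Lemma Rint_monotone (f_ : nat -> T -> R) f (c : R) :
  (forall n, intble (f_ n)) -> (forall n x, 0 <= f_ n x) ->
  (forall x, {homo (f_ ^~ x) : n k / (n <= k)%N >-> n <= k}) ->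
  (forall x, f_ n x @[n --> \oo] --> f x) ->
  \int[m]_x f_ n x @[n --> \oo] --> c -> intble f /\ \int[m]_x f x = c.
Proof.
move=> if_ f0 ndf cf cc.
have mf : measurable_fun setT f.
  apply: (@measurable_fun_cvg _ _ _ _ f_) => [n|x _]; last exact: cf.
  exact: intble_measurable.
have fp x : 0 <= f x.
  rewrite -(cvg_lim _ (cf x))//; apply: limr_ge; first exact: cvgP (cf x).
  exact: nearW.
have E : (\int[m]_x (f x)%:E)%E = c%:E.
  have := @monotone_convergence _ _ _ m setT measurableT (fun n x => (f_ n x)%:E).
  have -> : (fun x => limn (fun n => (f_ n x)%:E)) = (fun x => (f x)%:E).
    apply/funext => x; apply/cvg_lim => //; apply: cvg_EFin; first exact: nearW.
    exact: cf.
  move=> ->.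
  - apply/cvg_lim => //; under eq_fun do rewrite Rint_fin//.
    by apply: cvg_EFin; first exact: nearW.
  - by move=> n; apply/measurable_EFinP; exact: intble_measurable.
  - by move=> n x _; rewrite lee_fin.
  - by move=> x _ n k nk; rewrite lee_fin; exact: ndf.
split; last by rewrite /Rintegral E.
apply/integrableP; split; first exact/measurable_EFinP.
under eq_integral do rewrite /= ger0_norm//.
by rewrite E ltry.
Qed.

End RealIntegral.

Lemma intble_bounded d (T : measurableType d) (R : realType)
  (P : probability T R) (f : T -> R) (M : R) :
  measurable_fun setT f -> (forall x, `|f x| <= M) -> intble P f.
Proof.
move=> mf fM; apply: (intble_le mf fM).
exact: finite_measure_integrable_cst.
Qed.

Lemma Rint_cst_prob d (T : measurableType d) (R : realType)
  (P : probability T R) (r : R) : \int[P]_x r = r.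
Proof. by rewrite Rintegral_cst//= probability_setT mulr1. Qed.

Section LebesgueInvariance.
Context (R : realType).
Notation mu := (@lebesgue_measure R).

Lemma Rint_preserve (phi : R -> R) (f : R -> R) :
  measurable_fun [set: measurableTypeR R] (phi : _ -> measurableTypeR R) ->
  (forall A : set (measurableTypeR R), measurable A -> mu (phi @^-1` A) = mu A) ->
  intble mu f ->
  intble mu (f \o phi) /\ \int[mu]_x f (phi x) = \int[mu]_x f x.
Proof.
move=> mphi hphi hf; have mf := intble_measurable hf.
have hp A : measurable A -> A `<=` setT ->
    pushforward mu (phi : _ -> measurableTypeR R) A = mu A.
  by move=> mA _; exact: hphi.
have hI : intble mu (f \o phi).
  apply/integrableP; split.
    by apply/measurable_EFinP; exact: (measurableT_comp mf mphi).
  have := @ge0_integral_pushforward _ _ _ _ R _ mphi mu setT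
    (fun x => `|(f x)%:E|)%E measurableT.
  rewrite preimage_setT => <- //; last first.
    by apply: measurableT_comp => //; exact/measurable_EFinP.
  rewrite (eq_measure_integral mu) => [|A mA /hp]; last exact.
  by have /integrableP[] := hf.
split=> //; rewrite /Rintegral.
have := @integral_pushforward _ _ _ _ R _ mphi mu setT (EFin \o f) _ _ measurableT.
rewrite preimage_setT => <- //; last exact/measurable_EFinP.
by congr fine; apply: eq_measure_integral => A mA _; exact: hphi.
Qed.

Lemma Rint_opp (f : R -> R) : intble mu f ->
  intble mu (fun x => f (- x)) /\ \int[mu]_x f (- x) = \int[mu]_x f x.
Proof.
move=> hf; apply: (Rint_preserve (phi := -%R)) => //.
by move=> A mA; exact: lebesgue_measureN.
Qed.

Lemma Rint_shift (a : R) (f : R -> R) : intble mu f ->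
  intble mu (fun x => f (x + a)) /\ \int[mu]_x f (x + a) = \int[mu]_x f x.
Proof.
move=> hf; have mD : measurable_fun [set: measurableTypeR R]
   ((fun x => x + a) : _ -> measurableTypeR R).
  have : measurable_fun setT (fun x : R => x + a) by exact: measurable_funD.
  by move=> h mT Y mY; exact: h.
apply: (Rint_preserve (phi := fun x => x + a)) => // A mA.
suff : forall A, measurable A ->
    mu A = pushforward mu ((fun x => x + a) : _ -> measurableTypeR R) A.
  by move=> /(_ A mA) ->.
move=> {}A {}mA; apply: lebesgue_measure_unique => //= _ [[u v]] _ <-.
rewrite /pushforward (_ : _ @^-1` _ = `]u - a, v - a]%classic).
  rewrite !lebesgue_measure_itv/= !lte_fin ltrD2r.
  by case: ifP => // _; rewrite -!EFinB; congr EFin; ring.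
by apply/seteqP; split => x /=; rewrite !in_itv/= ltrBlDr lerBrDr.
Qed.

End LebesgueInvariance.

Section RealFubini.
Context d1 d2 (T1 : measurableType d1) (T2 : measurableType d2) (R : realType).
Context (m1 : {sigma_finite_measure set T1 -> \bar R})
  (m2 : {sigma_finite_measure set T2 -> \bar R}).
Variables (f : T1 -> T2 -> R) (a : T1 -> R) (b : T2 -> R).
Hypothesis mf : measurable_fun setT (fun z : T1 * T2 => f z.1 z.2).
Hypotheses (ha : intble m1 a) (hb : intble m2 b).
Hypothesis fab : forall x y, `|f x y| <= a x * b y.

(** The product bound [a x * b y] makes the iterated integral of Tonelli finite; this joint
    integrability justifies the exchange of integrals in [Rfubini]. *)
Lemma Rfubini_intble : (m1 \x m2)%E.-integrable setT (fun z : T1 * T2 => (f z.1 z.2)%:E).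
Proof.
apply/integrable12ltyP; first exact/measurable_EFinP.
have hab x : (\int[m2]_y `|(f x y)%:E| <= (`|a x| * \int[m2]_y `|b y|)%:E)%E.
  rewrite -RintZ; last exact: intble_norm.
  rewrite -Rint_fin; last by apply: intbleZ; exact: intble_norm.
  apply: ge0_le_integral => //.
  - apply: measurableT_comp => //; apply/measurable_EFinP.
    exact: (measurableT_comp mf (measurable_pair1 x)).
  - apply/measurable_EFinP; apply: measurable_funM => //.
    by apply: measurableT_comp => //; exact: intble_measurable hb.
  - by move=> y _ /=; rewrite lee_fin -normrM (le_trans (fab x y))// ler_norm.
have mF : measurable_fun setT (fun x => \int[m2]_y `|(f x y)%:E|)%E.
  have := @measurable_fun_fubini_tonelli_F _ _ T1 T2 R m2
    (fun z => `|(f z.1 z.2)%:E|)%E; apply => //.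
  by apply: measurableT_comp => //; exact/measurable_EFinP.
apply: (@le_lt_trans _ _ (\int[m1]_x (`|a x| * \int[m2]_y `|b y|)%:E)%E).
  apply: ge0_le_integral => //.
  - by move=> x _; apply: integral_ge0.
  - apply/measurable_EFinP; apply: measurable_funM => //.
    by apply: measurableT_comp => //; exact: intble_measurable ha.
  - by move=> x _; exact: hab.
have hi : intble m1 (fun x => (\int[m2]_y `|b y|) * `|a x|).
  by apply: intbleZ; exact: intble_norm.
under eq_integral do rewrite mulrC.
by rewrite Rint_fin// ltry.
Qed.

Lemma Rfubini_slice1 x : intble m2 (f x).
Proof.
apply: (@intble_le _ _ _ _ _ (fun y => a x * b y)); last exact: intbleZ.
  exact: (measurableT_comp mf (measurable_pair1 x)).
exact: fab.
Qed.

Lemma Rfubini_slice2 y : intble m1 (f ^~ y).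
Proof.
apply: (@intble_le _ _ _ _ _ (fun x => b y * a x)); last exact: intbleZ.
  exact: (measurableT_comp mf (measurable_pair2 y)).
by move=> x; rewrite mulrC; exact: fab.
Qed.

Lemma Rfubini_int1 : intble m1 (fun x => \int[m2]_y f x y).
Proof.
have := integrable_fubini_F Rfubini_intble; congr (_.-integrable _ _).
by apply/funext => x; rewrite /fubini_F /= Rint_fin//; exact: Rfubini_slice1.
Qed.

Lemma Rfubini :
  \int[m1]_x (\int[m2]_y f x y) = \int[m2]_y (\int[m1]_x f x y).
Proof.
have := Fubini Rfubini_intble => /=.
under eq_integral do rewrite (Rint_fin (Rfubini_slice1 _)).
under [X in _ = X -> _]eq_integral do rewrite (Rint_fin (Rfubini_slice2 _)).
by rewrite /Rintegral => ->.
Qed.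

End RealFubini.

Lemma Rfubini_int2 d1 d2 (T1 : measurableType d1) (T2 : measurableType d2)
  (R : realType) (m1 : {sigma_finite_measure set T1 -> \bar R})
  (m2 : {sigma_finite_measure set T2 -> \bar R})
  (f : T1 -> T2 -> R) (a : T1 -> R) (b : T2 -> R) :
  measurable_fun setT (fun z : T1 * T2 => f z.1 z.2) ->
  intble m1 a -> intble m2 b -> (forall x y, `|f x y| <= a x * b y) ->
  intble m2 (fun y => \int[m1]_x f x y).
Proof.
move=> mf ha hb fab.
apply: (@Rfubini_int1 _ _ _ _ _ m2 m1 (fun y x => f x y) b a) => //.
  exact: (measurableT_comp mf (@measurable_swap _ _ T2 T1)).
by move=> y x; rewrite mulrC.
Qed.

Lemma Rint_line_cvg (R : realType) (f : R -> R) : intble lebesgue_measure f ->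
  \int[lebesgue_measure]_(x in `[- n%:R, n%:R]) f x @[n --> \oo] -->
  \int[lebesgue_measure]_x f x.
Proof.
move=> hf; have mf := intble_measurable hf.
under eq_fun do rewrite Rintegral_mkcond.
apply: (Rint_dominated_cvg _ _ (intble_norm hf)).
- by move=> n; apply/(measurable_restrictT _ _).1 => //; exact: measurable_funTS.
- move=> x; apply: cvg_near_cst; near=> n.
  rewrite patchE mem_set//= in_itv/= -ler_norml.
  by near: n; exact: nbhs_infty_ger.
- by move=> n x; rewrite patchE; case: ifP => // _; rewrite normr0.
Unshelve. all: by end_near. Qed.

Section RealDerivatives.
Context (R : realType).
Implicit Types (f g : R -> R) (x a b : R).

(** A relation rather than a value: the derivative can be left as an existential variable, which the
    rules below fill in by unification, and [has_derive_val] then adjusts it to the wanted form. *)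
Definition has_derive f x a : Prop := is_derive x (1:R) f a.

Lemma has_derive_val f x a b : has_derive f x a -> a = b ->
  has_derive f x b.
Proof. by move=> h <-. Qed.

Lemma deriv_cst x a : has_derive (fun=> a) x 0.
Proof. exact: is_derive_cst. Qed.

Lemma deriv_id x : has_derive (fun y => y) x 1.
Proof. exact: is_derive_id. Qed.

Lemma derivD f g x a b : has_derive f x a -> has_derive g x b ->
  has_derive (fun y => f y + g y) x (a + b).
Proof. by move=> hf hg; exact: is_deriveD. Qed.

Lemma derivN f x a : has_derive f x a ->
  has_derive (fun y => - f y) x (- a).
Proof. by move=> hf; exact: is_deriveN. Qed.

Lemma derivB f g x a b : has_derive f x a -> has_derive g x b ->
  has_derive (fun y => f y - g y) x (a - b).
Proof. by move=> hf hg; exact: is_deriveB. Qed.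

Lemma derivM f g x a b : has_derive f x a -> has_derive g x b ->
  has_derive (fun y => f y * g y) x (a * g x + f x * b).
Proof.
move=> hf hg; apply: (has_derive_val (is_deriveM hf hg)).
by rewrite /GRing.scale/= addrC [g x * a]mulrC.
Qed.

Lemma derivMl f x a b : has_derive f x a ->
  has_derive (fun y => b * f y) x (b * a).
Proof.
move=> hf; apply: (has_derive_val (derivM (deriv_cst x b) hf)).
by rewrite mul0r add0r.
Qed.

Lemma derivMr f x a b : has_derive f x a ->
  has_derive (fun y => f y * b) x (a * b).
Proof.
move=> hf; apply: (has_derive_val (derivM hf (deriv_cst x b))).
by rewrite mulr0 addr0.
Qed.

Lemma deriv_comp (h : R -> R) f x a b : has_derive h (f x) b ->
  has_derive f x a -> has_derive (fun y => h (f y)) x (b * a).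
Proof. by move=> hh hf; apply: (has_derive_val (is_derive1_comp hh hf)). Qed.

Lemma deriv_exp f x a : has_derive f x a ->
  has_derive (fun y => expR (f y)) x (expR (f x) * a).
Proof. by move=> hf; exact: (deriv_comp (is_derive_expR _)). Qed.

Lemma deriv_cos f x a : has_derive f x a ->
  has_derive (fun y => cos (f y)) x (- sin (f x) * a).
Proof. by move=> hf; exact: (deriv_comp (is_derive_cos _)). Qed.

Lemma deriv_sin f x a : has_derive f x a ->
  has_derive (fun y => sin (f y)) x (cos (f x) * a).
Proof. by move=> hf; exact: (deriv_comp (is_derive_sin _)). Qed.

Lemma deriv_sqr f x a : has_derive f x a ->
  has_derive (fun y => f y ^+ 2) x (2 * f x * a).
Proof.
move=> hf; apply: (has_derive_val (derivM hf hf)); ring.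
Qed.

Lemma deriv_inv f x a : f x != 0 -> has_derive f x a ->
  has_derive (fun y => (f y)^-1) x (- a / f x ^+ 2).
Proof.
move=> f0 hf; apply: (has_derive_val (is_deriveV f0 hf)).
by rewrite /GRing.scale/= mulNr mulNr mulrC.
Qed.

Lemma deriv_continuous f : (forall x, exists a, has_derive f x a) ->
  continuous f.
Proof.
move=> df x; apply: differentiable_continuous; apply/derivable1_diffP.
by have [a []] := df x.
Qed.

Lemma deriv_mvt f (f' : R -> R) a b : (forall x, has_derive f x (f' x)) ->
  a < b -> exists2 c, a < c < b & f b - f a = f' c * (b - a).
Proof.
move=> df ab; have [c /= + ->] : exists2 c, c \in `]a, b[%R &
    f b - f a = f' c * (b - a).
  apply: (@MVT _ f f' a b ab); first by move=> t _; exact: df.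
  by apply: continuous_subspaceT; apply: deriv_continuous => t; exists (f' t).
by rewrite in_itv/= => h; exists c.
Qed.

Lemma deriv_ge0_le f (f' : R -> R) a b : (forall x, has_derive f x (f' x)) ->
  a <= b -> (forall x, a < x < b -> 0 <= f' x) -> f a <= f b.
Proof.
move=> df; rewrite le_eqVlt => /predU1P[->//|ab] f'0.
have [c cab e] := deriv_mvt df ab.
by rewrite -subr_ge0 e mulr_ge0 ?f'0// subr_ge0 ltW.
Qed.

End RealDerivatives.

(** The rules for a constant factor come before [derivM], so that the general product rule is
    reached only when both factors vary. [derive_val] leaves the equation between the computed and
    the stated derivative. *)
Ltac derivs := repeat first [exact: deriv_id | exact: deriv_cst
  | apply: derivMl | apply: derivMr | apply: derivN | apply: derivB | apply: derivD
  | apply: deriv_exp | apply: deriv_cos | apply: deriv_sin | apply: deriv_sqr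
  | apply: derivM].
Ltac derive_val := eapply has_derive_val; [by derivs|rewrite /=].

Lemma FTC_derive (R : realType) (F f : R -> R) (a b : R) : a <= b ->
  (forall x, has_derive F x (f x)) -> continuous f ->
  \int[lebesgue_measure]_(x in `[a, b]) f x = F b - F a.
Proof.
rewrite le_eqVlt => /predU1P[<- _ _|ab dF cf].
  by rewrite set_itv1 Rintegral_set1 subrr.
have cF : continuous F.
  move=> x; apply: differentiable_continuous; apply/derivable1_diffP.
  by have [] := dF x.
rewrite /Rintegral (@continuous_FTC2 _ f F)//.
- exact: continuous_subspaceT.
- split.
  + by move=> x _; have [] := dF x.
  + exact/cvg_at_right_filter/cF.
  + exact/cvg_at_left_filter/cF.
- by move=> x _; rewrite derive1E; have [_ ->] := dF x.
Qed.

Lemma Rint_derive_line (R : realType) (F f : R -> R) (l1 l2 : R) :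
  (forall x, has_derive F x (f x)) -> continuous f ->
  intble lebesgue_measure f -> F (- n%:R) @[n --> \oo] --> l1 ->
  F n%:R @[n --> \oo] --> l2 ->
  \int[lebesgue_measure]_x f x = l2 - l1.
Proof.
move=> dF cf hf h1 h2; have h := Rint_line_cvg hf.
have h' : F n%:R - F (- n%:R) @[n --> \oo] --> l2 - l1 by exact: cvgB.
have E : (fun n : nat => \int[lebesgue_measure]_(x in `[- n%:R, n%:R]) f x) =
  (fun n => F n%:R - F (- n%:R)).
  by apply/funext => n; rewrite (FTC_derive _ dF)// (@le_trans _ _ 0)// oppr_le0.
rewrite E in h; rewrite -(cvg_lim _ h)// (cvg_lim _ h')//.
Qed.

(** * Shifting a line of integration *)

Section Contour.
Context (R : realType).
Variables (A B D : R -> R -> R) (l th : R).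
Hypothesis dA : forall x t, has_derive (A x) t (D x t).
Hypothesis dB : forall x t, has_derive (B ^~ t) x (D x t).
Hypothesis cA : forall t, continuous (A ^~ t).
Hypothesis cD : forall t, continuous (D ^~ t).
Hypothesis bD : forall M : R, exists K : R, forall x t,
  `|x| <= M -> `|t| <= M -> `|D x t| <= K.
Hypothesis th0 : 0 <= th.
Hypothesis hB : forall e : R, 0 < e -> \forall n \near \oo, forall t,
  0 <= t <= th -> `|B n%:R t - B (- n%:R) t - l| <= e.

Notation mu := (@lebesgue_measure R).

(** For a holomorphic f, take [A] to be the real part of f (x + it) and [B] minus its imaginary
    part. Then [dA] and [dB] express a Cauchy-Riemann equation: the t-derivative of [A] is the
    x-derivative of [B], so that its integral over [[-n, n]] reduces to boundary values of [B]. *)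
Lemma contour_derive (n : nat) t : 
  has_derive (fun t => \int[mu]_(x in `[- n%:R, n%:R]) A x t) t
    (B n%:R t - B (- n%:R) t).
Proof.
have D1 x s : partial1of2 (fun t x => A x t) s x = D x s.
  by rewrite partial1of2E; have [_ ->] := dA x s.
have nn : - n%:R <= n%:R :> R by rewrite (@le_trans _ _ 0)// oppr_le0.
(* The second variable stays in []t - 1, t + 1[] and the first in [[-n, n]]; the radius covers
   both. *)
have [K hK] := bD (`|t| + n.+1%:R).
have aux : let F := fun t => \int[mu]_(x in `[- n%:R, n%:R]) A x t in
  derivable F t (1:R) /\ derive1 F t = \int[mu]_(x in `[- n%:R, n%:R]) D x t.
  have h1 : measurable `[- n%:R, n%:R : R] by [].
  have h2 : `]t - 1, t + 1[%classic t by rewrite /= in_itv/= ltrBlDr ltrDl ltr01.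
  have h3 x : `]t - 1, t + 1[%classic x ->
      mu.-integrable `[- n%:R, n%:R] (EFin \o (A^~ x)).
    move=> _; apply: continuous_compact_integrable; first exact: segment_compact.
    exact/continuous_subspaceT/cA.
  have h4 x y : `]t - 1, t + 1[%classic x -> `[- n%:R, n%:R]%classic y -> derivable (A y) x (1:R).
    by move=> _ _; have [] := dA y x.
  have h5 (y : R) : 0 <= `|K| by [].
  have h6 : mu.-integrable `[- n%:R, n%:R] (EFin \o (fun _ : R => `|K|)).
    apply: continuous_compact_integrable; first exact: segment_compact.
    by apply: continuous_subspaceT => x; exact: cvg_cst.
  have h7 x y : `]t - 1, t + 1[%classic x -> `[- n%:R, n%:R]%classic y ->
      `|partial1of2 (fun t x => A x t) x y| <= `|K|.
    rewrite /= !in_itv/= => /andP[tx xt] yn; rewrite D1.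
    rewrite (le_trans (hK _ _ _ _)) ?ler_norm//.
      rewrite (@le_trans _ _ n%:R)// ?ler_norml//.
      by rewrite -natr1; have := normr_ge0 t; clear h5; lra.
    rewrite -natr1 ler_norml; have := ler_norm t; have := ler_norm (- t).
    by rewrite normrN; have : 0 <= n%:R :> R by []; clear h5; lra.
  split.
    exact: (@derivable_under_integral R _ _ mu (fun t x => A x t) _ h1 t _ _ h2 h3 h4 (fun=> `|K|) h5 h6 h7).
  rewrite (@differentiation_under_integral R _ _ mu (fun t x => A x t) _ h1 t _ _ h2 h3 h4 (fun=> `|K|) h5 h6 h7).
  by apply: eq_Rintegral => x _; exact: D1.
have [d1 d2] := aux; apply: DeriveDef => //.
by rewrite -derive1E d2 (FTC_derive nn (F := B ^~ t)).
Qed.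

(** Instead of integrating the derivative in t, the mean value theorem is applied to the integral
    minus [l * t], whose derivative is small by the bound [hB], uniform in t. *)
Lemma contour_cvg :
  \int[mu]_(x in `[- n%:R, n%:R]) (A x th - A x 0) @[n --> \oo] --> l * th.
Proof.
pose G (n : nat) t := \int[mu]_(x in `[- n%:R, n%:R]) A x t.
have hI (n : nat) t : mu.-integrable `[- n%:R, n%:R] (EFin \o (A^~ t)).
  apply: continuous_compact_integrable; first exact: segment_compact.
  exact/continuous_subspaceT/cA.
under eq_fun do rewrite RintegralB//.
rewrite -/(G _ _) -[X in X @ _](_ : (fun n => G n th - G n 0) = _)//.
have [->|thN0] := eqVneq th 0.
  by under eq_fun do rewrite subrr; rewrite mulr0; exact: cvg_cst.
have th1 : 0 < th by rewrite lt_neqAle eq_sym thN0.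
apply/cvgrPdist_le => e e0.
have /hB := divr_gt0 e0 th1; apply: filterS => n hn.
pose g t := G n t - l * t.
have dg t : has_derive g t (B n%:R t - B (- n%:R) t - l).
  have h1 := contour_derive n t.
  rewrite -[X in _ - X](mulr1 l).
  exact: (derivB h1 (derivMl l (deriv_id t))).
have [c cth gE] := deriv_mvt dg th1.
have -> : l * th - (G n th - G n 0) = - (g th - g 0) by rewrite /g; ring.
rewrite gE subr0 normrN normrM (gtr0_norm th1) -ler_pdivlMr//.
by apply: hn; move: cth => /andP[/ltW-> /ltW->].
Qed.

(** Integrability is asked of the difference only. This is essential at exponent 1, where both terms
    tend to the same constant at minus infinity, in general nonzero ([contour_one]). *)
Lemma contour_shift : intble mu (fun x => A x th - A x 0) ->
  \int[mu]_x (A x th - A x 0) = l * th.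
Proof.
move=> /Rint_line_cvg h; have h' := contour_cvg.
by rewrite -(cvg_lim _ h)// (cvg_lim _ h').
Qed.

End Contour.

Lemma expR_nat_cvg0 (R : realType) (a : R) : 0 < a ->
  expR (- (a * n%:R)) @[n --> \oo] --> (0 : R).
Proof.
move=> a0; under eq_fun do rewrite -mulNr expRM_natr.
by apply: cvg_expr; rewrite ger0_norm ?expR_ge0// expR_lt1 oppr_lt0.
Qed.

Lemma sqr_abs (R : realDomainType) (x : R) : `|x| ^+ 2 = x ^+ 2.
Proof. by rewrite real_normK ?num_real. Qed.

(** * Levy's continuity theorem for integrable limits *)

Section Gaussian.
Context (R : realType).
Notation mu := (@lebesgue_measure R).

(** The parameter [e] is the reciprocal of the standard deviation, and the function is not
    normalised: its value at 0 is 1. *)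
Definition gauss (e x : R) : R := expR (- (e * x) ^+ 2 / 2).

Lemma gauss_ge0 e x : 0 <= gauss e x. Proof. exact: expR_ge0. Qed.

Lemma gauss_le1 e x : gauss e x <= 1.
Proof. by rewrite -expR0 ler_expR mulNr oppr_le0 divr_ge0// sqr_ge0. Qed.

Lemma gaussN e x : gauss e (- x) = gauss e x.
Proof. by rewrite /gauss mulrN sqrrN. Qed.

Lemma gauss_continuous e : continuous (gauss e).
Proof. by apply: deriv_continuous => x; eexists; rewrite /gauss; derivs. Qed.

Lemma gauss_measurable e : measurable_fun setT (gauss e).
Proof. exact: continuous_measurable_fun (@gauss_continuous e). Qed.

Lemma gauss_normal (e y x : R) : 0 < e ->
  gauss e (x - y) = Num.sqrt (2 * pi) / e * normal_pdf y e^-1 x.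
Proof.
move=> e0; have ei0 : e^-1 != 0 by rewrite invr_neq0// gt_eqF.
rewrite normal_pdfE//= /normal_peak /normal_fun.
have -> : - (x - y) ^+ 2 / (e^-1 ^+ 2 *+ 2) = - (e * (x - y)) ^+ 2 / 2.
  by field; rewrite gt_eqF.
have -> : e^-1 ^+ 2 * pi *+ 2 = (2 * pi) * e^-1 ^+ 2 by rewrite -mulr_natr; ring.
rewrite [Num.sqrt (2 * pi * _)]sqrtrM ?mulr_ge0 ?pi_ge0// sqrtr_sqr gtr0_norm ?invr_gt0//.
have s0 : Num.sqrt (2 * pi) != 0 :> R by rewrite gt_eqF// sqrtr_gt0 mulr_gt0// pi_gt0.
by rewrite mulrA mulfV ?mul1r// mulf_neq0.
Qed.

Lemma gauss_shift_intble (e y : R) : 0 < e -> intble mu (fun x => gauss e (x - y)).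
Proof.
move=> e0; rewrite (funext (fun x => gauss_normal y x e0)).
apply: intbleZ; exact: integrable_normal_pdf.
Qed.

Lemma Rint_gauss_shift (e y : R) : 0 < e ->
  \int[mu]_x gauss e (x - y) = Num.sqrt (2 * pi) / e.
Proof.
move=> e0; under eq_Rint do rewrite gauss_normal//.
rewrite RintZ; last exact: integrable_normal_pdf.
by rewrite [X in _ * X](_ : _ = 1) ?mulr1// /Rintegral integral_normal_pdf.
Qed.

Lemma gauss_intble (e : R) : 0 < e -> intble mu (gauss e).
Proof.
move=> e0; have := gauss_shift_intble 0 e0; congr intble.
by apply/funext => x; rewrite subr0.
Qed.

Lemma Rint_gauss (e : R) : 0 < e -> \int[mu]_x gauss e x = Num.sqrt (2 * pi) / e.
Proof.
by move=> e0; rewrite -(Rint_gauss_shift 0 e0); apply: eq_Rint => x; rewrite subr0.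
Qed.

Lemma continuous_cosM (u : R) : continuous (fun x => cos (u * x)).
Proof. by apply: deriv_continuous => x; eexists; derivs. Qed.

Lemma continuous_sinM (u : R) : continuous (fun x => sin (u * x)).
Proof. by apply: deriv_continuous => x; eexists; derivs. Qed.

Lemma cos_norm (x : R) : `|cos x| <= 1.
Proof. by rewrite ler_norml cos_geN1 cos_le1. Qed.

Lemma sin_norm (x : R) : `|sin x| <= 1.
Proof. by rewrite ler_norml sin_geN1 sin_le1. Qed.

Lemma gauss_cos_intble (e v : R) : 0 < e -> intble mu (fun x => cos (v * x) * gauss e x).
Proof.
move=> e0; apply: (@intbleM _ _ _ _ _ _ 1); last exact: gauss_intble.
  exact: continuous_measurable_fun (@continuous_cosM v).
by move=> x; exact: cos_norm.
Qed.

(** The line of integration of exp (- e^2 z^2 / 2) is moved up to the height v / e^2. Completing the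
    square there produces cos (v x) times the Gaussian, with the constant exp (v^2 / (2 e^2)), while
    the boundary terms vanish. *)
Lemma gauss_fourier (e v : R) : 0 < e ->
  \int[mu]_x (cos (v * x) * gauss e x) = Num.sqrt (2 * pi) / e * gauss e^-1 v.
Proof.
move=> e0; wlog v0 : v / 0 <= v.
  move=> H; have [v0|v0] := lerP 0 v; first exact: H.
  rewrite -[v]opprK gaussN -H ?oppr_ge0 1?ltW//.
  by apply: eq_Rint => x; rewrite opprK mulNr cosN.
pose A (x t : R) := expR (- (e ^+ 2 * (x ^+ 2 - t ^+ 2)) / 2) * cos (e ^+ 2 * (x * t)).
pose B (x t : R) := expR (- (e ^+ 2 * (x ^+ 2 - t ^+ 2)) / 2) * sin (e ^+ 2 * (x * t)).
pose D (x t : R) := e ^+ 2 * expR (- (e ^+ 2 * (x ^+ 2 - t ^+ 2)) / 2) *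
   (t * cos (e ^+ 2 * (x * t)) - x * sin (e ^+ 2 * (x * t))).
pose th := v / e ^+ 2.
have e20 : e ^+ 2 != 0 by rewrite expf_neq0// gt_eqF.
have AE x : A x th - A x 0 = expR (v ^+ 2 / e ^+ 2 / 2) *
    (cos (v * x) * gauss e x) - gauss e x.
  rewrite /A !mulr0 cos0 mulr1 expr0n subr0 -exprMn /gauss.
  congr (_ - _).
  have -> : - (e ^+ 2 * (x ^+ 2 - th ^+ 2)) / 2 =
      v ^+ 2 / e ^+ 2 / 2 + - (e * x) ^+ 2 / 2.
    by rewrite /th; field; rewrite gt_eqF.
  rewrite expRD (_ : e ^+ 2 * (x * th) = v * x); last first.
    by rewrite /th; field; rewrite gt_eqF.
  by ring.
have hI : intble mu (fun x => A x th - A x 0).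
  under eq_fun do rewrite AE.
  apply: intbleB; last exact: gauss_intble.
  by apply: intbleZ; exact: gauss_cos_intble.
have := @contour_shift R A B D 0 th.
rewrite mul0r; under eq_Rint do rewrite AE.
rewrite RintB; [|by apply: intbleZ; exact: gauss_cos_intble|exact: gauss_intble].
rewrite RintZ; last exact: gauss_cos_intble.
rewrite Rint_gauss// => H.
have {}H : expR (v ^+ 2 / e ^+ 2 / 2) * \int[mu]_x (cos (v * x) * gauss e x) =
    Num.sqrt (2 * pi) / e.
  apply/eqP; rewrite -subr_eq0; apply/eqP; apply: H => //.
  - by move=> x t; rewrite /A /D; derive_val; field.
  - by move=> x t; rewrite /B /D; derive_val; field.
  - by move=> t; apply: deriv_continuous => x; eexists; rewrite /A; derivs.
  - by move=> t; apply: deriv_continuous => x; eexists; rewrite /D; derivs.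
  - move=> M; exists (e ^+ 2 * expR (e ^+ 2 * M ^+ 2 / 2) * (M + M)) => x t xM tM.
    have M0 : 0 <= M by rewrite (le_trans _ xM).
    rewrite /D !normrM (ger0_norm (expR_ge0 _)).
    rewrite -expr2 sqr_abs -[leLHS]mulrA -[leRHS]mulrA ler_wpM2l ?sqr_ge0//.
    apply: ler_pM => //.
      rewrite ler_expR ler_pM2r ?invr_gt0// -mulrN ler_wpM2l ?sqr_ge0//.
      rewrite opprB lerBlDr (@le_trans _ _ (M ^+ 2))// ?lerDl ?sqr_ge0//.
      by rewrite -(sqr_abs t) lerXn2r ?nnegrE.
    rewrite (le_trans (ler_normB _ _))// lerD// normrM.
      by rewrite (le_trans (ler_piMr _ (cos_norm _))).
    by rewrite (le_trans (ler_piMr _ (sin_norm _))).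
  - by rewrite divr_ge0// sqr_ge0.
  - move=> d d0.
    have c0 : 2 * expR (e ^+ 2 * th ^+ 2 / 2) * expR (- (e ^+ 2 / 2 * n%:R)) @[n --> \oo] --> (0:R).
      rewrite -[X in _ --> X](mulr0 (2 * expR (e ^+ 2 * th ^+ 2 / 2))).
      apply: cvgMl_tmp; apply: expR_nat_cvg0.
      by rewrite divr_gt0// exprn_gt0.
    have : \forall n \near \oo, `|0 - 2 * expR (e ^+ 2 * th ^+ 2 / 2) * expR (- (e ^+ 2 / 2 * n%:R))| <= d.
      by move/cvgrPdist_le : c0; exact.
    apply: filterS => n; rewrite sub0r normrN => hn t /andP[t0 tth].
    apply: le_trans hn; rewrite subr0 [leRHS]ger0_norm ?mulr_ge0 ?expR_ge0//.
    have -> : B n%:R t - B (- n%:R) t = 2 * expR (- (e ^+ 2 * (n%:R ^+ 2 - t ^+ 2)) / 2) * sin (e ^+ 2 * (n%:R * t)).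
      rewrite /B sqrrN (mulNr n%:R t) mulrN sinN; ring.
    rewrite !normrM (ger0_norm (expR_ge0 _)) ger0_norm//.
    apply: (@le_trans _ _ (2 * expR (- (e ^+ 2 * (n%:R ^+ 2 - t ^+ 2)) / 2))).
      by rewrite ler_piMr ?mulr_ge0 ?expR_ge0 ?sin_norm.
    rewrite -[leRHS]mulrA ler_pM2l// -expRD ler_expR.
    have h1 : t ^+ 2 <= th ^+ 2 by rewrite lerXn2r ?nnegrE// (le_trans t0).
    have h2 : n%:R <= n%:R ^+ 2 :> R by rewrite -natrX ler_nat; case: (n) => // k; rewrite expnS expn1 leq_pmulr.
    have h3 : 0 <= e ^+ 2 by rewrite sqr_ge0.
    nra.
rewrite -H mulrAC -expRD mulrC /gauss exprMn exprVn.
by rewrite [X in expR X](_ : _ = 0) ?expR0 ?mulr1//; field; rewrite gt_eqF.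
Qed.

Lemma gauss_sin_intble (e v : R) : 0 < e ->
  intble mu (fun x => sin (v * x) * gauss e x).
Proof.
move=> e0; apply: (@intbleM _ _ _ _ _ _ 1); last exact: gauss_intble.
  exact: continuous_measurable_fun (@continuous_sinM v).
by move=> x; exact: sin_norm.
Qed.

Lemma gauss_fourier_sin (e v : R) : 0 < e ->
  \int[mu]_x (sin (v * x) * gauss e x) = 0.
Proof.
move=> e0; have [_] := Rint_opp (gauss_sin_intble v e0).
under eq_Rint do rewrite mulrN sinN gaussN mulNr.
rewrite RintN; last exact: gauss_sin_intble.
by move=> h; apply/eqP; rewrite -eqNr; apply/eqP.
Qed.

Lemma sqrt2pi_gt0 : 0 < Num.sqrt (2 * pi) :> R.
Proof. by rewrite sqrtr_gt0 mulr_gt0// pi_gt0. Qed.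

(** The density of the centred normal law with standard deviation 1 / k. *)
Definition gkernel (k z : R) : R := k / Num.sqrt (2 * pi) * gauss k z.

Lemma gkernel_ge0 (k z : R) : 0 <= k -> 0 <= gkernel k z.
Proof. by move=> k0; rewrite mulr_ge0 ?gauss_ge0// divr_ge0. Qed.

Lemma gkernel_le (k z : R) : 0 <= k -> gkernel k z <= k / Num.sqrt (2 * pi).
Proof. by move=> k0; rewrite ler_piMr ?gauss_le1// divr_ge0. Qed.

Lemma gkernel_measurable k : measurable_fun setT (gkernel k).
Proof. by apply: measurable_funM => //; exact: gauss_measurable. Qed.

Lemma gkernel_shift_intble (k y : R) : 0 < k -> intble mu (fun x => gkernel k (x - y)).
Proof. by move=> k0; apply: intbleZ; exact: gauss_shift_intble. Qed.

Lemma Rint_gkernel (k y : R) : 0 < k -> \int[mu]_x gkernel k (x - y) = 1.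
Proof.
move=> k0; rewrite RintZ ?Rint_gauss_shift//; last exact: gauss_shift_intble.
by field; rewrite !gt_eqF// sqrt2pi_gt0.
Qed.

Lemma gkernel_fourier (e z : R) : 0 < e ->
  (2 * pi)^-1 * \int[mu]_u (cos (u * z) * gauss e u) = gkernel e^-1 z.
Proof.
move=> e0; under eq_Rint do rewrite mulrC [_ * z]mulrC mulrC.
rewrite gauss_fourier// /gkernel mulrA; congr (_ * _).
have h := sqrt2pi_gt0.
have -> : (2 * pi)^-1 = (Num.sqrt (2 * pi) ^+ 2)^-1 :> R.
  by rewrite sqr_sqrtr// mulr_ge0// pi_ge0.
by field; rewrite !gt_eqF.
Qed.

(* Beyond distance [r] the kernel is at most [2 gauss (k/2) r] times the
   kernel of parameter [k/2], because [gauss k = (gauss (k/2)) ^ 4]. *)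
Lemma gkernel_approx (k r : R) (q : R -> R) (M h y : R) : 0 < k -> 0 < r ->
  measurable_fun setT q -> (forall x, `|q x| <= M) -> 0 <= h ->
  (forall x, `|x - y| < r -> `|q x - q y| <= h) ->
  `|\int[mu]_x (q x * gkernel k (x - y)) - q y| <= h + 4 * M * gauss (k / 2) r.
Proof.
move=> k0 r0 mq qM h0 hq.
have M0 : 0 <= M by rewrite (le_trans _ (qM 0)).
have k20 : 0 < k / 2 by rewrite divr_gt0.
have i1 := gkernel_shift_intble y k0.
have i2 := gkernel_shift_intble y k20.
have i3 : intble mu (fun x => q x * gkernel k (x - y)) by exact: intbleM i1.
have i4 : intble mu (fun x => (q x - q y) * gkernel k (x - y)).
  apply: (intbleM (M := M + M)) i1; first exact: measurable_funB.
  by move=> x; rewrite (le_trans (ler_normB _ _))// lerD.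
have -> : q y = \int[mu]_x (q y * gkernel k (x - y)).
  by rewrite RintZ ?Rint_gkernel ?mulr1.
rewrite -RintB//; last exact: intbleZ.
rewrite (_ : Rintegral _ _ _ = \int[mu]_x ((q x - q y) * gkernel k (x - y))); last first.
  by apply: eq_Rint => x; rewrite mulrBl.
rewrite (le_trans (Rint_norm i4))//.
set c := 4 * M * _.
have -> : h + c = \int[mu]_x (h * gkernel k (x - y) + c * gkernel (k / 2) (x - y)).
  by rewrite RintD; [|exact: intbleZ..]; rewrite RintZ// Rint_gkernel// mulr1 RintZ// Rint_gkernel// mulr1.
apply: Rint_le; [exact: intble_norm|by apply: intbleD; exact: intbleZ|] => x.
rewrite normrM (ger0_norm (gkernel_ge0 _ (ltW k0))).
have [xr|xr] := ltP `|x - y| r.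
  rewrite -[leLHS]addr0 lerD//.
    by rewrite ler_wpM2r ?hq// gkernel_ge0// ltW.
  by rewrite /c !mulr_ge0// ?gauss_ge0 ?invr_ge0 1?ltW// divr_ge0.
rewrite -[leLHS]add0r lerD//.
  by rewrite mulr_ge0// gkernel_ge0// ltW.
have gE : gauss k (x - y) <= gauss (k / 2) (x - y) * gauss (k / 2) r.
  rewrite /gauss -expRD ler_expR.
  have : r ^+ 2 <= (x - y) ^+ 2 by rewrite -[leRHS]sqr_abs lerXn2r// nnegrE// ltW.
  have : 0 <= k ^+ 2 by rewrite sqr_ge0.
  by rewrite !exprMn; nra.
have -> : c * gkernel (k / 2) (x - y) =
   (M + M) * (k / Num.sqrt (2 * pi) * (gauss (k / 2) (x - y) * gauss (k / 2) r)).
  by rewrite /c /gkernel; field; rewrite gt_eqF// sqrt2pi_gt0.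
apply: ler_pM => //.
- by rewrite gkernel_ge0// ltW.
- by rewrite (le_trans (ler_normB _ _))// lerD.
- by rewrite ler_wpM2l// divr_ge0// ltW.
Qed.

End Gaussian.

Lemma gauss_seq_cvg0 (R : realType) (a r : R) : 0 < a -> 0 < r ->
  gauss (n.+1%:R * a) r @[n --> \oo] --> (0 : R).
Proof.
move=> a0 r0.
have c0 := @expR_nat_cvg0 R ((a * r) ^+ 2 / 2) _.
have {}c0 : expR (- ((a * r) ^+ 2 / 2 * n%:R)) @[n --> \oo] --> (0 : R).
  by apply: c0; rewrite divr_gt0// exprn_gt0// mulr_gt0.
apply: (squeeze_cvgr _ (cvg_cst (0:R)) c0).
apply: nearW => n; rewrite gauss_ge0/= /gauss ler_expR.
have h1 : n%:R <= n.+1%:R ^+ 2 :> R.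
  by rewrite -natrX ler_nat (leq_trans (leqnSn n))// expnS expn1 leq_pmulr.
have h2 : 0 <= (a * r) ^+ 2 by rewrite sqr_ge0.
rewrite -mulrA exprMn; nra.
Qed.

Lemma gauss_inv_cvg1 (R : realType) (x : R) :
  gauss (n.+1%:R^-1) x @[n --> \oo] --> (1 : R).
Proof.
have h : - (n.+1%:R^-1 * x) ^+ 2 / 2 @[n --> \oo] --> (0 : R).
  have h0 : n.+1%:R^-1 * x @[n --> \oo] --> (0 : R).
    by rewrite -[X in _ --> X](mul0r x); apply: cvgMr_tmp; exact: cvg_harmonic.
  rewrite -[X in _ --> X](_ : - (0 * 0) * 2^-1 = 0); last by rewrite mul0r oppr0 mul0r.
  apply: cvgMr_tmp; apply: cvgN; under eq_fun do rewrite expr2.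
  exact: cvgM.
have := @cvg_comp _ _ _ _ expR _ _ _ h (@continuous_expR R 0).
by rewrite expR0.
Qed.

Lemma cvg_ext (R : realType) (u v : nat -> R) (l : R) : (forall n, v n = u n) ->
  u n @[n --> \oo] --> l -> v n @[n --> \oo] --> l.
Proof. by move=> uv; rewrite (funext uv). Qed.

Lemma cvg_bounded (R : realType) (u : nat -> R) (l : R) :
  u n @[n --> \oo] --> l -> exists2 M : R, 0 <= M & forall n, `|u n| <= M.
Proof.
move=> /cvgP/cvg_seq_bounded [M [Mr hM]].
exists (`|M| + 1) => [|n]; first by rewrite addr_ge0.
by apply: (hM (`|M| + 1)) => //; rewrite (le_lt_trans (ler_norm M))// ltrDl.
Qed.

Lemma cvg_le_cst (R : realType) (u : nat -> R) (l M : R) :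
  u n @[n --> \oo] --> l -> (forall n, u n <= M) -> l <= M.
Proof.
move=> cu uM; rewrite -(cvg_lim _ cu)//; apply: limr_le; first exact: cvgP cu.
exact: nearW.
Qed.

Lemma cvg_ge_cst (R : realType) (u : nat -> R) (l M : R) :
  u n @[n --> \oo] --> l -> (forall n, M <= u n) -> M <= l.
Proof.
move=> cu uM; rewrite -(cvg_lim _ cu)//; apply: limr_ge; first exact: cvgP cu.
exact: nearW.
Qed.

Section Cutoff.
Context (R : realType).
Notation mu := (@lebesgue_measure R).

Lemma compact_support_unif (g : R -> R) (M h : R) : continuous g ->
  (forall x, M < `|x| -> g x = 0) -> 0 < h ->
  exists2 r, 0 < r & forall x y, `|x - y| < r -> `|g x - g y| <= h.
Proof.
move=> cg g0 h0; have h20 : 0 < h / 2 by rewrite divr_gt0.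
have /compact_near_coveringP K := @segment_compact R (- (M + 1)) (M + 1).
have := K R (0^'+) (fun r x => forall y, `|x - y| < r -> `|g x - g y| <= h) _.
case=> [x _|r0 /= r00 hr].
  move/cvgrPdist_le : (cg x) => /(_ _ h20)/nbhs_ballP[r /= r0 hr].
  near=> x' r' => y /= xy.
  have h1 : `|g x - g x'| <= h / 2.
    apply: hr; near: x'; apply: nbhsx_ballx => //.
  have h2 : `|g x - g y| <= h / 2.
    apply: hr; rewrite /ball/=.
    have h3 : `|x - x'| < r / 2 by near: x'; apply: nbhsx_ballx; rewrite divr_gt0.
    have h4 : r' < r / 2 by near: r'; apply: nbhs_right_lt; rewrite divr_gt0.
    rewrite (_ : x - y = (x - x') + (x' - y)); last by ring.
    by rewrite (le_lt_trans (ler_normD _ _))//; lra.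
  rewrite (_ : g x' - g y = (g x - g y) - (g x - g x')); last by ring.
  by rewrite (le_trans (ler_normB _ _))//; lra.
(* The cap 1 handles points outside the compact interval: if |x| > M + 1 and |x - y| < 1 then |y| >
   M, and both values are 0. *)
pose r := Num.min (r0 / 2) 1.
have r_gt0 : 0 < r by rewrite lt_min divr_gt0//= ltr01.
exists r => // x y xy.
have [xM|xM] := leP `|x| (M + 1).
  apply: (hr r) => //=.
  - by rewrite sub0r normrN gtr0_norm// gt_min ltr_pdivrMr// ltr_pMr// ltr1n.
  - by rewrite in_itv/= -ler_norml.
rewrite !g0 ?subrr ?normr0 ?(ltW h0)//; last by rewrite (lt_trans _ xM)// ltrDl.
have : `|x - y| < 1 by rewrite (lt_le_trans xy)// ge_min lexx orbT.
have : `|x| <= `|x - y| + `|y| by rewrite -{1}(subrK y x) ler_normD.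
lra.
Unshelve. all: by end_near. Qed.

(** The projection of z onto [0, 1], written with absolute values so that its continuity is that of
    the norm. *)
Definition clamp (z : R) : R := (1 + `|z| - `|z - 1|) / 2.

Lemma clamp0 z : z <= 0 -> clamp z = 0.
Proof. by move=> z0; rewrite /clamp !ler0_norm//; lra. Qed.

Lemma clamp1 z : 1 <= z -> clamp z = 1.
Proof. by move=> z0; rewrite /clamp !ger0_norm//; lra. Qed.

Lemma clamp_ge0 z : 0 <= clamp z.
Proof.
rewrite /clamp; have := ler_norm (z - 1); have := ler_normB z 1.
rewrite normr1; lra.
Qed.

Lemma clamp_le1 z : clamp z <= 1.
Proof.
rewrite /clamp; have := ler_normD (z - 1) 1.
rewrite normr1 subrK; lra.
Qed.

Lemma clamp_continuous : continuous clamp.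
Proof.
move=> z; apply: cvgMr_tmp; apply: cvgB.
  by apply: cvgD; [exact: cvg_cst|exact: norm_continuous].
apply: (@cvg_comp _ _ _ (fun z => z - 1) (fun z => `|z|)); last exact: norm_continuous.
by apply: cvgB; [exact: cvg_id|exact: cvg_cst].
Qed.

(* Continuous, supported in [1/k <= |x - a| <= k + 1]; tends to 1 off [a]. *)
Definition cutoff (a : R) (k : nat) (x : R) : R :=
  clamp (k%:R * `|x - a| - 1) * clamp (k.+1%:R - `|x - a|).

Lemma cutoff_ge0 a k x : 0 <= cutoff a k x.
Proof. by rewrite mulr_ge0 ?clamp_ge0. Qed.

Lemma cutoff_le1 a k x : cutoff a k x <= 1.
Proof. by rewrite mulr_ile1 ?clamp_ge0 ?clamp_le1. Qed.

Lemma continuous_dist (a : R) : continuous (fun x : R => `|x - a|).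
Proof.
move=> x; apply: (@cvg_comp _ _ _ (fun z => z - a) (fun z => `|z|)); last exact: norm_continuous.
by apply: cvgB; [exact: cvg_id|exact: cvg_cst].
Qed.

Lemma cutoff_continuous a k : continuous (cutoff a k).
Proof.
move=> x; apply: cvgM.
  apply: (@cvg_comp _ _ _ (fun x => k%:R * `|x - a| - 1) clamp); last exact: clamp_continuous.
  by apply: cvgB; [apply: cvgMl_tmp; exact: continuous_dist|exact: cvg_cst].
apply: (@cvg_comp _ _ _ (fun x => k.+1%:R - `|x - a|) clamp); last exact: clamp_continuous.
by apply: cvgB; [exact: cvg_cst|exact: continuous_dist].
Qed.

Lemma cutoff_near a k x : k%:R * `|x - a| <= 1 -> cutoff a k x = 0.
Proof. by move=> h; rewrite /cutoff clamp0 ?mul0r// subr_le0. Qed.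

Lemma cutoff_far a k x : k.+1%:R <= `|x - a| -> cutoff a k x = 0.
Proof. by move=> h; rewrite /cutoff [X in _ * X]clamp0 ?mulr0// subr_le0. Qed.

Lemma cutoff_cvg a x : cutoff a k x @[k --> \oo] --> (if x == a then 0 else 1 : R).
Proof.
have [->|xa] := eqVneq x a.
  by apply: cvg_near_cst; apply: nearW => k; rewrite cutoff_near// subrr normr0 mulr0.
have d0 : 0 < `|x - a| by rewrite normr_gt0 subr_eq0.
apply: cvg_near_cst; near=> k.
rewrite /cutoff !clamp1 ?mulr1//.
  have : `|x - a| <= k%:R by near: k; exact: nbhs_infty_ger.
  by rewrite -natr1; lra.
have : 2 / `|x - a| <= k%:R by near: k; exact: nbhs_infty_ger.
by rewrite ler_pdivrMr//; lra.
Unshelve. all: by end_near. Qed.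

Lemma cutoffM_continuous a k (g : R -> R) : (0 < k)%N ->
  (forall x, x != a -> {for x, continuous g}) ->
  continuous (fun x => g x * cutoff a k x).
Proof.
move=> k0 cg x; have [->|xa] := eqVneq x a; last first.
  by apply: cvgM; [exact: cg|exact: cutoff_continuous].
rewrite /continuous_at [X in _ --> X](_ : _ = 0); last first.
  by rewrite cutoff_near ?mulr0// subrr normr0 mulr0.
apply: cvg_near_cst; apply/nbhs_ballP; exists k%:R^-1 => /=.
  by rewrite invr_gt0 ltr0n.
move=> y; rewrite /ball/= distrC => /ltW hy.
by rewrite cutoff_near ?mulr0// mulrC -ler_pdivlMr ?ltr0n// mul1r.
Qed.

Lemma Rint_remove_point (a : R) (f : R -> R) : intble mu f ->
  \int[mu]_x ((if x == a then 0 else 1) * f x) = \int[mu]_x f x.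
Proof.
move=> hf; have mf := intble_measurable hf.
have E x : (if x == a then 0 else 1) * f x = f x - (f \_ [set a]) x.
  rewrite patchE; case: eqP => [->|xa].
    by rewrite mem_set// mul0r subrr.
  by rewrite memNset ?mul1r ?subr0.
have hi : intble mu (f \_ [set a]).
  apply: (intble_le_norm _ _ hf).
    by apply/(measurable_restrictT _ _).1 => //; exact: measurable_funTS.
  by move=> x; rewrite patchE; case: ifP => // _; rewrite normr0.
under eq_Rint do rewrite E.
rewrite RintB// [X in _ - X](_ : _ = 0) ?subr0//.
by rewrite -Rintegral_mkcond Rintegral_set1.
Qed.

End Cutoff.

Lemma measurable_snd_real d (T : measurableType d) (R : realType) :
  measurable_fun [set: T * measurableTypeR R] (fun z => z.2 : R).
Proof. by move=> _ Y mY; exact: measurable_snd. Qed.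

Lemma measurable_fst_real d (T : measurableType d) (R : realType) :
  measurable_fun [set: measurableTypeR R * T] (fun z => z.1 : R).
Proof. by move=> _ Y mY; exact: measurable_fst. Qed.

Section Levy.
Context d (T : measurableType d) (R : realType) (P : probability T R).
Variables (w X : nat -> T -> R) (C S : R -> R).
Notation mu := (@lebesgue_measure R).
Hypothesis mw : forall n, measurable_fun setT (w n).
Hypothesis mX : forall n, measurable_fun setT (X n).
Hypothesis w_ge0 : forall n t, 0 <= w n t.
Hypothesis iw : forall n, intble P (w n).

(** The weights need not have mass 1. This generality allows two uses: with the local weights N_n
    e^(alpha W_n) ker (W_n) / alpha, and with constant weight 1 for the law of the normalised
    sum. *)
Definition wmean n (g : R -> R) := \int[P]_t (w n t * g (X n t)).

Hypothesis cvgC : forall u, wmean n (fun x => cos (u * x)) @[n --> \oo] --> C u.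
Hypothesis cvgS : forall u, wmean n (fun x => sin (u * x)) @[n --> \oo] --> S u.
Hypothesis iC : intble mu C.
Hypothesis iS : intble mu S.
Hypothesis cC : {for 0, continuous C}.

Lemma wmean_intble n (g : R -> R) (M : R) : measurable_fun setT g -> (forall x, `|g x| <= M) ->
  intble P (fun t => w n t * g (X n t)).
Proof.
move=> mg gM; rewrite [X in intble _ X](_ : _ = fun t => g (X n t) * w n t).
  apply: (intbleM (M := M)); [|by move=> t; exact: gM|exact: iw].
  exact: measurableT_comp.
by apply/funext => t; rewrite mulrC.
Qed.

Lemma wmean_le n (g : R -> R) (M : R) : measurable_fun setT g -> (forall x, `|g x| <= M) ->
  `|wmean n g| <= M * \int[P]_t w n t.
Proof.
move=> mg gM; rewrite /wmean.
rewrite [X in `|X|](_ : _ = \int[P]_t (g (X n t) * w n t)); last first.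
  by apply: eq_Rint => t; rewrite mulrC.
by apply: Rint_bound => //; exact: measurableT_comp.
Qed.

Lemma mass_cvg : \int[P]_t w n t @[n --> \oo] --> C 0.
Proof.
have -> : (fun n => \int[P]_t w n t) = (fun n => wmean n (fun x => cos (0 * x))).
  by apply/funext => n; apply: eq_Rint => t; rewrite mul0r cos0 mulr1.
exact: cvgC.
Qed.

Lemma mass_bounded : exists2 M : R, 0 <= M & forall n, \int[P]_t w n t <= M.
Proof.
have [M M0 hM] := cvg_bounded mass_cvg.
by exists M => // n; rewrite (le_trans (ler_norm _)).
Qed.

Lemma measurable_sinM (u : R) : measurable_fun setT (fun x : R => sin (u * x)).
Proof. exact: continuous_measurable_fun (@continuous_sinM R u). Qed.

Lemma measurable_cosM (u : R) : measurable_fun setT (fun x : R => cos (u * x)).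
Proof. exact: continuous_measurable_fun (@continuous_cosM R u). Qed.

(** Fubini rewrites the mean of a Fourier transform through the transforms of the weighted laws.
    These converge pointwise and are bounded by the masses, so dominated convergence in u
    applies. *)
Lemma wmean_fourier (a b : R -> R) : intble mu a -> intble mu b ->
  wmean n (fun y => \int[mu]_u (a u * cos (u * y) + b u * sin (u * y)))
    @[n --> \oo] --> \int[mu]_u (a u * C u + b u * S u).
Proof.
move=> ia ib; have ma := intble_measurable ia; have mb := intble_measurable ib.
pose f n t u := w n t * (a u * cos (u * X n t) + b u * sin (u * X n t)).
have iab : intble mu (fun u => `|a u| + `|b u|).
  by apply: intbleD; exact: intble_norm.
have mf n : measurable_fun [set: T * measurableTypeR R] (fun z => f n z.1 z.2).
  have m1 : measurable_fun [set: T * measurableTypeR R] (fun z => z.2 * X n z.1).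
    apply: measurable_funM; first exact: measurable_snd_real.
    exact: (measurableT_comp (mX n) measurable_fst).
  apply: measurable_funM; first exact: (measurableT_comp (mw n) measurable_fst).
  apply: measurable_funD; apply: measurable_funM.
  - exact: (measurableT_comp ma measurable_snd).
  - by apply: (measurableT_comp _ m1); exact: continuous_measurable_fun (@continuous_cos R).
  - exact: (measurableT_comp mb measurable_snd).
  - by apply: (measurableT_comp _ m1); exact: continuous_measurable_fun (@continuous_sin R).
have fb n t u : `|f n t u| <= w n t * (`|a u| + `|b u|).
  rewrite /f normrM (ger0_norm (w_ge0 n t)) ler_wpM2l//.
  rewrite (le_trans (ler_normD _ _))// !normrM lerD// ler_piMr// ?cos_norm//.
  exact: sin_norm.
have E n : wmean n (fun y => \int[mu]_u (a u * cos (u * y) + b u * sin (u * y))) =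
    \int[mu]_u (\int[P]_t f n t u).
  rewrite -(Rfubini (mf n) (iw n) iab (fb n)); apply: eq_Rint => t.
  rewrite RintZ//; apply: intbleD.
    rewrite [X in intble _ X](_ : _ = fun u => cos (X n t * u) * a u).
      apply: (intbleM (M := 1)) => //; first exact: measurable_cosM.
      by move=> x; exact: cos_norm.
    by apply/funext => u; rewrite mulrC [u * _]mulrC.
  rewrite [X in intble _ X](_ : _ = fun u => sin (X n t * u) * b u).
    apply: (intbleM (M := 1)) => //; first exact: measurable_sinM.
    by move=> x; exact: sin_norm.
  by apply/funext => u; rewrite mulrC [u * _]mulrC.
under eq_fun do rewrite E.
have F n u : \int[P]_t f n t u = a u * wmean n (fun x => cos (u * x)) +
    b u * wmean n (fun x => sin (u * x)).
  have i1 := @wmean_intble n _ 1 (measurable_cosM u) (fun x => cos_norm _).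
  have i2 := @wmean_intble n _ 1 (measurable_sinM u) (fun x => sin_norm _).
  rewrite -!RintZ// -RintD; [|exact: intbleZ..].
  by apply: eq_Rint => t; rewrite /f; ring.
have [M M0 hM] := mass_bounded.
apply: (@Rint_dominated_cvg _ _ _ mu (fun n u => \int[P]_t f n t u)
  (fun u => a u * C u + b u * S u) (fun u => M * (`|a u| + `|b u|))).
- by move=> n; apply: intble_measurable; exact: (Rfubini_int2 (mf n) (iw n) iab (fb n)).
- move=> u; under eq_fun do rewrite F.
  by apply: cvgD; apply: cvgMl_tmp; [exact: cvgC|exact: cvgS].
- exact: intbleZ.
- move=> n u; have ifu := Rfubini_slice2 (mf n) (iw n) (fb n) u.
  rewrite (le_trans (Rint_norm ifu))//.
  rewrite (@le_trans _ _ ((`|a u| + `|b u|) * \int[P]_t w n t))//.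
    rewrite -RintZ//; apply: Rint_le; [exact: intble_norm|exact: intbleZ|] => t.
    by rewrite mulrC.
  by rewrite mulrC ler_wpM2r// addr_ge0.
Qed.

Definition levy_density x :=
  (2 * pi)^-1 * \int[mu]_u (cos (u * x) * C u + sin (u * x) * S u).

(** The inversion formula with the damping factor [gauss e], which amounts to convolving the limit
    with a centred normal law of standard deviation [e]. *)
Definition smooth_density e x := (2 * pi)^-1 *
  \int[mu]_u (cos (u * x) * gauss e u * C u + sin (u * x) * gauss e u * S u).

Lemma fourier_intble x : intble mu (fun u => cos (u * x) * C u + sin (u * x) * S u).
Proof.
apply: intbleD; apply: (intbleM (M := 1)) => //.
- by under eq_fun do rewrite mulrC; exact: measurable_cosM.
- by move=> u; exact: cos_norm.
- by under eq_fun do rewrite mulrC; exact: measurable_sinM.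
- by move=> u; exact: sin_norm.
Qed.

Lemma norm_CS_intble : intble mu (fun u => `|C u| + `|S u|).
Proof. by apply: intbleD; exact: intble_norm. Qed.

Lemma fourier_le x u :
  `|cos (u * x) * C u + sin (u * x) * S u| <= `|C u| + `|S u|.
Proof.
rewrite (le_trans (ler_normD _ _))// !normrM lerD// ler_piMl// ?cos_norm//.
exact: sin_norm.
Qed.

Lemma smooth_fourierE e x u :
  cos (u * x) * gauss e u * C u + sin (u * x) * gauss e u * S u =
  gauss e u * (cos (u * x) * C u + sin (u * x) * S u).
Proof. by ring. Qed.

Lemma twopi_neq0 : 2 * pi != 0 :> R.
Proof. by rewrite gt_eqF// mulr_gt0// pi_gt0. Qed.

Lemma inv2pi_gt0 : 0 < (2 * pi)^-1 :> R.
Proof. by rewrite invr_gt0 mulr_gt0// pi_gt0. Qed.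

Lemma smooth_density_le e x : `|smooth_density e x| <=
  (2 * pi)^-1 * \int[mu]_u (`|C u| + `|S u|).
Proof.
rewrite normrM (gtr0_norm inv2pi_gt0) ler_wpM2l// ?(ltW inv2pi_gt0)//.
have i : intble mu (fun u => cos (u * x) * gauss e u * C u + sin (u * x) * gauss e u * S u).
  under eq_fun do rewrite smooth_fourierE.
  apply: (intbleM (M := 1)); [exact: gauss_measurable| |exact: fourier_intble].
  by move=> u; rewrite ger0_norm ?gauss_ge0 ?gauss_le1.
rewrite (le_trans (Rint_norm i))//.
apply: Rint_le; [exact: intble_norm|exact: norm_CS_intble|] => u.
rewrite smooth_fourierE normrM (le_trans _ (fourier_le x u))//.
by rewrite ler_piMl// ger0_norm ?gauss_ge0 ?gauss_le1.
Qed.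

Lemma wmean_kernel e x : 0 < e ->
  wmean n (fun y => gkernel e^-1 (x - y)) @[n --> \oo] --> smooth_density e x.
Proof.
move=> e0.
have ic : intble mu (fun u => cos (u * x) * gauss e u).
  by under eq_fun do rewrite [_ * x]mulrC; exact: gauss_cos_intble.
have is' : intble mu (fun u => sin (u * x) * gauss e u).
  by under eq_fun do rewrite [_ * x]mulrC; exact: gauss_sin_intble.
have := wmean_fourier (intbleZ (2 * pi)^-1 ic) (intbleZ (2 * pi)^-1 is').
have E : smooth_density e x = \int[mu]_u ((2 * pi)^-1 * (cos (u * x) * gauss e u) * C u +
    (2 * pi)^-1 * (sin (u * x) * gauss e u) * S u).
  rewrite /smooth_density -RintZ.
    by apply: eq_Rint => u; ring.
  under eq_fun do rewrite smooth_fourierE.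
  apply: (intbleM (M := 1)); [exact: gauss_measurable| |exact: fourier_intble].
  by move=> u; rewrite ger0_norm ?gauss_ge0 ?gauss_le1.
rewrite -E; apply: cvg_ext => n.
congr (wmean n _); apply/funext => y.
rewrite -gkernel_fourier// -RintZ; last first.
  by under eq_fun do rewrite [_ * (x - y)]mulrC; exact: gauss_cos_intble.
by apply: eq_Rint => u; rewrite mulrBr cosB; ring.
Qed.

(** Positivity cannot be read off the inversion formula. It is inherited from the weighted means of
    a positive kernel, and then passes to [levy_density] as [e] tends to 0. *)
Lemma smooth_density_ge0 e x : 0 < e -> 0 <= smooth_density e x.
Proof.
move=> e0; apply: (cvg_ge_cst (wmean_kernel (x := x) e0)) => n.
apply: Rint_ge0 => t; rewrite mulr_ge0// gkernel_ge0// invr_ge0 ltW//.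
Qed.

Lemma smooth_density_cvg x :
  smooth_density n.+1%:R^-1 x @[n --> \oo] --> levy_density x.
Proof.
apply: cvgMl_tmp.
apply: (@Rint_dominated_cvg _ _ _ mu _ _ (fun u => `|C u| + `|S u|)).
- move=> n; under eq_fun do rewrite smooth_fourierE.
  apply: measurable_funM; first exact: gauss_measurable.
  exact: intble_measurable (fourier_intble x).
- move=> u; under eq_fun do rewrite smooth_fourierE.
  set z := (cos _ * _ + _).
  suff : gauss n.+1%:R^-1 u * z @[n --> \oo] --> 1 * z by rewrite mul1r.
  by apply: cvgMr_tmp; exact: gauss_inv_cvg1.
- exact: norm_CS_intble.
- move=> n u; rewrite smooth_fourierE normrM (le_trans _ (fourier_le x u))//.
  by rewrite ler_piMl// ger0_norm ?gauss_ge0 ?gauss_le1.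
Qed.

Lemma levy_density_ge0 x : 0 <= levy_density x.
Proof.
apply: (cvg_ge_cst (smooth_density_cvg (x := x))) => n.
exact: smooth_density_ge0.
Qed.

Let f e x u := gauss e x * (cos (u * x) * C u + sin (u * x) * S u).

Let mf e : measurable_fun [set: measurableTypeR R * measurableTypeR R]
  (fun z => f e z.1 z.2).
Proof.
have m1 : measurable_fun [set: measurableTypeR R * measurableTypeR R]
    (fun z => z.2 * z.1 : R).
  by apply: measurable_funM; [exact: measurable_snd_real|exact: measurable_fst_real].
apply: measurable_funM.
  by apply: (measurableT_comp (@gauss_measurable R e)); exact: measurable_fst_real.
apply: measurable_funD; apply: measurable_funM.
- by apply: (measurableT_comp _ m1); exact: continuous_measurable_fun (@continuous_cos R).
- by apply: (measurableT_comp (intble_measurable iC)); exact: measurable_snd.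
- by apply: (measurableT_comp _ m1); exact: continuous_measurable_fun (@continuous_sin R).
- by apply: (measurableT_comp (intble_measurable iS)); exact: measurable_snd.
Qed.

Let fb e x u : `|f e x u| <= gauss e x * (`|C u| + `|S u|).
Proof. by rewrite normrM (ger0_norm (gauss_ge0 _ _)) ler_wpM2l ?gauss_ge0 ?fourier_le. Qed.

Let intf e x : \int[mu]_u f e x u = 2 * pi * (gauss e x * levy_density x).
Proof.
rewrite RintZ; last exact: fourier_intble.
by rewrite /levy_density (mulrCA (2 * pi)) mulVKf// twopi_neq0.
Qed.

Lemma gauss_density_intble e : 0 < e -> intble mu (fun x => gauss e x * levy_density x).
Proof.
move=> e0; have := Rfubini_int1 (mf e) (gauss_intble e0) norm_CS_intble (fb e).
under eq_fun do rewrite intf.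
move=> /(intbleZ (2 * pi)^-1); congr intble; apply/funext => x.
by rewrite mulKf// twopi_neq0.
Qed.

(** Fubini moves the Gaussian factor to the frequency side: its cosine transform is an approximate
    identity at 0 acting on [C], and its sine transform vanishes by oddness. *)
Lemma gauss_density e : 0 < e -> \int[mu]_x (gauss e x * levy_density x) =
  \int[mu]_u (C u * gkernel e^-1 (u - 0)).
Proof.
move=> e0.
have : \int[mu]_x (\int[mu]_u f e x u) = \int[mu]_u (\int[mu]_x f e x u).
  exact: (Rfubini (mf e) (gauss_intble e0) norm_CS_intble (fb e)).
under eq_Rint do rewrite intf.
rewrite RintZ; last exact: gauss_density_intble.
have E u : \int[mu]_x f e x u = (2 * pi) * (C u * gkernel e^-1 (u - 0)).
  have -> : \int[mu]_x f e x u =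
      \int[mu]_x (C u * (cos (u * x) * gauss e x) + S u * (sin (u * x) * gauss e x)).
    by apply: eq_Rint => x; rewrite /f; ring.
  have ic := gauss_cos_intble u e0; have is' := gauss_sin_intble u e0.
  rewrite RintD; [|exact: intbleZ..].
  rewrite RintZ// RintZ// gauss_fourier_sin// mulr0 addr0 subr0 -gkernel_fourier//.
  under [in RHS]eq_Rint do rewrite [_ * u]mulrC.
  by rewrite (mulrCA (2 * pi)) mulVKf// twopi_neq0.
under [X in _ = X -> _]eq_Rint do rewrite E.
rewrite [X in _ = X -> _]RintZ; first by move/mulfI => -> //; exact: twopi_neq0.
have [M M0 hM] := mass_bounded.
under eq_fun do rewrite mulrC; apply: (intbleM (M := e^-1 / Num.sqrt (2 * pi))) => //.
  by under eq_fun do rewrite subr0; exact: gkernel_measurable.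
by move=> x; rewrite ger0_norm ?gkernel_ge0 ?gkernel_le ?invr_ge0 1?ltW.
Qed.

Lemma C_bounded : exists2 M : R, 0 <= M & forall u, `|C u| <= M.
Proof.
have [M M0 hM] := mass_bounded; exists M => // u.
have /cvg_norm h := @cvgC u.
apply: (cvg_le_cst h) => n.
have := @wmean_le n _ 1 (measurable_cosM u) (fun x => cos_norm _).
by rewrite mul1r => /le_trans; apply.
Qed.

Lemma kernel_C_cvg : \int[mu]_u (C u * gkernel n.+1%:R (u - 0)) @[n --> \oo] --> C 0.
Proof.
have [M M0 hM] := C_bounded.
apply/cvgrPdist_le => e e0; have e20 : 0 < e / 2 by rewrite divr_gt0.
have [r /= r0 hr] : exists2 r : R, 0 < r & forall x, `|x - 0| < r -> `|C x - C 0| <= e / 2.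
  move/cvgrPdist_le : cC => /(_ _ e20)/nbhs_ballP[r /= r0 hr].
  exists r => // x xr; rewrite distrC; apply: hr.
  by rewrite /ball/= distrC.
have h2 : 4 * M * gauss (n.+1%:R * 2^-1) r @[n --> \oo] --> (0 : R).
  rewrite -[X in _ --> X](mulr0 (4 * M)); apply: cvgMl_tmp.
  by apply: gauss_seq_cvg0.
move/cvgrPdist_le : h2 => /(_ _ e20); apply: filterS => n.
rewrite sub0r normrN ger0_norm ?mulr_ge0 ?gauss_ge0// => hn.
rewrite distrC (le_trans (gkernel_approx (M := M) (h := e / 2) _ r0 _ _ _ hr))//.
- exact: intble_measurable iC.
- exact: ltW.
- by rewrite [leRHS]splitr lerD2l.
Qed.

(** Integrability of the density is not known in advance. The Gaussian factors increase to 1, so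
    monotone convergence gives it together with the mass, and continuity of [C] at 0 identifies this
    mass as [C 0]: no mass is lost. *)
Lemma levy_density_mass : intble mu levy_density /\ \int[mu]_x levy_density x = C 0.
Proof.
apply: (@Rint_monotone _ _ _ mu (fun n x => gauss n.+1%:R^-1 x * levy_density x)).
- by move=> n; exact: gauss_density_intble.
- by move=> n x; rewrite mulr_ge0 ?gauss_ge0 ?levy_density_ge0.
- move=> x n k nk; rewrite ler_wpM2r ?levy_density_ge0// ler_expR.
  rewrite ler_pM2r ?invr_gt0// lerN2 !exprMn ler_wpM2r ?sqr_ge0//.
  by rewrite lerXn2r ?nnegrE// lef_pV2 ?posrE// ler_nat.
- move=> x; rewrite -[X in _ --> X]mul1r; apply: cvgMr_tmp; exact: gauss_inv_cvg1.
- apply: cvg_ext kernel_C_cvg => n.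
  have e0 : 0 < n.+1%:R^-1 :> R by [].
  by have := gauss_density e0; rewrite (invrK n.+1%:R).
Qed.

Lemma wmean_smooth n e (g : R -> R) : 0 < e -> intble mu g ->
  intble P (fun t => w n t * \int[mu]_x (g x * gkernel e^-1 (x - X n t))) /\
  wmean n (fun y => \int[mu]_x (g x * gkernel e^-1 (x - y))) =
  \int[mu]_x (g x * wmean n (fun y => gkernel e^-1 (x - y))).
Proof.
move=> e0 ig; have mg := intble_measurable ig.
have ei0 : 0 <= e^-1 by rewrite invr_ge0 ltW.
pose h t x := w n t * (g x * gkernel e^-1 (x - X n t)).
have mh : measurable_fun [set: T * measurableTypeR R] (fun z => h z.1 z.2).
  apply: measurable_funM; first exact: (measurableT_comp (mw n) measurable_fst).
  apply: measurable_funM; first by apply: (measurableT_comp mg); exact: measurable_snd.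
  apply: (measurableT_comp (@gkernel_measurable R e^-1)); apply: measurable_funB.
    exact: measurable_snd_real.
  exact: (measurableT_comp (mX n) measurable_fst).
have hb t x : `|h t x| <= w n t * (e^-1 / Num.sqrt (2 * pi) * `|g x|).
  rewrite /h normrM (ger0_norm (w_ge0 n t)) ler_wpM2l// normrM mulrC ler_wpM2r//.
  by rewrite (ger0_norm (gkernel_ge0 _ ei0)) gkernel_le.
have ib : intble mu (fun x => e^-1 / Num.sqrt (2 * pi) * `|g x|).
  by apply: intbleZ; exact: intble_norm.
have : \int[P]_t (\int[mu]_x h t x) = \int[mu]_x (\int[P]_t h t x).
  exact: (Rfubini mh (iw n) ib hb).
move=> H.
have E t : \int[mu]_x h t x = w n t * \int[mu]_x (g x * gkernel e^-1 (x - X n t)).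
  rewrite RintZ//.
  under eq_fun do rewrite mulrC; apply: (intbleM (M := e^-1 / Num.sqrt (2 * pi))) => //.
    by apply: (measurableT_comp (@gkernel_measurable R e^-1)); exact: measurable_funB.
  by move=> x; rewrite (ger0_norm (gkernel_ge0 _ ei0)) gkernel_le.
split.
  have := Rfubini_int1 mh (iw n) ib hb.
  by congr intble; apply/funext => t; exact: E.
transitivity (\int[P]_t (\int[mu]_x h t x)); first by apply: eq_Rint => t; rewrite E.
rewrite H; apply: eq_Rint => x; rewrite -RintZ.
  by apply: eq_Rint => t; rewrite /h; ring.
apply: (@wmean_intble n (fun y => gkernel e^-1 (x - y)) (e^-1 / Num.sqrt (2 * pi))).
  apply: (measurableT_comp (@gkernel_measurable R e^-1)); exact: measurable_funB.
by move=> y; rewrite (ger0_norm (gkernel_ge0 _ ei0)) gkernel_le.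
Qed.

(** Measurability in x comes from Fubini, whose product bound must be integrable in x. The factor
    [gauss 1 x] supplies this, and is divided out afterwards through [expR ((1 * x) ^+ 2 / 2)]. *)
Lemma wmean_kernel_measurable n e : 0 < e ->
  measurable_fun setT (fun x : R => wmean n (fun y => gkernel e^-1 (x - y))).
Proof.
move=> e0; have ei0 : 0 <= e^-1 by rewrite invr_ge0 ltW.
pose h' t x := w n t * (gauss 1 x * gkernel e^-1 (x - X n t)).
have mh : measurable_fun [set: T * measurableTypeR R] (fun z => h' z.1 z.2).
  apply: measurable_funM; first exact: (measurableT_comp (mw n) measurable_fst).
  apply: measurable_funM.
    by apply: (measurableT_comp (@gauss_measurable R 1)); exact: measurable_snd_real.
  apply: (measurableT_comp (@gkernel_measurable R e^-1)); apply: measurable_funB.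
    exact: measurable_snd_real.
  exact: (measurableT_comp (mX n) measurable_fst).
have hb t x : `|h' t x| <= w n t * (e^-1 / Num.sqrt (2 * pi) * gauss 1 x).
  rewrite /h' normrM (ger0_norm (w_ge0 n t)) ler_wpM2l// normrM.
  rewrite (ger0_norm (gauss_ge0 _ _)) mulrC ler_wpM2r ?gauss_ge0//.
  by rewrite (ger0_norm (gkernel_ge0 _ ei0)) gkernel_le.
have ib : intble mu (fun x => e^-1 / Num.sqrt (2 * pi) * gauss 1 x).
  by apply: intbleZ; exact: gauss_intble.
have h1 : intble mu (fun x => \int[P]_t h' t x) by exact: (Rfubini_int2 mh (iw n) ib hb).
have := intble_measurable h1.
have h2 : measurable_fun setT (fun x : R => expR ((1 * x) ^+ 2 / 2)).
  apply: continuous_measurable_fun; apply: deriv_continuous => x.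
  by eexists; derivs.
move=> /(measurable_funM h2); congr (measurable_fun _ _); apply/funext => x /=.
rewrite /wmean -RintZ; last exact: (Rfubini_slice2 mh (iw n) hb).
have E : expR ((1 * x) ^+ 2 / 2) * gauss 1 x = 1.
  by rewrite /gauss -expRD mulNr subrr expR0.
apply: eq_Rint => t; rewrite /h'.
transitivity (expR ((1 * x) ^+ 2 / 2) * gauss 1 x * (w n t * gkernel e^-1 (x - X n t))).
  by ring.
by rewrite E mul1r.
Qed.

Lemma wmean_smooth_cvg e (g : R -> R) : 0 < e -> intble mu g ->
  wmean n (fun y => \int[mu]_x (g x * gkernel e^-1 (x - y))) @[n --> \oo] -->
  \int[mu]_x (g x * smooth_density e x).
Proof.
move=> e0 ig; have mg := intble_measurable ig.
have ei0 : 0 <= e^-1 by rewrite invr_ge0 ltW.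
under eq_fun do rewrite (wmean_smooth _ e0 ig).2.
have [M M0 hM] := mass_bounded.
have mk (x : R) : measurable_fun setT (fun y : R => gkernel e^-1 (x - y)).
  apply: (measurableT_comp (@gkernel_measurable R e^-1)); exact: measurable_funB.
have kb x y : `|gkernel e^-1 (x - y)| <= e^-1 / Num.sqrt (2 * pi).
  by rewrite (ger0_norm (gkernel_ge0 _ ei0)) gkernel_le.
pose K := e^-1 / Num.sqrt (2 * pi) * M.
have K0 : 0 <= K by rewrite mulr_ge0// divr_ge0.
apply: (@Rint_dominated_cvg _ _ _ mu _ _ (fun x => K * `|g x|)).
- by move=> n; apply: measurable_funM => //; exact: wmean_kernel_measurable.
- by move=> x; apply: cvgMl_tmp; exact: wmean_kernel.
- by apply: intbleZ; exact: intble_norm.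
- move=> n x; rewrite normrM mulrC ler_wpM2r// (le_trans (wmean_le _ (mk x) (kb x)))//.
  by rewrite ler_wpM2l// divr_ge0.
Qed.

Lemma smooth_integral_cvg (g : R -> R) : intble mu g ->
  \int[mu]_x (g x * smooth_density n.+1%:R^-1 x) @[n --> \oo] -->
  \int[mu]_x (g x * levy_density x).
Proof.
move=> ig; have mg := intble_measurable ig.
pose K := (2 * pi)^-1 * \int[mu]_u (`|C u| + `|S u|).
apply: (@Rint_dominated_cvg _ _ _ mu _ _ (fun x => K * `|g x|)).
- move=> n; apply: measurable_funM => //.
  have e0 : 0 < n.+1%:R^-1 :> R by [].
  have mk k : measurable_fun setT
      (fun x : R => wmean k (fun y => gkernel n.+1%:R^-1^-1 (x - y))).
    exact: wmean_kernel_measurable.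
  have ck x : [set: R] x ->
      wmean k (fun y => gkernel n.+1%:R^-1^-1 (x - y)) @[k --> \oo] -->
      smooth_density n.+1%:R^-1 x.
    by move=> _; exact: wmean_kernel.
  exact: (measurable_fun_cvg mk ck).
- by move=> x; apply: cvgMl_tmp; exact: smooth_density_cvg.
- by apply: intbleZ; exact: intble_norm.
- by move=> n x; rewrite normrM mulrC ler_wpM2r// smooth_density_le.
Qed.

(** The test function is replaced by its convolution with a narrow Gaussian kernel, for which
    convergence is known. The width is fixed before n: uniform continuity makes the replacement
    error proportional to the mass, which is bounded in n. *)
Lemma wmean_unif_cvg (g : R -> R) (B : R) : intble mu g -> (forall x, `|g x| <= B) ->
  (forall h, 0 < h -> exists2 r, 0 < r & forall x y, `|x - y| < r -> `|g x - g y| <= h) ->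
  wmean n g @[n --> \oo] --> \int[mu]_x (g x * levy_density x).
Proof.
move=> ig gB ug; have mg := intble_measurable ig.
have [M M0 hM] := mass_bounded.
have B0 : 0 <= B by rewrite (le_trans _ (gB 0)).
apply/cvgrPdist_le => e e0.
(* Smoothing changes [g] by at most 2h, hence its mean by at most 2hM <= e / 2; the smoothed mean
   and the smoothed limit cost e / 4 each. The [+ 1] keeps the denominator positive when the mass
   bound is 0. *)
pose h := e / (4 * (M + 1)).
have h0 : 0 < h by rewrite divr_gt0// mulr_gt0// ltr_wpDl.
have e40 : 0 < e / 4 by rewrite divr_gt0.
have [r r0 hr] := ug _ h0.
have c1 : 4 * B * gauss (n.+1%:R * 2^-1) r @[n --> \oo] --> (0 : R).
  rewrite -[X in _ --> X](mulr0 (4 * B)); apply: cvgMl_tmp.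
  by apply: gauss_seq_cvg0.
have c2 := smooth_integral_cvg ig.
have [k [k1 k2]] : exists k : nat, `|4 * B * gauss (k.+1%:R * 2^-1) r| <= h /\
   `|\int[mu]_x (g x * levy_density x) - \int[mu]_x (g x * smooth_density k.+1%:R^-1 x)| <= e / 4.
  move/cvgrPdist_le : c1 => /(_ _ h0) [N1 _ H1].
  move/cvgrPdist_le : c2 => /(_ _ e40) [N2 _ H2].
  exists (maxn N1 N2); split.
    by have := H1 (maxn N1 N2) (leq_maxl _ _); rewrite /= sub0r normrN.
  by have := H2 (maxn N1 N2) (leq_maxr _ _).
have e10 : 0 < k.+1%:R^-1 :> R by [].
have c3 := wmean_smooth_cvg e10 ig.
move/cvgrPdist_le : c3 => /(_ _ e40); apply: filterS => n hn.
pose ge y := \int[mu]_x (g x * gkernel k.+1%:R^-1^-1 (x - y)).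
have hge y : `|ge y - g y| <= h + h.
  rewrite /ge; under eq_Rint do rewrite (invrK k.+1%:R).
  rewrite (le_trans (gkernel_approx (M := B) (h := h) _ r0 mg gB (ltW h0) _))//.
    by move=> x; exact: hr.
  by rewrite lerD2l (le_trans (ler_norm _)).
have [i1 E1] := wmean_smooth n e10 ig.
have d1 : `|wmean n g - wmean n ge| <= e / 2.
  rewrite /wmean -RintB//; last exact: (wmean_intble _ mg gB).
  have E2 t : w n t * g (X n t) - w n t * ge (X n t) = (g (X n t) - ge (X n t)) * w n t.
    by ring.
  have i2 : intble P (fun t => (g (X n t) - ge (X n t)) * w n t).
    under eq_fun do rewrite -E2.
    by apply: intbleB => //; exact: (wmean_intble _ mg gB).
  rewrite (eq_Rint _ E2) (le_trans (Rint_norm i2))//.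
  apply: (@le_trans _ _ ((h + h) * \int[P]_t w n t)).
    rewrite -RintZ//; apply: Rint_le; [exact: intble_norm|exact: intbleZ|] => t.
    by rewrite normrM (ger0_norm (w_ge0 n t)) ler_wpM2r// distrC.
  have -> : e / 2 = (h + h) * (M + 1) by rewrite /h; field; rewrite gt_eqF// ltr_wpDl.
  by rewrite ler_wpM2l ?addr_ge0 ?(ltW h0)// (le_trans (hM n))// lerDl.
move: hn; rewrite /= -/ge => hn.
set I := \int[mu]_x (g x * levy_density x) in k2 *.
set J := \int[mu]_x (g x * smooth_density _ x) in k2 hn.
have -> : I - wmean n g = (I - J) + (J - wmean n ge) - (wmean n g - wmean n ge) by ring.
rewrite (le_trans (ler_normB _ _))// (le_trans (lerD (ler_normD _ _) d1))//.
rewrite (le_trans (lerD (lerD k2 hn) (lexx _)))//.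
by lra.
Qed.

Lemma compact_intble (g : R -> R) (B M : R) : continuous g ->
  (forall x, `|g x| <= B) -> (forall x, M < `|x| -> g x = 0) -> intble mu g.
Proof.
move=> cg gB g0.
have B0 : 0 <= B by rewrite (le_trans _ (gB 0)).
apply: (@intble_le _ _ _ mu _ (fun x => B * expR (M ^+ 2 / 2) * gauss 1 x)).
- exact: continuous_measurable_fun.
- move=> x; have [xM|xM] := leP `|x| M; last first.
    by rewrite g0// normr0 !mulr_ge0// ?expR_ge0 ?gauss_ge0.
  rewrite (le_trans (gB x))// -mulrA ler_peMr// /gauss -expRD.
  rewrite -[leLHS]expR0 ler_expR mul1r -(sqr_abs x).
  have : `|x| ^+ 2 <= M ^+ 2 by rewrite lerXn2r// nnegrE// (le_trans _ xM).
  lra.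
- by apply: intbleZ; exact: gauss_intble.
Qed.

(** The cutoff makes [g] continuous with compact support. The mass that it removes is controlled
    because the cutoff is itself an admissible test function and the total masses converge to [C 0],
    the full mass of the density; so nothing escapes to infinity or concentrates at [a]. *)
Theorem wmean_cvg (g : R -> R) (a B : R) : measurable_fun setT g ->
  (forall x, `|g x| <= B) -> (forall x, x != a -> {for x, continuous g}) ->
  wmean n g @[n --> \oo] --> \int[mu]_x (g x * levy_density x).
Proof.
move=> mg gB cg; have [idens mdens] := levy_density_mass.
have B0 : 0 <= B by rewrite (le_trans _ (gB 0)).
have far k x : `|a| + k.+1%:R < `|x| -> cutoff a k x = 0.
  move=> h; apply: cutoff_far; have := ler_normD (x - a) a; rewrite subrK; lra.
have cN k x : `|cutoff a k x| <= 1 by rewrite ger0_norm ?cutoff_ge0 ?cutoff_le1.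
have gcB k x : `|g x * cutoff a k x| <= B.
  by rewrite normrM (le_trans (ler_piMr _ (cN k x))).
have cc k : wmean n (cutoff a k) @[n --> \oo] -->
    \int[mu]_x (cutoff a k x * levy_density x).
  apply: (wmean_unif_cvg (B := 1)) => //.
    exact: (compact_intble (@cutoff_continuous _ a k) (cN k) (far k)).
  by move=> h h0; exact: (compact_support_unif (@cutoff_continuous _ a k) (far k)).
have cgc k : (0 < k)%N -> wmean n (fun x => g x * cutoff a k x) @[n --> \oo] -->
    \int[mu]_x (g x * cutoff a k x * levy_density x).
  move=> k0; have ct := cutoffM_continuous k0 cg.
  have far' x : `|a| + k.+1%:R < `|x| -> g x * cutoff a k x = 0.
    by move=> /far ->; rewrite mulr0.
  apply: (wmean_unif_cvg (B := B)) => //.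
    exact: (compact_intble ct (gcB k) far').
  by move=> h h0; exact: (compact_support_unif ct far').
have mc k : measurable_fun setT (cutoff a k).
  exact: continuous_measurable_fun (@cutoff_continuous _ a k).
have clim : \int[mu]_x (cutoff a k x * levy_density x) @[k --> \oo] --> C 0.
  rewrite -mdens -(Rint_remove_point a idens).
  apply: (@Rint_dominated_cvg _ _ _ mu _ _ levy_density) => //.
  - by move=> k; exact: (measurable_funM (mc k) (intble_measurable idens)).
  - by move=> x; apply: cvgMr_tmp; exact: cutoff_cvg.
  - move=> k x; rewrite normrM (ger0_norm (levy_density_ge0 x)).
    by rewrite ler_piMl ?levy_density_ge0.
apply/cvgrPdist_le => e e0.
(* The mass cut from the limit is at most h and that cut from the weights at most 2h for large n.
   These cost B h <= e / 4 and 2 B h <= e / 2, which leaves e / 4 for the truncated function. *)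
pose h := e / (4 * (B + 1)).
have h0 : 0 < h by rewrite divr_gt0// mulr_gt0// ltr_wpDl.
have [k [k0 hk]] : exists k, (0 < k)%N /\
    `|C 0 - \int[mu]_x (cutoff a k x * levy_density x)| <= h.
  move/cvgrPdist_le : clim => /(_ _ h0) [N _ HN].
  by exists N.+1; split => //; apply: HN => /=.
have idc : intble mu (fun x => cutoff a k x * levy_density x) by apply: (intbleM (M := 1)) => //; exact: mc.
have idg : intble mu (fun x => g x * levy_density x) by apply: (intbleM (M := B)) => //; exact: mg.
have idgc : intble mu (fun x => g x * cutoff a k x * levy_density x).
  by apply: (intbleM (M := B)) => //; exact: (measurable_funM mg (mc k)).
have e40 : 0 < e / 4 by rewrite divr_gt0.
have cm : \int[P]_t w n t - wmean n (cutoff a k) @[n --> \oo] -->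
    C 0 - \int[mu]_x (cutoff a k x * levy_density x).
  by apply: cvgB; [exact: mass_cvg|exact: cc].
move/cvgrPdist_le : cm => /(_ _ h0) H1.
move/cvgrPdist_le : (cgc k k0) => /(_ _ e40) H2.
near=> n.
have h1 : `|(C 0 - \int[mu]_x (cutoff a k x * levy_density x)) -
   (\int[P]_t w n t - wmean n (cutoff a k))| <= h by near: n.
have h2 : `|\int[mu]_x (g x * cutoff a k x * levy_density x) -
   wmean n (fun x => g x * cutoff a k x)| <= e / 4 by near: n.
have d1 : `|wmean n g - wmean n (fun x => g x * cutoff a k x)| <=
    B * (\int[P]_t w n t - wmean n (cutoff a k)).
  have i1 := wmean_intble n mg gB.
  have i2 : intble P (fun t => w n t * (g (X n t) * cutoff a k (X n t))).
    exact: (wmean_intble n (measurable_funM mg (mc k)) (gcB k)).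
  have i3 := wmean_intble n (mc k) (cN k).
  rewrite /wmean -RintB// -RintB// -RintZ; last exact: intbleB.
  rewrite (le_trans (Rint_norm (intbleB i1 i2)))//; apply: Rint_le.
  - exact: intble_norm (intbleB i1 i2).
  - by apply: intbleZ; exact: intbleB.
  - move=> t; rewrite (_ : _ - _ = g (X n t) * (w n t * (1 - cutoff a k (X n t)))); last by ring.
    have wc : 0 <= w n t * (1 - cutoff a k (X n t)) by rewrite mulr_ge0// subr_ge0 cutoff_le1.
    rewrite normrM (ger0_norm wc).
    rewrite (_ : w n t - _ = w n t * (1 - cutoff a k (X n t))); last by ring.
    by rewrite ler_wpM2r.
have d2 : `|\int[mu]_x (g x * levy_density x) -
    \int[mu]_x (g x * cutoff a k x * levy_density x)| <=
    B * (C 0 - \int[mu]_x (cutoff a k x * levy_density x)).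
  rewrite -mdens -RintB// -RintB// -RintZ; last exact: intbleB.
  rewrite (le_trans (Rint_norm (intbleB idg idgc)))//; apply: Rint_le.
  - exact: intble_norm (intbleB idg idgc).
  - by apply: intbleZ; exact: intbleB.
  - move=> x; rewrite (_ : _ - _ = g x * (levy_density x * (1 - cutoff a k x))); last by ring.
    have wc : 0 <= levy_density x * (1 - cutoff a k x).
      by rewrite mulr_ge0 ?levy_density_ge0// subr_ge0 cutoff_le1.
    rewrite normrM (ger0_norm wc).
    rewrite (_ : levy_density x - _ = levy_density x * (1 - cutoff a k x)); last by ring.
    by rewrite ler_wpM2r.
have Bh : B * h <= e / 4.
  rewrite /h mulrA ler_pdivrMr; last by rewrite mulr_gt0// ltr_wpDl.
  by rewrite -mulrA [X in _ <= _ * X](_ : _ = B + 1); [nra|field].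
move: h1 h2 d1 d2 hk.
set I1 := \int[mu]_x (g x * levy_density x); set I2 := \int[mu]_x (g x * cutoff a k x * _).
set I3 := \int[mu]_x (cutoff a k x * _); set W2 := wmean n (fun x => g x * _).
set W1 := wmean n g; set W3 := wmean n (cutoff a k); set m0 := \int[P]_t w n t.
move=> h1 h2 d1 d2 hk.
rewrite (_ : I1 - W1 = (I1 - I2) + (I2 - W2) - (W1 - W2)); last by ring.
rewrite (le_trans (ler_normB _ _))// (le_trans (lerD (ler_normD _ _) d1))//.
rewrite (le_trans (lerD (lerD d2 h2) (lexx _)))//.
move: h1 hk; rewrite !ler_norml => /andP[h11 h12] /andP[k1 k2].
have : B * (C 0 - I3) <= B * h by rewrite ler_wpM2l.
have : B * (m0 - W3) <= B * (h + h) by rewrite ler_wpM2l//; lra.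
lra.
Unshelve. all: by end_near. Qed.

End Levy.

Lemma deriv_slope (R : realType) (f : R -> R) (b : R) (k : nat -> nat) :
  has_derive f 0 b -> (\forall n \near \oo, (0 < k n)%N) ->
  (k n)%:R^-1 @[n --> \oo] --> (0 : R) ->
  (k n)%:R * (f (k n)%:R^-1 - f 0) @[n --> \oo] --> b.
Proof.
move=> df k0 ck.
have [dr bE] := df.
have h : h^-1 *: ((f \o shift 0) (h *: 1) - f 0) @[h --> 0^'] --> b.
  by rewrite -bE; exact: dr.
(* The sequential criterion asks for nonzero increments at every n, whereas [k n] is positive only
   from some point on. *)
pose u n : R := (maxn (k n) 1)%:R^-1.
have uk : \forall n \near \oo, (k n)%:R^-1 = u n.
  by apply: filterS k0 => n kn; rewrite /u; congr (_%:R^-1); apply/esym/maxn_idPl.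
have u0 n : u n != 0 by rewrite invr_neq0// pnatr_eq0 -lt0n leq_max orbT.
have cu : u n @[n --> \oo] --> 0 by apply: cvg_trans ck; apply: near_eq_cvg; apply: filterS uk.
move/cvgr_dnbhsP : h => /(_ u (conj u0 cu)); apply: cvg_trans.
apply: near_eq_cvg; apply: filterS uk => n E.
by rewrite -E /= /GRing.scale/= mulr1 addr0 invrK.
Qed.

(** * Powers of complex numbers in the unit disc *)

Section ComplexModulus.
Context (R : realType).
Notation C := R[i].
Notation Re := complex.Re.
Notation Im := complex.Im.
Notation normc := (@Normc.normc R).
Implicit Types (z w : C) (a b : R).

Lemma reM z w : Re (z * w) = Re z * Re w - Im z * Im w.
Proof. by case: z w => [? ?] [? ?]. Qed.

Lemma imM z w : Im (z * w) = Re z * Im w + Im z * Re w.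
Proof. by case: z w => [? ?] [? ?]. Qed.

Lemma reD z w : Re (z + w) = Re z + Re w. Proof. by case: z w => [? ?] [? ?]. Qed.
Lemma imD z w : Im (z + w) = Im z + Im w. Proof. by case: z w => [? ?] [? ?]. Qed.
Lemma reN z : Re (- z) = - Re z. Proof. by case: z => [? ?]. Qed.
Lemma imN z : Im (- z) = - Im z. Proof. by case: z => [? ?]. Qed.

Lemma normcE2 z : normc z = Num.sqrt (Re z ^+ 2 + Im z ^+ 2).
Proof. by case: z. Qed.

Lemma normc_nneg z : 0 <= normc z. Proof. by rewrite normcE2 sqrtr_ge0. Qed.

Lemma normc_sqr z : normc z ^+ 2 = Re z ^+ 2 + Im z ^+ 2.
Proof. by rewrite normcE2 sqr_sqrtr// addr_ge0 ?sqr_ge0. Qed.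

Lemma normc_geRe z : `|Re z| <= normc z.
Proof.
rewrite -(@ler_sqr R) ?nnegrE ?normc_nneg// sqr_abs normc_sqr lerDl.
exact: sqr_ge0.
Qed.

Lemma normc_geIm z : `|Im z| <= normc z.
Proof.
rewrite -(@ler_sqr R) ?nnegrE ?normc_nneg// sqr_abs normc_sqr lerDr.
exact: sqr_ge0.
Qed.

Lemma normc_le z : normc z <= `|Re z| + `|Im z|.
Proof.
rewrite -(@ler_sqr R) ?nnegrE ?normc_nneg ?addr_ge0//.
rewrite normc_sqr sqrrD !sqr_abs -addrA lerD2l lerDr.
by rewrite mulrn_wge0// mulr_ge0.
Qed.

Lemma normc_triangle z w : normc (z + w) <= normc z + normc w.
Proof. exact: le_normcD. Qed.

Lemma normcX z n : normc (z ^+ n) = normc z ^+ n.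
Proof.
elim: n => [|n ih]; first by rewrite !expr0 Normc.normc1.
by rewrite !exprS Normc.normcM ih.
Qed.

Lemma normc_pow_sub z w n : normc z <= 1 -> normc w <= 1 ->
  normc (z ^+ n - w ^+ n) <= n%:R * normc (z - w).
Proof.
move=> z1 w1; elim: n => [|n ih].
  by rewrite !expr0 subrr Normc.normc0 mul0r.
rewrite (_ : z ^+ n.+1 - _ = z * (z ^+ n - w ^+ n) + (z - w) * w ^+ n); last first.
  by rewrite !exprS; ring.
rewrite (le_trans (normc_triangle _ _))// !Normc.normcM -natr1 mulrDl mul1r lerD//.
  rewrite (le_trans _ ih)// ler_piMl ?normc_nneg//.
by rewrite ler_piMr ?normc_nneg// normcX exprn_ile1 ?normc_nneg.
Qed.

Lemma cexpD z w : cexp (z + w) = cexp z * cexp w.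
Proof.
apply/eqP; rewrite eq_complex /= reD imD expRD cosD sinD.
by apply/andP; split; apply/eqP; ring.
Qed.

Lemma cexp0 : cexp (0 : C) = 1.
Proof. by rewrite /cexp /= expR0 cos0 sin0 mulr1 mulr0. Qed.

Lemma normc_cexp z : normc (cexp z) = expR (Re z).
Proof.
rewrite normcE2 /= !exprMn -mulrDr cos2Dsin2 mulr1 sqrtr_sqr ger0_norm//.
Qed.

Definition cscale (a : R) z : C := Complex (a * Re z) (a * Im z).

Lemma cexp_nat z n : cexp (cscale n%:R z) = cexp z ^+ n.
Proof.
elim: n => [|n ih].
  by rewrite expr0 (_ : cscale _ _ = 0) ?cexp0// /cscale !mul0r.
rewrite exprSr -ih -cexpD; congr cexp; case: z {ih} => x y.
by rewrite /cscale -natr1 !mulrDl !mul1r.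
Qed.

Lemma cexp_div_nat z n : (0 < n)%N -> cexp (cscale n%:R^-1 z) ^+ n = cexp z.
Proof.
move=> n0; rewrite -cexp_nat; congr cexp; case: z => x y.
by rewrite /cscale /= !mulrA mulfV ?mul1r// pnatr_eq0 -lt0n.
Qed.

(* |z_n^N_n - e^psi| <= N_n |z_n - e^(psi/N_n)| when both bases are in the
   unit disc. *)
Lemma cpow_cvg (z : nat -> C) (N : nat -> nat) (psi : C) :
  (forall n, normc (z n) <= 1) -> Re psi <= 0 ->
  (N n)%:R^-1 @[n --> \oo] --> (0 : R) ->
  (\forall n \near \oo, (0 < N n)%N) ->
  (N n)%:R * (Re (z n) - 1) @[n --> \oo] --> Re psi ->
  (N n)%:R * Im (z n) @[n --> \oo] --> Im psi ->
  normc (z n ^+ N n - cexp psi) @[n --> \oo] --> (0 : R).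
Proof.
move=> z1 psi0 N0 Np cRe cIm.
pose w n := cexp (cscale (N n)%:R^-1 psi).
have w1 n : normc (w n) <= 1.
  by rewrite normc_cexp /= -expR0 ler_expR mulr_ge0_le0// invr_ge0.
have cR : (N n)%:R * (Re (w n) - 1) @[n --> \oo] --> Re psi.
  have := @deriv_slope R (fun t => expR (t * Re psi) * cos (t * Im psi)) (Re psi) N _ Np N0.
  rewrite !mul0r expR0 cos0 mulr1; apply.
  by derive_val; rewrite !mul0r expR0 cos0 sin0; ring.
have cI : (N n)%:R * Im (w n) @[n --> \oo] --> Im psi.
  have := @deriv_slope R (fun t => expR (t * Re psi) * sin (t * Im psi)) (Im psi) N _ Np N0.
  rewrite !mul0r expR0 sin0 mulr0 => H.
  apply: cvg_ext (H _) => [n|]; first by rewrite subr0.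
  by derive_val; rewrite !mul0r expR0 cos0 sin0; ring.
have c1 : `|(N n)%:R * (Re (z n) - 1) - (N n)%:R * (Re (w n) - 1)| +
    `|(N n)%:R * Im (z n) - (N n)%:R * Im (w n)| @[n --> \oo] --> (0 : R).
  rewrite -[X in _ --> X](_ : `|Re psi - Re psi| + `|Im psi - Im psi| = 0); last first.
    by rewrite !subrr normr0 addr0.
  by apply: cvgD; apply: cvg_norm; apply: cvgB.
apply: (squeeze_cvgr _ (cvg_cst (0:R)) c1).
apply: filterS Np => n n0; rewrite normc_nneg/= -{1}(cexp_div_nat psi n0) -/(w n).
rewrite (le_trans (normc_pow_sub _ (z1 n) (w1 n)))//.
rewrite -!mulrBr !normrM ger0_norm// -mulrDr ler_wpM2l//.
rewrite (le_trans (normc_le _))// reD imD reN imN lerD2r.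
by have -> : Re (z n) - Re (w n) = Re (z n) - 1 - (Re (w n) - 1) by ring.
Qed.

End ComplexModulus.

Lemma Rint_scale (R : realType) (a : R) (f : R -> R) : 0 < a ->
  intble lebesgue_measure f ->
  intble lebesgue_measure (fun x => f (a * x)) /\
  \int[lebesgue_measure]_x f (a * x) = a^-1 * \int[lebesgue_measure]_x f x.
Proof.
move=> a0 hf; have mf := intble_measurable hf.
set mu := @lebesgue_measure R.
pose phi : R -> measurableTypeR R := fun x => a * x.
have mphi : measurable_fun [set: measurableTypeR R] phi.
  have : measurable_fun setT (fun x : R => a * x) by exact: measurable_funM.
  by move=> h mT Y mY; exact: h.
have ai0 : 0 <= a^-1 by rewrite invr_ge0 ltW.
pose k : {nonneg R} := NngNum ai0.
have E (A : set (measurableTypeR R)) : measurable A -> A `<=` setT ->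
    pushforward mu phi A = mscale k mu A.
  move=> mA _; have kE (B : set (measurableTypeR R)) : measurable B ->
     mu B = mscale (NngNum (ltW a0)) (pushforward mu phi) B.
    move=> mB; apply: lebesgue_measure_unique => //= _ [[u v]] _ <-.
    transitivity (a%:E * mu [set` `](a^-1 * u)%R, (a^-1 * v)%R]])%E.
      rewrite /mu !lebesgue_measure_itv/= !lte_fin ltr_pM2l ?invr_gt0//.
      case: ifP => _; last by rewrite mule0.
      by rewrite -!EFinB -EFinM; congr EFin; field; rewrite gt_eqF.
    congr (_ * mu _)%E; apply/seteqP; split => x /=; rewrite !in_itv/= /phi
      ![a^-1 * _]mulrC ltr_pdivrMr// ler_pdivlMr// ![_ * a]mulrC//.
  change (mu (phi @^-1` A) = (a^-1)%:E * mu A)%E; rewrite (kE mphi A mA).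
  change (mu (phi @^-1` A) = (a^-1)%:E * (a%:E * mu (phi @^-1` A)))%E.
  rewrite muleA -EFinM mulVf ?mul1e//.
  by rewrite gt_eqF.
have P (g : R -> \bar R) : measurable_fun setT g -> (forall x, 0 <= g x)%E ->
    (\int[mu]_x g (a * x)%R = (a^-1)%:E * \int[mu]_x g x)%E.
  move=> mg g0.
  have := @ge0_integral_pushforward _ _ _ _ R _ mphi mu setT g measurableT.
  rewrite preimage_setT => <- //.
  rewrite (eq_measure_integral (mscale k mu)) => [|A mA /E]; last exact.
  by rewrite ge0_integral_mscale.
have hI : intble mu (fun x => f (a * x)).
  apply/integrableP; split.
    by apply/measurable_EFinP; exact: (measurableT_comp mf mphi).
  rewrite (P (fun x => `|(f x)%:E|)%E)//; last first.
    by apply: measurableT_comp => //; exact/measurable_EFinP.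
  by have /integrableP[_ h] := hf; rewrite lte_mul_pinfty.
split=> //; rewrite /Rintegral.
have := @integral_pushforward _ _ _ _ R _ mphi mu setT (EFin \o f) _ _ measurableT.
rewrite preimage_setT => <- //; last exact/measurable_EFinP.
have -> : (\int[pushforward mu phi]_y (EFin \o f) y = \int[mscale k mu]_y (f y)%:E)%E.
  by apply: eq_measure_integral => A mA _; exact: E.
rewrite [in LHS]integralE !ge0_integral_mscale//; first last.
- by apply: measurable_funepos; exact/measurable_EFinP.
- by apply: measurable_funeneg; exact/measurable_EFinP.
rewrite -muleBr//; last exact: integrable_add_def.
by rewrite -integralE fineM//; exact: integrable_fin_num.
Qed.

(** * A positive kernel with compactly supported Fourier transform *)

Section Kernel.
Context (R : realType).
Notation mu := (@lebesgue_measure R).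

Definition tri (u : R) : R := Num.max 0 (1 - `|u|).

Lemma tri_ge0 u : 0 <= tri u. Proof. by rewrite /tri le_max lexx. Qed.

Lemma tri_le1 u : tri u <= 1.
Proof. by rewrite /tri ge_max ler01 gerBl normr_ge0. Qed.

Lemma tri_out u : 1 <= `|u| -> tri u = 0.
Proof. by move=> h; rewrite /tri max_l// subr_le0. Qed.

Lemma triE u : tri u = (1 - `|u| + `|1 - `|u| |) / 2.
Proof.
rewrite /tri; case: (leP (1 - `|u|) 0) => h.
  by rewrite (ler0_norm h) subrr mul0r.
by rewrite (gtr0_norm h); field.
Qed.

Lemma tri_continuous : continuous tri.
Proof.
have c1 : continuous (fun u : R => 1 - `|u|).
  by move=> u; apply: cvgB; [exact: cvg_cst|exact: norm_continuous].
rewrite (_ : tri = fun u => (1 - `|u| + `|1 - `|u| |) / 2); last first.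
  by apply/funext => u; rewrite triE.
move=> u; apply: cvgMr_tmp; apply: cvgD; first exact: c1.
apply: (@cvg_comp _ _ _ (fun u : R => 1 - `|u|) (fun z => `|z|)); first exact: c1.
exact: norm_continuous.
Qed.

Lemma tri_intble : intble mu tri.
Proof.
apply: (@compact_intble R tri 1 1) => //.
- exact: tri_continuous.
- by move=> x; rewrite ger0_norm ?tri_ge0 ?tri_le1.
- by move=> x /ltW; exact: tri_out.
Qed.

Definition fejer (y : R) : R := \int[mu]_u (tri u * cos (u * y)).

Lemma fejer_intble y : intble mu (fun u => tri u * cos (u * y)).
Proof.
under eq_fun do rewrite mulrC [_ * y]mulrC.
apply: (intbleM (M := 1)); last exact: tri_intble.
  exact: continuous_measurable_fun (@continuous_cosM R y).
by move=> x; exact: cos_norm.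
Qed.

(** This is the closed form 2 (1 - cos y) / y^2 of the Fejer kernel, multiplied out to include y =
    0. On each half of [-1, 1] one integration by parts gives an explicit primitive. *)
Lemma fejer_sqr y : fejer y * y ^+ 2 = 2 * (1 - cos y).
Proof.
pose f u := tri u * cos (u * y) * y ^+ 2.
have fi : intble mu f.
  have -> : f = fun u => y ^+ 2 * (tri u * cos (u * y)).
    by apply/funext => u; rewrite /f mulrC.
  by apply: intbleZ; exact: fejer_intble.
rewrite /fejer -RintZr; last exact: fejer_intble.
have -> : \int[mu]_x (tri x * cos (x * y) * y ^+ 2) = \int[mu]_(x in `[-1, 1]) f x.
  rewrite [RHS]Rintegral_mkcond; apply: eq_Rint => x; rewrite patchE.
  case: ifP => // /negbT; rewrite notin_setE /= in_itv/= => /negP.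
  rewrite -ler_norml -ltNge => /ltW h.
  by rewrite tri_out// !mul0r.
have fi1 : mu.-integrable `[-1, 1] (EFin \o f) by exact: integrableS fi.
have b1 : (BLeft (-1) <= BRight (0 : R))%O by rewrite bnd_simp lerN10.
have b2 : (BRight (0 : R) <= BRight 1)%O by rewrite bnd_simp ler01.
have /eqP := Rintegral_itvB fi1 b1 b2; rewrite subr_eq => /eqP ->.
rewrite Rintegral_itv_obnd_cbnd; last exact: integrableS fi.
have I1 : \int[mu]_(x in `[0, 1]) f x = 1 - cos y.
  rewrite (_ : Rintegral _ _ _ = \int[mu]_(x in `[0, 1]) ((1 - x) * cos (x * y) * y ^+ 2)).
    rewrite (@FTC_derive R (fun u => y * (1 - u) * sin (u * y) - cos (u * y)))//.
    - by rewrite mul0r sin0 cos0 mul1r subrr mulr0 mul0r mulr0; ring.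
    - by move=> x; derive_val; ring.
    - by apply: deriv_continuous => x; eexists; derivs.
  apply: eq_Rintegral => x; rewrite inE/= in_itv/= => /andP[x0 x1].
  by rewrite /f /tri ger0_norm// max_r// subr_ge0.
have I2 : \int[mu]_(x in `[-1, 0]) f x = 1 - cos y.
  rewrite (_ : Rintegral _ _ _ = \int[mu]_(x in `[-1, 0]) ((1 + x) * cos (x * y) * y ^+ 2)).
    rewrite (@FTC_derive R (fun u => y * (1 + u) * sin (u * y) + cos (u * y)))//.
    - by rewrite mul0r sin0 cos0 mulN1r sinN cosN; ring.
    - by move=> x; derive_val; ring.
    - by apply: deriv_continuous => x; eexists; derivs.
  apply: eq_Rintegral => x; rewrite inE/= in_itv/= => /andP[x0 x1].
  by rewrite /f /tri ler0_norm// opprK max_r//; lra.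
by rewrite I1 I2; ring.
Qed.

Lemma fejer_ge0 y : 0 <= fejer y.
Proof.
have [->|y0] := eqVneq y 0.
  by apply: Rint_ge0 => u; rewrite mulr0 cos0 mulr1 tri_ge0.
have y2 : 0 < y ^+ 2 by rewrite exprn_even_gt0.
rewrite -(pmulr_lge0 _ y2) fejer_sqr mulr_ge0// subr_ge0; exact: cos_le1.
Qed.

(* A nonnegative kernel with compactly supported Fourier transform [kap]. The
   zeros of one Fejer kernel are removed by adding two shifted copies. *)
Definition kap (u : R) : R := tri u * (2 * cos (u * (pi / 2))).

Definition ker (x : R) : R := (2 * pi)^-1 * \int[mu]_u (cos (u * x) * kap u).

Lemma kap_le u : `|kap u| <= 2 * tri u.
Proof.
rewrite /kap !normrM (ger0_norm (tri_ge0 u)) (ger0_norm (ler0n R 2)).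
by rewrite mulrCA ler_pM2l// ler_piMr ?tri_ge0 ?cos_norm.
Qed.

Lemma kap_le2 u : `|kap u| <= 2.
Proof. by rewrite (le_trans (kap_le u))// ler_piMr// tri_le1. Qed.

Lemma kap_out u : 1 <= `|u| -> kap u = 0.
Proof. by move=> h; rewrite /kap tri_out// mul0r. Qed.

Lemma kapN u : kap (- u) = kap u.
Proof. by rewrite /kap /tri normrN mulNr cosN. Qed.

Lemma kap_continuous : continuous kap.
Proof.
move=> u; apply: cvgM; first exact: tri_continuous.
apply: cvgMl_tmp.
by apply: (@deriv_continuous R (fun u => cos (u * (pi / 2)))) => x; eexists; derivs.
Qed.

Lemma kap_measurable : measurable_fun setT kap.
Proof. exact: continuous_measurable_fun kap_continuous. Qed.

Lemma kap_intble : intble mu kap.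
Proof.
apply: (@compact_intble R kap 2 1) => //.
- exact: kap_continuous.
- exact: kap_le2.
- by move=> x /ltW; exact: kap_out.
Qed.

Lemma ker_fejer x : ker x = (2 * pi)^-1 * (fejer (x + pi / 2) + fejer (x - pi / 2)).
Proof.
congr (_ * _); rewrite -RintD; [|exact: fejer_intble..].
apply: eq_Rint => u; rewrite /kap mulrDr mulrBr cosD cosB; ring.
Qed.

(** At the shifts by pi / 2 and - pi / 2 the Fejer numerators are 2 (1 + sin x) and 2 (1 - sin x).
    Their sum is the constant 4, so the two kernels never vanish together, and both denominators are
    at most (|x| + pi / 2)^2. *)
Lemma ker_ge x : 2 / pi / (`|x| + pi / 2) ^+ 2 <= ker x.
Proof.
have p0 : 0 < pi / 2 :> R by rewrite divr_gt0// pi_gt0.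
have d0 : 0 < `|x| + pi / 2 by rewrite ltr_wpDl.
rewrite ler_pdivrMr ?exprn_gt0// ker_fejer.
rewrite (_ : 2 / pi = (2 * pi)^-1 * (fejer (x + pi / 2) * (x + pi / 2) ^+ 2 +
    fejer (x - pi / 2) * (x - pi / 2) ^+ 2)); last first.
  rewrite !fejer_sqr cosD cosB cos_pihalf sin_pihalf.
  have : pi != 0 :> R by rewrite gt_eqF// pi_gt0.
  by generalize (pi : R) => p pn; field.
rewrite -mulrA ler_pM2l ?invr_gt0 ?mulr_gt0 ?pi_gt0//.
have h : `|pi / 2| = pi / 2 :> R by rewrite gtr0_norm.
move: (pi / 2 : R) p0 d0 h => q p0 d0 h; rewrite mulrDl.
have h1 : `|x + q| <= `|x| + q by rewrite -{2}h ler_normD.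
have h2 : `|x - q| <= `|x| + q by rewrite -{2}h ler_normB.
by apply: lerD; rewrite ler_wpM2l ?fejer_ge0// -sqr_abs lerXn2r ?nnegrE ?(ltW d0).
Qed.

Lemma ker_gt0 x : 0 < ker x.
Proof.
apply: lt_le_trans (ker_ge x); rewrite !divr_gt0 ?pi_gt0//.
by rewrite exprn_gt0// ltr_wpDl// divr_gt0 ?pi_gt0.
Qed.

End Kernel.

(** * Independence and exponential moments *)

Section Independence.
Context d (T : measurableType d) (R : realType) (P : probability T R).

Definition indep_real (f g : T -> R) : Prop :=
  forall A B : set R, measurable A -> measurable B ->
    P (f @^-1` A `&` g @^-1` B) = (P (f @^-1` A) * P (g @^-1` B))%E.

Lemma intble_distribution d' (T' : measurableType d') (X : {RV P >-> T'}) (f : T' -> R) :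
  measurable_fun setT f -> intble (distribution P X) f <-> intble P (f \o X).
Proof.
move=> mf; have E : (\int[distribution P X]_y `|(f y)%:E| = \int[P]_t `|(f (X t))%:E|)%E.
  apply: (@ge0_integral_distribution _ _ _ _ R P X (fun y => `|(f y)%:E|)%E) => //.
  by apply: measurableT_comp => //; exact/measurable_EFinP.
split=> /integrableP[_ h]; apply/integrableP; split.
- by apply/measurable_EFinP; apply: measurableT_comp.
- by move: h; rewrite E.
- exact/measurable_EFinP.
- by rewrite E.
Qed.

Lemma Rint_distribution d' (T' : measurableType d') (X : {RV P >-> T'}) (f : T' -> R) :
  measurable_fun setT f -> intble P (f \o X) ->
  \int[distribution P X]_y f y = \int[P]_t f (X t).
Proof.
move=> mf hf; rewrite /Rintegral (@integral_distribution _ _ _ _ R P X (EFin \o f))//.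
exact/measurable_EFinP.
Qed.

(** Independence says that the law of the pair agrees with the product of the laws on rectangles,
    hence on all measurable sets; the expectation of the product is then computed by Fubini on the
    plane. *)
Lemma indep_expectation (f g : T -> R) : indep_real f g -> intble P f ->
  intble P g -> intble P (fun t => f t * g t) /\
  \int[P]_t (f t * g t) = (\int[P]_t f t) * (\int[P]_t g t).
Proof.
move=> fg iF iG; have mf := intble_measurable iF; have mg := intble_measurable iG.
pose F : {RV P >-> R} := mfun_Sub (mem_set mf).
pose G : {RV P >-> R} := mfun_Sub (mem_set mg).
have mh : measurable_fun setT (fun t => (f t, g t)) by exact: measurable_fun_pair.
pose H : {RV P >-> (R * R)%type} := mfun_Sub (mem_set mh).
pose D1 := distribution P F; pose D2 := distribution P G.
have E A : measurable A -> (D1 \x D2)%E A = distribution P H A.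
  apply: product_measure_unique => B C mB mC.
  by rewrite /D1 /D2 /distribution /pushforward /= -fg.
have mu' : measurable_fun [set: R * R] (fun z => z.1 * z.2).
  by apply: measurable_funM.
have i1 : intble D1 (fun x => `|x|).
  apply: intble_norm; apply/(intble_distribution (f := id) F) => //.
have i2 : intble D2 (fun x => `|x|).
  apply: intble_norm; apply/(intble_distribution (f := id) G) => //.
have b (x y : R) : `|x * y| <= `|x| * `|y| by rewrite normrM.
have iP := @Rfubini_intble _ _ R R R D1 D2 (fun x y => x * y) _ _ mu' i1 i2 b.
have iH : intble (distribution P H) (fun z => z.1 * z.2).
  have /integrableP[h1 h2] := iP; apply/integrableP; split => //.
  have <- : (\int[D1 \x D2]_x `|(x.1 * x.2)%:E| = \int[distribution P H]_x `|(x.1 * x.2)%:E|)%E.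
    by apply: eq_measure_integral => A mA _; exact: E.
  exact: h2.
have iT : intble P (fun t => f t * g t) by move/(intble_distribution H mu') : iH.
split=> //.
have -> : \int[P]_t (f t * g t) = \int[distribution P H]_z (z.1 * z.2).
  by rewrite (Rint_distribution (X := H)).
have -> : \int[distribution P H]_z (z.1 * z.2) = \int[(D1 \x D2)%E]_z (z.1 * z.2).
  by congr fine; apply: eq_measure_integral => A mA _; exact/esym/E.
rewrite /Rintegral -(integral12_prod_meas1 iP) -!/(Rintegral _ _ _).
have E2 x : fubini_F D2 (fun z : R * R => (z.1 * z.2)%:E) x = (x * \int[P]_t g t)%:E.
  rewrite /fubini_F /= Rint_fin; last first.
    by apply: intbleZ; apply/(intble_distribution (f := id) G).
  rewrite RintZ; last by apply/(intble_distribution (f := id) G).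
  by rewrite (Rint_distribution (X := G) (f := id)).
under eq_integral do rewrite E2.
rewrite -/(Rintegral _ _ _) RintZr; last by apply/(intble_distribution (f := id) F).
by rewrite (Rint_distribution (X := F) (f := id)).
Qed.

Context (I : eqType) (Y : I -> {RV P >-> R}).

(** The pi-system of rectangles generating the sigma-algebra of the variables indexed by [s].
    Working with this sigma-algebra avoids forming random vectors for blocks of variables. *)
Definition cylinder (s : seq I) : set (set T) :=
  [set A | exists B : I -> set R, (forall k, measurable (B k)) /\
     A = \bigcap_(k in [set` s]) (Y k @^-1` B k)].

Lemma cylinder_measurable s : cylinder s `<=` measurable.
Proof.
move=> _ [B [mB ->]]; apply: fin_bigcap_measurable => // k _.
by rewrite -[X in measurable X]setTI; exact: measurable_funP.
Qed.

Lemma cylinderI s : setI_closed (cylinder s).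
Proof.
move=> _ _ [B [mB ->]] [C [mC ->]]; exists (fun k => B k `&` C k); split.
  by move=> k; exact: measurableI.
by rewrite -bigcapI; apply: eq_bigcapr => k _; rewrite preimage_setI.
Qed.

Lemma cylinderT s : cylinder s setT.
Proof.
exists (fun=> setT); split=> [k|]; first exact: measurableT.
by apply/seteqP; split => // x _ k _.
Qed.

Hypothesis indY : independent Y.

Lemma cylinder_indep s1 s2 A B : uniq (s1 ++ s2) -> cylinder s1 A ->
  cylinder s2 B -> P (A `&` B) = (P A * P B)%E.
Proof.
move=> us [C [mC ->]] [D [mD ->]].
have := us; rewrite cat_uniq => /and3P[u1 /hasPn ds u2].
pose E k := if k \in s1 then C k else D k.
have mE k : measurable (E k) by rewrite /E; case: ifP.
have E1 : \bigcap_(k in [set` s1]) (Y k @^-1` C k) = \bigcap_(k in [set` s1]) (Y k @^-1` E k).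
  by apply: eq_bigcapr => k /= ks; rewrite /E ks.
have E2 : \bigcap_(k in [set` s2]) (Y k @^-1` D k) = \bigcap_(k in [set` s2]) (Y k @^-1` E k).
  by apply: eq_bigcapr => k /= ks; rewrite /E (negbTE (ds _ ks)).
rewrite E1 E2 (indY u1 mE) (indY u2 mE) -big_cat -(indY us mE).
congr (P _); apply/seteqP; split => x.
  by move=> [h1 h2] k /=; rewrite mem_cat => /orP[]; [exact: h1|exact: h2].
by move=> h; split => k /= ks; apply: h; rewrite /= mem_cat ks ?orbT.
Qed.

(** The uniqueness theorem for measures on a pi-system is applied once per factor: with the other
    event fixed, A -> P (A B) and A -> P (A) P (B) are finite measures that agree on cylinders. *)
Lemma sigma_indep s1 s2 A B : uniq (s1 ++ s2) -> <<s cylinder s1 >> A ->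
  <<s cylinder s2 >> B -> P (A `&` B) = (P A * P B)%E.
Proof.
move=> us; have gm s := @cylinder_measurable s.
have sm s X : <<s cylinder s >> X -> measurable X.
  exact: (smallest_sub (@sigma_algebra_measurable _ T) (gm s)).
have step s (B0 : set T) : measurable B0 ->
    (forall A0, cylinder s A0 -> P (A0 `&` B0) = (P A0 * P B0)%E) ->
    forall A0, <<s cylinder s >> A0 -> P (A0 `&` B0) = (P A0 * P B0)%E.
  move=> mB H A0 sA.
  have fB : P B0 \is a fin_num by exact: fin_num_measure.
  have nB : 0 <= fine (P B0) by exact: fine_ge0.
  pose k : {nonneg R} := NngNum nB.
  have := @g_sigma_algebra_measure_unique _ R T (cylinder s) (gm s) (fun=> setT)
    (fun=> cylinderT s) _ (mrestr P mB) (mscale k P) (cylinderI (s := s)) _ _ A0 sA.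
  have kE X : mscale k P X = (P X * P B0)%E by rewrite /mscale/= fineK// muleC.
  move=> h; transitivity (mscale k P A0); last exact: kE.
  apply: h.
  - by rewrite bigcup_const.
  - by move=> X /H h1; transitivity (P X * P B0)%E; [exact: h1|exact/esym/kE].
  - move=> _; change (P (setT `&` B0) < +oo)%E; by rewrite setTI ltey_eq fB.
move=> sA sB; apply: (step s1) => //; first exact: sm sB.
move=> A0 cA; rewrite setIC muleC; apply: (step s2) => //.
  by apply: (sm s1); exact: sub_sigma_algebra.
by move=> B0 cB; rewrite setIC muleC; exact: (cylinder_indep us).
Qed.

Definition sigma_measurable (s : seq I) (f : T -> R) : Prop :=
  measurable_fun [set: g_sigma_algebraType (cylinder s)] f.

Lemma sigma_measurable_indep s1 s2 f g : uniq (s1 ++ s2) ->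
  sigma_measurable s1 f -> sigma_measurable s2 g -> indep_real f g.
Proof.
move=> us mf mg A B mA mB; apply: (sigma_indep us).
  by rewrite -[X in <<s _ >> X]setTI; exact: mf.
by rewrite -[X in <<s _ >> X]setTI; exact: mg.
Qed.

Lemma sigma_measurable_RV s k : k \in s -> sigma_measurable s (Y k).
Proof.
move=> ks _ B mB; rewrite setTI; apply: sub_sigma_algebra.
exists (fun j => if j == k then B else setT); split.
  by move=> j; case: ifP => // _; exact: measurableT.
apply/seteqP; split => x /=.
  by move=> Yx j _; case: eqP => [->//|].
by move=> /(_ k ks); rewrite /= eqxx.
Qed.

Lemma sigma_measurable_comp s f (h : R -> R) : sigma_measurable s f ->
  measurable_fun setT h -> sigma_measurable s (fun t => h (f t)).
Proof. by move=> mf mh; exact: (measurableT_comp mh mf). Qed.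

Lemma sigma_measurable_cst s (a : R) : sigma_measurable s (fun=> a).
Proof. exact: measurable_cst. Qed.

Lemma sigma_measurable_sub s1 s2 f : {subset s1 <= s2} ->
  sigma_measurable s1 f -> sigma_measurable s2 f.
Proof.
move=> ss mf _ B mB.
have h : cylinder s1 `<=` cylinder s2.
  move=> _ [C [mC ->]]; exists (fun k => if k \in s1 then C k else setT); split.
    by move=> k; case: ifP => // _; exact: measurableT.
  apply/seteqP; split => x h k /= ks.
    by case: ifP => // k1; exact: h.
  by have := h k (ss _ ks); rewrite ks.
have : <<s cylinder s1 >> (setT `&` f @^-1` B) by exact: mf.
by apply: sub_sigma_algebra2.
Qed.

Lemma sigma_measurable_measurable s f : sigma_measurable s f -> measurable_fun setT f.
Proof.
move=> mf _ B mB; apply: (smallest_sub (@sigma_algebra_measurable _ T) (@cylinder_measurable s)).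
exact: mf.
Qed.

End Independence.

(** * Taylor bounds and exponential moments *)

Section Taylor.
Context (R : realType).
Implicit Types y : R.

Lemma exp_taylor y : `|expR y - 1 - y| <= y ^+ 2 * expR `|y|.
Proof.
have h1 := expR_ge1Dx y; have h2 := expR_ge1Dx (- y).
have h3 : expR y - 1 <= y * expR y.
  have : expR y * (1 - y) <= expR y * expR (- y) by rewrite ler_wpM2l ?expR_ge0.
  by rewrite expRxMexpNx_1; lra.
have e0 := expR_gt0 y.
rewrite ger0_norm; last by lra.
have [y0|y0] := leP 0 y.
  rewrite ger0_norm//; have : y * (expR y - 1) <= y * (y * expR y) by rewrite ler_wpM2l.
  by rewrite expr2 -mulrA; lra.
have : - y * (1 - expR y) <= - y * - y by rewrite ler_wpM2l; lra.
have e1 : 1 <= expR `|y| by rewrite -expR0 ler_expR.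
have : y ^+ 2 <= y ^+ 2 * expR `|y| by rewrite ler_peMr ?sqr_ge0.
rewrite expr2; nra.
Qed.

Lemma sin_le_id y : 0 <= y -> sin y <= y.
Proof.
move=> y0; suff : 0 - sin 0 <= y - sin y by rewrite sin0; lra.
apply: (@deriv_ge0_le _ (fun z => z - sin z) (fun z => 1 - cos z)) => // x.
by derive_val; ring.
Qed.

Lemma cos_le_sqr y : 0 <= y -> 1 - cos y <= y ^+ 2 / 2.
Proof.
move=> y0; suff : 0 ^+ 2 / 2 + cos 0 <= y ^+ 2 / 2 + cos y by rewrite cos0; lra.
apply: (@deriv_ge0_le _ (fun z => z ^+ 2 / 2 + cos z) (fun z => z - sin z)) => // x.
  by derive_val; field.
by move=> /andP[/ltW x0 _]; rewrite subr_ge0 sin_le_id.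
Qed.

Lemma sin_ge_sqr y : 0 <= y -> y - sin y <= y ^+ 2.
Proof.
have c2 (x : R) : 0 <= x -> 1 - cos x <= 2 * x.
  move=> x0; suff : 2 * 0 + cos 0 <= 2 * x + cos x by rewrite cos0; lra.
  apply: (@deriv_ge0_le _ (fun z => 2 * z + cos z) (fun z => 2 - sin z)) => [z|//|z _]; last by have := sin_le1 z; lra.
  by derive_val; ring.
move=> y0; suff : 0 ^+ 2 - 0 + sin 0 <= y ^+ 2 - y + sin y by rewrite sin0; lra.
apply: (@deriv_ge0_le _ (fun z => z ^+ 2 - z + sin z) (fun z => 2 * z - 1 + cos z)) => // x.
  by derive_val; ring.
by move=> /andP[/ltW x0 _]; have := c2 x x0; lra.
Qed.

Lemma sin_ge_cube y : 0 <= y -> y - sin y <= y ^+ 3.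
Proof.
move=> y0; suff : 0 ^+ 2 * 0 - 0 + sin 0 <= y ^+ 2 * y - y + sin y by rewrite sin0 -exprSr; lra.
apply: (@deriv_ge0_le _ (fun z => z ^+ 2 * z - z + sin z)
  (fun z => 3 * z ^+ 2 - 1 + cos z)) => // x.
  by derive_val; ring.
move=> /andP[/ltW x0 _]; have := cos_le_sqr x0; have := sqr_ge0 x; lra.
Qed.

Lemma cos_ge_cube y : 0 <= y -> y ^+ 2 / 2 - (1 - cos y) <= y ^+ 3.
Proof.
move=> y0; suff : 0 ^+ 2 * 0 - 0 ^+ 2 / 2 - cos 0 <= y ^+ 2 * y - y ^+ 2 / 2 - cos y.
  by rewrite cos0 -exprSr; lra.
apply: (@deriv_ge0_le _ (fun z => z ^+ 2 * z - z ^+ 2 / 2 - cos z)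
  (fun z => 3 * z ^+ 2 - z + sin z)) => // x.
  by derive_val; field.
move=> /andP[/ltW x0 _]; have := sin_ge_sqr x0; have := sqr_ge0 x; lra.
Qed.

Lemma sin_abs y : `|sin y| = `|sin `|y| |.
Proof. by have [y0|y0] := ger0P y; rewrite ?sinN ?normrN. Qed.

Lemma cos_abs y : cos `|y| = cos y.
Proof. by have [y0|y0] := ger0P y; rewrite ?cosN. Qed.

Lemma sinB_abs y : `|sin y - y| = `|y| - sin `|y|.
Proof.
have [y0|y0] := leP 0 y; have := @sin_le_id `|y| (normr_ge0 y).
  by rewrite (ger0_norm y0) => h; rewrite distrC ger0_norm// subr_ge0.
by rewrite (ltr0_norm y0) sinN => h; rewrite ger0_norm; lra.
Qed.

Lemma sin_norm_le y : `|sin y| <= `|y|.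
Proof.
rewrite sin_abs ler_norml sin_le_id// andbT.
have := @sin_ge_sqr `|y| (normr_ge0 y); have := normr_ge0 y.
move: (sin_geN1 `|y|) => *; have [/ltW h|h] := ltP 1 `|y|; first by lra.
have : `|y| ^+ 2 <= `|y| by rewrite expr2 ler_piMl.
lra.
Qed.

Lemma cosB_norm_le y : `|1 - cos y| <= y ^+ 2 / 2.
Proof.
rewrite ger0_norm ?subr_ge0 ?cos_le1// -cos_abs -(sqr_abs y).
exact: cos_le_sqr.
Qed.

Lemma sin_taylor2 y : `|sin y - y| <= y ^+ 2.
Proof. by rewrite sinB_abs -(sqr_abs y) sin_ge_sqr. Qed.

Lemma sin_taylor3 y : `|sin y - y| <= `|y| ^+ 3.
Proof. by rewrite sinB_abs sin_ge_cube. Qed.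

Lemma cos_taylor3 y : `|y ^+ 2 / 2 - (1 - cos y)| <= `|y| ^+ 3.
Proof.
rewrite -cos_abs -(sqr_abs y) ger0_norm; first exact: cos_ge_cube.
by rewrite subr_ge0 cos_le_sqr.
Qed.

Lemma expR_pow_bound (k : nat) (s x : R) : 0 < s ->
  `|x| ^+ k <= (s^-1) ^+ k * expR (k%:R * s * `|x|).
Proof.
move=> s0; have h : `|x| <= s^-1 * expR (s * `|x|).
  rewrite -ler_pdivrMl ?invr_gt0// invrK.
  have := expR_ge1Dx (s * `|x|); lra.
rewrite -mulrA expRM_natl -exprMn; apply: lerXn2r => //=; rewrite nnegrE//.
by rewrite mulr_ge0 ?expR_ge0// invr_ge0 ltW.
Qed.

(** A two-sided margin s around the exponent t is paid for by the exponential moments at t + s and t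
    - s. *)
Lemma expR_abs_le (t s x : R) : 0 <= s ->
  expR (t * x + s * `|x|) <= expR ((t + s) * x) + expR ((t - s) * x).
Proof.
move=> s0; have [x0|x0] := ger0P x.
  have -> : t * x + s * x = (t + s) * x by ring.
  by rewrite lerDl expR_ge0.
have -> : t * x + s * - x = (t - s) * x by ring.
by rewrite lerDr expR_ge0.
Qed.

(** A remainder of order h^2 suffices for differentiability. It lets moments be differentiated with
    one integrated Taylor bound, with no limit taken under the integral. *)
Lemma deriv_quadratic (f : R -> R) (x a r K : R) : 0 < r ->
  (forall h, `|h| <= r -> `|f (x + h) - f x - h * a| <= K * h ^+ 2) ->
  has_derive f x a.
Proof.
move=> r0 H; rewrite /has_derive.
have K0 : 0 <= K.
  have : 0 <= K * r ^+ 2 by rewrite (le_trans _ (H r _))// ger0_norm// ltW.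
  by rewrite pmulr_lge0// exprn_gt0.
have lim : (fun h : R => h^-1 *: (f (h *: 1 + x) - f x)) h @[h --> 0^'] --> a.
  have small (p : R) : 0 < p -> \forall h \near (0 : R)^', `|h| <= p.
    move=> p0; apply: nbhs_dnbhs; apply/nbhs_normP; exists p => //= z /=.
    by rewrite sub0r normrN; exact: ltW.
  apply/cvgrPdist_le => e e0.
  have p : 0 < e / (K + 1) by rewrite divr_gt0//; lra.
  near=> h.
  have h0 : h != 0 by near: h; exact: nbhs_dnbhs_neq.
  have hr : `|h| <= r.
        by near: h; exact: small.
  have he : (K + 1) * `|h| <= e.
    have : `|h| <= e / (K + 1).
            by near: h; exact: small.
    by rewrite ler_pdivlMr ?[_ * (K + 1)]mulrC//; lra.
  have -> : a - h^-1 *: (f (h *: 1 + x) - f x) = - (h^-1 * (f (x + h) - f x - h * a)).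
    rewrite /GRing.scale/= mulr1 [h + x]addrC; by field.
  rewrite normrN normrM normfV ler_pdivrMl ?normr_gt0//.
  apply: (le_trans (H h hr)); rewrite -(sqr_abs h) expr2 mulrCA.
  rewrite ler_wpM2l//; have := normr_ge0 h; nra.
split; first by apply/cvg_ex; exists a.
exact: (cvg_lim _ lim).
Unshelve. all: by end_near. Qed.

End Taylor.

Section ExponentialMoments.
Context d (T : measurableType d) (R : realType) (P : probability T R).
Variable X : T -> R.
Hypothesis mX : measurable_fun setT X.
Hypothesis iE : forall t : R, 0 <= t -> intble P (fun w => expR (t * X w)).

Definition emoment (k : nat) (t : R) : R := \int[P]_w (X w ^+ k * expR (t * X w)).

Lemma emoment_measurable k t : measurable_fun setT (fun w => X w ^+ k * expR (t * X w)).
Proof.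
apply: measurable_funM; first exact: measurable_funX.
by apply: (measurableT_comp (@measurable_expR R)); exact: measurable_funM.
Qed.

Lemma emoment_intble k t : 0 < t -> intble P (fun w => X w ^+ k * expR (t * X w)).
Proof.
move=> t0; pose s := t / (2 * k.+1%:R).
have k0 : 0 < k.+1%:R :> R by rewrite ltr0n.
have s0 : 0 < s by rewrite divr_gt0// mulr_gt0.
have ks0 : 0 <= k%:R * s by rewrite mulr_ge0// ltW.
have kst : k%:R * s <= t.
  rewrite /s mulrA ler_pdivrMr ?mulr_gt0//.
  rewrite mulrC ler_wpM2l ?ltW//; have : k%:R <= k.+1%:R :> R by rewrite ler_nat.
  lra.
apply: (@intble_le _ _ _ _ _ (fun w => (s^-1) ^+ k *
   (expR ((t + k%:R * s) * X w) + expR ((t - k%:R * s) * X w)))).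
- exact: emoment_measurable.
- move=> w; rewrite normrM normrX (ger0_norm (expR_ge0 _)).
  apply: (le_trans (ler_wpM2r (expR_ge0 _) (expR_pow_bound k (X w) s0))).
  rewrite -[X in X <= _]mulrA -expRD ler_wpM2l ?exprn_ge0 ?invr_ge0 ?(ltW s0)//.
  rewrite addrC.
  exact: expR_abs_le.
- by apply: intbleZ; apply: intbleD; apply: iE; lra.
Qed.

(** The second-order remainder of exp (h x) costs the factor x^2 exp (|h x|). The radius t / 2 keeps
    all exponents positive, so the moment of order k + 2 at t + r and t - r dominates. *)
Lemma deriv_emoment k t : 0 < t -> has_derive (emoment k) t (emoment k.+1 t).
Proof.
move=> t0; pose r := t / 2; have r0 : 0 < r by rewrite divr_gt0.
pose g w := `|X w ^+ k.+2 * expR ((t + r) * X w)| + `|X w ^+ k.+2 * expR ((t - r) * X w)|.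
have ig : intble P g.
  by apply: intbleD; apply: intble_norm; apply: emoment_intble; rewrite /r; lra.
apply: (@deriv_quadratic _ _ _ _ r (\int[P]_w g w) r0) => h hr.
have th : 0 < t + h by move: hr; rewrite ler_norml /r => /andP[]; lra.
have [i1 i2] := (emoment_intble k th, emoment_intble k t0).
have i3 := emoment_intble k.+1 t0.
rewrite /emoment -RintB// -RintZ// -RintB; [|exact: intbleB|exact: intbleZ].
have i4 : intble P (fun x => X x ^+ k * expR ((t + h) * X x) - X x ^+ k * expR (t * X x) -
   h * (X x ^+ k.+1 * expR (t * X x))) by apply: intbleB; [exact: intbleB|exact: intbleZ].
apply: (le_trans (Rint_norm i4)); rewrite mulrC -RintZ//.
apply: Rint_le; [exact: intble_norm|exact: intbleZ|move=> w].
set x := X w.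
have -> : x ^+ k * expR ((t + h) * x) - x ^+ k * expR (t * x) - h * (x ^+ k.+1 * expR (t * x))
   = x ^+ k * expR (t * x) * (expR (h * x) - 1 - h * x).
  by rewrite mulrDl expRD exprS; ring.
rewrite normrM normrM (ger0_norm (expR_ge0 _)).
have b : expR (t * x) * expR `|h * x| <= expR ((t + r) * x) + expR ((t - r) * x).
  rewrite -expRD; apply: (le_trans _ (expR_abs_le t x (ltW r0))).
  by rewrite ler_expR lerD2l normrM ler_wpM2r.
have xk : 0 <= `|x ^+ k| by [].
apply: (@le_trans _ _ (`|x ^+ k| * expR (t * x) * ((h * x) ^+ 2 * expR `|h * x|))).
  by rewrite ler_wpM2l ?exp_taylor// mulr_ge0// expR_ge0.
have -> : g w = `|x ^+ k.+2| * (expR ((t + r) * x) + expR ((t - r) * x)).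
  rewrite /g -/x (normrM _ (expR ((t + r) * x))) (normrM _ (expR ((t - r) * x))).
  by rewrite !(ger0_norm (expR_ge0 _)) -mulrDr.
rewrite !exprS !(normrM x).
have -> : `|x ^+ k| * expR (t * x) * (h * x * (h * x * 1) * expR `|h * x|) =
   (h ^+ 2 * x ^+ 2 * `|x ^+ k|) * (expR (t * x) * expR `|h * x|) by ring.
rewrite -(sqr_abs x).
have -> : h * (h * 1) * (`|x| * (`|x| * `|x ^+ k|) * (expR ((t + r) * x) + expR ((t - r) * x)))
  = (h ^+ 2 * `|x| ^+ 2 * `|x ^+ k|) * (expR ((t + r) * x) + expR ((t - r) * x)) by ring.
by rewrite ler_wpM2l// mulr_ge0// mulr_ge0 ?sqr_ge0// exprn_ge0.
Qed.

End ExponentialMoments.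

Section CosineOne.
Context (R : realType).

(** After reduction modulo 2 pi, the remainder r lies in [0, 2 pi[ and 1 - cos r = 2 sin^2 (r / 2),
    where the sine is positive unless r = 0. *)
Lemma cos_eq1 (y : R) : cos y = 1 -> exists k : int, y = 2 * pi * k%:~R.
Proof.
have natE (q : R) (n : nat) : 2 * q * n%:~R = q *+ 2 *+ n.
  by rewrite -[RHS]mulr_natr -pmulrn -[q *+ 2]mulr_natl.
move=> cy; have p0 : 0 < 2 * pi :> R by rewrite mulr_gt0// pi_gt0.
have p1 : 2 * pi != 0 :> R by rewrite gt_eqF.
pose k := Num.floor (y / (2 * pi)); exists k.
pose r := y - 2 * pi * k%:~R.
have r0 : 0 <= r.
  have := floor_le_tmp (y / (2 * pi)); rewrite ler_pdivlMr// mulrC /r; lra.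
have r1 : r < 2 * pi.
  have := floorD1_gt (y / (2 * pi)); rewrite ltr_pdivrMr// intrD mulrDl mul1r /r mulrC; lra.
have yE : y = r + 2 * pi * k%:~R by rewrite /r subrK.
have cr : cos r = 1.
  rewrite -cy yE; case: k {r0 r1 yE} @r => n r.
    rewrite (natE pi n).
    by rewrite (periodicn (@cosD2pi R)).
  by rewrite -[RHS](periodicn (@cosD2pi R) n.+1) -natE NegzE mulrNz; congr cos; ring.
have [r00|rp] := eqVneq r 0; first by rewrite yE r00 add0r.
have : 0 < sin (r / 2).
  by apply: sin_gt0_pi; rewrite divr_gt0 ?lt_neqAle ?r0 1?eq_sym ?rp//=; lra.
suff : sin (r / 2) ^+ 2 = 0 by move/eqP; rewrite sqrf_eq0 => /eqP ->; rewrite ltxx.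
have := cr; have {1}-> : r = (r / 2) *+ 2 by rewrite -mulr_natr divfK.
by rewrite cos_mulr2n cos2sin2 -mulr_natr; lra.
Qed.

End CosineOne.

Section TrigLipschitz.
Context (R : realType).

Lemma deriv_lipschitz (f f' : R -> R) (x y : R) : (forall x, has_derive f x (f' x)) ->
  (forall x, `|f' x| <= 1) -> `|f x - f y| <= `|x - y|.
Proof.
move=> df f1; wlog : x y / x <= y => [H|xy].
  have [/H//|/ltW /H] := leP x y; by rewrite distrC [in X in _ -> _ <= X]distrC.
have [->|/eqP xny] := eqVneq x y; first by rewrite !subrr.
have lxy : x < y by rewrite lt_neqAle xy andbT; exact/eqP.
have [c _ e] := deriv_mvt df lxy.
by rewrite distrC e [in X in _ <= X]distrC normrM ler_piMl.
Qed.

Lemma cos_lipschitz (x y : R) : `|cos x - cos y| <= `|x - y|.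
Proof.
apply: (@deriv_lipschitz _ (fun z => - sin z)) => z; first by derive_val; ring.
by rewrite normrN sin_norm.
Qed.

Lemma sin_lipschitz (x y : R) : `|sin x - sin y| <= `|x - y|.
Proof.
apply: (@deriv_lipschitz _ (fun z => cos z)) => z; first by derive_val; ring.
exact: cos_norm.
Qed.

Lemma polar_unit (a b : R) : a ^+ 2 + b ^+ 2 = 1 -> exists t, a = cos t /\ b = sin t.
Proof.
move=> ab; have a1 : -1 <= a <= 1.
  rewrite -ler_norml -(@ler_pXn2r _ 2)// ?nnegrE// expr1n sqr_abs.
  by have := sqr_ge0 b; lra.
have sE : sin (acos a) = `|b|.
  by rewrite sin_acos// (_ : 1 - a ^+ 2 = b ^+ 2) ?sqrtr_sqr//; lra.
have cE : cos (acos a) = a by rewrite acosK// in_itv.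
have [b0|b0] := leP 0 b.
  by exists (acos a); rewrite cE sE ger0_norm.
by exists (- acos a); rewrite cosN sinN cE sE ltr0_norm// opprK.
Qed.

Lemma Rint_le0_ae d (T : measurableType d) (m : {measure set T -> \bar R}) (f : T -> R) :
  intble m f -> (forall x, 0 <= f x) -> \int[m]_x f x <= 0 -> {ae m, forall x, f x = 0}.
Proof.
move=> hf f0 h; have e : \int[m]_x f x = 0 by apply/le_anti; rewrite h Rint_ge0.
have := @ae_eq_integral_abs _ _ _ m setT measurableT (EFin \o f).
case; first by apply/measurable_EFinP; exact: intble_measurable hf.
move=> + _ => /(_ _) H; have /H : (\int[m]_x `|(EFin \o f) x| = 0)%E.
  under eq_integral do rewrite /= ger0_norm//.
  by rewrite Rint_fin// e.
apply: filterS => x /(_ I) /= [->//].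
Qed.

End TrigLipschitz.

(** * Characteristic functions under a change of measure *)

Section WeightedCharacteristic.
Context d (T : measurableType d) (R : realType) (P : probability T R).
Variables (p Y : T -> R).
Hypotheses (mY : measurable_fun setT Y) (p_gt0 : forall w, 0 < p w).
Hypotheses (ip : intble P p) (p1 : \int[P]_w p w = 1).
Hypothesis iY3 : intble P (fun w => p w * `|Y w| ^+ 3).

Lemma weighted_intble (g : T -> R) (K : R) : measurable_fun setT g ->
  (forall w, `|g w| <= K * (1 + `|Y w| ^+ 3)) -> intble P (fun w => p w * g w).
Proof.
move=> mg gK; apply: (@intble_le _ _ _ _ _ (fun w => K * (p w + p w * `|Y w| ^+ 3))).
- by apply: measurable_funM => //; exact: intble_measurable ip.
- move=> w; rewrite normrM (gtr0_norm (p_gt0 w)).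
  apply: (le_trans (ler_wpM2l (ltW (p_gt0 w)) (gK w))); lra.
- by apply: intbleZ; apply: intbleD.
Qed.

Lemma weighted_bounded (g : T -> R) (K : R) : measurable_fun setT g ->
  (forall w, `|g w| <= K) -> intble P (fun w => p w * g w).
Proof.
move=> mg gK; apply: (weighted_intble (K := K)) => // w.
have K0 : 0 <= K by rewrite (le_trans _ (gK w)).
have : 0 <= `|Y w| ^+ 3 by [].
have := gK w; nra.
Qed.

Definition wcos (u : R) := \int[P]_w (p w * cos (u * Y w)).
Definition wsin (u : R) := \int[P]_w (p w * sin (u * Y w)).

Lemma measurable_cosY (u : R) : measurable_fun setT (fun w => cos (u * Y w)).
Proof. exact: (measurableT_comp (measurable_cosM u) mY). Qed.

Lemma measurable_sinY (u : R) : measurable_fun setT (fun w => sin (u * Y w)).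
Proof. exact: (measurableT_comp (measurable_sinM u) mY). Qed.

Lemma wcos_intble u : intble P (fun w => p w * cos (u * Y w)).
Proof.
by apply: (weighted_bounded (K := 1)) => [|w]; [exact: measurable_cosY|exact: cos_norm].
Qed.

Lemma wsin_intble u : intble P (fun w => p w * sin (u * Y w)).
Proof.
by apply: (weighted_bounded (K := 1)) => [|w]; [exact: measurable_sinY|exact: sin_norm].
Qed.

Lemma wY_intble : intble P (fun w => p w * Y w).
Proof.
apply: (weighted_intble (K := 1)) => // w; rewrite mul1r.
have : 0 <= `|Y w| :> R by []. 
move: (`|Y w| : R) => y y0.
have [y1|y1] := leP y 1; first by have := exprn_ge0 3 y0; lra.
suff : y <= y ^+ 3 by lra.
by rewrite exprS ler_peMr// exprn_ege1// ltW.
Qed.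

Lemma wY2_intble : intble P (fun w => p w * Y w ^+ 2).
Proof.
apply: (weighted_intble (K := 1)) => [|w]; first exact: measurable_funX.
rewrite mul1r normrX.
have : 0 <= `|Y w| :> R by []. 
move: (`|Y w| : R) => y y0.
have [y1|y1] := leP y 1.
  have : y ^+ 2 <= 1 by rewrite exprn_ile1.
  have : 0 <= y ^+ 3 by rewrite exprn_ge0.
  lra.
suff : y ^+ 2 <= y ^+ 3 by lra.
by rewrite [X in _ <= X]exprS ler_peMl ?exprn_ge0// ltW.
Qed.

Lemma weighted_lipschitz (g : R -> R) (u v : R) : measurable_fun setT g ->
  (forall x, `|g x| <= 1) -> (forall x y, `|g x - g y| <= `|x - y|) ->
  `|\int[P]_w (p w * g (u * Y w)) - \int[P]_w (p w * g (v * Y w))|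
    <= `|u - v| * \int[P]_w `|p w * Y w|.
Proof.
move=> mg g1 gL.
have ig z : intble P (fun w => p w * g (z * Y w)).
  apply: (weighted_bounded (K := 1)) => // .
  by apply: (measurableT_comp mg); exact: measurable_funM.
rewrite -RintB// -RintZ; last by apply: intble_norm; exact: wY_intble.
have iB := intbleB (ig u) (ig v).
apply: (le_trans (Rint_norm iB)); apply: Rint_le; first exact: intble_norm.
  by apply: intbleZ; apply: intble_norm; exact: wY_intble.
move=> w; rewrite -mulrBr normrM (normrM (p w)) mulrCA ler_wpM2l//.
by apply: (le_trans (gL _ _)); rewrite -mulrBl normrM.
Qed.

Lemma continuous_lipschitz (f : R -> R) (K : R) :
  (forall x y, `|f x - f y| <= `|x - y| * K) -> continuous f.
Proof.
move=> fK x; have K0 : 0 <= K.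
  have := le_trans (normr_ge0 _) (fK 1 0); by rewrite subr0 normr1 mul1r.
apply/cvgrPdist_le => e e0; near=> y.
apply: (le_trans (fK _ _)); apply: (@le_trans _ _ (`|x - y| * (K + 1))).
  by rewrite ler_wpM2l// lerDl.
rewrite -ler_pdivlMr; last by lra.
near: y; apply/nbhs_normP; exists (e / (K + 1)) => /=; first by rewrite divr_gt0//; lra.
by move=> y /= /ltW.
Unshelve. all: by end_near. Qed.

Lemma wcos_continuous : continuous wcos.
Proof.
apply: continuous_lipschitz => u v; apply: weighted_lipschitz.
- exact: continuous_measurable_fun (@continuous_cos R).
- exact: cos_norm.
- exact: cos_lipschitz.
Qed.

Lemma wsin_continuous : continuous wsin.
Proof.
apply: continuous_lipschitz => u v; apply: weighted_lipschitz.
- exact: continuous_measurable_fun (@continuous_sin R).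
- exact: sin_norm.
- exact: sin_lipschitz.
Qed.

Definition wthird : R := \int[P]_w (p w * `|Y w| ^+ 3).
Definition wvar : R := \int[P]_w (p w * Y w ^+ 2).

Lemma wcos_taylor u : `|u ^+ 2 / 2 * wvar - (1 - wcos u)| <= `|u| ^+ 3 * wthird.
Proof.
have -> : 1 - wcos u = \int[P]_w p w - wcos u by rewrite p1.
rewrite /wvar /wcos /wthird -RintB ?wcos_intble//.
rewrite -RintZ ?wY2_intble// -RintZ//.
have i1 : intble P (fun w => p w - p w * cos (u * Y w)) by apply: intbleB => //; exact: wcos_intble.
have i2 := intbleZ (u ^+ 2 / 2) wY2_intble.
rewrite -RintB//; have i3 := intbleB i2 i1.
apply: (le_trans (Rint_norm i3)); apply: Rint_le; [exact: intble_norm|exact: intbleZ|move=> w].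
have -> : u ^+ 2 / 2 * (p w * Y w ^+ 2) - (p w - p w * cos (u * Y w)) =
  p w * ((u * Y w) ^+ 2 / 2 - (1 - cos (u * Y w))) by field.
rewrite normrM (gtr0_norm (p_gt0 w)) mulrCA (ler_wpM2l (ltW (p_gt0 w)))//.
by apply: (le_trans (cos_taylor3 _)); rewrite normrM exprMn.
Qed.

Hypothesis Y1 : \int[P]_w (p w * Y w) = 0.

Lemma wsin_taylor u : `|wsin u| <= `|u| ^+ 3 * wthird.
Proof.
have -> : wsin u = \int[P]_w (p w * sin (u * Y w)) - u * \int[P]_w (p w * Y w).
  by rewrite Y1 mulr0 subr0.
rewrite -RintZ ?wY_intble// /wthird -RintZ//.
have i2 := intbleZ u wY_intble; have i1 := wsin_intble u.
rewrite -RintB//; have i3 := intbleB i1 i2.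
apply: (le_trans (Rint_norm i3)); apply: Rint_le; [exact: intble_norm|exact: intbleZ|move=> w].
have -> : p w * sin (u * Y w) - u * (p w * Y w) = p w * (sin (u * Y w) - u * Y w) by ring.
rewrite normrM (gtr0_norm (p_gt0 w)) mulrCA (ler_wpM2l (ltW (p_gt0 w)))//.
by apply: (le_trans (sin_taylor3 _)); rewrite normrM exprMn.
Qed.

Hypothesis nonlat : forall h a : R, ~ {ae P, forall w, exists n : int, Y w = h * n%:~R + a}.

(** If the modulus reached 1, rotating the value to the positive real axis by a phase t would give E
    [p (1 - cos (u Y - t))] <= 0. The integrand is nonnegative and p > 0, so u Y - t would be a
    multiple of 2 pi almost surely, and Y lattice of span 2 pi / u. *)
Lemma wchar_lt1 u : u != 0 -> wcos u ^+ 2 + wsin u ^+ 2 < 1.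
Proof.
move=> u0; rewrite ltNge; apply/negP => ge1.
pose r := Num.sqrt (wcos u ^+ 2 + wsin u ^+ 2).
have r2 : r ^+ 2 = wcos u ^+ 2 + wsin u ^+ 2 by rewrite sqr_sqrtr// (le_trans _ ge1).
have r1 : 1 <= r by rewrite -[X in X <= _]sqrtr1 ler_wsqrtr.
have rp : 0 < r by lra.
have [t [ct st]] : exists t, wcos u / r = cos t /\ wsin u / r = sin t.
  apply: polar_unit; rewrite !expr_div_n -mulrDl -r2 divff// sqrf_eq0 gt_eqF//.
have i1 := intbleZ (cos t) (wcos_intble u); have i2 := intbleZ (sin t) (wsin_intble u).
have i3 := intbleD i1 i2; have i4 := intbleB ip i3.
have E w : p w - (cos t * (p w * cos (u * Y w)) + sin t * (p w * sin (u * Y w))) =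
  p w * (1 - cos (u * Y w - t)) by rewrite cosB; ring.
have : {ae P, forall w, p w - (cos t * (p w * cos (u * Y w)) + sin t * (p w * sin (u * Y w))) = 0}.
  apply: Rint_le0_ae => //.
    by move=> w; rewrite E mulr_ge0 ?subr_ge0 ?cos_le1// ltW.
  rewrite RintB// RintD// !RintZ ?wcos_intble ?wsin_intble// p1.
  rewrite -/(wcos u) -/(wsin u) -ct -st.
  have -> : wcos u / r * wcos u + wsin u / r * wsin u = (wcos u ^+ 2 + wsin u ^+ 2) / r.
    by rewrite mulrDl !expr2; ring.
  by rewrite -r2 expr2 mulfK ?gt_eqF// subr_le0.
move=> H; apply: (nonlat (h := 2 * pi / u) (a := t / u)).
apply: filterS H => w; rewrite E => /eqP; rewrite mulf_eq0 (gt_eqF (p_gt0 w))/=.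
rewrite subr_eq0 eq_sym => /eqP /cos_eq1[k kE]; exists k.
have -> : Y w = (u * Y w - t) / u + t / u by rewrite -mulrDl subrK mulrAC mulfV// mul1r.
by rewrite kE; ring.
Qed.

Hypothesis var_gt0 : 0 < wvar.

(** Near 0 the second-order Taylor expansion gives the Gaussian bound. On the rest of [0, L] a
    continuous function below 1 has a maximum below 1, whence a constant [k] depending on [L];
    evenness covers negative u. *)
Lemma wchar_bound (L : R) : exists2 k : R, 0 < k & forall u, `|u| <= L ->
  wcos u ^+ 2 + wsin u ^+ 2 <= expR (- k * u ^+ 2).
Proof.
pose G u := wcos u ^+ 2 + wsin u ^+ 2.
suff [k k0 H] : exists2 k : R, 0 < k & forall u, `|u| <= L -> G u <= 1 - k * u ^+ 2.
  exists k => // u /H h; apply: (le_trans h).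
  by have := expR_ge1Dx (- k * u ^+ 2); lra.
have K0 : 0 <= wthird.
  by apply: Rint_ge0 => w; rewrite mulr_ge0 ?exprn_ge0// ltW.
pose K := wthird + 1; have K1 : 1 <= K by rewrite /K; lra.
have [d0 d00 near0] : exists2 d : R, 0 < d & forall u, `|u| <= d -> G u <= 1 - wvar / 8 * u ^+ 2.
  pose v := wvar; have v0 : 0 < v by [].
  (* [e] makes the cubic Taylor errors at most v u^2 / 8. The further bounds 1 and 1 / (v + 1) on
     the radius give v u^2 <= 1, so that [wcos u] is nonnegative and its upper bound can be
     squared. *)
  pose e := v / (8 * K) ; have e0 : 0 < e by rewrite divr_gt0//; lra.
  pose r := Num.min e (Num.min 1 (v + 1)^-1).
  have d0 : 0 < r by rewrite !lt_min e0 ltr01 invr_gt0; lra.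
  have de : r <= e by rewrite ge_min lexx.
  have d1 : r <= 1 by rewrite !ge_min lexx orbT.
  have dv : r * (v + 1) <= 1 by rewrite -ler_pdivlMr ?div1r ?ge_min ?lexx ?orbT//; lra.
  exists r => // u ud.
  have hc := wcos_taylor u; have hs := wsin_taylor u.
  have u2 : u ^+ 2 = `|u| ^+ 2 by rewrite sqr_abs.
  have u3 : `|u| ^+ 3 * wthird <= v / 8 * u ^+ 2.
    rewrite exprSr -u2 -mulrA mulrC ler_wpM2r ?sqr_ge0//.
    apply: (@le_trans _ _ (e * K)); last by rewrite /e invfM mulrA divfK ?gt_eqF//; lra.
    by rewrite ler_pM// /K; lra.
  have hc2 := le_trans hc u3; have hs2 := le_trans hs u3.
  have us : u ^+ 2 <= r.
    by rewrite u2 expr2; have := normr_ge0 u; nra.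
  have vu : v * u ^+ 2 <= 1 by nra.
  move: hc2; rewrite -/v ler_norml => /andP[c1 c2].
  have vu0 : 0 <= v * u ^+ 2 by rewrite mulr_ge0 ?sqr_ge0// ltW.
  have C0 : 0 <= wcos u by lra.
  have C1 : wcos u <= 1 - v * u ^+ 2 * (3 / 8) by lra.
  have S2 : wsin u ^+ 2 <= (v / 8 * u ^+ 2) ^+ 2.
    by rewrite -(sqr_abs (wsin u)) lerXn2r ?nnegrE//; lra.
  rewrite /G -/v; move: S2; rewrite !expr2; move: (v * u ^+ 2) vu vu0 C1 => q; nra.
have [Ld|dL] := leP L d0.
  exists (wvar / 8); first by rewrite divr_gt0.
  by move=> u uL; apply: near0; exact: le_trans uL Ld.
have cG : continuous G.
  by move=> u; apply: cvgD; rewrite /exprz; apply: cvgM; [exact: wcos_continuous|exact: wcos_continuous|exact: wsin_continuous|exact: wsin_continuous].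
have [t + tm] := @EVT_max _ G d0 L (ltW dL) (continuous_subspaceT cG).
rewrite in_itv/= => /andP[t1 t2].
have Gt : G t < 1 by apply: wchar_lt1; rewrite gt_eqF//; lra.
have L0 : 0 < L by lra.
pose k2 := (1 - G t) / L ^+ 2; have k20 : 0 < k2 by rewrite divr_gt0 ?exprn_gt0//; lra.
exists (Num.min (wvar / 8) k2); first by rewrite lt_min k20 divr_gt0.
have GN u : G (- u) = G u.
  rewrite /G /wcos /wsin; congr (_ + _); first by congr (_ ^+ 2); apply: eq_Rint => w; rewrite mulNr cosN.
  rewrite -[RHS]sqrrN -RintN ?wsin_intble//; congr (_ ^+ 2).
  by apply: eq_Rint => w; rewrite mulNr sinN mulrN.
move=> u uL; have u20 := sqr_ge0 u.
have [ud|du] := leP `|u| d0.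
  apply: (le_trans (near0 u ud)); rewrite lerD2l lerN2 ler_wpM2r// ge_min lexx//.
have GE : G u = G `|u| by have [_|_] := ger0P u; rewrite ?GN.
rewrite GE; apply: (@le_trans _ _ (G t)).
  by apply: tm; rewrite in_itv/= ltW.
apply: (@le_trans _ _ (1 - k2 * u ^+ 2)).
  have : k2 * u ^+ 2 <= k2 * L ^+ 2.
    by rewrite ler_wpM2l ?(ltW k20)// -(sqr_abs u) lerXn2r ?nnegrE// ltW.
  by rewrite /k2 divfK ?expf_neq0 ?gt_eqF//; lra.
by rewrite lerD2l lerN2 ler_wpM2r// ge_min lexx orbT.
Qed.

End WeightedCharacteristic.

Section KernelPhase.
Context (R : realType).
Notation mu := (@lebesgue_measure R).

Lemma Rint_reflect (v : R) (f : R -> R) : intble mu f ->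
  intble mu (fun u => f (v - u)) /\ \int[mu]_u f (v - u) = \int[mu]_u f u.
Proof.
move=> hf; have [h1 e1] := Rint_shift v hf; have [h2 e2] := Rint_opp h1.
rewrite -e1 -e2; split; last by apply: eq_Rint => u; rewrite addrC.
by move: h2; congr intble; apply/funext => u; rewrite addrC.
Qed.

Lemma kap_cos_intble (x q : R) : intble mu (fun u => cos (u * x + q) * kap u).
Proof.
apply: (intbleM (M := 1)) => //; last exact: kap_intble.
by apply: (measurableT_comp (continuous_measurable_fun (@continuous_cos R)));
  apply: measurable_funD => //; exact: measurable_funM.
by move=> u; exact: cos_norm.
Qed.

Lemma kap_sin_intble (x : R) : intble mu (fun u => sin (u * x) * kap u).
Proof.
apply: (intbleM (M := 1)) => //; last exact: kap_intble.
by apply: (measurableT_comp (continuous_measurable_fun (@continuous_sin R)));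
  exact: measurable_funM.
by move=> u; exact: sin_norm.
Qed.

Lemma kap_sin0 (x : R) : \int[mu]_u (sin (u * x) * kap u) = 0.
Proof.
have [_ e] := Rint_opp (kap_sin_intble x).
have : \int[mu]_u (sin (u * x) * kap u) = - \int[mu]_u (sin (u * x) * kap u).
  rewrite -RintN; last exact: kap_sin_intble.
  by rewrite -e; apply: eq_Rint => u; rewrite mulNr sinN mulNr kapN.
lra.
Qed.

(** Multiplication by [ker x] averages the phase over frequencies u with |v - u| <= 1, since [kap]
    vanishes outside [-1, 1]. The sine term of the expansion drops out because [kap] is even. *)
Lemma ker_cos (x v q : R) : ker x * cos (v * x + q) =
  (2 * pi)^-1 * \int[mu]_u (kap (v - u) * cos (u * x + q)).
Proof.
have iK := kap_cos_intble x 0.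
have [_ e] := Rint_reflect v (kap_cos_intble (- x) (v * x + q)).
rewrite /ker -mulrA; congr (_ * _).
transitivity (\int[mu]_u (cos (u * - x + (v * x + q)) * kap u)); last first.
  rewrite -e; apply: eq_Rint => u; rewrite mulrC; congr (_ * cos _); ring.
have i1 : intble mu (fun u => cos (u * x) * kap u).
  by have := kap_cos_intble x 0; under eq_fun do rewrite addr0.
have E u : cos (u * - x + (v * x + q)) * kap u =
  (cos (u * x) * kap u) * cos (v * x + q) + sin (v * x + q) * (sin (u * x) * kap u).
  rewrite cosD mulrN cosN sinN; ring.
under [RHS]eq_Rint do rewrite E.
rewrite RintD; [|by under eq_fun do rewrite mulrC; exact: intbleZ|exact/intbleZ/kap_sin_intble].
by rewrite RintZr// RintZ ?kap_sin0 ?mulr0 ?addr0//; exact: kap_sin_intble.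
Qed.

Lemma ker_continuous : continuous (@ker R).
Proof.
have iK (x : R) : intble mu (fun u => cos (u * x) * kap u).
  by have := kap_cos_intble x 0; under eq_fun do rewrite addr0.
have i0 : intble mu (fun u => `|kap u|) by apply: intble_norm; exact: kap_intble.
apply: (@continuous_lipschitz _ _ ((2 * pi)^-1 * \int[mu]_u `|kap u|)) => x y.
rewrite /ker -mulrBr normrM (gtr0_norm (inv2pi_gt0 R)) mulrCA ler_wpM2l ?(ltW (inv2pi_gt0 R))//.
rewrite -RintB// -RintZ//; have i1 := intbleB (iK x) (iK y).
apply: (le_trans (Rint_norm i1)); apply: Rint_le; [exact: intble_norm|exact: intbleZ|move=> u].
rewrite -mulrBl normrM.
have [u1|u1] := leP 1 `|u|; first by rewrite kap_out// normr0 !mulr0.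
rewrite ler_wpM2r//; apply: (le_trans (cos_lipschitz _ _)).
by rewrite -mulrBr normrM ler_piMl// ltW.
Qed.

End KernelPhase.

(** * Rescaled powers of a characteristic function *)

Section CharacteristicPower.
Context (R : realType).
Notation mu := (@lebesgue_measure R).
Notation C := R[i].
Notation Re := complex.Re.
Notation Im := complex.Im.
Notation normc := (@Normc.normc R).
Variables (z : R -> C) (s : R) (K : R).
Hypothesis s0 : 0 < s.
Hypothesis reT : forall u, `|u ^+ 2 / 2 * s - (1 - Re (z u))| <= `|u| ^+ 3 * K.
Hypothesis imT : forall u, `|Im (z u)| <= `|u| ^+ 3 * K.
Hypothesis bnd : forall L, exists2 k : R, 0 < k & forall u, `|u| <= L ->
  normc (z u) <= expR (- k * u ^+ 2).
Hypothesis reC : continuous (fun u => Re (z u)).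
Hypothesis imC : continuous (fun u => Im (z u)).

Lemma sqrt_nat_inv_cvg0 : (Num.sqrt n.+1%:R : R)^-1 @[n --> \oo] --> (0 : R).
Proof.
have := @cvg_comp _ _ _ _ Num.sqrt _ _ _ (@cvg_harmonic R) (@sqrt_continuous R 0).
by rewrite sqrtr0; apply: cvg_ext => n /=; rewrite sqrtrV.
Qed.

(** The central limit theorem at the level of characteristic functions: at t / sqrt n the cubic
    errors, multiplied by n, are of order 1 / sqrt n. *)
Lemma char_pow_cvg t :
  normc (z (t / Num.sqrt n.+1%:R) ^+ n.+1 - Complex (expR (- (s * t ^+ 2 / 2))) 0)
    @[n --> \oo] --> (0 : R).
Proof.
have sq n : Num.sqrt n.+1%:R ^+ 2 = n.+1%:R :> R by rewrite sqr_sqrtr.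
have sp n : 0 < Num.sqrt n.+1%:R :> R by rewrite sqrtr_gt0.
pose psi : C := Complex (- (s * t ^+ 2 / 2)) 0.
have -> : Complex (expR (- (s * t ^+ 2 / 2))) 0 = cexp psi.
  by rewrite /cexp /= cos0 sin0 mulr1 mulr0.
have lim0 : `|t| ^+ 3 * K * (Num.sqrt n.+1%:R)^-1 @[n --> \oo] --> (0 : R).
  by rewrite -(mulr0 (`|t| ^+ 3 * K)); apply: cvgMl_tmp; exact: sqrt_nat_inv_cvg0.
move/cvgr0Pnorm_le : lim0 => lim1.
have E3 n : n.+1%:R * (`|t / Num.sqrt n.+1%:R| ^+ 3 * K) = `|t| ^+ 3 * K * (Num.sqrt n.+1%:R)^-1.
  rewrite normrM normfV (gtr0_norm (sp n)) expr_div_n -{1}(sq n).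
  have := sp n; move: (Num.sqrt n.+1%:R) => q q0; field; by rewrite gt_eqF.
apply: (@cpow_cvg R (fun n => z (t / Num.sqrt n.+1%:R)) (fun n => n.+1) psi).
- move=> n; have [k k0 /(_ (t / Num.sqrt n.+1%:R) (lexx _)) h] := bnd `|t / Num.sqrt n.+1%:R|.
  by apply: (le_trans h); rewrite -expR0 ler_expR mulNr oppr_le0 mulr_ge0 ?sqr_ge0// ltW.
- by rewrite /= oppr_le0 divr_ge0// mulr_ge0 ?sqr_ge0// ltW.
- exact: cvg_harmonic.
- exact: nearW.
- apply/cvgrPdist_le => e e0; near=> n.
  have -> : Re psi - n.+1%:R * (Re (z (t / Num.sqrt n.+1%:R)) - 1) =
     - (n.+1%:R * ((t / Num.sqrt n.+1%:R) ^+ 2 / 2 * s - (1 - Re (z (t / Num.sqrt n.+1%:R))))).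
    rewrite /= mulrBr expr_div_n sq; have : n.+1%:R != 0 :> R by [].
    move: (n.+1%:R : R) => q q0; by field.
  rewrite normrN normrM ger0_norm//.
  apply: (le_trans (ler_wpM2l (ler0n _ _) (reT _))); rewrite E3.
  apply: (le_trans (ler_norm (`|t| ^+ 3 * K / Num.sqrt n.+1%:R))).
  by near: n; exact: lim1.
- apply/cvgr0Pnorm_le => e e0; near=> n.
  rewrite normrM ger0_norm//.
  apply: (le_trans (ler_wpM2l (ler0n _ _) (imT _))); rewrite E3.
  apply: (le_trans (ler_norm (`|t| ^+ 3 * K / Num.sqrt n.+1%:R))).
  by near: n; exact: lim1.
Unshelve. all: by end_near. Qed.

Lemma char_pow_continuous n : continuous (fun u => Re (z u ^+ n)) /\
  continuous (fun u => Im (z u ^+ n)).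
Proof.
elim: n => [|n [h1 h2]]; first by split=> u; exact: cvg_cst.
have eR : (fun u => Re (z u ^+ n.+1)) =
    (fun u => Re (z u) * Re (z u ^+ n) - Im (z u) * Im (z u ^+ n)).
  by apply/funext => u; rewrite exprS reM.
have eI : (fun u => Im (z u ^+ n.+1)) =
    (fun u => Re (z u) * Im (z u ^+ n) + Im (z u) * Re (z u ^+ n)).
  by apply/funext => u; rewrite exprS imM.
rewrite eR eI; split=> u.
- by apply: cvgB; apply: cvgM; [exact: reC|exact: h1|exact: imC|exact: h2].
- by apply: cvgD; apply: cvgM; [exact: reC|exact: h2|exact: imC|exact: h1].
Qed.

Lemma normc_char_le1 u : normc (z u) <= 1.
Proof.
have [k k0 /(_ u (lexx _)) h] := bnd `|u|.
by apply: (le_trans h); rewrite -expR0 ler_expR mulNr oppr_le0 mulr_ge0 ?sqr_ge0// ltW.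
Qed.

(** The real part of z(u)^n e^(i (u y + q)). *)
Definition char_phase (n : nat) (y q u : R) : R :=
  Re (z u ^+ n) * cos (u * y + q) - Im (z u ^+ n) * sin (u * y + q).

Lemma char_phase_le n y q u : `|char_phase n y q u| <= 2 * normc (z u) ^+ n.
Proof.
rewrite -normcX /char_phase; set w := z u ^+ n.
apply: (le_trans (ler_normB _ _)); rewrite !normrM mulrDl mul1r lerD//.
  by rewrite -[X in _ <= X]mulr1 ler_pM// ?normc_geRe// cos_norm.
by rewrite -[X in _ <= X]mulr1 ler_pM// ?normc_geIm// sin_norm.
Qed.

Lemma char_phase_continuous n y q : continuous (char_phase n y q).
Proof.
have [h1 h2] := char_pow_continuous n.
have cl : continuous (fun u : R => u * y + q).
  move=> u; apply: cvgD; last exact: cvg_cst.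
  by apply: cvgMr_tmp; exact: cvg_id.
move=> u; apply: cvgB; apply: cvgM.
- exact: h1.
- exact: (continuous_comp (cl u) (@continuous_cos R _)).
- exact: h2.
- exact: (continuous_comp (cl u) (@continuous_sin R _)).
Qed.

(** The substitution u = t / sqrt n absorbs the factor sqrt n and turns the power into a Gaussian in
    t. A shift [y n] of smaller order than sqrt n disappears from the phase, and [kap] tends to its
    value at v. *)
Lemma local_integral (y : nat -> R) (v q : R) :
  y n / Num.sqrt n.+1%:R @[n --> \oo] --> (0 : R) ->
  Num.sqrt n.+1%:R * \int[mu]_u (kap (v - u) * char_phase n.+1 (y n) q u) @[n --> \oo]
    --> kap v * cos q * (Num.sqrt (2 * pi) / Num.sqrt s).
Proof.
move=> hy.
have sq n : Num.sqrt n.+1%:R ^+ 2 = n.+1%:R :> R by rewrite sqr_sqrtr.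
have sp n : 0 < Num.sqrt n.+1%:R :> R by rewrite sqrtr_gt0.
have sV n : 0 < (Num.sqrt n.+1%:R)^-1 :> R by rewrite invr_gt0.
pose F n u := kap (v - u) * char_phase n.+1 (y n) q u.
have mk : continuous (fun u => kap (v - u)).
  have c u : {for u, continuous (fun u => v - u)}.
    by apply: cvgB; [exact: cvg_cst|exact: cvg_id].
  by move=> u; exact: (continuous_comp (c u) (@kap_continuous R _)).
have cF n : continuous (F n).
  by move=> u; apply: cvgM; [exact: mk|exact: char_phase_continuous].
have mF n := continuous_measurable_fun (cF n).
have iF n : intble mu (F n).
  have [h _] := Rint_reflect v (@kap_intble R).
  rewrite /F; under eq_fun do rewrite mulrC.
  have mc := continuous_measurable_fun (@char_phase_continuous n.+1 (y n) q).
  apply: (intbleM (M := 2)) => //.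
  move=> u; apply: (le_trans (char_phase_le _ _ _ _)).
  by rewrite ler_piMr// exprn_ile1 ?normc_nneg// normc_char_le1.
apply: (@cvg_ext R (fun n => \int[mu]_t F n ((Num.sqrt n.+1%:R)^-1 * t))).
  by move=> n; have [_ ->] := Rint_scale (sV n) (iF n); rewrite invrK.
have s1 : 0 < Num.sqrt s by rewrite sqrtr_gt0.
rewrite -(Rint_gauss s1) -RintZ; last exact: gauss_intble.
(* The factor [kap (v - u)] vanishes for |u| > |v| + 1. Inside this window the bound gives exp (- k
   u^2)^(n + 1) = exp (- k t^2), a domination independent of n. *)
have [k k0 hk] := bnd (`|v| + 1).
have sk : 0 < Num.sqrt (2 * k) by rewrite sqrtr_gt0 mulr_gt0.
apply: (@Rint_dominated_cvg _ _ _ mu _ _ (fun t => 4 * gauss (Num.sqrt (2 * k)) t)).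
- move=> n; apply: (measurableT_comp (mF n)); exact: measurable_funM.
- move=> t; rewrite /F.
  have c1 : kap (v - (Num.sqrt n.+1%:R)^-1 * t) @[n --> \oo] --> kap v.
    have h : (Num.sqrt n.+1%:R)^-1 * t @[n --> \oo] --> (0 : R).
      by rewrite -(mul0r t); apply: cvgMr_tmp; exact: sqrt_nat_inv_cvg0.
    have := @cvg_comp _ _ _ _ (fun u => kap (v - u)) _ _ _ h (mk 0).
    by rewrite subr0.
  have c2 : (Num.sqrt n.+1%:R)^-1 * t * y n + q @[n --> \oo] --> q.
    rewrite -[X in _ --> X]add0r; apply: cvgD; last exact: cvg_cst.
    have h : (t : R) * (y n / Num.sqrt n.+1%:R) @[n --> \oo] --> (t : R) * 0 by exact: cvgMl_tmp.
    rewrite mulr0 in h; by apply: cvg_ext h => n /=; ring.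
  have c3 := @cvg_comp _ _ _ _ (@cos R) _ _ _ c2 (@continuous_cos R q).
  have /cvgr0Pnorm_le c4 := char_pow_cvg t.
  have cRe : Re (z ((Num.sqrt n.+1%:R)^-1 * t) ^+ n.+1) @[n --> \oo] --> expR (- (s * t ^+ 2 / 2)).
    apply/cvgrPdist_le => e e0; near=> n.
    rewrite distrC [X in Re (z X ^+ _)]mulrC.
    have -> : expR (- (s * t ^+ 2 / 2)) = Re (Complex (expR (- (s * t ^+ 2 / 2))) 0) by [].
    rewrite -reN -reD; apply: (le_trans (normc_geRe _)).
    rewrite -[X in X <= _](ger0_norm (normc_nneg _)); near: n; exact: c4.
  have cIm : Im (z ((Num.sqrt n.+1%:R)^-1 * t) ^+ n.+1) @[n --> \oo] --> (0 : R).
    apply/cvgrPdist_le => e e0; near=> n.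
    rewrite distrC [X in Im (z X ^+ _)]mulrC.
    have -> : (0 : R) = Im (Complex (expR (- (s * t ^+ 2 / 2))) 0) by [].
    rewrite -imN -imD; apply: (le_trans (normc_geIm _)).
    rewrite -[X in X <= _](ger0_norm (normc_nneg _)); near: n; exact: c4.
  have c5 := @cvg_comp _ _ _ _ (@sin R) _ _ _ c2 (@continuous_sin R q).
  have := cvgM c1 (cvgB (cvgM cRe c3) (cvgM cIm c5)).
  rewrite mul0r subr0 /gauss exprMn sqr_sqrtr ?(ltW s0)// mulNr.
  by rewrite (mulrC (expR _)) mulrA; exact.
- by apply: intbleZ; exact: gauss_intble.
- move=> n t; rewrite /F; set u := _ * t.
  have [u1|u1] := leP `|u| (`|v| + 1); last first.
    rewrite kap_out ?mul0r ?normr0 ?mulr_ge0 ?gauss_ge0//.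
    have := ler_normD (u - v) v; rewrite subrK distrC; lra.
  have -> : 4 * gauss (Num.sqrt (2 * k)) t = 2 * (2 * gauss (Num.sqrt (2 * k)) t) by ring.
  rewrite normrM ler_pM// ?kap_le2//.
  apply: (le_trans (char_phase_le _ _ _ _)); rewrite ler_wpM2l//.
  have h : normc (z u) ^+ n.+1 <= expR (- k * u ^+ 2) ^+ n.+1.
    by rewrite lerXn2r ?nnegrE ?normc_nneg ?expR_ge0// hk.
  apply: (le_trans h); rewrite -expRM_natl ler_expR /u /gauss !exprMn exprVn sq.
  rewrite sqr_sqrtr; last by rewrite mulr_ge0// ltW.
  have n0 : n.+1%:R != 0 :> R by [].
  rewrite le_eqVlt; apply/orP; left; apply/eqP.
  by move: (n.+1%:R : R) n0 => m m0; field.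
Unshelve. all: by end_near. Qed.

End CharacteristicPower.

(** * Complex expectations of independent products *)

Section ComplexExpectation.
Context d (T : measurableType d) (R : realType) (P : probability T R).

(** E [A e^(iB)] for a real weight [A] and a real phase [B]: when independent factors are
    multiplied, weights multiply and phases add. *)
Definition cexpect (A B : T -> R) : R[i] :=
  Complex (\int[P]_t (A t * cos (B t))) (\int[P]_t (A t * sin (B t))).

Lemma cexpect_intble (A B : T -> R) : intble P A -> measurable_fun setT B ->
  intble P (fun t => A t * cos (B t)) /\ intble P (fun t => A t * sin (B t)).
Proof.
move=> iA mB; split.
  apply: (@intble_le_norm _ _ _ _ _ A) => // [|t].
    apply: measurable_funM; first exact: intble_measurable iA.
    exact: (measurableT_comp (continuous_measurable_fun (@continuous_cos R)) mB).
  by rewrite normrM ler_piMr// cos_norm.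
apply: (@intble_le_norm _ _ _ _ _ A) => // [|t].
  apply: measurable_funM; first exact: intble_measurable iA.
  exact: (measurableT_comp (continuous_measurable_fun (@continuous_sin R)) mB).
by rewrite normrM ler_piMr// sin_norm.
Qed.

Lemma cexpect_phase (A B : T -> R) (q : R) : intble P A -> measurable_fun setT B ->
  \int[P]_t (A t * cos (B t + q)) =
  complex.Re (cexpect A B) * cos q - complex.Im (cexpect A B) * sin q.
Proof.
move=> iA mB; have [i1 i2] := cexpect_intble iA mB.
rewrite /= -RintZr// -RintZr// -RintB; last 2 first.
- by under eq_fun do rewrite mulrC; exact: intbleZ.
- by under eq_fun do rewrite mulrC; exact: intbleZ.
by apply: eq_Rint => t; rewrite cosD; ring.
Qed.

(** With r the modulus of the value z, r^2 is the expectation of A times the real part of conj(z)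
    e^(iB), which is pointwise at most r A; then r is cancelled. *)
Lemma normc_cexpect_le (A B : T -> R) : intble P A -> measurable_fun setT B ->
  (forall t, 0 <= A t) -> Normc.normc (cexpect A B) <= \int[P]_t A t.
Proof.
move=> iA mB A0; have [i1 i2] := cexpect_intble iA mB.
set z := cexpect A B; set r := Normc.normc z; have r0 : 0 <= r by exact: normc_nneg.
have : r * r <= r * \int[P]_t A t.
  have -> : r * r = complex.Re z * \int[P]_t (A t * cos (B t)) + complex.Im z * \int[P]_t (A t * sin (B t)).
    by rewrite -expr2 normc_sqr !expr2.
  rewrite -RintZ// -RintZ// -RintD; [|exact: intbleZ..].
  rewrite -RintZ//; apply: Rint_le.
  - by apply: intbleD; exact: intbleZ.
  - exact: intbleZ.
  move=> t; have -> : complex.Re z * (A t * cos (B t)) + complex.Im z * (A t * sin (B t)) =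
    A t * (complex.Re z * cos (B t) + complex.Im z * sin (B t)) by ring.
  rewrite [X in _ <= X]mulrC ler_wpM2l//.
  have : complex.Re (z * Complex (cos (B t)) (- sin (B t))) <= r.
    apply: (le_trans (ler_norm _)); apply: (le_trans (normc_geRe _)).
    by rewrite Normc.normcM /= sqrrN cos2Dsin2 sqrtr1 mulr1.
  by rewrite reM /= mulrN opprK.
have [r00|rp] := eqVneq r 0; first by rewrite r00 => _; exact: Rint_ge0.
by rewrite ler_pM2l// lt_neqAle eq_sym rp.
Qed.

Definition same_law d' (T' : measurableType d') (P' : probability T' R) (f : T -> R)
  (g : T' -> R) := forall B : set R, measurable B -> P (f @^-1` B) = P' (g @^-1` B).

End ComplexExpectation.
Arguments same_law {d T R} P {d' T'} P' f g.

Section SameLaw.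
Context d (T : measurableType d) (R : realType) (P : probability T R).
Context d' (T' : measurableType d') (P' : probability T' R).

Lemma same_law_expectation (f : T -> R) (g : T' -> R) (h : R -> R) :
  measurable_fun setT f -> measurable_fun setT g -> measurable_fun setT h ->
  same_law P P' f g -> intble P' (h \o g) ->
  intble P (h \o f) /\ \int[P]_t h (f t) = \int[P']_t h (g t).
Proof.
move=> mf mg mh fg ih.
pose F : {RV P >-> R} := mfun_Sub (mem_set mf).
pose G : {RV P' >-> R} := mfun_Sub (mem_set mg).
have E A : measurable A -> distribution P F A = distribution P' G A by exact: fg.
have iG : intble (distribution P' G) h by apply/intble_distribution.
have iF : intble (distribution P F) h.
  have /integrableP[h1 h2] := iG; apply/integrableP; split => //.
  rewrite (_ : (\int[distribution P F]_x _)%E =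
    (\int[distribution P' G]_x `|(EFin \o h) x|)%E)//.
  by apply: eq_measure_integral => A mA _; exact: E.
have iFP : intble P (h \o F) by move/(intble_distribution F mh) : iF.
split; first exact: iFP.
have e1 := Rint_distribution (X := F) mh iFP.
have e2 := Rint_distribution (X := G) mh ih.
transitivity (\int[distribution P F]_y h y); first by rewrite e1.
transitivity (\int[distribution P' G]_y h y); last by rewrite e2.
by congr fine; apply: eq_measure_integral => A mA _; exact: E.
Qed.

Lemma same_law_add (f1 f2 : T -> R) (g1 g2 : T' -> R) :
  measurable_fun setT f1 -> measurable_fun setT f2 ->
  measurable_fun setT g1 -> measurable_fun setT g2 ->
  indep_real P f1 f2 -> indep_real P' g1 g2 ->
  same_law P P' f1 g1 -> same_law P P' f2 g2 ->
  same_law P P' (fun t => f1 t + f2 t) (fun t => g1 t + g2 t).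
Proof.
move=> mf1 mf2 mg1 mg2 If Ig L1 L2 B mB.
pose F1 : {RV P >-> R} := mfun_Sub (mem_set mf1).
pose F2 : {RV P >-> R} := mfun_Sub (mem_set mf2).
pose D1 := distribution P F1; pose D2 := distribution P F2.
have mF : measurable_fun setT (fun t => (f1 t, f2 t)) by exact: measurable_fun_pair.
have mG : measurable_fun setT (fun t => (g1 t, g2 t)) by exact: measurable_fun_pair.
pose F : {RV P >-> (R * R)%type} := mfun_Sub (mem_set mF).
pose G : {RV P' >-> (R * R)%type} := mfun_Sub (mem_set mG).
have EF A : measurable A -> (D1 \x D2)%E A = distribution P F A.
  apply: product_measure_unique => X Y mX mY.
  by rewrite /D1 /D2 /distribution /pushforward /= -If.
have EG A : measurable A -> (D1 \x D2)%E A = distribution P' G A.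
  apply: product_measure_unique => X Y mX mY.
  change (P' (g1 @^-1` X `&` g2 @^-1` Y) = (P (f1 @^-1` X) * P (f2 @^-1` Y))%E).
  by rewrite L1// L2// Ig.
have mA : measurable_fun setT (fun z : R * R => z.1 + z.2) by exact: measurable_funD.
have mAB : measurable ((fun z : R * R => z.1 + z.2) @^-1` B).
  by rewrite -[X in measurable X]setTI; exact: mA.
by have := EF _ mAB; rewrite EG// /distribution /pushforward /=.
Qed.

End SameLaw.

Section IndependentProducts.
Context d (T : measurableType d) (R : realType) (P : probability T R).
Context (I : eqType) (Y : I -> {RV P >-> R}).
Hypothesis indY : independent Y.

Lemma sigma_measurable_prod s (A : nat -> T -> R) n :
  (forall k, (k < n)%N -> sigma_measurable Y s (A k)) ->
  sigma_measurable Y s (fun t => \prod_(k < n) A k t).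
Proof.
elim: n => [|n IH] mA; first by under eq_fun do rewrite big_ord0; exact: sigma_measurable_cst.
under eq_fun do rewrite big_ord_recr/=.
by apply: measurable_funM; [apply: IH => k kn; apply: mA; exact: ltnW|exact: mA].
Qed.

Lemma sigma_measurable_sum s (A : nat -> T -> R) n :
  (forall k, (k < n)%N -> sigma_measurable Y s (A k)) ->
  sigma_measurable Y s (fun t => \sum_(k < n) A k t).
Proof.
elim: n => [|n IH] mA; first by under eq_fun do rewrite big_ord0; exact: sigma_measurable_cst.
under eq_fun do rewrite big_ord_recr/=.
by apply: measurable_funD; [apply: IH => k kn; apply: mA; exact: ltnW|exact: mA].
Qed.

Lemma cexpect_mul s1 s2 (A1 B1 A2 B2 : T -> R) : uniq (s1 ++ s2) ->
  sigma_measurable Y s1 A1 -> sigma_measurable Y s1 B1 ->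
  sigma_measurable Y s2 A2 -> sigma_measurable Y s2 B2 ->
  intble P A1 -> intble P A2 ->
  intble P (fun t => A1 t * A2 t) /\
  cexpect P (fun t => A1 t * A2 t) (fun t => B1 t + B2 t) =
    cexpect P A1 B1 * cexpect P A2 B2.
Proof.
move=> us mA1 mB1 mA2 mB2 i1 i2; split.
  by have [] := indep_expectation (sigma_measurable_indep indY us mA1 mA2) i1 i2.
have b1 := sigma_measurable_measurable mB1; have b2 := sigma_measurable_measurable mB2.
have [c1 s1'] := cexpect_intble i1 b1; have [c2 s2'] := cexpect_intble i2 b2.
have mc s A B : sigma_measurable Y s A -> sigma_measurable Y s B ->
    sigma_measurable Y s (fun t => A t * cos (B t)).
  move=> mA mB; apply: measurable_funM => //.
  by apply: (sigma_measurable_comp mB); exact: continuous_measurable_fun (@continuous_cos R).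
have ms s A B : sigma_measurable Y s A -> sigma_measurable Y s B ->
    sigma_measurable Y s (fun t => A t * sin (B t)).
  move=> mA mB; apply: measurable_funM => //.
  by apply: (sigma_measurable_comp mB); exact: continuous_measurable_fun (@continuous_sin R).
have [j1 e1] := indep_expectation (sigma_measurable_indep indY us (mc _ _ _ mA1 mB1) (mc _ _ _ mA2 mB2)) c1 c2.
have [j2 e2] := indep_expectation (sigma_measurable_indep indY us (ms _ _ _ mA1 mB1) (ms _ _ _ mA2 mB2)) s1' s2'.
have [j3 e3] := indep_expectation (sigma_measurable_indep indY us (mc _ _ _ mA1 mB1) (ms _ _ _ mA2 mB2)) c1 s2'.
have [j4 e4] := indep_expectation (sigma_measurable_indep indY us (ms _ _ _ mA1 mB1) (mc _ _ _ mA2 mB2)) s1' c2.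
apply/eqP; rewrite eq_complex reM imM /=; apply/andP; split; apply/eqP.
  by rewrite -e1 -e2 -RintB//; apply: eq_Rint => t; rewrite cosD; ring.
by rewrite -e3 -e4 -RintD//; apply: eq_Rint => t; rewrite sinD; ring.
Qed.

(** The blocks [s k] allow two uses: singletons, to factor over the entries of one row, and whole
    rows, to factor over the array. *)
Lemma cexpect_prod (s : nat -> seq I) (A B : nat -> T -> R) (z : R[i]) n :
  uniq (flatten (mkseq s n)) ->
  (forall k, (k < n)%N -> sigma_measurable Y (s k) (A k)) ->
  (forall k, (k < n)%N -> sigma_measurable Y (s k) (B k)) ->
  (forall k, (k < n)%N -> intble P (A k)) ->
  (forall k, (k < n)%N -> cexpect P (A k) (B k) = z) ->
  intble P (fun t => \prod_(k < n) A k t) /\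
  cexpect P (fun t => \prod_(k < n) A k t) (fun t => \sum_(k < n) B k t) = z ^+ n.
Proof.
elim: n => [|n IH] us mA mB iA hz.
  split; first by under eq_fun do rewrite big_ord0; apply: (@intble_bounded _ _ _ _ _ 1) => // t; rewrite normr1.
  rewrite expr0 /cexpect; under eq_Rint do rewrite !big_ord0 cos0 mulr1.
  under [X in Complex _ X]eq_Rint do rewrite !big_ord0 sin0 mulr0.
  by rewrite Rint_cst_prob Rint0.
have fE : flatten (mkseq s n.+1) = flatten (mkseq s n) ++ s n.
  by rewrite /mkseq -addn1 iotaD add0n map_cat flatten_cat /= cats0.
rewrite fE in us; have := us; rewrite cat_uniq => /and3P[us1 _ _].
have lt k : (k < n)%N -> (k < n.+1)%N by exact: ltnW.
have [i1 e1] := IH us1 (fun k kn => mA k (lt k kn)) (fun k kn => mB k (lt k kn))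
  (fun k kn => iA k (lt k kn)) (fun k kn => hz k (lt k kn)).
have sub k : (k < n)%N -> {subset s k <= flatten (mkseq s n)}.
  move=> kn x xk; apply/flattenP; exists (s k) => //.
  by apply/mapP; exists k => //; rewrite mem_iota.
have [i2 e2] := cexpect_mul us
  (sigma_measurable_prod (fun k kn => sigma_measurable_sub (sub k kn) (mA k (lt k kn))))
  (sigma_measurable_sum (fun k kn => sigma_measurable_sub (sub k kn) (mB k (lt k kn))))
  (mA n (ltnSn n)) (mB n (ltnSn n)) i1 (iA n (ltnSn n)).
split; first by under eq_fun do rewrite big_ord_recr/=.
rewrite exprSr -e1 -(hz n (ltnSn n)) -e2; congr Complex; apply: eq_Rint => t;
  by rewrite !big_ord_recr.
Qed.

End IndependentProducts.

(** * The log moment generating function and the tilted law *)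

Section LogMgf.
Context d (T : measurableType d) (R : realType) (P : probability T R).
Variable X : {RV P >-> R}.
Hypothesis hfin : forall t : R, 0 <= t -> ('M_P X t < +oo)%E.
Notation m := (emoment P X).
Notation phi := (log_mgf X).

Let mX : measurable_fun setT X. Proof. exact: measurable_funP. Qed.

Lemma mgf_intble t : 0 <= t -> intble P (fun w => expR (t * X w)).
Proof.
move=> t0; apply/integrableP; split.
  apply/measurable_EFinP; apply: (measurableT_comp (@measurable_expR R)).
  exact: measurable_funM.
have := hfin t0; rewrite /mmt_gen_fun unlock; congr (_ < _)%E.
apply: eq_integral => w _ /=; rewrite ger0_norm ?expR_ge0//.
by rewrite mulrC.
Qed.

Lemma mgfE t : 0 <= t -> fine ('M_P X t) = m 0 t.
Proof.
move=> t0; rewrite /mmt_gen_fun unlock /emoment /Rintegral; congr fine.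
by apply: eq_integral => w _ /=; rewrite expr0 mul1r mulrC.
Qed.

Let iE := mgf_intble.

Lemma emoment0_intble t : 0 <= t -> intble P (fun w => X w ^+ 0 * expR (t * X w)).
Proof.
by move=> t0; have := iE t0; congr intble; apply/funext => w; rewrite expr0 mul1r.
Qed.

Lemma Rint_gt0 (f : T -> R) : intble P f -> (forall w, 0 < f w) -> 0 < \int[P]_w f w.
Proof.
move=> fi f0; rewrite lt_neqAle Rint_ge0 => [|w]; last exact: ltW.
rewrite andbT; apply/eqP => e.
have := Rint_le0_ae fi (fun w => ltW (f0 w)); rewrite -e lexx => /(_ isT).
case=> A [mA A0 sA]; have : P setT = 0%E.
  apply/eqP; rewrite -measure_le0 -A0 le_measure ?inE// => w _; apply: sA => /= h.
  by have := f0 w; rewrite h ltxx.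
by rewrite probability_setT => /eqP; rewrite onee_eq0.
Qed.

Lemma mgf_gt0 t : 0 <= t -> 0 < m 0 t.
Proof.
move=> t0; apply: Rint_gt0; first exact: emoment0_intble.
by move=> w; rewrite expr0 mul1r expR_gt0.
Qed.

Lemma log_mgfE t : 0 <= t -> phi t = ln (m 0 t).
Proof. by move=> t0; rewrite /log_mgf mgfE. Qed.

Lemma near_pos_eq (f g : R -> R) (t : R) : 0 < t -> (forall s, 0 < s -> f s = g s) ->
  {near t, f =1 g}.
Proof.
move=> t0 fg; apply/nbhs_normP; exists t => //= s /= h; apply: fg.
by have := ler_norm (t - s); lra.
Qed.

Lemma deriv_near_pos (f g : R -> R) (t a : R) : 0 < t -> (forall s, 0 < s -> f s = g s) ->
  has_derive f t a -> has_derive g t a.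
Proof.
by move=> t0 fg hf; apply: near_eq_is_derive hf; exact: near_pos_eq.
Qed.

Lemma deriv_log_mgf t : 0 < t -> has_derive phi t (m 1 t / m 0 t).
Proof.
move=> t0; apply: (@deriv_near_pos (fun s => ln (m 0 s))) => //.
  by move=> s s0; rewrite log_mgfE// ltW.
rewrite mulrC; apply: deriv_comp; last exact: deriv_emoment.
by apply: is_derive1_ln; exact/mgf_gt0/ltW.
Qed.

Lemma has_derive1 (f : R -> R) t a : has_derive f t a -> derive1 f t = a.
Proof. by move=> hf; rewrite derive1E; exact: derive_val. Qed.

Lemma log_mgf1 t : 0 < t -> derive1 phi t = m 1 t / m 0 t.
Proof. by move=> t0; exact/has_derive1/deriv_log_mgf. Qed.

Lemma deriv_log_mgf1 t : 0 < t ->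
  has_derive (derive1 phi) t (m 2 t / m 0 t - (m 1 t / m 0 t) ^+ 2).
Proof.
move=> t0; apply: (@deriv_near_pos (fun s => m 1 s / m 0 s)) => //.
  by move=> s s0; rewrite log_mgf1.
have n0 : m 0 t != 0 by rewrite gt_eqF// mgf_gt0// ltW.
apply: has_derive_val.
  by apply: derivM; [exact: deriv_emoment|apply: deriv_inv => //; exact: deriv_emoment].
by rewrite /=; field.
Qed.

Lemma log_mgf2 t : 0 < t ->
  derive1n 2 phi t = m 2 t / m 0 t - (m 1 t / m 0 t) ^+ 2.
Proof. by move=> t0; rewrite derive1nS derive1n1; exact/has_derive1/deriv_log_mgf1. Qed.

Section Tilt.
Variable a : R.
Hypothesis a0 : 0 < a.

(** The density of Cramer's exponential change of measure. Under it X has mean phi'(a) and variance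
    phi''(a) ([tilt_centred], [tilt_variance]). *)
Definition tilt (x : R) : R := expR (a * x) / m 0 a.
Definition centred (x : R) : R := x - derive1 phi a.

Let n0 : m 0 a != 0. Proof. by rewrite gt_eqF// mgf_gt0// ltW. Qed.

Lemma tilt_gt0 x : 0 < tilt x.
Proof. by rewrite /tilt divr_gt0 ?expR_gt0// mgf_gt0// ltW. Qed.

Lemma tilt_measurable : measurable_fun setT tilt.
Proof.
apply: measurable_funM => //; apply: (measurableT_comp (@measurable_expR R)).
exact: measurable_funM.
Qed.

Lemma tilt_moment_intble k : intble P (fun w => tilt (X w) * X w ^+ k).
Proof.
have := intbleZ (m 0 a)^-1 (emoment_intble mX iE k a0); congr intble.
by apply/funext => w; rewrite /tilt; ring.
Qed.

Lemma tilt_moment k : \int[P]_w (tilt (X w) * X w ^+ k) = m k a / m 0 a.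
Proof.
rewrite -[RHS]mulrC /emoment -RintZ; last exact: emoment_intble.
by apply: eq_Rint => w; rewrite /tilt; ring.
Qed.

Lemma tilt_intble : intble P (fun w => tilt (X w)).
Proof. by have := tilt_moment_intble 0; under eq_fun do rewrite expr0 mulr1. Qed.

Lemma tilt_mass : \int[P]_w tilt (X w) = 1.
Proof.
by have := tilt_moment 0; under eq_Rint do rewrite expr0 mulr1; rewrite divff.
Qed.

Lemma tilt_third : intble P (fun w => tilt (X w) * `|centred (X w)| ^+ 3).
Proof.
pose b := derive1 phi a.
have i3 : intble P (fun w => tilt (X w) * `|X w| ^+ 3).
  have := intble_norm (tilt_moment_intble 3); congr intble; apply/funext => w.
  by rewrite normrM normrX (gtr0_norm (tilt_gt0 _)).
have i := intbleZ 8 (intbleD i3 (intbleZ (`|b| ^+ 3) tilt_intble)).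
apply: (intble_le _ _ i) => [|w].
  apply: measurable_funM; first exact: measurableT_comp tilt_measurable mX.
  by apply: measurable_funX; apply: measurableT_comp => //; exact: measurable_funB.
rewrite normrM (gtr0_norm (tilt_gt0 _)) (ger0_norm (exprn_ge0 3 (normr_ge0 _))).
have -> : 8 * (tilt (X w) * `|X w| ^+ 3 + `|b| ^+ 3 * tilt (X w)) =
  tilt (X w) * (8 * (`|X w| ^+ 3 + `|b| ^+ 3)) by ring.
rewrite ler_wpM2l ?(ltW (tilt_gt0 _))//.
have h : `|centred (X w)| <= `|X w| + `|b| by exact: ler_normB.
apply: (@le_trans _ _ ((`|X w| + `|b|) ^+ 3)); first by rewrite lerXn2r ?nnegrE// addr_ge0.
have [x0 y0] := (normr_ge0 (X w), normr_ge0 b).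
move: (`|X w| : R) (`|b| : R) x0 y0 => x y x0 y0.
have [xy|yx] := leP x y.
  apply: (@le_trans _ _ ((y + y) ^+ 3)); first by rewrite lerXn2r ?nnegrE ?addr_ge0// lerD2r.
  by have := exprn_ge0 3 x0; rewrite !exprS expr0; nra.
apply: (@le_trans _ _ ((x + x) ^+ 3)).
  by rewrite lerXn2r ?nnegrE ?addr_ge0// lerD2l ltW.
by have := exprn_ge0 3 y0; rewrite !exprS expr0; nra.
Qed.

Lemma tilt_centred : \int[P]_w (tilt (X w) * centred (X w)) = 0.
Proof.
have i1 : intble P (fun w => tilt (X w) * X w) by have := tilt_moment_intble 1.
have E w : tilt (X w) * centred (X w) = tilt (X w) * X w - derive1 phi a * tilt (X w).
  by rewrite /centred; ring.
under eq_Rint do rewrite E.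
rewrite RintB ?RintZ ?tilt_mass//; [|exact: tilt_intble|exact/intbleZ/tilt_intble].
have -> : \int[P]_w (tilt (X w) * X w) = m 1 a / m 0 a by rewrite -(tilt_moment 1).
by rewrite log_mgf1// mulr1 subrr.
Qed.

Lemma tilt_variance : \int[P]_w (tilt (X w) * centred (X w) ^+ 2) = derive1n 2 phi a.
Proof.
have i1 : intble P (fun w => tilt (X w) * X w) by have := tilt_moment_intble 1.
pose b := derive1 phi a.
have E w : tilt (X w) * centred (X w) ^+ 2 =
   tilt (X w) * X w ^+ 2 - (2 * b * (tilt (X w) * X w) - b ^+ 2 * tilt (X w)).
  by rewrite /centred -/b; ring.
under eq_Rint do rewrite E.
rewrite RintB; [|exact: tilt_moment_intble|by apply: intbleB; [exact: intbleZ|exact/intbleZ/tilt_intble]].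
rewrite RintB; [|exact: intbleZ|exact/intbleZ/tilt_intble].
rewrite RintZ// RintZ ?tilt_mass; last exact: tilt_intble.
have -> : \int[P]_w (tilt (X w) * X w) = m 1 a / m 0 a by rewrite -(tilt_moment 1).
by rewrite tilt_moment /b log_mgf1// log_mgf2//; ring.
Qed.

Hypothesis hnd : ~ degenerate X.

(** A vanishing tilted variance would make X almost surely equal to phi'(a), also under the original
    law because the tilt is strictly positive. *)
Lemma log_mgf2_gt0 : 0 < derive1n 2 phi a.
Proof.
rewrite -tilt_variance lt_neqAle Rint_ge0 => [|w]; last first.
  by rewrite mulr_ge0 ?sqr_ge0// ltW// tilt_gt0.
rewrite andbT; apply/eqP => e; apply: hnd; exists (derive1 phi a).
have i2 : intble P (fun w => tilt (X w) * centred (X w) ^+ 2).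
  by apply: (@wY2_intble _ _ _ _ (fun w => tilt (X w)) (fun w => centred (X w)));
    [exact: measurable_funB|move=> w; exact: tilt_gt0|exact: tilt_intble|exact: tilt_third].
have n2 w : 0 <= tilt (X w) * centred (X w) ^+ 2.
  by rewrite mulr_ge0 ?sqr_ge0// ltW// tilt_gt0.
have := Rint_le0_ae i2 n2; rewrite -e lexx => /(_ isT).
apply: filterS => w /eqP; rewrite mulf_eq0 (gt_eqF (tilt_gt0 _))/= sqrf_eq0.
by rewrite subr_eq0 => /eqP.
Qed.

(** The graph of phi lies above its tangent at a. This is Jensen's inequality under the tilted law,
    obtained from exp y >= 1 + y with y = (t - a)(X - phi'(a)), whose tilted mean is 0. *)
Lemma tilt_mgf_ge t : 0 <= t ->
  phi a + derive1 phi a * (t - a) <= phi t.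
Proof.
move=> t0; pose b := derive1 phi a.
have i1 : intble P (fun w => tilt (X w) * X w) by have := tilt_moment_intble 1.
have h : expR (b * (t - a)) * m 0 a <= m 0 t.
  have ic : intble P (fun w => tilt (X w) * centred (X w)).
    have := intbleB i1 (intbleZ b tilt_intble); congr intble.
    by apply/funext => w; rewrite /centred /b; ring.
  have -> : expR (b * (t - a)) * m 0 a = expR (b * (t - a)) * m 0 a *
     (\int[P]_w tilt (X w) + (t - a) * \int[P]_w (tilt (X w) * centred (X w))).
    by rewrite tilt_centred tilt_mass mulr0 addr0 mulr1.
  rewrite -(RintZ _ ic) -RintD; [|exact: tilt_intble|exact: intbleZ].
  have [M ME] : exists M, M = m 0 a by eexists.
  rewrite -ME.
  rewrite -(@RintZ _ _ _ _ _ (expR (b * (t - a)) * M)); last by apply: intbleD; [exact: tilt_intble|exact: intbleZ].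
  rewrite /emoment; apply: Rint_le.
  - by apply: intbleZ; apply: intbleD; [exact: tilt_intble|exact: intbleZ].
  - exact: emoment0_intble.
  move=> w; rewrite expr0 mul1r.
  have -> : expR (b * (t - a)) * M *
      (tilt (X w) + (t - a) * (tilt (X w) * centred (X w))) =
      expR (a * X w) * expR (b * (t - a)) * (1 + (t - a) * centred (X w)).
    by rewrite ME /tilt; field.
  have -> : expR (t * X w) = expR (a * X w) * expR (b * (t - a)) * expR ((t - a) * centred (X w)).
    by rewrite -!expRD /centred /b; congr expR; ring.
  by rewrite ler_wpM2l ?mulr_ge0 ?expR_ge0// expR_ge1Dx.
have ma := mgf_gt0 (ltW a0).
have mt := mgf_gt0 t0; rewrite (log_mgfE (ltW a0)) (log_mgfE t0) -/b.
move: (m 0 a) (m 0 t) ma mt h => u v u0 v0 h.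
by rewrite addrC -ler_expR expRD !lnK.
Qed.

Lemma rate_log_mgf : rate phi (derive1 phi a) = (a * derive1 phi a - phi a)%:E.
Proof.
apply/le_anti/andP; split.
  apply: ge_ereal_sup => _ [t + <-]; rewrite /= in_itv/= andbT => t0.
  by rewrite lee_fin; have := tilt_mgf_ge t0; lra.
apply: ereal_sup_ubound; exists a; first by rewrite /= in_itv/= ltW.
by rewrite mulrC.
Qed.

End Tilt.

Hypothesis hnd : ~ degenerate X.

(** The derivative of s phi'(s) - phi(s) is s phi''(s) > 0. This monotonicity translates the
    position of c relative to c_1 into that of alpha relative to 1. *)
Lemma rate_increasing (a b : R) : 0 < a -> a < b ->
  a * derive1 phi a - phi a < b * derive1 phi b - phi b.
Proof.
move=> a0 ab; have b0 : 0 < b by exact: lt_trans ab.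
pose J s := s * derive1 phi s - phi s.
have dJ s : 0 < s -> has_derive J s (s * derive1n 2 phi s).
  move=> s0; apply: has_derive_val.
    apply: derivB; last exact: deriv_log_mgf.
    by apply: derivM; [exact: deriv_id|exact: deriv_log_mgf1].
  transitivity (s * (m 2 s / m 0 s - (m 1 s / m 0 s) ^+ 2)).
    by rewrite /= (log_mgf1 s0); ring.
  by congr (_ * _); exact/esym/log_mgf2.
have [c] : exists2 c, c \in `]a, b[%R & J b - J a = c * derive1n 2 phi c * (b - a).
  apply: (@MVT _ J (fun s => s * derive1n 2 phi s)) => //.
    by move=> s; rewrite in_itv/= => /andP[h _]; apply: dJ; exact: lt_trans h.
  apply: derivable_within_continuous => s; rewrite in_itv/= => /andP[h _].
  by have [] := dJ s (lt_le_trans a0 h).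
rewrite in_itv/= => /andP[h _] e; suff : 0 < J b - J a by rewrite subr_gt0.
rewrite e.
have c0 := lt_trans a0 h.
by rewrite !mulr_gt0 ?subr_gt0//; exact: log_mgf2_gt0.
Qed.

End LogMgf.

(** * The local limit theorem *)

Section RandomEnergyModel.
Context (R : realType).
Context (d0 : measure_display) (T0 : measurableType d0) (P0 : probability T0 R).
Variable X : {RV P0 >-> R}.
Hypothesis hfin : forall t : R, 0 <= t -> ('M_P0 X t < +oo)%E.
Hypothesis hnd : ~ degenerate X.
Hypothesis hnl : ~ lattice X.
Context (d : measure_display) (T : measurableType d) (P : probability T R).
Variable Xs : nat -> nat -> {RV P >-> R}.
Hypothesis hind : independent (fun k : nat * nat => Xs k.1 k.2).
Hypothesis hcopy : forall (i j : nat) (B : set R), measurable B ->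
  distribution P (Xs i j) B = distribution P0 X B.
Notation phi := (log_mgf X).
Notation Y := (fun k : nat * nat => Xs k.1 k.2).
Notation mu := (@lebesgue_measure R).

Lemma copy_expectation i j (h : R -> R) : measurable_fun setT h -> intble P0 (h \o X) ->
  intble P (fun t => h (Xs i j t)) /\ \int[P]_t h (Xs i j t) = \int[P0]_w h (X w).
Proof.
move=> mh ih; apply: (same_law_expectation (h := h)) => //.
by move=> B mB; exact: hcopy.
Qed.

Definition rowsum i n (t : T) : R := \sum_(j < n) Xs i j t.

Definition row i n : seq (nat * nat) := mkseq (fun j => (i, j)) n.

Lemma uniq_row i n : uniq (row i n).
Proof. by rewrite map_inj_uniq ?iota_uniq// => j k []. Qed.

Lemma uniq_rows n k : uniq (flatten (mkseq (fun i => row i n) k)).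
Proof.
rewrite [flatten _](_ : _ = [seq (i, j) | i <- iota 0 k, j <- iota 0 n])//.
by rewrite allpairs_uniq ?iota_uniq// => -[a b] [c e] _ _ [-> ->].
Qed.

Lemma flatten_single (I : Type) (f : nat -> I) n :
  flatten (mkseq (fun j => [:: f j]) n) = mkseq f n.
Proof. by rewrite /mkseq; elim: (iota 0 n) => //= x s ->. Qed.

Lemma rowsum_sigma i n : sigma_measurable Y (row i n) (rowsum i n).
Proof.
apply: (sigma_measurable_sum (Y := Y) (A := fun k t => Xs i k t)) => k kn.
apply: (@sigma_measurable_RV _ _ _ _ _ Y (row i n) (i, k)).
by apply: map_f; rewrite mem_iota.
Qed.

Lemma rowsum_measurable i n : measurable_fun setT (rowsum i n).
Proof. exact: sigma_measurable_measurable (@rowsum_sigma i n). Qed.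

Lemma row_cexpect i n (a b : R -> R) : measurable_fun setT a -> measurable_fun setT b ->
  intble P0 (a \o X) ->
  intble P (fun t => \prod_(j < n) a (Xs i j t)) /\
  cexpect P (fun t => \prod_(j < n) a (Xs i j t)) (fun t => \sum_(j < n) b (Xs i j t)) =
  cexpect P0 (a \o X) (b \o X) ^+ n.
Proof.
move=> ma mb ia.
have sX k : sigma_measurable Y [:: (i, k)] (Xs i k).
  exact: (@sigma_measurable_RV _ _ _ _ _ Y [:: (i, k)] (i, k) (mem_head _ _)).
apply: (cexpect_prod hind (s := fun j => [:: (i, j)])
  (A := fun j t => a (Xs i j t)) (B := fun j t => b (Xs i j t))).
- by rewrite flatten_single uniq_row.
- by move=> k _; exact: sigma_measurable_comp (sX k) ma.
- by move=> k _; exact: sigma_measurable_comp (sX k) mb.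
- by move=> k _; have [] := copy_expectation i k ma ia.
- move=> k _.
  have mbX : measurable_fun setT (b \o X) by exact: measurableT_comp.
  have [i1 i2] := cexpect_intble ia mbX.
  have mc : measurable_fun setT (fun x => a x * cos (b x)).
    apply: measurable_funM => //.
    exact: (measurableT_comp (continuous_measurable_fun (@continuous_cos R))).
  have ms : measurable_fun setT (fun x => a x * sin (b x)).
    apply: measurable_funM => //.
    exact: (measurableT_comp (continuous_measurable_fun (@continuous_sin R))).
  have [_ e1] := copy_expectation i k mc i1.
  have [_ e2] := copy_expectation i k ms i2.
  by rewrite /cexpect e1 e2.
Qed.

Lemma rowsum_same_law i n : same_law P P (rowsum i n) (rowsum 0 n).
Proof.
elim: n => [|n IH].
  move=> B mB; congr (P (_ @^-1` B)).
  by apply/funext => t; rewrite /rowsum !big_ord0.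
have E j : rowsum j n.+1 = fun t => rowsum j n t + Xs j n t.
  by apply/funext => t; rewrite /rowsum big_ord_recr.
have I j : indep_real P (rowsum j n) (Xs j n).
  apply: (sigma_measurable_indep hind (s1 := row j n) (s2 := [:: (j, n)])).
  - have := uniq_row j n.+1.
    by rewrite /row /mkseq -(addn1 n) iotaD add0n map_cat.
  - exact: rowsum_sigma.
  - exact: (@sigma_measurable_RV _ _ _ _ _ Y [:: (j, n)] (j, n) (mem_head _ _)).
rewrite !E; apply: same_law_add => //; [exact: rowsum_measurable..|].
move=> B mB; have h1 := hcopy i n mB; have h2 := hcopy 0 n mB.
by transitivity (distribution P0 X B); [exact: h1|exact/esym/h2].
Qed.

Lemma rows_cexpect n k (b : R -> R) : measurable_fun setT b ->
  cexpect P (fun=> 1) (fun t => \sum_(i < k) b (rowsum i n t)) =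
  cexpect P (fun=> 1) (fun t => b (rowsum 0 n t)) ^+ k.
Proof.
move=> mb.
have i1 : intble P (fun=> 1 : R) by apply: (@intble_bounded _ _ _ _ _ 1) => // t; rewrite normr1.
have [|||||_] := cexpect_prod hind (s := fun i => row i n) (n := k)
  (A := fun i t => 1) (B := fun i t => b (rowsum i n t))
  (z := cexpect P (fun=> 1) (fun t => b (rowsum 0 n t))).
- exact: uniq_rows.
- by move=> j _; exact: sigma_measurable_cst.
- by move=> j _; exact: sigma_measurable_comp (@rowsum_sigma j n) mb.
- by move=> j _.
- move=> j _; rewrite /cexpect; congr Complex.
    have [|||||_ e] := @same_law_expectation _ _ R P _ _ P (rowsum j n) (rowsum 0 n)
      (fun x => 1 * cos (b x)).
    + exact: rowsum_measurable.
    + exact: rowsum_measurable.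
    + by apply: measurable_funM => //; exact: (measurableT_comp (continuous_measurable_fun (@continuous_cos R))).
    + exact: rowsum_same_law.
    + have [] := cexpect_intble (B := fun t => b (rowsum 0 n t)) i1 => //.
      by apply: measurableT_comp => //; exact: rowsum_measurable.
    + exact: e.
  have [|||||_ e] := @same_law_expectation _ _ R P _ _ P (rowsum j n) (rowsum 0 n)
      (fun x => 1 * sin (b x)).
  + exact: rowsum_measurable.
  + exact: rowsum_measurable.
  + by apply: measurable_funM => //; exact: (measurableT_comp (continuous_measurable_fun (@continuous_sin R))).
  + exact: rowsum_same_law.
  + have [] := cexpect_intble (B := fun t => b (rowsum 0 n t)) i1 => //.
    by apply: measurableT_comp => //; exact: rowsum_measurable.
  + exact: e.
- by move=> <-; congr cexpect; apply/funext => t; rewrite big1_eq.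
Qed.

Lemma rowsum_mgf i n (a : R) : 0 <= a ->
  intble P (fun t => expR (a * rowsum i n t)) /\
  \int[P]_t expR (a * rowsum i n t) = emoment P0 X 0 a ^+ n.
Proof.
move=> a0.
have ma : measurable_fun setT (fun x : R => expR (a * x)).
  by apply: (measurableT_comp (@measurable_expR R)); exact: measurable_funM.
have [i1 e1] := row_cexpect i n ma (measurable_cst (0 : R)) (mgf_intble hfin a0).
have E t : \prod_(j < n) expR (a * Xs i j t) = expR (a * rowsum i n t).
  by rewrite /rowsum mulr_sumr expR_sum.
split; first by have := i1; congr intble; apply/funext => t; rewrite E.
have {1}-> : \int[P]_t expR (a * rowsum i n t) =
   complex.Re (cexpect P (fun t => \prod_(j < n) expR (a * Xs i j t)) (fun t => \sum_(j < n) cst 0 (Xs i j t))).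
  apply: eq_Rint => t; rewrite (_ : \sum_(j < n) _ = 0) ?cos0 ?mulr1 ?E//.
  by rewrite big1.
rewrite e1 (_ : cexpect _ _ _ = (emoment P0 X 0 a)%:C%C).
  by rewrite -rmorphXn.
rewrite /cexpect /emoment; congr Complex.
  by apply: eq_Rint => w; rewrite /= cos0 mulr1 expr0 mul1r.
by under eq_Rint do rewrite /= sin0 mulr0; rewrite Rint0.
Qed.

Variables (c alpha : R) (N : nat -> nat).
Hypothesis a0 : 0 < alpha.
Hypothesis hN : expR (- c * n%:R) * (N n)%:R @[n --> \oo] --> (1 : R).
Hypothesis hc : c = alpha * derive1 phi alpha - phi alpha.

Notation beta := (derive1 phi alpha).
Notation s2 := (derive1n 2 phi alpha).
Notation m := (emoment P0 X 0 alpha).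
Notation b := (scale_exponent phi alpha).
Notation p := (fun w => tilt X alpha (X w)).
Notation q := (fun w => centred X alpha (X w)).

Definition tilted_char (u : R) : R[i] := Complex (wcos P0 p q u) (wsin P0 p q u).

Definition rowshift n (t : T) : R := rowsum 0 n t - b n.

(** The product of the n tilts is e^(alpha S) / m^n, so the tilted expectation of a phase factors
    into the n-th power of [tilted_char]. Centering each entry at beta leaves the deterministic
    phase u (beta n - y). *)
Lemma tilted_row_phase n (y u v : R) :
  intble P (fun t => expR (alpha * (rowsum 0 n t - y))) /\
  \int[P]_t (expR (alpha * (rowsum 0 n t - y)) * cos (u * (rowsum 0 n t - y) + v)) =
  m ^+ n * expR (- alpha * y) * char_phase tilted_char n (beta * n%:R - y) v u.
Proof.
have m0 : m != 0 by rewrite gt_eqF// mgf_gt0// ltW.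
have ma : measurable_fun setT (tilt X alpha) by exact: tilt_measurable.
have mb : measurable_fun setT (fun x => u * centred X alpha x).
  by apply: measurable_funM => //; exact: measurable_funB.
have [i1 e1] := row_cexpect 0 n ma mb (tilt_intble hfin a0).
have zE : cexpect P0 (tilt X alpha \o X) ((fun x => u * centred X alpha x) \o X) = tilted_char u by [].
have E1 t : expR (alpha * (rowsum 0 n t - y)) =
   m ^+ n * expR (- alpha * y) * \prod_(j < n) tilt X alpha (Xs 0 j t).
  rewrite /tilt prodf_div -expR_sum -mulr_sumr prodr_const card_ord.
  rewrite mulrBr -mulNr expRD -/(rowsum 0 n t).
  by move: (expf_neq0 n m0) => h; field.
have E2 t : u * (rowsum 0 n t - y) + v = \sum_(j < n) u * centred X alpha (Xs 0 j t) +
    (u * (beta * n%:R - y) + v).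
  rewrite -mulr_sumr /centred sumrB sumr_const card_ord -/(rowsum 0 n t) -mulr_natr.
  by ring.
split; first by have := intbleZ (m ^+ n * expR (- alpha * y)) i1; congr intble; apply/funext => t; rewrite E1.
under eq_Rint do rewrite E1 E2 -mulrA.
rewrite RintZ; last first.
  apply: (intble_le_norm _ _ i1) => [|t].
    apply: measurable_funM; first exact: intble_measurable i1.
    apply: (measurableT_comp (continuous_measurable_fun (@continuous_cos R))).
    apply: measurable_funD => //; apply: measurable_sum => j.
    exact: (measurableT_comp mb).
  by rewrite normrM ler_piMr// cos_norm.
congr (_ * _); rewrite cexpect_phase//; last first.
  by apply: measurable_sum => j; exact: (measurableT_comp mb).
by rewrite e1 zE.
Qed.

Let pq_gt0 w : 0 < p w. Proof. exact: tilt_gt0. Qed.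
Let pq_measurable : measurable_fun setT q. Proof. exact: measurable_funB. Qed.

Lemma tilted_char_nonlattice (h a : R) :
  ~ {ae P0, forall w, exists n : int, q w = h * n%:~R + a}.
Proof.
move=> H; apply: hnl; exists h, (a + beta); apply: filterS H => w [n nE].
by exists n; rewrite addrA -nE /centred subrK.
Qed.

Lemma tilted_char_var : wvar P0 p q = s2.
Proof. exact: tilt_variance. Qed.

Lemma s2_gt0 : 0 < s2. Proof. exact: log_mgf2_gt0. Qed.

Lemma tilted_char_re u : `|u ^+ 2 / 2 * s2 - (1 - complex.Re (tilted_char u))|
  <= `|u| ^+ 3 * wthird P0 p q.
Proof.
rewrite -tilted_char_var; apply: wcos_taylor => //.
- exact: tilt_intble.
- exact: tilt_mass.
- exact: tilt_third.
Qed.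

Lemma tilted_char_im u : `|complex.Im (tilted_char u)| <= `|u| ^+ 3 * wthird P0 p q.
Proof.
apply: wsin_taylor => //.
- exact: tilt_intble.
- exact: tilt_third.
- exact: tilt_centred.
Qed.

Lemma tilted_char_bound L : exists2 k : R, 0 < k & forall u, `|u| <= L ->
  Normc.normc (tilted_char u) <= expR (- k * u ^+ 2).
Proof.
have [|||||k k0 hk] := @wchar_bound _ _ R P0 p q pq_measurable pq_gt0 _ _ _ _ tilted_char_nonlattice _ L.
- exact: tilt_intble.
- exact: tilt_mass.
- exact: tilt_third.
- exact: tilt_centred.
- by rewrite tilted_char_var s2_gt0.
exists (k / 2) => [|u uL]; first by rewrite divr_gt0.
rewrite -(@ler_pXn2r R 2)// ?nnegrE ?normc_nneg ?expR_ge0//.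
rewrite normc_sqr [X in _ <= X]expr2 -expRD; apply: (le_trans (hk u uL)).
by rewrite ler_expR; lra.
Qed.

Lemma tilted_char_re_continuous : continuous (fun u => complex.Re (tilted_char u)).
Proof.
apply: (@wcos_continuous _ _ R P0 p q) => //; [exact: tilt_intble|exact: tilt_third].
Qed.

Lemma tilted_char_im_continuous : continuous (fun u => complex.Im (tilted_char u)).
Proof.
apply: (@wsin_continuous _ _ R P0 p q) => //; [exact: tilt_intble|exact: tilt_third].
Qed.

Lemma rowshift_measurable n : measurable_fun setT (rowshift n).
Proof. by apply: measurable_funB => //; exact: rowsum_measurable. Qed.

(** Dividing by alpha normalises the limit: the weighted cosine transform tends to [kap] itself, so
    the limiting density is [ker]. *)
Definition llt_weight n t : R := (N n)%:R / alpha * (expR (alpha * rowshift n t) * ker (rowshift n t)).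

Lemma ker_measurable : measurable_fun setT (@ker R).
Proof. exact: continuous_measurable_fun (@ker_continuous R). Qed.

Lemma ker_le : exists2 M : R, 0 <= M & forall x : R, ker x <= M.
Proof.
exists ((2 * pi)^-1 * \int[mu]_u `|kap u|).
  by rewrite mulr_ge0 ?Rint_ge0// ltW// inv2pi_gt0.
move=> x; rewrite /ker ler_wpM2l ?(ltW (inv2pi_gt0 R))//.
apply: Rint_le => [||u].
- by have := kap_cos_intble x 0; under eq_fun do rewrite addr0.
- by apply: intble_norm; exact: kap_intble.
by rewrite (le_trans (ler_norm _))// normrM ler_piMl// cos_norm.
Qed.

Lemma llt_weight_intble n : intble P (llt_weight n).
Proof.
have [i1 _] := tilted_row_phase n (b n) 0 0.
have [M M0 kM] := ker_le.
apply: intbleZ; under eq_fun do rewrite mulrC.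
apply: (intbleM (M := M)); [|move=> t|exact: i1].
  by apply: (measurableT_comp ker_measurable); exact: rowshift_measurable.
by rewrite ger0_norm// ltW// ker_gt0.
Qed.

Lemma llt_weight_phase n (v r : R) :
  \int[P]_t (llt_weight n t * cos (v * rowshift n t + r)) =
  (N n)%:R / alpha * (2 * pi)^-1 * (m ^+ n * expR (- alpha * b n)) *
  \int[mu]_u (kap (v - u) * char_phase tilted_char n (beta * n%:R - b n) r u).
Proof.
pose f t u := kap (v - u) * (expR (alpha * rowshift n t) * cos (u * rowshift n t + r)).
have [i1 _] := tilted_row_phase n (b n) 0 0.
have [ik _] := Rint_reflect v (@kap_intble R).
have E t : llt_weight n t * cos (v * rowshift n t + r) =
    (N n)%:R / alpha * (2 * pi)^-1 * \int[mu]_u f t u.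
  have -> : llt_weight n t * cos (v * rowshift n t + r) = (N n)%:R / alpha *
      (expR (alpha * rowshift n t) * (ker (rowshift n t) * cos (v * rowshift n t + r))).
    by rewrite /llt_weight -!mulrA.
  rewrite ker_cos.
  have -> : \int[mu]_u f t u = expR (alpha * rowshift n t) *
      \int[mu]_u (kap (v - u) * cos (u * rowshift n t + r)).
    rewrite -RintZ; last first.
      under eq_fun do rewrite mulrC.
      apply: (intbleM (M := 1)) => //; last by move=> u; exact: cos_norm.
      apply: (measurableT_comp (continuous_measurable_fun (@continuous_cos R))).
      by apply: measurable_funD => //; exact: measurable_funM.
    by apply: eq_Rint => u; rewrite /f; ring.
  move: ((2 * pi)^-1 : R) (\int[mu]_u (kap (v - u) * cos (u * rowshift n t + r))) => A B.
  by ring.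
have mf : measurable_fun [set: T * measurableTypeR R] (fun z => f z.1 z.2).
  have m1 : measurable_fun [set: T * measurableTypeR R] (fun z => rowshift n z.1).
    by apply: measurableT_comp; [exact: rowshift_measurable|exact: measurable_fst].
  have m2 := @measurable_snd_real _ T R.
  apply: measurable_funM.
    apply: (measurableT_comp (@kap_measurable R)); exact: measurable_funB.
  apply: measurable_funM.
    by apply: (measurableT_comp (@measurable_expR R)); exact: measurable_funM.
  apply: (measurableT_comp (continuous_measurable_fun (@continuous_cos R))).
  by apply: measurable_funD => //; exact: measurable_funM.
have ib : intble mu (fun u => `|kap (v - u)|) by exact: intble_norm.
have fab t u : `|f t u| <= expR (alpha * rowshift n t) * `|kap (v - u)|.
  rewrite /f normrM mulrC ler_wpM2r// normrM (ger0_norm (expR_ge0 _)).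
  by rewrite ler_piMr ?expR_ge0// cos_norm.
under eq_Rint do rewrite E.
rewrite RintZ; last exact: (Rfubini_int1 mf i1 ib fab).
rewrite -[RHS]mulrA; congr (_ * _).
have -> : \int[P]_t \int[mu]_u f t u = \int[mu]_u \int[P]_t f t u.
  exact: (Rfubini mf i1 ib fab).
rewrite -RintZ; last first.
  under eq_fun do rewrite mulrC.
  have mc : measurable_fun setT (char_phase tilted_char n (beta * n%:R - b n) r).
    apply: continuous_measurable_fun.
    exact: (char_phase_continuous tilted_char_re_continuous tilted_char_im_continuous).
  apply: (intbleM (M := 2)) => // u.
  apply: (le_trans (char_phase_le _ _ _ _ _)); rewrite ler_piMr//.
  rewrite exprn_ile1 ?normc_nneg//; exact: (normc_char_le1 tilted_char_bound).
apply: eq_Rint => u; rewrite /f RintZ.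
  by have [_ ->] := tilted_row_phase n (b n) u r; ring.
apply: (intble_le_norm _ _ i1) => [|t].
  apply: measurable_funM; first exact: intble_measurable i1.
  apply: (measurableT_comp (continuous_measurable_fun (@continuous_cos R))).
  by apply: measurable_funD => //; apply: measurable_funM => //; exact: rowshift_measurable.
by rewrite normrM ler_piMr// cos_norm.
Qed.

Let y n := beta * n%:R - b n.

Lemma scale_gap n : y n = alpha^-1 * ln (alpha * Num.sqrt (2 * pi * s2 * n%:R)).
Proof. by rewrite /y /scale_exponent; ring. Qed.

Let K := alpha * Num.sqrt (2 * pi * s2).

Let K_gt0 : 0 < K.
Proof. by rewrite mulr_gt0// sqrtr_gt0 !mulr_gt0// ?pi_gt0// s2_gt0. Qed.

Let KE n : alpha * Num.sqrt (2 * pi * s2 * n%:R) = K * Num.sqrt n%:R.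
Proof.
by rewrite /K sqrtrM ?mulrA// !mulr_ge0// ?pi_ge0// ltW// s2_gt0.
Qed.

(** The gap is logarithmic in n. With r the fourth root of the index, ln (K r^2) is at most |ln K| +
    2 r, while the denominator is r^2. Indices start at 1 because the logarithm in [b] has a zero
    argument at n = 0. *)
Lemma scale_gap_cvg0 : y n.+1 / Num.sqrt n.+1%:R @[n --> \oo] --> (0 : R).
Proof.
pose r n : R := Num.sqrt (Num.sqrt n.+1%:R).
have rp n : 0 < r n by rewrite !sqrtr_gt0.
have r2 n : r n ^+ 2 = Num.sqrt n.+1%:R by rewrite sqr_sqrtr.
have r1 n : 1 <= r n.
  have s1 (x : R) : 1 <= x -> 1 <= Num.sqrt x.
    by move=> x1; rewrite -[X in X <= _]sqrtr1 ler_wsqrtr.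
  by rewrite /r (s1 _ (s1 _ _))// ler1n.
have cr : (r n)^-1 @[n --> \oo] --> (0 : R).
  have := @cvg_comp _ _ _ _ Num.sqrt _ _ _ (@sqrt_nat_inv_cvg0 R) (@sqrt_continuous R 0).
  by rewrite sqrtr0; apply: cvg_ext => n /=; rewrite sqrtrV.
have lim : alpha^-1 * (`|ln K| + 2) * (r n)^-1 @[n --> \oo] --> (0 : R).
  by rewrite -(mulr0 (alpha^-1 * (`|ln K| + 2))); exact: cvgMl_tmp.
apply/norm_cvg0P; apply: (squeeze_cvgr _ (cvg_cst (0 : R)) lim).
apply: nearW => n; rewrite normr_ge0/= scale_gap KE -r2 lnM ?posrE ?exprn_gt0//.
rewrite lnXn// !normrM normfV (gtr0_norm a0) -!mulrA ler_pM2l ?invr_gt0//.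
rewrite (gtr0_norm (_ : 0 < (r n ^+ 2)^-1)) ?invr_gt0 ?exprn_gt0//.
rewrite ler_pdivrMr ?exprn_gt0// -mulrA expr2 mulKf ?gt_eqF//.
apply: (le_trans (ler_normD _ _)).
have l0 : 0 <= ln (r n) by rewrite ln_ge0.
have l1 : ln (r n) <= r n by rewrite ltW// ln_sublinear.
rewrite (ger0_norm (_ : 0 <= ln (r n) *+ 2)) ?mulrn_wge0//.
rewrite mulrDl lerD//; first by rewrite ler_peMr.
by rewrite -mulr_natl; lra.
Qed.

(** The choices of c and b_n meet here. Since c = alpha beta - phi(alpha), the exponential factors
    combine into e^(- c n) N_n, which tends to 1; the logarithm in b_n leaves the factor alpha sqrt
    (2 pi phi''(alpha) n), whose sqrt n is the one that [local_integral] requires. *)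
Lemma llt_constant n : (N n.+1)%:R / alpha * (2 * pi)^-1 * (m ^+ n.+1 * expR (- alpha * b n.+1)) =
  expR (- c * n.+1%:R) * (N n.+1)%:R * (Num.sqrt (2 * pi * s2) * (2 * pi)^-1) * Num.sqrt n.+1%:R.
Proof.
have mE : m ^+ n.+1 = expR (phi alpha * n.+1%:R).
  by rewrite (log_mgfE X (ltW a0)) mulrC expRM_natl lnK ?posrE// mgf_gt0// ltW.
have bE : expR (- alpha * b n.+1) =
    expR (- (alpha * beta) * n.+1%:R) * (K * Num.sqrt n.+1%:R).
  have -> : - alpha * b n.+1 = - (alpha * beta) * n.+1%:R + ln (K * Num.sqrt n.+1%:R).
    rewrite /scale_exponent KE; move: (ln _) => l; field; by rewrite gt_eqF.
  by rewrite expRD lnK// posrE mulr_gt0// sqrtr_gt0.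
have cE : expR (- c * n.+1%:R) = expR (phi alpha * n.+1%:R) * expR (- (alpha * beta) * n.+1%:R).
  by rewrite -expRD hc; congr expR; ring.
rewrite mE bE cE /K; move: (Num.sqrt (2 * pi * s2)) (Num.sqrt n.+1%:R) ((2 * pi)^-1 : R).
move=> A B C'; field; by rewrite gt_eqF.
Qed.

(** The phase [r] treats both transforms at once: r = 0 gives the cosine, and r = - pi / 2 the sine,
    with limit 0. *)
Lemma llt_phase_cvg v r :
  \int[P]_t (llt_weight n.+1 t * cos (v * rowshift n.+1 t + r)) @[n --> \oo] --> kap v * cos r.
Proof.
have sp : 0 < Num.sqrt (2 * pi) :> R := sqrt2pi_gt0 R.
have ss : 0 < Num.sqrt s2 by rewrite sqrtr_gt0 s2_gt0.
have hN1 : expR (- c * n.+1%:R) * (N n.+1)%:R @[n --> \oo] --> (1 : R).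
  by rewrite (cvg_shiftS (fun n => expR (- c * n%:R) * (N n)%:R)).
have L := local_integral s2_gt0 tilted_char_re tilted_char_im tilted_char_bound
  tilted_char_re_continuous tilted_char_im_continuous (v := v) (q := r) scale_gap_cvg0.
have L1 : expR (- c * n.+1%:R) * (N n.+1)%:R * (Num.sqrt (2 * pi * s2) * (2 * pi)^-1)
    @[n --> \oo] --> 1 * (Num.sqrt (2 * pi * s2) * (2 * pi)^-1) by exact: cvgMr_tmp.
have L2 : (expR (- c * n.+1%:R) * (N n.+1)%:R * (Num.sqrt (2 * pi * s2) * (2 * pi)^-1)) *
    (Num.sqrt n.+1%:R * \int[mu]_u (kap (v - u) * char_phase tilted_char n.+1 (y n.+1) r u))
    @[n --> \oo] --> 1 * (Num.sqrt (2 * pi * s2) * (2 * pi)^-1) *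
    (kap v * cos r * (Num.sqrt (2 * pi) / Num.sqrt s2)) by exact: cvgM.
move: L2; have -> : 1 * (Num.sqrt (2 * pi * s2) * (2 * pi)^-1) *
    (kap v * cos r * (Num.sqrt (2 * pi) / Num.sqrt s2)) = kap v * cos r.
  have -> : Num.sqrt (2 * pi * s2) = Num.sqrt (2 * pi) * Num.sqrt s2.
    by rewrite sqrtrM// mulr_ge0// pi_ge0.
  have -> : (2 * pi)^-1 = (Num.sqrt (2 * pi) ^+ 2)^-1 :> R.
    by rewrite sqr_sqrtr// mulr_ge0// pi_ge0.
  move: (Num.sqrt (2 * pi)) (Num.sqrt s2) sp ss => A B A0 B0.
  by field; rewrite !gt_eqF.
apply: cvg_ext => n /=; rewrite llt_weight_phase llt_constant -/(y n.+1).
by rewrite [RHS]mulrA.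
Qed.

(* The weight carries the factor e^(alpha W) ker W, so that a test function g
   with g e^(-alpha x) = O(ker) becomes a bounded one. *)
Lemma local_limit (g : R -> R) (x0 B : R) : measurable_fun setT g ->
  (forall x, `|g x * expR (- alpha * x)| <= B * ker x) ->
  (forall x, x != x0 -> {for x, continuous g}) ->
  (N n.+1)%:R * \int[P]_t g (rowshift n.+1 t) @[n --> \oo] -->
  alpha * \int[mu]_x (g x * expR (- alpha * x)).
Proof.
move=> mg gB cg; pose h x := g x * expR (- alpha * x) / ker x.
have hB x : `|h x| <= B.
  by rewrite /h normrM normfV (gtr0_norm (ker_gt0 x)) ler_pdivrMr ?ker_gt0.
have me : continuous (fun x : R => expR (- alpha * x)).
  have c1 : continuous (fun x : R => - alpha * x).
    by move=> x; apply: cvgMl_tmp; exact: cvg_id.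
  by move=> x; exact: (continuous_comp (c1 x) (@continuous_expR R _)).
have mV : continuous (fun x : R => (ker x)^-1).
  by move=> x; apply: cvgV; [rewrite gt_eqF// ker_gt0|exact: ker_continuous].
have mh : measurable_fun setT h.
  apply: measurable_funM; last exact: continuous_measurable_fun.
  by apply: measurable_funM => //; exact: continuous_measurable_fun.
have ch x : x != x0 -> {for x, continuous h}.
  by move=> xx; apply: cvgM; [apply: cvgM; [exact: cg|exact: me]|exact: mV].
have D x : levy_density (@kap R) (fun=> 0) x = ker x.
  by rewrite /levy_density /ker; congr (_ * _); apply: eq_Rint => u; rewrite mulr0 addr0.
have i0 : intble mu (fun=> 0 : R).
  by have := intbleZ 0 (@kap_intble R); under eq_fun do rewrite mul0r.
have := @wmean_cvg _ _ R P (fun n => llt_weight n.+1) (fun n => rowshift n.+1) (@kap R) (fun=> 0)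
  (fun n => intble_measurable (llt_weight_intble n.+1)) (fun n => @rowshift_measurable n.+1)
  _ (fun n => llt_weight_intble n.+1) _ _ (@kap_intble R) i0 (@kap_continuous R 0) h x0 B mh hB ch.
have H1 n t : 0 <= llt_weight n.+1 t.
  by rewrite /llt_weight mulr_ge0 ?divr_ge0 ?ler0n ?(ltW a0)// mulr_ge0 ?expR_ge0// ltW// ker_gt0.
have H2 u : wmean P (fun n => llt_weight n.+1) (fun n => rowshift n.+1) n (fun x => cos (u * x))
    @[n --> \oo] --> kap u.
  have := @llt_phase_cvg u 0; rewrite cos0 mulr1; apply: cvg_ext => n.
  by rewrite /wmean; under eq_Rint do rewrite -[X in cos X]addr0.
have H3 u : wmean P (fun n => llt_weight n.+1) (fun n => rowshift n.+1) n (fun x => sin (u * x))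
    @[n --> \oo] --> (0 : R).
  have := @llt_phase_cvg u (- (pi / 2)); rewrite cosN cos_pihalf mulr0; apply: cvg_ext => n.
  by rewrite /wmean; under eq_Rint do rewrite -cosBpihalf.
move=> /(_ H1 H2 H3) H0.
have H : alpha * wmean P (fun n => llt_weight n.+1) (fun n => rowshift n.+1) n h @[n --> \oo] -->
    alpha * \int[mu]_x (h x * levy_density (@kap R) (fun=> 0) x) by exact: cvgMl_tmp.
have E1 : \int[mu]_x (g x * expR (- alpha * x)) = \int[mu]_x (h x * levy_density (@kap R) (fun=> 0) x).
  by apply: eq_Rint => x; rewrite D /h divfK// gt_eqF// ker_gt0.
rewrite E1; apply: cvg_ext H => n; rewrite /wmean.
have E2 t : llt_weight n.+1 t * h (rowshift n.+1 t) = (N n.+1)%:R / alpha * g (rowshift n.+1 t).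
  rewrite /llt_weight /h mulNr expRN; have := ker_gt0 (rowshift n.+1 t).
  have := expR_gt0 (alpha * rowshift n.+1 t).
  move: (expR _) (ker _) => A C' A0 C0; field; by rewrite !gt_eqF.
under [X in _ = _ * X]eq_Rint do rewrite E2.
have ig : intble P (fun t => g (rowshift n.+1 t)).
  have [i1 _] := tilted_row_phase n.+1 (b n.+1) 0 0.
  have [M M0 kM] := ker_le.
  apply: (intble_le _ _ (intbleZ (B * M) i1)) => [|t].
    by apply: (measurableT_comp mg); exact: rowshift_measurable.
  have := gB (rowshift n.+1 t); rewrite normrM (ger0_norm (expR_ge0 _)) mulNr expRN.
  rewrite ler_pdivrMr ?expR_gt0// => /le_trans; apply.
  have B0 : 0 <= B by rewrite (le_trans _ (hB 0)).
  by rewrite ler_wpM2r ?expR_ge0// ler_wpM2l.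
rewrite RintZ// mulrA; congr (_ * _).
by rewrite mulrC divfK// gt_eqF.
Qed.

End RandomEnergyModel.

(** * The stable exponent *)

Section ExponentialDecay.
Context (R : realType).

Lemma expR_le1 (x : R) : x <= 0 -> expR x <= 1.
Proof. by move=> x0; rewrite -expR0 ler_expR. Qed.
Notation mu := (@lebesgue_measure R).

Lemma intble_derive (F f : R -> R) (l1 l2 : R) :
  (forall x, has_derive F x (f x)) -> continuous f -> (forall x, 0 <= f x) ->
  F (- n%:R) @[n --> \oo] --> l1 -> F n%:R @[n --> \oo] --> l2 ->
  intble mu f.
Proof.
move=> dF cf f0 h1 h2; have mf := continuous_measurable_fun cf.
have ii (n : nat) : mu.-integrable `[- n%:R, n%:R] (EFin \o f).
  apply: continuous_compact_integrable; first exact: segment_compact.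
  exact: continuous_subspaceT.
have E (n : nat) : \int[mu]_x (f \_ `[- n%:R, n%:R]%classic) x = F n%:R - F (- n%:R).
  rewrite -Rintegral_mkcond (FTC_derive _ dF)//.
  by rewrite (@le_trans _ _ 0)// oppr_le0.
have cI : \int[mu]_x (f \_ `[- n%:R, n%:R]%classic) x @[n --> \oo] --> l2 - l1.
  by apply: (@cvg_ext _ (fun n => F n%:R - F (- n%:R))) => //; exact: cvgB.
have [] // := @Rint_monotone _ _ _ mu (fun n => f \_ `[- n%:R, n%:R]%classic) f (l2 - l1).
- move=> n; have /integrable_mkcond := ii n => /(_ _) H.
  have : mu.-integrable setT ((EFin \o f) \_ `[- n%:R, n%:R]%classic) by exact: H.
  congr (_.-integrable _ _); apply/funext => x.
  by rewrite /= !patchE; case: ifP.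
- by move=> n x; rewrite patchE; case: ifP.
- move=> x n k nk; rewrite !patchE; case: ifP => [|_]; last by case: ifP.
  rewrite inE/= in_itv/= -ler_norml => h; rewrite mem_set//= in_itv/= -ler_norml.
  by rewrite (le_trans h)// ler_nat.
- move=> x; apply: cvg_near_cst; near=> n.
  rewrite patchE mem_set//= in_itv/= -ler_norml.
  by near: n; exact: nbhs_infty_ger.
Unshelve. all: by end_near. Qed.

(** Comparison with the logistic density e^x / (1 + e^x)^2, which has an elementary primitive and is
    at least e^(- |x|) / 4; the general rate follows by scaling. *)
Lemma exp_abs_intble (r : R) : 0 < r -> intble mu (fun x => expR (- r * `|x|)).
Proof.
move=> r0; have i1 : intble mu (fun x : R => expR (- `|x|)).
  pose f (x : R) := expR x / (1 + expR x) ^+ 2.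
  pose F (x : R) := - (1 + expR x)^-1.
  have p1 (x : R) : 0 < 1 + expR x by rewrite addr_gt0 ?expR_gt0.
  have f0 (x : R) : 0 <= f x by rewrite divr_ge0 ?expR_ge0// exprn_ge0// ltW.
  have dF (x : R) : has_derive F x (f x).
    apply: has_derive_val.
      apply: derivN; apply: deriv_inv; first by rewrite gt_eqF.
      by derivs.
    by rewrite /f mulr1 add0r mulNr opprK.
  have ce : continuous (fun x : R => 1 + expR x).
    by move=> x; apply: cvgD; [exact: cvg_cst|exact: continuous_expR].
  have cf : continuous f.
    move=> x; apply: cvgM; first exact: continuous_expR.
    apply: cvgV; first by rewrite expf_neq0// gt_eqF.
    have h := ce x; exact: (cvgM h h).
  have e0 : expR (- n%:R) @[n --> \oo] --> (0 : R).
    by have := @expR_nat_cvg0 R 1 ltr01; apply: cvg_ext => n; rewrite mul1r.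
  have i : intble mu f.
    apply: (@intble_derive F f (- 1) 0 dF cf f0).
      apply: cvgN; rewrite -[X in _ --> X]invr1; apply: cvgV => //.
      by rewrite -[X in _ --> X]addr0; apply: cvgD => //; exact: cvg_cst.
    have h : - (expR (- n%:R) / (1 + expR (- n%:R))) @[n --> \oo] --> - (0 / (1 + 0) : R).
      apply: cvgN; apply: cvgM => //; apply: cvgV; first by rewrite addr0.
      by apply: cvgD => //; exact: cvg_cst.
    rewrite mul0r oppr0 in h; apply: cvg_ext h => n; rewrite /F expRN.
    congr (- _); have := expR_gt0 (n%:R : R); move: (expR (n%:R : R)) => e e0'.
    by field; rewrite !gt_eqF ?addr_gt0.
  apply: (intble_le _ _ (intbleZ 4 i)) => [|x].
    by apply: (measurableT_comp (@measurable_expR R)); apply: measurableT_comp => //; exact: measurableT_comp.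
  rewrite ger0_norm ?expR_ge0// /f.
  have [x0|x0] := ger0P x.
    have e1 : 1 <= expR x by rewrite -expR0 ler_expR.
    rewrite expRN mulrA ler_pdivlMr ?exprn_gt0// ler_pdivrMl ?expR_gt0//.
    by move: (expR x) e1 => e e1; rewrite expr2; nra.
  have e1 : expR x <= 1 by rewrite -expR0 ler_expR ltW.
  rewrite opprK mulrA ler_pdivlMr ?exprn_gt0//.
  by have := expR_gt0 x; move: (expR x) e1 => e e1 e2; rewrite expr2; nra.
have [h _] := Rint_scale r0 i1; move: h; congr intble.
by apply/funext => x; rewrite normrM (gtr0_norm r0) mulNr.
Qed.

Definition exp_decay (f : R -> R) : Prop := exists C r : R,
  0 < r /\ forall x, `|f x| <= C * expR (- r * `|x|).

Lemma exp_decay_intro (f : R -> R) (C r1 r2 : R) : 0 < r1 -> 0 < r2 ->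
  (forall x, x <= 0 -> `|f x| <= C * expR (r1 * x)) ->
  (forall x, 0 <= x -> `|f x| <= C * expR (- r2 * x)) -> exp_decay f.
Proof.
move=> r10 r20 h1 h2; have C0 : 0 <= C.
  by have := h1 0 (lexx _); rewrite mulr0 expR0 mulr1; exact: le_trans.
exists C, (Num.min r1 r2); split; first by rewrite lt_min r10.
move=> x; have [x0|x0] := ger0P x.
  apply: (le_trans (h2 x x0)); rewrite ler_wpM2l// ler_expR ler_wpM2r//.
  by rewrite lerN2 ge_min lexx orbT.
apply: (le_trans (h1 x (ltW x0))); rewrite ler_wpM2l// ler_expR mulrNN.
by rewrite ler_wnM2r ?(ltW x0)// ge_min lexx.
Qed.

Lemma exp_decay_intble (f : R -> R) : measurable_fun setT f -> exp_decay f -> intble mu f.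
Proof.
move=> mf [C [r [r0 h]]]; have i := intbleZ C (exp_abs_intble r0).
exact: (intble_le _ _ i).
Qed.

(** The kernel decays only quadratically, so any exponential rate beats it. With s = r / 2 the bound
    y^2 <= s^(-2) e^(2 s y) at y = |x| + pi / 2 absorbs e^(- r |x|) exactly and leaves the constant
    [D]. *)
Lemma exp_decay_ker (f : R -> R) : exp_decay f -> exists B, forall x, `|f x| <= B * ker x.
Proof.
move=> [C [r [r0 h]]]; have C0 : 0 <= C.
  by have := h 0; rewrite normr0 mulr0 expR0 mulr1; exact: le_trans.
have p0 : 0 < pi / 2 :> R by rewrite divr_gt0// pi_gt0.
pose s := r / 2; have s0 : 0 < s by rewrite divr_gt0.
pose D := (s^-1) ^+ 2 * expR (2 * s * (pi / 2)).
have D0 : 0 < D by rewrite mulr_gt0 ?expR_gt0// exprn_gt0// invr_gt0.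
exists (C * (D / (2 / pi))) => x; apply: (le_trans (h x)); rewrite -mulrA ler_wpM2l//.
apply: (@le_trans _ _ (D / (2 / pi) * (2 / pi / (`|x| + pi / 2) ^+ 2))); last first.
  by rewrite ler_wpM2l ?ker_ge// divr_ge0 ?(ltW D0)// divr_ge0// pi_ge0.
have y0 : 0 < `|x| + pi / 2 by rewrite ltr_wpDl.
rewrite mulrA divfK ?gt_eqF ?divr_gt0 ?pi_gt0// ler_pdivlMr ?exprn_gt0//.
have := @expR_pow_bound R 2 s (`|x| + pi / 2) s0.
rewrite (gtr0_norm y0) mulrDr expRD => H.
rewrite mulrC; apply: (le_trans (ler_wpM2r (expR_ge0 _) H)).
rewrite /D -[X in X <= _]mulrA ler_wpM2l ?exprn_ge0 ?invr_ge0 ?(ltW s0)//.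
rewrite mulrAC -expRD -[X in _ <= X]mul1r ler_wpM2r ?expR_ge0// expR_le1//.
by rewrite /s; have := normr_ge0 x; move: (`|x| : R) => z; nra.
Qed.

End ExponentialDecay.

(** * Rotating the line of integration towards Euler's integral *)

Section ContourKernel.
Context (R : realType).
Notation mu := (@lebesgue_measure R).

(* The real part of [e^(ir) (exp (- w) - 1 + k w)] at [w = y e^(it)]. *)
Definition contour_trig (k r y t : R) : R :=
  expR (- (y * cos t)) * cos (r - y * sin t) - cos r + k * (y * cos (r + t)).

Lemma contour_trig_right (k r y t : R) : 0 <= k -> 0 <= y -> 0 <= cos t ->
  `|contour_trig k r y t| <= 2 + k * y.
Proof.
move=> k0 y0 c0; rewrite /contour_trig.
have e1 : expR (- (y * cos t)) <= 1 by rewrite expR_le1// oppr_le0 mulr_ge0.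
apply: (le_trans (ler_normD _ _)); apply: lerD.
  apply: (le_trans (ler_normB _ _)); have -> : 2 = 1 + 1 :> R by [].
  apply: lerD; last exact: cos_norm.
  by rewrite normrM (ger0_norm (expR_ge0 _)) mulr_ile1 ?expR_ge0// cos_norm.
rewrite normrM (ger0_norm k0) ler_wpM2l// normrM (ger0_norm y0).
by rewrite ler_piMr// cos_norm.
Qed.

Lemma expRN_bound (v : R) : 0 <= v -> `|expR (- v) - 1| <= v.
Proof.
move=> v0; have := expR_ge1Dx (- v); have := @expR_le1 R (- v).
rewrite oppr_le0 => /(_ v0) h1 h2; rewrite ler0_norm; lra.
Qed.

Lemma contour_trig0 (r y t : R) : 0 <= y -> 0 <= cos t ->
  `|contour_trig 0 r y t| <= 2 * y.
Proof.
move=> y0 c0; have yc : 0 <= y * cos t by rewrite mulr_ge0.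
have ycy : y * cos t <= y by rewrite ler_piMr// cos_le1.
have -> : contour_trig 0 r y t = (expR (- (y * cos t)) - 1) * cos (r - y * sin t) +
  (cos (r - y * sin t) - cos r) by rewrite /contour_trig; ring.
apply: (le_trans (ler_normD _ _)); rewrite mulr_natl mulr2n; apply: lerD.
  rewrite normrM -[X in _ <= X]mulr1 ler_pM// ?cos_norm//.
  exact: le_trans (expRN_bound yc) ycy.
apply: (le_trans (cos_lipschitz _ _)).
have -> : r - y * sin t - r = - (y * sin t) by ring.
by rewrite normrN normrM (ger0_norm y0) ler_piMr// sin_norm.
Qed.

(** With k = 1 the linear term of exp (- w) is compensated and a zero of second order remains at w =
    0: the expression splits into four pieces of size at most y^2 each, with bounded trigonometric
    factors. *)
Lemma contour_trig1 (r y t : R) : 0 <= y -> y <= 1 -> 0 <= cos t ->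
  `|contour_trig 1 r y t| <= 8 * y ^+ 2.
Proof.
move=> y0 y1 c0; have yc : 0 <= y * cos t by rewrite mulr_ge0.
have ycy : y * cos t <= y by rewrite ler_piMr// cos_le1.
have ysy : `|y * sin t| <= y by rewrite normrM (ger0_norm y0) ler_piMr// sin_norm.
set v := y * cos t in yc ycy *; set w := y * sin t in ysy *.
have -> : contour_trig 1 r y t =
  cos r * (expR (- v) - 1 + v + expR (- v) * (cos w - 1)) +
  sin r * (expR (- v) * (sin w - w) + (expR (- v) - 1) * w).
  by rewrite /contour_trig cosB cosD /v /w; ring.
have e1 : expR (- v) <= 1 by rewrite expR_le1// oppr_le0.
have e0 := expR_ge0 (- v).
have y2 : 0 <= y ^+ 2 by rewrite sqr_ge0.
have v2 : v ^+ 2 <= y ^+ 2 by rewrite lerXn2r ?nnegrE.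
have w2 : w ^+ 2 <= y ^+ 2 by rewrite -(sqr_abs w) lerXn2r ?nnegrE.
have b1 : `|expR (- v) - 1 + v| <= y ^+ 2.
  have h := expR_ge1Dx (- v); rewrite ger0_norm; last by lra.
  apply: le_trans v2; suff : expR (- v) <= 1 - v + v ^+ 2 by lra.
  rewrite -(@ler_pM2r _ (1 + v)); last by lra.
  apply: (@le_trans _ _ 1).
    by rewrite -[X in _ <= X](expRxMexpNx_1 v) mulrC ler_wpM2r// expR_ge1Dx.
  have v3 : 0 <= v ^+ 3 by rewrite exprn_ge0.
  have -> : (1 - v + v ^+ 2) * (1 + v) = 1 + v ^+ 3 by ring.
  by lra.
have b2 : `|expR (- v) * (cos w - 1)| <= y ^+ 2.
  rewrite normrM (ger0_norm e0) -[X in _ <= X]mul1r ler_pM// distrC.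
  by apply: (le_trans (cosB_norm_le w)); have := sqr_ge0 w; lra.
have b3 : `|expR (- v) * (sin w - w)| <= y ^+ 2.
  rewrite normrM (ger0_norm e0) -[X in _ <= X]mul1r ler_pM//.
  exact: le_trans (sin_taylor2 w) w2.
have b4 : `|(expR (- v) - 1) * w| <= y ^+ 2.
  by rewrite normrM expr2 ler_pM//; exact: le_trans (expRN_bound yc) ycy.
apply: (le_trans (ler_normD _ _)).
have -> : 8 * y ^+ 2 = 4 * y ^+ 2 + 4 * y ^+ 2 :> R by ring.
apply: lerD; rewrite normrM -[X in _ <= X]mul1r ler_pM// ?cos_norm ?sin_norm//.
  by apply: (le_trans (ler_normD _ _)); lra.
by apply: (le_trans (ler_normD _ _)); lra.
Qed.

Variables (a k : R).
Hypothesis a0 : 0 < a.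
Hypothesis k0 : 0 <= k.

(* The real part of [e^(ip) e^(- a z) (exp (- e^z) - 1 + k e^z)] at [z = x + it]. *)
Definition contour_fun (p x t : R) : R :=
  expR (- a * x) * contour_trig k (p - a * t) (expR x) t.

Definition contour_fun_derive (p x t : R) : R :=
  expR (- a * x) * (expR (- (expR x * cos t)) *
    (expR x * sin t * cos (p - a * t - expR x * sin t) +
     (a + expR x * cos t) * sin (p - a * t - expR x * sin t))
   - a * sin (p - a * t) - k * (expR x * ((1 - a) * sin (p - a * t + t)))).

Lemma contour_fun_dt p x t : has_derive (contour_fun p x) t (contour_fun_derive p x t).
Proof.
rewrite /contour_fun /contour_trig; derive_val; rewrite /contour_fun_derive; ring.
Qed.

Lemma contour_fun_shift p x t : contour_fun (p + pi / 2) x t =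
  expR (- a * x) * (- (expR (- (expR x * cos t)) * sin (p - a * t - expR x * sin t))
   + sin (p - a * t) - k * (expR x * sin (p - a * t + t))).
Proof.
rewrite /contour_fun /contour_trig.
have -> : p + pi / 2 - a * t - expR x * sin t = p - a * t - expR x * sin t + pi / 2 by ring.
have -> : p + pi / 2 - a * t + t = p - a * t + t + pi / 2 by ring.
have -> : p + pi / 2 - a * t = p - a * t + pi / 2 by ring.
by rewrite !cosDpihalf; ring.
Qed.

(** Adding pi / 2 to the phase multiplies by i, hence turns the real part into minus the imaginary
    part. The conjugate function [B] that [contour_shift] asks for therefore belongs to the same
    family. *)
Lemma contour_fun_dx p x t :
  has_derive (fun x => contour_fun (p + pi / 2) x t) x (contour_fun_derive p x t).
Proof.
rewrite (_ : (fun x => _) = (fun x => expR (- a * x) *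
   (- (expR (- (expR x * cos t)) * sin (p - a * t - expR x * sin t))
   + sin (p - a * t) - k * (expR x * sin (p - a * t + t))))); last first.
  by apply/funext => z; exact: contour_fun_shift.
derive_val; rewrite /contour_fun_derive; ring.
Qed.

Lemma contour_fun_continuous p t : continuous (fun x => contour_fun p x t).
Proof.
have := @deriv_continuous R (fun x => contour_fun (p - pi / 2 + pi / 2) x t).
rewrite subrK; apply => x; exists (contour_fun_derive (p - pi / 2) x t).
by have := contour_fun_dx (p - pi / 2) x t; rewrite subrK.
Qed.

Lemma contour_fun_derive_continuous p t : continuous (fun x => contour_fun_derive p x t).
Proof.
apply: deriv_continuous => x; rewrite /contour_fun_derive; eexists; by derivs.
Qed.

Lemma contour_fun_derive_bound p (M : R) : exists K : R, forall x t,
  `|x| <= M -> `|t| <= M -> `|contour_fun_derive p x t| <= K.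
Proof.
pose Y := expR M.
exists (expR (a * M) * (expR Y * (Y + (a + Y)) + a + k * (Y * (1 + a)))) => x t xM tM.
have Y0 : 0 <= Y by exact: expR_ge0.
have yY : expR x <= Y by rewrite ler_expR; exact: le_trans (ler_norm _) xM.
have y0 := expR_ge0 x.
have yc (z : R) : `|z| <= 1 -> `|expR x * z| <= Y.
  by move=> z1; rewrite normrM (ger0_norm y0) -[X in _ <= X]mulr1 ler_pM.
have b1 : `|expR (- (expR x * cos t))| <= expR Y.
  rewrite ger0_norm ?expR_ge0// ler_expR; apply: (le_trans (ler_norm _)).
  by rewrite normrN yc// cos_norm.
have bm (u v A B : R) : `|u| <= A -> `|v| <= B -> `|u * v| <= A * B.
  by move=> uA vB; rewrite normrM ler_pM.
have bd (u v A B : R) : `|u| <= A -> `|v| <= B -> `|u + v| <= A + B.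
  by move=> uA vB; apply: (le_trans (ler_normD _ _)); exact: lerD.
have bb (u v A B : R) : `|u| <= A -> `|v| <= B -> `|u - v| <= A + B.
  by move=> uA vB; apply: (le_trans (ler_normB _ _)); exact: lerD.
have b11 (u A : R) (v : R) : `|u| <= A -> `|v| <= 1 -> `|u * v| <= A.
  by move=> uA vB; rewrite -[X in _ <= X]mulr1; exact: bm.
rewrite /contour_fun_derive; apply: (bm _ _ _ _).
  rewrite ger0_norm ?expR_ge0// ler_expR.
  have : - x <= M by rewrite (le_trans _ xM)// -normrN ler_norm.
  by move=> h; rewrite mulNr -mulrN ler_pM2l.
apply: (bb _ _ _ _); first apply: (bb _ _ _ _); first apply: (bm _ _ _ _) => //.
- apply: (bd _ _ _ _); first by apply: (b11 _ _ _); [apply: (yc _); exact: sin_norm|exact: cos_norm].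
  apply: (b11 _ _ _); last exact: sin_norm.
  by apply: (bd _ _ _ _); [rewrite gtr0_norm|apply: (yc _); exact: cos_norm].
- by apply: (b11 _ _ _); [rewrite gtr0_norm|exact: sin_norm].
- apply: (bm _ _ _ _); first by rewrite ger0_norm.
  apply: (bm _ _ _ _); first by rewrite ger0_norm.
  by apply: (b11 _ _ _); [apply: (le_trans (ler_normB _ _)); rewrite normr1 gtr0_norm|exact: sin_norm].
Qed.

End ContourKernel.

Section ContourIntegrals.
Context (R : realType).
Notation mu := (@lebesgue_measure R).
Implicit Types (a k p x t : R).

Lemma contour_fun_pihalf a k p x : contour_fun a k p x (pi / 2) = expR (- a * x) *
  (cos (p - a * (pi / 2) - expR x) - cos (p - a * (pi / 2)) -
   k * (expR x * sin (p - a * (pi / 2)))).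
Proof.
rewrite /contour_fun /contour_trig cos_pihalf sin_pihalf cosDpihalf mulr0 oppr0 expR0 mulr1.
ring.
Qed.

Lemma contour_fun0 a k p x : contour_fun a k p x 0 =
  cos p * (expR (- a * x) * (expR (- expR x) - 1 + k * expR x)).
Proof.
rewrite /contour_fun /contour_trig cos0 sin0 !mulr0 !subr0 addr0 mulr1; ring.
Qed.

Lemma contour_fun_right0 a p x t : 0 <= cos t ->
  `|contour_fun a 0 p x t| <= 2 * expR (- a * x).
Proof.
move=> c0; rewrite /contour_fun normrM (ger0_norm (expR_ge0 _)) mulrC ler_wpM2r ?expR_ge0//.
have := contour_trig_right (p - a * t) (lexx 0) (expR_ge0 x) c0.
by rewrite mul0r addr0.
Qed.

Lemma contour_fun_right1 a p x t : 0 <= x -> 0 <= cos t ->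
  `|contour_fun a 1 p x t| <= 3 * expR ((1 - a) * x).
Proof.
move=> x0 c0; rewrite /contour_fun normrM (ger0_norm (expR_ge0 _)).
have h := contour_trig_right (p - a * t) ler01 (expR_ge0 x) c0.
apply: (le_trans (ler_wpM2l (expR_ge0 _) h)).
have -> : (1 - a) * x = - a * x + x by ring.
rewrite expRD mulrCA ler_wpM2l ?expR_ge0//.
have e1 : 1 <= expR x by rewrite -expR0 ler_expR.
lra.
Qed.

Lemma contour_fun_left0 a p x t : 0 <= cos t ->
  `|contour_fun a 0 p x t| <= 2 * expR ((1 - a) * x).
Proof.
move=> c0; rewrite /contour_fun normrM (ger0_norm (expR_ge0 _)).
have h := contour_trig0 (p - a * t) (expR_ge0 x) c0.
apply: (le_trans (ler_wpM2l (expR_ge0 _) h)).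
have -> : (1 - a) * x = - a * x + x by ring.
by rewrite expRD mulrCA.
Qed.

Lemma contour_fun_left1 a p x t : x <= 0 -> 0 <= cos t ->
  `|contour_fun a 1 p x t| <= 8 * expR ((2 - a) * x).
Proof.
move=> x0 c0; rewrite /contour_fun normrM (ger0_norm (expR_ge0 _)).
have h := contour_trig1 (p - a * t) (expR_ge0 x) (expR_le1 x0) c0.
apply: (le_trans (ler_wpM2l (expR_ge0 _) h)).
have -> : (2 - a) * x = - a * x + (x + x) by ring.
by rewrite !expRD mulrCA expr2.
Qed.

Lemma cos_pihalf_ge0 t : 0 <= t <= pi / 2 -> 0 <= cos t.
Proof.
move=> /andP[t0 t1]; apply: cos_ge0_pihalf; rewrite t1 andbT (le_trans _ t0)// oppr_le0.
by rewrite divr_ge0// pi_ge0.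
Qed.

Let h2 : 0 <= pi / 2 :> R. Proof. by rewrite divr_ge0// pi_ge0. Qed.

(** Between the heights 0 and pi / 2 the cosine is nonnegative, so exp (- e^z) stays bounded and the
    boundary terms vanish uniformly. The oscillating integrand on the upper line is thus exchanged
    for a real exponential one on the lower line. *)
Lemma contour_decay a k (C r1 r2 : R) : 0 < a -> 0 <= k -> 0 < r1 -> 0 < r2 ->
  (forall p x t, x <= 0 -> 0 <= cos t -> `|contour_fun a k p x t| <= C * expR (r1 * x)) ->
  (forall p x t, 0 <= x -> 0 <= cos t -> `|contour_fun a k p x t| <= C * expR (- r2 * x)) ->
  forall p, intble mu (fun x => contour_fun a k p x (pi / 2)) /\
    \int[mu]_x contour_fun a k p x (pi / 2) =
    cos p * \int[mu]_x (expR (- a * x) * (expR (- expR x) - 1 + k * expR x)).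
Proof.
move=> a0 k0 r10 r20 hl hr p.
have i t q : 0 <= cos t -> intble mu (fun x => contour_fun a k q x t).
  move=> c0; apply: exp_decay_intble.
    exact: continuous_measurable_fun (@contour_fun_continuous R _ _ _ _).
  by apply: (exp_decay_intro r10 r20) => x x0; [exact: hl|exact: hr].
have i1 := i (pi / 2) p; rewrite cos_pihalf lexx in i1; have {}i1 := i1 isT.
have i2 := i 0 p; rewrite cos0 ler01 in i2; have {}i2 := i2 isT.
have i3 : intble mu (fun x => expR (- a * x) * (expR (- expR x) - 1 + k * expR x)).
  have := i 0 0; rewrite cos0 ler01 => /(_ isT).
  by congr intble; apply/funext => x; rewrite contour_fun0 cos0 mul1r.
split=> //.
have := @contour_shift R (contour_fun a k p) (contour_fun a k (p + pi / 2))
  (contour_fun_derive a k p) 0 (pi / 2) (contour_fun_dt a k p) (contour_fun_dx a k p)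
  (@contour_fun_continuous R a k p) (@contour_fun_derive_continuous R a k p)
  (contour_fun_derive_bound a0 k0 p) h2.
have hB (e : R) : 0 < e -> \forall n \near \oo, forall t, 0 <= t <= pi / 2 ->
    `|contour_fun a k (p + pi / 2) n%:R t - contour_fun a k (p + pi / 2) (- n%:R) t - 0| <= e.
  move=> e0; have c1 : C * (expR (- (r2 * n%:R)) + expR (- (r1 * n%:R))) @[n --> \oo] --> (0 : R).
    rewrite -(mulr0 C) -[X in C * X](addr0 0); apply: cvgMl_tmp.
    by apply: cvgD; exact: expR_nat_cvg0.
  move/cvgr0Pnorm_le : c1 => /(_ e e0); apply: filterS => n /(le_trans (ler_norm _)) h t ht.
  have c0 := cos_pihalf_ge0 ht; rewrite subr0; apply: le_trans h.
  apply: (le_trans (ler_normB _ _)); rewrite mulrDr -mulNr; apply: lerD; first exact: hr.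
  by rewrite -mulrN; apply: hl => //; rewrite oppr_le0.
move=> /(_ hB (intbleB i1 i2)); rewrite mul0r RintB// => /eqP; rewrite subr_eq0 => /eqP ->.
by under eq_Rint do rewrite contour_fun0; rewrite RintZ.
Qed.

Lemma contour_small a p : 0 < a -> a < 1 ->
  intble mu (fun x => contour_fun a 0 p x (pi / 2)) /\
  \int[mu]_x contour_fun a 0 p x (pi / 2) =
  cos p * \int[mu]_x (expR (- a * x) * (expR (- expR x) - 1)).
Proof.
move=> a0 a1.
have [|||i e] := @contour_decay a 0 2 (1 - a) a a0 (lexx 0) _ a0 _ _ p.
- by rewrite subr_gt0.
- by move=> q x t _; exact: contour_fun_left0.
- by move=> q x t _; exact: contour_fun_right0.
split=> //; rewrite e; congr (_ * _); apply: eq_Rint => x.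
by rewrite mul0r addr0.
Qed.

Lemma contour_large a p : 1 < a -> a < 2 ->
  intble mu (fun x => contour_fun a 1 p x (pi / 2)) /\
  \int[mu]_x contour_fun a 1 p x (pi / 2) =
  cos p * \int[mu]_x (expR (- a * x) * (expR (- expR x) - 1 + expR x)).
Proof.
move=> a1 a2; have a0 : 0 < a by lra.
have [||||i e] := @contour_decay a 1 8 (2 - a) (a - 1) a0 ler01 _ _ _ _ p.
- by rewrite subr_gt0.
- by rewrite subr_gt0.
- by move=> q x t; exact: contour_fun_left1.
- move=> q x t x0 c0; apply: (le_trans (contour_fun_right1 a q x0 c0)).
  by rewrite opprB ler_wpM2r ?expR_ge0// ler_nat.
split=> //; rewrite e; congr (_ * _); apply: eq_Rint => x.
by rewrite mul1r.
Qed.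

Lemma contour_fun_one p x t : contour_fun 1 0 p x t = contour_fun 1 1 p x t - cos p.
Proof.
rewrite /contour_fun /contour_trig !mul0r addr0 !mul1r subrK.
have -> : expR (-1 * x) * (expR (- (expR x * cos t)) * cos (p - t - expR x * sin t) - cos (p - t) +
   expR x * cos p) = expR (-1 * x) * (expR (- (expR x * cos t)) * cos (p - t - expR x * sin t) - cos (p - t))
   + expR (-1 * x) * expR x * cos p by ring.
have -> : expR (-1 * x) * expR x = 1 by rewrite mulN1r mulrC expRxMexpNx_1.
by rewrite mul1r addrK.
Qed.

(** At exponent 1 the integrand with k = 0 tends to - cos p at minus infinity, by [contour_fun_one].
    The conjugate function then leaves the boundary value l = cos (p + pi / 2) = - sin p, which is
    multiplied by the height pi / 2; this is the source of pi / 2 in the exponent for alpha = 1. *)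
Lemma contour_one p :
  intble mu (fun x => contour_fun 1 0 p x (pi / 2) - contour_fun 1 0 p x 0) /\
  \int[mu]_x (contour_fun 1 0 p x (pi / 2) - contour_fun 1 0 p x 0) = - (sin p * (pi / 2)).
Proof.
have e21 : 2 - 1 = 1 :> R by ring.
have c1 : 0 <= cos (pi / 2) :> R by rewrite cos_pihalf.
have c2 : 0 <= cos 0 :> R by rewrite cos0.
have i : intble mu (fun x => contour_fun 1 0 p x (pi / 2) - contour_fun 1 0 p x 0).
  apply: exp_decay_intble.
    by apply: measurable_funB; exact: continuous_measurable_fun (@contour_fun_continuous R _ _ _ _).
  apply: (@exp_decay_intro _ _ 16 1 1) => // x x0.
    rewrite !contour_fun_one; have -> (u v w : R) : u - w - (v - w) = u - v by ring.
    apply: (le_trans (ler_normB _ _)).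
    have := contour_fun_left1 1 p x0 c1; have := contour_fun_left1 1 p x0 c2.
    by rewrite e21; lra.
  apply: (le_trans (ler_normB _ _)).
  have := contour_fun_right0 1 p x c1; have := contour_fun_right0 1 p x c2.
  by have := expR_ge0 (- 1 * x); lra.
split=> //.
have := @contour_shift R (contour_fun 1 0 p) (contour_fun 1 0 (p + pi / 2))
  (contour_fun_derive 1 0 p) (cos (p + pi / 2)) (pi / 2) (contour_fun_dt 1 0 p) (contour_fun_dx 1 0 p)
  (@contour_fun_continuous R 1 0 p) (@contour_fun_derive_continuous R 1 0 p)
  (contour_fun_derive_bound ltr01 (lexx 0) p) h2.
have hB (e : R) : 0 < e -> \forall n \near \oo, forall t, 0 <= t <= pi / 2 ->
    `|contour_fun 1 0 (p + pi / 2) n%:R t - contour_fun 1 0 (p + pi / 2) (- n%:R) t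
      - cos (p + pi / 2)| <= e.
  (* 10 = 2 + 8, from the bound on the right for k = 0 and the bound on the left for k = 1. *)
  move=> e0; have c3 : 10 * expR (- (1 * n%:R)) @[n --> \oo] --> (0 : R).
    by rewrite -(mulr0 10); apply: cvgMl_tmp; exact: expR_nat_cvg0.
  move/cvgr0Pnorm_le : c3 => /(_ e e0); apply: filterS => n /(le_trans (ler_norm _)) h t ht.
  have c0 := cos_pihalf_ge0 ht; apply: le_trans h; set q := p + pi / 2.
  rewrite (contour_fun_one q (- n%:R)).
  have -> (u v w : R) : u - (v - w) - w = u - v by ring.
  apply: (le_trans (ler_normB _ _)).
  have n0 : - n%:R <= 0 :> R by rewrite oppr_le0.
  have := contour_fun_left1 1 q n0 c0; have := contour_fun_right0 1 q n%:R c0.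
  by rewrite e21 mulN1r !mul1r; lra.
by move=> /(_ hB i) ->; rewrite cosDpihalf mulNr.
Qed.

End ContourIntegrals.

(** * Gamma integrals on the whole line *)

Section GammaLine.
Context (R : realType).
Notation mu := (@lebesgue_measure R).
Implicit Types (a s x : R).

Lemma exp_decay_cvg (F : R -> R) : exp_decay F ->
  F n%:R @[n --> \oo] --> (0 : R) /\ F (- n%:R) @[n --> \oo] --> (0 : R).
Proof.
move=> [C [r [r0 h]]].
have c1 : C * expR (- (r * n%:R)) @[n --> \oo] --> (0 : R).
  by rewrite -(mulr0 C); apply: cvgMl_tmp; exact: expR_nat_cvg0.
by split; apply/norm_cvg0P; apply: (squeeze_cvgr _ (cvg_cst (0 : R)) c1); apply: nearW => n;
  rewrite normr_ge0/= (le_trans (h _))// ?normrN ger0_norm// mulNr.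
Qed.

Lemma Rint_derive_decay (F f : R -> R) : (forall x, has_derive F x (f x)) ->
  continuous f -> exp_decay F -> intble mu f -> \int[mu]_x f x = 0.
Proof.
move=> dF cf hF hf; have [h1 h2] := exp_decay_cvg hF.
by rewrite (Rint_derive_line dF cf hf h2 h1) subrr.
Qed.

Lemma expexp_bound x : expR (- expR x) <= 4 * expR (- 2 * x).
Proof.
have h := @expR_pow_bound R 2 (2^-1) (expR x); have := h ltac:(by rewrite invr_gt0).
rewrite invrK mulfV ?mul1r// (ger0_norm (expR_ge0 _)) => {}h.
have -> : 4 = 2 ^+ 2 :> R by rewrite expr2; ring.
have -> : expR (- 2 * x) = (expR x ^+ 2)^-1.
  by rewrite mulNr expRN -expRM_natl.
rewrite ler_pdivlMr ?exprn_gt0 ?expR_gt0// expRN mulrC ler_pdivrMr ?expR_gt0//.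
Qed.

Lemma gamma_line_decay s : 0 < s -> s <= 1 -> exp_decay (fun x => expR (s * x) * expR (- expR x)).
Proof.
move=> s0 s1; apply: (@exp_decay_intro _ _ 4 s 1) => // x x0.
  rewrite ger0_norm ?mulr_ge0 ?expR_ge0// mulrC ler_wpM2r ?expR_ge0//.
  by rewrite (@le_trans _ _ 1)// ?ler1n// expR_le1// oppr_le0 expR_ge0.
rewrite ger0_norm ?mulr_ge0 ?expR_ge0//.
apply: (le_trans (ler_wpM2l (expR_ge0 _) (expexp_bound x))).
by rewrite mulrCA -expRD ler_wpM2l// ler_expR; nra.
Qed.

Lemma expexp_continuous : continuous (fun x => expR (- expR x)).
Proof. by apply: deriv_continuous => x; eexists; derivs. Qed.

Lemma expM_continuous s : continuous (fun x => expR (s * x)).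
Proof. by apply: deriv_continuous => x; eexists; derivs. Qed.

Lemma gamma_line_continuous s : continuous (fun x => expR (s * x) * expR (- expR x)).
Proof. by move=> x; apply: cvgM; [exact: expM_continuous|exact: expexp_continuous]. Qed.

Lemma gamma_line_intble s : 0 < s -> s <= 1 -> intble mu (fun x => expR (s * x) * expR (- expR x)).
Proof.
move=> s0 s1; apply: exp_decay_intble; last exact: gamma_line_decay.
exact: continuous_measurable_fun (@gamma_line_continuous s).
Qed.

(** The substitution y = e^x is made on [-n, n], away from the possible singularity at y = 0, and
    monotone convergence exhausts the half-line. The range s <= 1 is where the bound e^(- e^x) <= 4
    e^(- 2x) gives decay at rate 1 on the right. *)
Lemma gamma_line s : 0 < s -> s <= 1 ->
  gamma_integral s = \int[mu]_x (expR (s * x) * expR (- expR x)).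
Proof.
move=> s0 s1; rewrite /gamma_integral.
pose g (y : R) := y `^ (s - 1) * expR (- y).
pose I (n : nat) : set R := `[expR (- n%:R), expR n%:R]%classic.
have cg (y : R) : 0 < y -> {for y, continuous g}.
  move=> y0; apply: cvgM; last by apply: continuous_comp; [exact: opp_continuous|exact: continuous_expR].
  have : {for y, continuous (fun x : R => x `^ (s - 1))}.
    apply: differentiable_continuous; apply/derivable1_diffP.
    by apply: derivable_powR; rewrite in_itv/= andbT.
  exact.
have cI n : {within I n, continuous g}.
  apply: continuous_in_subspaceT => y; rewrite inE /I /= in_itv/= => /andP[h _].
  by apply: cg; exact: lt_le_trans h.
have nn (n : nat) : - n%:R <= n%:R :> R by rewrite (@le_trans _ _ 0)// oppr_le0.
have dE : derive1 (@expR R) = @expR R by apply/funext => x; rewrite derive1E; have [_ ->] := is_derive_expR x.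
have sub n : \int[mu]_(y in I n) g y = \int[mu]_(x in `[- n%:R, n%:R]) (expR (s * x) * expR (- expR x)).
  rewrite /Rintegral /I; congr fine.
  rewrite (@integration_by_substitution_increasing _ expR g _ _ (nn n)).
  - apply: eq_integral => x _; congr EFin.
    rewrite dE; change (expR (x : R) `^ (s - 1) * expR (- expR x) * expR x = expR (s * x) * expR (- expR x)).
    have -> : s * x = x * (s - 1) + x by ring.
    by rewrite -expRM expRD; ring.
  - by move=> x y _ _ xy; rewrite ltr_expR.
  - move=> x _; rewrite dE; exact: continuous_expR.
  - rewrite dE; apply/cvg_ex; exists (expR (- n%:R)).
    exact/cvg_at_right_filter/continuous_expR.
  - rewrite dE; apply/cvg_ex; exists (expR (n%:R)).
    exact/cvg_at_left_filter/continuous_expR.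
  - split; [by move=> x _; exact: derivable_expR|exact/cvg_at_right_filter/continuous_expR|
      exact/cvg_at_left_filter/continuous_expR].
  - exact: cI.
rewrite Rintegral_mkcond.
have g0 y : 0 <= g y by rewrite mulr_ge0 ?powR_ge0 ?expR_ge0.
have [] // := @Rint_monotone _ _ _ mu (fun n => g \_ (I n)) (g \_ `]0, +oo[%classic)
   (\int[mu]_x (expR (s * x) * expR (- expR x))).
- move=> n; have ii : mu.-integrable (I n) (EFin \o g).
    by apply: continuous_compact_integrable; [exact: segment_compact|exact: cI].
  have /integrable_mkcond := ii => /(_ _) H.
  have : mu.-integrable setT ((EFin \o g) \_ (I n)) by apply: H; exact: measurable_itv.
  congr (_.-integrable _ _); apply/funext => x.
  by rewrite /= !patchE; case: ifP.
- by move=> n x; rewrite patchE; case: ifP.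
- move=> x n k nk; rewrite !patchE /I; case: ifP => [|_]; last by case: ifP.
  rewrite inE/= in_itv/= => /andP[h1 h2]; rewrite mem_set//= in_itv/=.
  apply/andP; split.
    by apply: le_trans h1; rewrite ler_expR lerN2 ler_nat.
  by apply: (le_trans h2); rewrite ler_expR ler_nat.
- move=> x; have [x0|x0] := ltP 0 x; last first.
    apply: cvg_near_cst; apply: nearW => n.
    rewrite !patchE /I !memNset//=; first by rewrite in_itv/= andbT => h; lra.
    by rewrite in_itv/= => /andP[h _]; have := expR_gt0 (- n%:R : R); lra.
  apply: cvg_near_cst; near=> n.
  have h : `|ln x| <= n%:R by near: n; exact: nbhs_infty_ger.
  rewrite !patchE /I !mem_set//= in_itv/= ?x0//.
  move: h; rewrite ler_norml => /andP[h1 h2].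
  by rewrite -(@lnK _ x) ?posrE// !ler_expR h1 h2.
- have := Rint_line_cvg (gamma_line_intble s0 s1); apply: cvg_ext => n.
  by rewrite -Rintegral_mkcond sub.
Unshelve. all: by end_near. Qed.

Lemma expRN1_le (y : R) : 0 <= y -> `|expR (- y) - 1| <= 1.
Proof.
move=> y0; have := expR_gt0 (- y); have : expR (- y) <= 1 by rewrite expR_le1// oppr_le0.
by move=> h1 h2; rewrite ler_norml; lra.
Qed.

Lemma expRN_taylor (y : R) : 0 <= y -> `|expR (- y) - 1 + y| <= y /\ `|expR (- y) - 1 + y| <= y ^+ 2.
Proof.
move=> y0; have h := expR_ge1Dx (- y).
have h1 : expR (- y) <= 1 by rewrite expR_le1// oppr_le0.
rewrite ger0_norm; last by lra.
split; first by lra.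
suff : expR (- y) <= 1 - y + y ^+ 2 by lra.
rewrite -(@ler_pM2r _ (1 + y)); last by lra.
apply: (@le_trans _ _ 1).
  by rewrite -[X in _ <= X](expRxMexpNx_1 y) mulrC ler_wpM2r ?expR_ge0// expR_ge1Dx.
have v3 : 0 <= y ^+ 3 by rewrite exprn_ge0.
have -> : (1 - y + y ^+ 2) * (1 + y) = 1 + y ^+ 3 by ring.
by lra.
Qed.

Lemma small_decay a : 0 < a -> a < 1 -> exp_decay (fun x => expR (- a * x) * (expR (- expR x) - 1)).
Proof.
move=> a0 a1; apply: (@exp_decay_intro _ _ 1 (1 - a) a) => //; first by rewrite subr_gt0.
  move=> x _; rewrite mul1r normrM (ger0_norm (expR_ge0 _)).
  apply: (le_trans (ler_wpM2l (expR_ge0 _) (expRN_bound (expR_ge0 x)))).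
  by rewrite -expRD ler_expR; lra.
move=> x _; rewrite mulrC normrM (ger0_norm (expR_ge0 _)) ler_wpM2r ?expR_ge0//.
exact: expRN1_le (expR_ge0 x).
Qed.

Lemma small_continuous a : continuous (fun x => expR (- a * x) * (expR (- expR x) - 1)).
Proof.
move=> x; apply: cvgM; first exact: expM_continuous.
by apply: cvgB; [exact: expexp_continuous|exact: cvg_cst].
Qed.

Lemma small_intble a : 0 < a -> a < 1 ->
  intble mu (fun x => expR (- a * x) * (expR (- expR x) - 1)).
Proof.
move=> a0 a1; apply: exp_decay_intble; last exact: small_decay.
exact: continuous_measurable_fun (@small_continuous a).
Qed.

(** Integration by parts: the derivative of - e^(- a x) (e^(- e^x) - 1) is a times the integrand
    plus the Gamma integrand at 1 - a, and the differentiated function vanishes at both ends. *)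
Lemma gamma_small a : 0 < a -> a < 1 ->
  a * \int[mu]_x (expR (- a * x) * (expR (- expR x) - 1)) = - gamma_integral (1 - a).
Proof.
move=> a0 a1; have s0 : 0 < 1 - a by lra.
have s1 : 1 - a <= 1 by lra.
have i1 := small_intble a0 a1; have i2 := gamma_line_intble s0 s1.
have e : \int[mu]_x (a * (expR (- a * x) * (expR (- expR x) - 1)) +
     expR ((1 - a) * x) * expR (- expR x)) = 0.
  apply: (@Rint_derive_decay (fun x => - (expR (- a * x) * (expR (- expR x) - 1)))).
  - move=> x; derive_val.
    have -> : (1 - a) * x = - a * x + x by ring.
    by rewrite expRD; ring.
  - move=> x; apply: cvgD; last exact: gamma_line_continuous.
    by apply: cvgMl_tmp; exact: small_continuous.
  - have [C [r [r0 h]]] := small_decay a0 a1.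
    by exists C, r; split=> // x; rewrite normrN.
  - by apply: intbleD => //; exact: intbleZ.
move: e; rewrite RintD ?RintZ ?gamma_line//; last exact: intbleZ.
lra.
Qed.

(** The same integration by parts lowers the exponent from a to a - 1, which lies in ]0, 1[ and is
    covered by [gamma_small]. Dividing by 1 - a matches the functional equation of Gamma. *)
Lemma gamma_large a : 1 < a -> a < 2 ->
  a * \int[mu]_x (expR (- a * x) * (expR (- expR x) - 1 + expR x)) =
  - (gamma_integral (2 - a) / (1 - a)).
Proof.
move=> a1 a2; have b0 : 0 < a - 1 by lra.
have b1 : a - 1 < 1 by lra.
have i2 := small_intble b0 b1; have g := gamma_small b0 b1.
have c : continuous (fun x => expR (- a * x) * (expR (- expR x) - 1 + expR x)).
  move=> x; apply: cvgM; first exact: expM_continuous.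
  apply: cvgD; last exact: continuous_expR.
  by apply: cvgB; [exact: expexp_continuous|exact: cvg_cst].
have dd : exp_decay (fun x => expR (- a * x) * (expR (- expR x) - 1 + expR x)).
  apply: (@exp_decay_intro _ _ 1 (2 - a) (a - 1)) => //; first by rewrite subr_gt0.
    move=> x _; rewrite mul1r normrM (ger0_norm (expR_ge0 _)).
    have [_ h] := expRN_taylor (expR_ge0 x).
    apply: (le_trans (ler_wpM2l (expR_ge0 _) h)).
    by rewrite expr2 -!expRD ler_expR; lra.
  move=> x _; rewrite mul1r normrM (ger0_norm (expR_ge0 _)).
  have [h _] := expRN_taylor (expR_ge0 x).
  apply: (le_trans (ler_wpM2l (expR_ge0 _) h)).
  by rewrite -!expRD ler_expR; lra.
have i1 : intble mu (fun x => expR (- a * x) * (expR (- expR x) - 1 + expR x)).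
  by apply: exp_decay_intble => //; exact: continuous_measurable_fun.
have e : \int[mu]_x (a * (expR (- a * x) * (expR (- expR x) - 1 + expR x)) +
     expR (- (a - 1) * x) * (expR (- expR x) - 1)) = 0.
  apply: (@Rint_derive_decay (fun x => - (expR (- a * x) * (expR (- expR x) - 1 + expR x)))).
  - move=> x; derive_val.
    have -> : - (a - 1) * x = - a * x + x by ring.
    by rewrite expRD; ring.
  - move=> x; apply: cvgD; last exact: small_continuous.
    by apply: cvgMl_tmp; exact: c.
  - have [C [r [r0 h]]] := dd.
    by exists C, r; split=> // x; rewrite normrN.
  - by apply: intbleD => //; exact: intbleZ.
move: e; rewrite RintD ?RintZ//; last exact: intbleZ.
move/eqP; rewrite addr_eq0 => /eqP ->.
have -> : 2 - a = 1 - (a - 1) by ring.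
have -> : gamma_integral (1 - (a - 1)) = - ((a - 1) * \int[mu]_x (expR (- (a - 1) * x) * (expR (- expR x) - 1))).
  by rewrite g opprK.
have n0 : 1 - a != 0 by rewrite lt_eqF//; lra.
by move: (\int[mu]_x _) => J; field.
Qed.

Lemma Gamma_small a : 0 < a -> a < 1 -> Gamma (1 - a) = gamma_integral (1 - a).
Proof.
by move=> a0 a1; rewrite /Gamma subr_gt0 a1 big_ord0 divr1 addr0.
Qed.

Lemma Gamma_large a : 1 < a -> a < 2 -> Gamma (1 - a) = gamma_integral (2 - a) / (1 - a).
Proof.
move=> a1 a2; rewrite /Gamma.
have -> : 0 < 1 - a = false by apply/negbTE; rewrite -leNgt; lra.
(* Since 0 < a - 1 < 1, exactly one step of the functional equation is taken: m = 1. *)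
have -> : Num.truncn (- (1 - a)) = 0%N.
  by apply/truncn0Pn; rewrite -ltNge; lra.
rewrite big_ord_recl big_ord0 mulr1 addr0.
by have -> : 1 - a + 1%:R = 2 - a by ring.
Qed.

End GammaLine.

(** * Euler's constant as an integral over the line *)

Section EulerConstant.
Context (R : realType).
Notation mu := (@lebesgue_measure R).
Implicit Types (a x y z : R).

Lemma deriv_pow (f : R -> R) x a n : has_derive f x a ->
  has_derive (fun y => f y ^+ n.+1) x (n.+1%:R * f x ^+ n * a).
Proof.
move=> hf; elim: n => [|n IH].
  by apply: has_derive_val hf _; rewrite expr0 !mul1r.
apply: has_derive_val; first exact: (derivM hf IH).
by rewrite /= -[in RHS]natr1 exprS; ring.
Qed.

Definition neg x : R := \1_(`]-oo, 0]%classic : set R) x.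

Lemma negE x : neg x = ((x <= 0)%R)%:R.
Proof. by rewrite /neg indicE mem_setE in_itv. Qed.

Lemma neg_measurable : measurable_fun setT neg.
Proof. exact: measurable_indic. Qed.

(** This is how logarithms arise from translations: moving the step by ln n gives the logarithm in
    Euler's constant, and moving it by ln u gives the term |u| log |u| of the exponent for alpha =
    1. *)
Lemma Rint_step a : intble mu (fun x => neg (x - a) - neg x) /\
  \int[mu]_x (neg (x - a) - neg x) = a.
Proof.
wlog a0 : a / 0 <= a => [H|].
  have [/H//|/ltW a0] := leP 0 a.
  have [i e] := H (- a) ltac:(by rewrite oppr_ge0).
  have [i1 e1] := Rint_shift (- a) (intbleN i).
  have E x : - (neg (x + - a - - a) - neg (x + - a)) = neg (x - a) - neg x.
    by rewrite opprK subrK opprB.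
  split; first by have := i1; congr intble; apply/funext => x; exact: E.
  have -> : \int[mu]_x (neg (x - a) - neg x) = \int[mu]_x - (neg (x + - a - - a) - neg (x + - a)).
    by apply: eq_Rint => x; rewrite E.
  by rewrite e1 RintN// e opprK.
have E x : neg (x - a) - neg x = \1_(`]0, a]%classic : set R) x.
  rewrite !negE indicE mem_setE in_itv/= subr_le0.
  have [x0|x0] := leP x 0; first by rewrite (le_trans x0 a0) subrr.
  by rewrite subr0.
have mI : measurable (`]0, a]%classic : set R) by [].
have IE : (\int[mu]_x (\1_(`]0, a]%classic : set R) x)%:E = a%:E)%E.
  rewrite integral_indic// setIT; transitivity (mu [set` `]0, a]]); first by [].
  rewrite lebesgue_measure_itv/= lte_fin.
  by have [|] := ltP 0 a; [rewrite -EFinB subr0|move=> h; congr EFin; apply/le_anti; rewrite a0 h].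
have i : intble mu (\1_(`]0, a]%classic : set R)).
  apply/integrableP; split; first by apply/measurable_EFinP; exact: measurable_indic.
  rewrite (_ : (\int[mu]_x _)%E = a%:E) ?ltry// -IE.
  by apply: eq_integral => x _ /=; rewrite ger0_norm.
split; first by have := i; congr intble; apply/funext => x; rewrite E.
by under eq_Rint do rewrite E; rewrite /Rintegral IE.
Qed.

Lemma Rint_half_line (F h : R -> R) (l : R) : (forall x, has_derive F x (h x)) ->
  continuous h -> intble mu (fun x => neg x * h x) -> F (- n%:R) @[n --> \oo] --> l ->
  \int[mu]_x (neg x * h x) = F 0 - l.
Proof.
move=> dF ch ih cF; have H := Rint_line_cvg ih.
have E (n : nat) : \int[mu]_(x in `[- n%:R, n%:R]) (neg x * h x) = F 0 - F (- n%:R).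
  have n0 : - n%:R <= 0 :> R by rewrite oppr_le0.
  rewrite -(FTC_derive n0 dF ch) Rintegral_mkcond [RHS]Rintegral_mkcond.
  apply: eq_Rint => x; rewrite !patchE !mem_setE !in_itv/= negE.
  have nn : 0 <= n%:R :> R by [].
  have [x0|x0] := leP x 0; last by rewrite andbF mul0r; case: ifP.
  by rewrite (le_trans x0 nn) mul1r.
have H2 : F 0 - F (- n%:R) @[n --> \oo] --> F 0 - l by apply: cvgB => //; exact: cvg_cst.
have {}H : F 0 - F (- n%:R) @[n --> \oo] --> \int[mu]_x (neg x * h x).
  by apply: cvg_ext H => n; rewrite E.
by rewrite -(cvg_lim _ H)// (cvg_lim _ H2).
Qed.

Lemma bernoulli (v : R) n : 0 <= v -> v <= 1 -> 1 - n%:R * v <= (1 - v) ^+ n.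
Proof.
move=> v0 v1; elim: n => [|n IH]; first by rewrite mul0r subr0 expr0.
rewrite exprS -natr1; have n0 : 0 <= n%:R :> R by [].
have v1' : 0 <= 1 - v by lra.
apply: (le_trans _ (ler_wpM2l v1' IH)); nra.
Qed.

Lemma pow_exp_le (y : R) (n : nat) : y <= n.+1%:R -> (1 - y / n.+1%:R) ^+ n.+1 <= expR (- y).
Proof.
move=> yn; have -> : expR (- y) = expR (- (y / n.+1%:R)) ^+ n.+1.
  by rewrite -expRM_natl; congr expR; field.
apply: lerXn2r; rewrite ?nnegrE ?expR_ge0//; last exact: expR_ge1Dx.
by rewrite subr_ge0 ler_pdivrMr// mul1r.
Qed.

(** From (1 + v)(1 - v) <= e^v (1 - v), raised to the power n + 1, with Bernoulli's inequality for
    the left-hand side. *)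
Lemma pow_exp_ge (y : R) (n : nat) : 0 <= y -> y <= n.+1%:R ->
  expR (- y) * (1 - y ^+ 2 / n.+1%:R) <= (1 - y / n.+1%:R) ^+ n.+1.
Proof.
move=> y0 yn; set v := y / n.+1%:R.
have v0 : 0 <= v by rewrite divr_ge0.
have v1 : v <= 1 by rewrite ler_pdivrMr// mul1r.
have yE : y = n.+1%:R * v by rewrite /v mulrC divfK.
have h : (1 - v ^+ 2) ^+ n.+1 <= (expR v * (1 - v)) ^+ n.+1.
  apply: lerXn2r; rewrite ?nnegrE ?mulr_ge0 ?expR_ge0 ?subr_ge0 ?expr_le1//.
  have -> : 1 - v ^+ 2 = (1 + v) * (1 - v) by ring.
  by rewrite ler_wpM2r ?subr_ge0// expR_ge1Dx.
have h2 : 1 - n.+1%:R * v ^+ 2 <= (1 - v ^+ 2) ^+ n.+1.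
  by apply: bernoulli; rewrite ?sqr_ge0// expr_le1.
have -> : 1 - y ^+ 2 / n.+1%:R = 1 - n.+1%:R * v ^+ 2.
  rewrite yE; have : n.+1%:R != 0 :> R by []. 
  by move: (n.+1%:R : R) => q q0; field.
have H : 1 - n.+1%:R * v ^+ 2 <= expR y * (1 - v) ^+ n.+1.
  have -> : expR y = expR v ^+ n.+1 by rewrite -expRM_natl -yE.
  by rewrite -exprMn; exact: le_trans h2 h.
rewrite -(@ler_pM2l _ (expR y)) ?expR_gt0// mulrA expRxMexpNx_1 mul1r.
exact: H.
Qed.

Lemma pow_exp_cvg (y : R) : 0 <= y ->
  (1 - y / n.+1%:R) ^+ n.+1 @[n --> \oo] --> expR (- y).
Proof.
move=> y0.
have c1 : expR (- y) * (1 - y ^+ 2 * n.+1%:R^-1) @[n --> \oo] --> expR (- y).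
  have : expR (- y) * (1 - y ^+ 2 * n.+1%:R^-1) @[n --> \oo] --> expR (- y) * (1 - y ^+ 2 * 0).
    apply: cvgMl_tmp; apply: cvgB; first exact: cvg_cst.
    by apply: cvgMl_tmp; exact: cvg_harmonic.
  by rewrite mulr0 subr0 mulr1.
apply: (squeeze_cvgr _ c1 (cvg_cst (expR (- y)))).
near=> n; have yn : y <= n.+1%:R.
  apply: (@le_trans _ _ n%:R); last by rewrite ler_nat.
  by near: n; exact: nbhs_infty_ger.
by rewrite pow_exp_ge// pow_exp_le.
Unshelve. all: by end_near. Qed.

Definition cut (n : nat) z : R := neg z * (1 - expR z) ^+ n.

(** With t = 1 - e^z this is the integral of (1 - t^n) / (1 - t) over [0, 1]. The induction adds the
    integral of t^n, which is 1 / (n + 1). *)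
Lemma harmonic_cut n : intble mu (fun z => neg z - cut n z) /\
  \int[mu]_z (neg z - cut n z) = \sum_(1 <= k < n.+1) (k%:R : R)^-1.
Proof.
have mc k : measurable_fun setT (cut k).
  apply: measurable_funM; first exact: neg_measurable.
  by apply: measurable_funX; apply: measurable_funB => //; exact: measurable_expR.
have ih k : intble mu (fun z => neg z * ((1 - expR z) ^+ k * expR z)).
  apply: exp_decay_intble.
    apply: measurable_funM; first exact: neg_measurable.
    apply: measurable_funM; last exact: measurable_expR.
    by apply: measurable_funX; apply: measurable_funB => //; exact: measurable_expR.
  apply: (@exp_decay_intro _ _ 1 1 1) => // z z0.
    rewrite negE z0 !mul1r normrM normrX (ger0_norm (expR_ge0 _)) ler_piMl ?expR_ge0//.
    rewrite exprn_ile1// ger0_norm ?subr_ge0 ?expR_le1//.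
  rewrite negE; have [z1|_] := leP z 0; last by rewrite mul0r normr0 mulr_ge0 ?expR_ge0.
  have -> : z = 0 by apply/le_anti; rewrite z0 z1.
  rewrite mulr0 expR0 subrr !mulr1 mul1r normrX normr0.
  by case: k => [|k]; rewrite ?expr0// expr0n.
have eh k : \int[mu]_z (neg z * ((1 - expR z) ^+ k * expR z)) = k.+1%:R^-1.
  pose F z : R := - (1 - expR z) ^+ k.+1 / k.+1%:R.
  have dF z : has_derive F z ((1 - expR z) ^+ k * expR z).
    apply: has_derive_val; first by apply: derivMr; apply: derivN; apply: deriv_pow; derivs.
    by rewrite /=; have : k.+1%:R != 0 :> R by []; move: (k.+1%:R : R) => q q0; field.
  have c0 : continuous (fun y : R => - (1 - y) ^+ k.+1 / k.+1%:R).
    apply: deriv_continuous => y; eexists.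
    by apply: derivMr; apply: derivN; apply: deriv_pow; derivs.
  have cF : F (- n%:R) @[n --> \oo] --> (- k.+1%:R^-1 : R).
    have h := @expR_nat_cvg0 R 1 ltr01; have := @cvg_comp _ _ _ _ _ _ _ _ h (c0 0).
    by rewrite subr0 expr1n mulN1r; apply: cvg_ext => j /=; rewrite mul1r.
  rewrite (Rint_half_line dF _ (ih k) cF) /F.
    by rewrite expR0 subrr expr0n/= oppr0 mul0r sub0r opprK.
  have ce : continuous (fun z : R => 1 - expR z).
    by apply: deriv_continuous => z; eexists; derivs.
  move=> z; apply: cvgM; last exact: continuous_expR.
  exact: (continuous_comp (ce z) (@exprn_continuous R k _)).
elim: n => [|n [i e]].
  rewrite big_geq//; have E z : neg z - cut 0 z = 0 by rewrite /cut expr0 mulr1 subrr.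
  split; last by under eq_Rint do rewrite E; exact: Rint0.
  by have := intbleZ 0 (ih 0%N); congr intble; apply/funext => z; rewrite mul0r E.
have E z : neg z - cut n.+1 z = (neg z - cut n z) + neg z * ((1 - expR z) ^+ n * expR z).
  by rewrite /cut exprS; ring.
split; first by have := intbleD i (ih n); congr intble; apply/funext => z; rewrite E.
under eq_Rint do rewrite E.
by rewrite RintD// e eh [RHS]big_nat_recr.
Qed.

(** Translating [cut] by ln (n + 1) turns the power into (1 - e^x / (n + 1))^(n + 1), which tends to
    e^(- e^x), and subtracts ln (n + 1) from the harmonic sum. Domination by 4 e^(- |x|) comes from
    Bernoulli's inequality on the left and from e^(- e^x) <= 4 e^(- 2x) on the right. *)
Lemma euler_line : intble mu (fun x => neg x - expR (- expR x)) /\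
  euler_gamma R = \int[mu]_x (neg x - expR (- expR x)).
Proof.
pose L (n : nat) : R := ln n.+1%:R.
have L0 n : 0 <= L n by rewrite ln_ge0// ler1n.
pose f n x := neg x - cut n.+1 (x - L n).
have mc k : measurable_fun setT (cut k).
  apply: measurable_funM; first exact: neg_measurable.
  by apply: measurable_funX; apply: measurable_funB => //; exact: measurable_expR.
have fE n : \int[mu]_x f n x = \sum_(1 <= k < n.+2) (k%:R : R)^-1 - L n.
  have [i1 e1] := harmonic_cut n.+1.
  have [i2 e2] := Rint_step (- L n).
  have [i3 e3] := Rint_shift (- L n) (intbleD i1 i2).
  have E x : f n x = (neg (x + - L n) - cut n.+1 (x + - L n)) + (neg (x + - L n - - L n) - neg (x + - L n)).
    by rewrite /f opprK subrK; ring.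
  by under eq_Rint do rewrite E; rewrite e3 RintD// e1 e2.
have eL n x : expR (x - L n) = expR x / n.+1%:R by rewrite expRD expRN lnK// posrE.
have mf n : measurable_fun setT (f n).
  apply: measurable_funB; first exact: neg_measurable.
  by apply: (measurableT_comp (mc n.+1)); exact: measurable_funB.
have cut0 n x : 0 <= cut n.+1 (x - L n).
  rewrite /cut negE; have [h|_] := leP (x - L n) 0; last by rewrite mul0r.
  by rewrite mul1r exprn_ge0// subr_ge0 expR_le1.
have cut_le n x : cut n.+1 (x - L n) <= expR (- expR x).
  rewrite /cut negE eL; have [h|_] := leP (x - L n) 0; last by rewrite mul0r expR_ge0.
  rewrite mul1r pow_exp_le// -(@lnK _ n.+1%:R) ?posrE// ler_expR -/(L n); lra.
have cut1 n x : x <= 0 -> cut n.+1 (x - L n) <= 1.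
  by move=> _; apply: (le_trans (cut_le n x)); rewrite expR_le1// oppr_le0 expR_ge0.
have cut_ge n x : x <= 0 -> 1 - expR x <= cut n.+1 (x - L n).
  move=> x0; have h : x - L n <= 0 by have := L0 n; lra.
  rewrite /cut negE h mul1r eL; set v := expR x / n.+1%:R.
  have v0 : 0 <= v by rewrite divr_ge0 ?expR_ge0.
  have v1 : v <= 1 by rewrite /v -eL expR_le1.
  by have := bernoulli n.+1 v0 v1; rewrite {1}/v mulrC divfK.
have fb n x : `|f n x| <= 4 * expR (- 1 * `|x|).
  rewrite /f negE; have [x0|x0] := leP x 0.
    rewrite (ler0_norm x0) mulrNN mul1r ler_norml.
    have -> : true%:R = 1 :> R by [].
    have := cut_ge n x x0; have := cut1 n x x0; have := expR_ge0 x; lra.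
  rewrite sub0r normrN (ger0_norm (cut0 n x)) (gtr0_norm x0).
  apply: (le_trans (cut_le n x)); apply: (le_trans (expexp_bound x)).
  by rewrite ler_wpM2l// ler_expR; lra.
have fc x : f n x @[n --> \oo] --> neg x - expR (- expR x).
  apply: cvgB; first exact: cvg_cst.
  have := pow_exp_cvg (expR_ge0 x); apply: cvg_trans; apply: near_eq_cvg; near=> n.
  rewrite /cut eL negE; have -> : x - L n <= 0; last by rewrite mul1r.
  rewrite subr_le0 -ler_expR lnK ?posrE//.
  apply: (@le_trans _ _ n%:R); last by rewrite ler_nat.
  by near: n; exact: nbhs_infty_ger.
have [i c] : intble mu (fun x => neg x - expR (- expR x)) /\
    \int[mu]_x f n x @[n --> \oo] --> \int[mu]_x (neg x - expR (- expR x)).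
  apply: (@Rint_dominated _ _ R mu f _ (fun x => 4 * expR (- 1 * `|x|)) mf fc _ fb).
  exact: (intbleZ 4 (exp_abs_intble ltr01)).
split=> //; rewrite /euler_gamma; apply: cvg_lim => //.
rewrite -(cvg_shiftS (fun n => \sum_(1 <= k < n.+1) (k%:R : R)^-1 - ln n%:R)).
by apply: cvg_ext c => n; rewrite fE.
Unshelve. all: by end_near. Qed.

End EulerConstant.

(** * The Levy-Khintchine integral in closed form *)

Section StableExponent.
Context (R : realType).
Notation mu := (@lebesgue_measure R).
Implicit Types (a u x : R).

(* The compensator h of the jump e^x, which accounts for the centering A_n. *)
Definition stable_comp a x : R := if a < 1 then 0 else if a == 1 then neg x else 1.
Definition jump_re u x : R := cos (u * expR x) - 1.
Definition jump_im a u x : R := sin (u * expR x) - u * expR x * stable_comp a x.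

Lemma stable_comp_measurable a : measurable_fun setT (stable_comp a).
Proof.
by rewrite /stable_comp; case: (a < 1) => //; case: (a == 1) => //; exact: neg_measurable.
Qed.

Let sin_exp_continuous u : continuous (fun x => sin (u * expR x)).
Proof. by apply: deriv_continuous => x; eexists; derivs. Qed.

Lemma jump_re_continuous u : continuous (jump_re u).
Proof. by apply: deriv_continuous => x; eexists; rewrite /jump_re; derivs. Qed.

Lemma jump_im_measurable a u : measurable_fun setT (jump_im a u).
Proof.
apply: measurable_funB; first exact: continuous_measurable_fun (@sin_exp_continuous u).
apply: measurable_funM; last exact: stable_comp_measurable.
by apply: measurable_funM => //; exact: measurable_expR.
Qed.

Lemma neg_continuous x : x != 0 -> {for x, continuous (@neg R)}.
Proof.
move=> x0; suff : neg y @[y --> x] --> neg x by [].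
apply: cvg_near_cst.
have r0 : 0 < `|x| by rewrite normr_gt0.
apply/nbhs_normP; exists `|x| => //= y /= h; rewrite !negE; congr (_%:R).
have [x1|x1] := ltP x 0.
  have : y < 0 by move: h; rewrite (ltr0_norm x1) ltr_norml => /andP[]; lra.
  by move=> /ltW ->; rewrite (ltW x1).
have {}x1 : 0 < x by rewrite lt_neqAle eq_sym x0.
have : 0 < y by move: h; rewrite (gtr0_norm x1) ltr_norml => /andP[]; lra.
by move=> y0; rewrite leNgt y0 leNgt x1.
Qed.

Lemma jump_im_continuous a u x : x != 0 -> {for x, continuous (jump_im a u)}.
Proof.
move=> x0; apply: cvgB; first exact: sin_exp_continuous.
apply: cvgM; first by apply: cvgMl_tmp; exact: continuous_expR.
rewrite /stable_comp; case: ifP => _; first exact: cvg_cst.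
by case: ifP => _; [exact: neg_continuous|exact: cvg_cst].
Qed.

Let expM_cont a : continuous (fun x => expR (- a * x)).
Proof. exact: expM_continuous. Qed.

Lemma jump_re_decay a u : 0 < a -> a < 2 -> exp_decay (fun x => jump_re u x * expR (- a * x)).
Proof.
move=> a0 a2; have u2 := sqr_ge0 u.
apply: (@exp_decay_intro _ _ (u ^+ 2 + 2) (2 - a) a) => //; first by rewrite subr_gt0.
  move=> x _; rewrite normrM (ger0_norm (expR_ge0 _)) /jump_re distrC.
  have h := cosB_norm_le (u * expR x).
  apply: (le_trans (ler_wpM2r (expR_ge0 _) h)).
  have -> : (2 - a) * x = x + x - a * x by ring.
  rewrite 2!expRD mulNr exprMn !expr2.
  have := mulr_ge0 (mulr_ge0 (expR_ge0 x) (expR_ge0 x)) (expR_ge0 (- (a * x))).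
  move: (expR x) (expR (- (a * x))) => e f; rewrite expr2 in u2; nra.
move=> x _; rewrite normrM (ger0_norm (expR_ge0 _)) ler_wpM2r ?expR_ge0//.
apply: (le_trans (ler_normB _ _)); rewrite normr1; have := cos_norm (u * expR x); lra.
Qed.

(** At minus infinity the sine is of order e^x, which is enough for alpha < 1; from alpha = 1 on its
    linear term has to be removed there. At plus infinity the linear term is harmless for alpha > 1
    but not for alpha = 1, which is why the compensator is then cut off at 0. *)
Lemma jump_im_decay a u : 0 < a -> a < 2 -> exp_decay (fun x => jump_im a u x * expR (- a * x)).
Proof.
move=> a0 a2; pose C := u ^+ 2 + `|u| + 2.
have u2 := sqr_ge0 u; have u0 := normr_ge0 u.
have sq x : `|sin (u * expR x) - u * expR x| * expR (- a * x) <= C * expR ((2 - a) * x).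
  apply: (le_trans (ler_wpM2r (expR_ge0 _) (sin_taylor2 _))).
  have -> : (2 - a) * x = x + x - a * x by ring.
  rewrite 2!expRD mulNr exprMn !expr2 -!mulrA.
  have h := mulr_ge0 (expR_ge0 x) (mulr_ge0 (expR_ge0 x) (expR_ge0 (- (a * x)))).
  rewrite [X in X <= _]mulrA ler_wpM2r// /C expr2; lra.
have one x : `|sin (u * expR x)| * expR (- a * x) <= C * expR (- a * x).
  by rewrite ler_wpM2r ?expR_ge0// (le_trans (sin_norm _))// /C; lra.
rewrite /jump_im /stable_comp; have [a1|a1|a1] := ltgtP a 1.
- apply: (@exp_decay_intro _ _ C (1 - a) a) => //; first by rewrite subr_gt0.
    move=> x _; rewrite mulr0 subr0 normrM (ger0_norm (expR_ge0 _)).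
    apply: (le_trans (ler_wpM2r (expR_ge0 _) (sin_norm_le _))).
    have -> : (1 - a) * x = x - a * x by ring.
    rewrite expRD mulNr normrM (ger0_norm (expR_ge0 _)) -mulrA ler_wpM2r ?mulr_ge0 ?expR_ge0//.
    by rewrite /C; lra.
  by move=> x _; rewrite mulr0 subr0 normrM (ger0_norm (expR_ge0 _)); exact: one.
- apply: (@exp_decay_intro _ _ C (2 - a) (a - 1)) => //; [by rewrite subr_gt0..| |].
    by move=> x _; rewrite mulr1 normrM (ger0_norm (expR_ge0 _)); exact: sq.
  move=> x x0; rewrite mulr1 normrM (ger0_norm (expR_ge0 _)).
  have e1 : 1 <= expR x by rewrite -expR0 ler_expR.
  have -> : - (a - 1) * x = x - a * x by ring.
  rewrite expRD mulNr mulrA ler_wpM2r ?expR_ge0//.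
  apply: (le_trans (ler_normB _ _)); rewrite normrM (ger0_norm (expR_ge0 _)).
  have := sin_norm (u * expR x); rewrite /C; move: (expR x) e1 => e e1 h; nra.
- apply: (@exp_decay_intro _ _ C 1 1) => // x x0.
    rewrite negE x0 mulr1 normrM (ger0_norm (expR_ge0 _)).
    by have := sq x; rewrite a1; have -> : 2 - 1 = 1 :> R by ring.
  rewrite negE; have [x1|_] := leP x 0.
    have xE : x = 0 by apply/le_anti; rewrite x0 x1.
    rewrite mulr1 normrM (ger0_norm (expR_ge0 _)).
    by have := sq x; rewrite a1 xE !mulr0.
  by rewrite mulr0 subr0 normrM (ger0_norm (expR_ge0 _)) -a1; exact: one.
Qed.

Lemma jump_re_intble a u : 0 < a -> a < 2 -> intble mu (fun x => jump_re u x * expR (- a * x)).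
Proof.
move=> a0 a2; apply: exp_decay_intble; last exact: jump_re_decay.
apply: measurable_funM; first exact: continuous_measurable_fun (@jump_re_continuous u).
exact: continuous_measurable_fun (@expM_cont a).
Qed.

Lemma jump_im_intble a u : 0 < a -> a < 2 -> intble mu (fun x => jump_im a u x * expR (- a * x)).
Proof.
move=> a0 a2; apply: exp_decay_intble; last exact: jump_im_decay.
apply: measurable_funM; first exact: jump_im_measurable.
exact: continuous_measurable_fun (@expM_cont a).
Qed.

Lemma cosN_pihalf_sub x : cos (- (pi / 2) - x) = - sin x :> R.
Proof. by rewrite -cosN opprB opprK cosDpihalf. Qed.

(** On the line of height pi / 2 the factor e^(- a z) rotates by - a pi / 2. The phase p = a pi / 2
    undoes this and yields the cosine part, and p = a pi / 2 - pi / 2 yields minus the sine part.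
    The two regimes differ only in the compensation k. *)
Lemma stable_base a : 0 < a -> a < 2 -> a != 1 ->
  a * (\int[mu]_x (jump_re 1 x * expR (- a * x))) = - Gamma (1 - a) * cos (pi / 2 * a) /\
  a * (\int[mu]_x (jump_im a 1 x * expR (- a * x))) = Gamma (1 - a) * sin (pi / 2 * a).
Proof.
move=> a0 a2 aN1.
have q0 : a * (pi / 2) - a * (pi / 2) = 0 :> R by ring.
have q1 : a * (pi / 2) - pi / 2 - a * (pi / 2) = - (pi / 2) :> R by ring.
have s1 : cos (a * (pi / 2) - pi / 2) = sin (pi / 2 * a) :> R by rewrite cosBpihalf mulrC.
have [a1|a1|a1] := ltgtP a 1; last by rewrite a1 eqxx in aN1.
- have [i1 e1] := contour_small (a * (pi / 2)) a0 a1.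
  have [i2 e2] := contour_small (a * (pi / 2) - pi / 2) a0 a1.
  have g := gamma_small a0 a1; rewrite Gamma_small//; split.
    transitivity (a * \int[mu]_x contour_fun a 0 (a * (pi / 2)) x (pi / 2)).
      congr (_ * _); apply: eq_Rint => x; rewrite contour_fun_pihalf q0 sub0r cosN cos0.
      by rewrite /jump_re !mul1r; ring.
    by rewrite e1 mulrCA g [pi / 2 * a]mulrC; ring.
  transitivity (- (a * \int[mu]_x contour_fun a 0 (a * (pi / 2) - pi / 2) x (pi / 2))).
    rewrite -mulrN -RintN//; congr (_ * _); apply: eq_Rint => x.
    rewrite contour_fun_pihalf q1 cosN_pihalf_sub cosN cos_pihalf.
    by rewrite /jump_im /stable_comp a1 !mul1r; ring.
  by rewrite e2 s1 mulrCA g; ring.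
- have [i1 e1] := contour_large (a * (pi / 2)) a1 a2.
  have [i2 e2] := contour_large (a * (pi / 2) - pi / 2) a1 a2.
  have g := gamma_large a1 a2; rewrite Gamma_large//; split.
    transitivity (a * \int[mu]_x contour_fun a 1 (a * (pi / 2)) x (pi / 2)).
      congr (_ * _); apply: eq_Rint => x; rewrite contour_fun_pihalf q0 sub0r cosN cos0 sin0.
      by rewrite /jump_re !mul1r; ring.
    by rewrite e1 mulrCA g [pi / 2 * a]mulrC; ring.
  transitivity (- (a * \int[mu]_x contour_fun a 1 (a * (pi / 2) - pi / 2) x (pi / 2))).
    rewrite -mulrN -RintN//; congr (_ * _); apply: eq_Rint => x.
    rewrite contour_fun_pihalf q1 cosN_pihalf_sub cosN cos_pihalf sinN sin_pihalf.
    rewrite /jump_im /stable_comp ltNge (ltW a1)/= (gt_eqF a1) !mul1r; ring.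
  by rewrite e2 s1 mulrCA g; ring.
Qed.

(** The real part is [contour_one] at p = pi / 2. At p = 0 the contour term vanishes, and what
    remains of the imaginary part splits into the derivative [f], whose integral is -1, and the
    integrand of [euler_line]; both enter with a minus sign, whence 1 - gamma. *)
Lemma stable_base1 :
  \int[mu]_x (jump_re 1 x * expR (- 1 * x)) = - (pi / 2) /\
  \int[mu]_x (jump_im 1 1 x * expR (- 1 * x)) = 1 - euler_gamma R.
Proof.
have [i1 e1] := @contour_one R (pi / 2); have [i2 e2] := @contour_one R 0.
have q0 : pi / 2 - 1 * (pi / 2) = 0 :> R by ring.
have q1 : 0 - 1 * (pi / 2) = - (pi / 2) :> R by ring.
split.
  transitivity (\int[mu]_x (contour_fun 1 0 (pi / 2) x (pi / 2) - contour_fun 1 0 (pi / 2) x 0)).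
    apply: eq_Rint => x; rewrite contour_fun_pihalf contour_fun0 q0 sub0r cosN cos0 cos_pihalf.
    by rewrite /jump_re !mul1r; ring.
  by rewrite e1 sin_pihalf mul1r.
pose F x := - (expR (- 1 * x) * (expR (- expR x) - 1)).
pose f x := expR (- 1 * x) * (expR (- expR x) - 1) + expR (- expR x).
have ee x : expR (- 1 * x) * expR x = 1 by rewrite mulN1r mulrC expRxMexpNx_1.
have dF x : has_derive F x (f x).
  rewrite /F; derive_val; rewrite /f.
  have -> : - (expR (-1 * x) * (-1 * 1) * (expR (- expR x) - 1) +
    expR (-1 * x) * (expR (- expR x) * - (expR x * 1) - 0)) =
    expR (-1 * x) * (expR (- expR x) - 1) + expR (-1 * x) * expR x * expR (- expR x) by ring.
  by rewrite ee mul1r.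
have cf : continuous f.
  move=> x; apply: cvgD; last exact: expexp_continuous.
  exact: small_continuous.
have fd : exp_decay f.
  apply: (@exp_decay_intro _ _ 5 1 1) => // x x0.
    have -> : f x = expR (- 1 * x) * (expR (- expR x) - 1 + expR x) + (expR (- expR x) - 1).
      by rewrite mulrDr ee /f; ring.
    apply: (le_trans (ler_normD _ _)); rewrite normrM (ger0_norm (expR_ge0 _)).
    have [_ h] := expRN_taylor (expR_ge0 x).
    have h2 := ler_wpM2l (expR_ge0 (- 1 * x)) h; rewrite expr2 mulrA ee mul1r in h2.
    by have := expRN_bound (expR_ge0 x); have := expR_ge0 x; rewrite mul1r; lra.
  apply: (le_trans (ler_normD _ _)); rewrite normrM (ger0_norm (expR_ge0 _)).
  have h := ler_wpM2l (expR_ge0 (- 1 * x)) (expRN1_le (expR_ge0 x)).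
  rewrite (ger0_norm (expR_ge0 (- expR x))); have := expexp_bound x.
  have : expR (- 2 * x) <= expR (- 1 * x) by rewrite ler_expR; lra.
  by lra.
have fi : intble mu f by apply: exp_decay_intble => //; exact: continuous_measurable_fun.
have e0 : expR (- (1 * n%:R)) @[n --> \oo] --> (0 : R) by exact: expR_nat_cvg0.
have Fr : F n%:R @[n --> \oo] --> (0 : R).
  apply/norm_cvg0P; apply: (squeeze_cvgr _ (cvg_cst (0 : R)) e0); apply: nearW => n.
  rewrite normr_ge0/= /F normrN normrM (ger0_norm (expR_ge0 _)) mulNr ler_piMr ?expR_ge0//.
  exact: expRN1_le (expR_ge0 _).
have Fl : F (- n%:R) @[n --> \oo] --> (1 : R).
  apply/cvgrPdist_le => e ep; move/cvgr0Pnorm_le : e0 => /(_ e ep); apply: filterS => n.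
  rewrite ger0_norm ?expR_ge0// => h; apply: le_trans h; rewrite mul1r; set x := - n%:R.
  have -> : 1 - F x = expR (- 1 * x) * (expR (- expR x) - 1 + expR x).
    by rewrite mulrDr ee /F; ring.
  rewrite normrM (ger0_norm (expR_ge0 _)).
  have [_ h] := expRN_taylor (expR_ge0 x).
  by have := ler_wpM2l (expR_ge0 (- 1 * x)) h; rewrite expr2 mulrA ee mul1r.
have ef : \int[mu]_x f x = 0 - 1 := Rint_derive_line dF cf fi Fl Fr.
have [gi ge] := @euler_line R.
have E x : jump_im 1 1 x * expR (- 1 * x) =
  - (contour_fun 1 0 0 x (pi / 2) - contour_fun 1 0 0 x 0) - (f x + (neg x - expR (- expR x))).
  rewrite contour_fun_pihalf contour_fun0 q1 cosN_pihalf_sub cosN cos_pihalf cos0 sinN sin_pihalf.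
  rewrite /jump_im /stable_comp ltxx eqxx /f !mul1r mulrBl.
  have -> : expR x * neg x * expR (-1 * x) = neg x * (expR (-1 * x) * expR x) by ring.
  by rewrite ee; ring.
under eq_Rint do rewrite E.
rewrite RintB; [|exact: intbleN|exact: intbleD].
by rewrite RintN// e2 sin0 mul0r RintD// ef ge; ring.
Qed.

Lemma jump_im_opp a u x : jump_im a (- u) x = - jump_im a u x.
Proof. by rewrite /jump_im mulNr sinN; ring. Qed.

Lemma jump_re_opp u x : jump_re (- u) x = jump_re u x.
Proof. by rewrite /jump_re mulNr cosN. Qed.

Lemma stable_scale_re a u : 0 < a -> a < 2 -> 0 < u ->
  \int[mu]_x (jump_re u x * expR (- a * x)) =
  u `^ a * \int[mu]_x (jump_re 1 x * expR (- a * x)).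
Proof.
move=> a0 a2 u0; have [i e] := Rint_shift (ln u) (jump_re_intble 1 a0 a2).
rewrite -e -RintZ//; apply: eq_Rint => x; rewrite /jump_re.
rewrite /powR gt_eqF// mul1r expRD lnK ?posrE// [expR x * u]mulrC mulrCA -expRD.
by congr (_ * expR _); ring.
Qed.

Lemma stable_scale_im a u : 0 < a -> a < 2 -> a != 1 -> 0 < u ->
  \int[mu]_x (jump_im a u x * expR (- a * x)) =
  u `^ a * \int[mu]_x (jump_im a 1 x * expR (- a * x)).
Proof.
move=> a0 a2 a1 u0; have [i e] := Rint_shift (ln u) (jump_im_intble 1 a0 a2).
rewrite -e -RintZ//; apply: eq_Rint => x; rewrite /jump_im.
have -> : stable_comp a (x + ln u) = stable_comp a x by rewrite /stable_comp (negbTE a1).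
rewrite /powR gt_eqF// mul1r expRD lnK ?posrE// [expR x * u]mulrC mulrCA -expRD.
by congr (_ * expR _); ring.
Qed.

(** As for the other exponents, x is translated by ln u. For alpha = 1, however, the compensator is
    not invariant: the step moves by ln u, and [Rint_step] turns this into the term - u ln u. *)
Lemma stable_scale_im1 u : 0 < u ->
  \int[mu]_x (jump_im 1 u x * expR (- 1 * x)) =
  u * (\int[mu]_x (jump_im 1 1 x * expR (- 1 * x)) - ln u).
Proof.
move=> u0; have a2 : 1 < 2 :> R by lra.
have i1 := jump_im_intble 1 ltr01 a2; have [i2 e2] := Rint_step (ln u).
have [i e] := Rint_shift (ln u) (intbleB i1 i2).
rewrite -[in RHS]e2 -RintB// -e -RintZ//; apply: eq_Rint => x; rewrite /jump_im /stable_comp ltxx eqxx.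
rewrite addrK !mulN1r mul1r expRD opprD expRD lnK ?posrE// (expRN (ln u)) lnK ?posrE//.
rewrite expRN [expR x * u]mulrC; have := expR_gt0 x.
move: (expR x) (neg x) (neg (x + ln u)) => y n1 n2 y0; move: (sin _) => s.
by field; rewrite !gt_eqF.
Qed.

Lemma stable_log_charfunE a u : a != 1 -> stable_log_charfun a u =
  Complex (- (Gamma (1 - a) * `|u| `^ a * cos (pi / 2 * a * Num.sg u)))
    (Gamma (1 - a) * `|u| `^ a * sin (pi / 2 * a * Num.sg u)).
Proof.
move=> a1; rewrite /stable_log_charfun a1; set t := pi / 2 * a * Num.sg u.
have -> : - 'i%C * t%:C%C = Complex 0 (- t).
  by apply/eqP; rewrite eq_complex/=; apply/andP; split; apply/eqP; ring.
rewrite /cexp /= expR0 cosN sinN; move: (Gamma (1 - a) * `|u| `^ a) => A.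
by apply/eqP; rewrite eq_complex/=; apply/andP; split; apply/eqP; ring.
Qed.

Lemma stable_log_charfun1 u : stable_log_charfun 1 u =
  Complex (- (`|u| * (pi / 2))) (u * (1 - euler_gamma R) - `|u| * (Num.sg u * ln `|u|)).
Proof.
rewrite /stable_log_charfun eqxx /=; move: (pi / 2) (1 - _) (Num.sg u * _) => A B C.
by apply/eqP; rewrite eq_complex/=; apply/andP; split; apply/eqP; ring.
Qed.

(** Scaling reduces positive u to u = 1, and parity (the real part is even, the imaginary part odd)
    gives negative u. *)
Lemma stable_exponent a u : 0 < a -> a < 2 ->
  Complex (a * \int[mu]_x (jump_re u x * expR (- a * x)))
    (a * \int[mu]_x (jump_im a u x * expR (- a * x))) = stable_log_charfun a u.
Proof.
move=> a0 a2.
have pos v : 0 < v -> a * \int[mu]_x (jump_re v x * expR (- a * x)) =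
     complex.Re (stable_log_charfun a v) /\
   a * \int[mu]_x (jump_im a v x * expR (- a * x)) = complex.Im (stable_log_charfun a v).
  move=> v0; rewrite stable_scale_re//; have [a1|a1] := eqVneq a 1.
    rewrite a1 stable_scale_im1//; have [-> ->] := stable_base1.
    rewrite stable_log_charfun1 /= (gtr0_norm v0) (gtr0_sg v0) powRr1 ?(ltW v0)//.
    by split; ring.
  rewrite stable_scale_im//; have [h1 h2] := stable_base a0 a2 a1.
  rewrite stable_log_charfunE//= (gtr0_norm v0) (gtr0_sg v0) mulr1 !(mulrCA a) h1 h2.
  by split; ring.
suff [-> ->] : a * \int[mu]_x (jump_re u x * expR (- a * x)) =
     complex.Re (stable_log_charfun a u) /\
   a * \int[mu]_x (jump_im a u x * expR (- a * x)) = complex.Im (stable_log_charfun a u).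
  by apply/eqP; rewrite eq_complex/= !eqxx.
have [u0|u0|u0] := ltgtP u 0; last 2 first.
- exact: pos.
- rewrite u0.
  have -> : \int[mu]_x (jump_re 0 x * expR (- a * x)) = 0.
    by rewrite -[RHS](Rint0 mu); apply: eq_Rint => x; rewrite /jump_re mul0r cos0 subrr mul0r.
  have -> : \int[mu]_x (jump_im a 0 x * expR (- a * x)) = 0.
    by rewrite -[RHS](Rint0 mu); apply: eq_Rint => x; rewrite /jump_im !mul0r sin0 subrr mul0r.
  have [a1|a1] := eqVneq a 1.
    by rewrite a1 stable_log_charfun1 /= normr0 !mul0r subrr oppr0 mulr0.
  rewrite stable_log_charfunE//= normr0 powR0 ?gt_eqF// !mulr0 !mul0r oppr0//.
have v0 : 0 < - u by rewrite oppr_gt0.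
have [h1 h2] := pos _ v0.
have e1 : \int[mu]_x (jump_re u x * expR (- a * x)) = \int[mu]_x (jump_re (- u) x * expR (- a * x)).
  by apply: eq_Rint => x; rewrite jump_re_opp.
have e2 : \int[mu]_x (jump_im a u x * expR (- a * x)) = - \int[mu]_x (jump_im a (- u) x * expR (- a * x)).
  by rewrite -RintN; [apply: eq_Rint => x; rewrite jump_im_opp; ring|exact: jump_im_intble].
rewrite e1 e2 mulrN h1 h2; have [a1|a1] := eqVneq a 1.
  rewrite a1 !stable_log_charfun1 /= normrN (gtr0_sg v0) (ltr0_sg u0).
  by split; ring.
rewrite !stable_log_charfunE//= normrN (gtr0_sg v0) (ltr0_sg u0) mulrN mulr1.
by rewrite cosN sinN; split; ring.
Qed.

End StableExponent.

(** * Convergence to the stable law *)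

Section DensityProbability.
Context (R : realType).
Notation mu := (@lebesgue_measure R).

(** Bundles the function with its proofs, so that [density_prob] can carry the measure and
    probability instances. *)
Record density := Density {
  density_fun :> R -> R;
  density_ge0 : forall x, 0 <= density_fun x;
  density_intble : intble mu density_fun;
  density_mass : \int[mu]_x density_fun x = 1 }.

Definition density_prob (f : density) (V : set (measurableTypeR R)) : \bar R :=
  (\int[mu]_(x in V) (f x)%:E)%E.

Variable f : density.

Let density0 : density_prob f set0 = 0%E.
Proof. by rewrite /density_prob integral_set0. Qed.

Let density_prob_ge0 V : (0 <= density_prob f V)%E.
Proof. by apply: integral_ge0 => x _; rewrite lee_fin density_ge0. Qed.

Let density_sigma_additive : semi_sigma_additive (density_prob f).
Proof.
move=> A mA tA mUA; rewrite /density_prob integral_bigcup//; last first.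
  by apply: (integrableS _ _ (@subsetT _ _)) => //; exact: density_intble.
apply: is_cvg_ereal_nneg_natsum_cond => n _ _.
by apply: integral_ge0 => x _; rewrite lee_fin density_ge0.
Qed.

HB.instance Definition _ := isMeasure.Build _ _ _
  (density_prob f) density0 density_prob_ge0 density_sigma_additive.

Let density_setT : density_prob f setT = 1%E.
Proof. by rewrite /density_prob (Rint_fin (density_intble f)) density_mass. Qed.

HB.instance Definition _ :=
  @Measure_isProbability.Build _ _ R (density_prob f) density_setT.

Lemma density_prob_dominated : density_prob f `<< mu.
Proof.
apply/null_content_dominatesP => A mA A0; apply: null_set_integral => //.
apply: measurable_funTS; apply/measurable_EFinP.
exact: intble_measurable (density_intble f).
Qed.

(** The Radon-Nikodym derivative of the constructed measure has the same integral as [f] over every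
    measurable set, hence agrees with [f] almost everywhere; the change of variables is then
    available. *)
Lemma Rint_density (g : R -> R) (B : R) : measurable_fun setT g ->
  (forall x, `|g x| <= B) ->
  \int[density_prob f]_x g x = \int[mu]_x (g x * f x).
Proof.
move=> mg gB; congr fine.
have ig : (density_prob f).-integrable setT (EFin \o g).
  exact: (@intble_bounded _ _ _ (density_prob f) g B).
rewrite -(Radon_Nikodym_change_of_variables density_prob_dominated)//=.
apply: ae_eq_integral => //.
- apply: emeasurable_funM; first exact: measurable_int ig.
  apply: (measurable_int mu); apply: Radon_Nikodym_integrable.
  exact: density_prob_dominated.
- apply/measurable_EFinP; apply: measurable_funM => //.
  exact: intble_measurable (density_intble f).
- under [X in ae_eq _ _ _ X]eq_fun do rewrite EFinM.
  apply: ae_eqe_mul2l => /=.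
  rewrite Radon_NikodymE//=; first exact: density_prob_dominated.
  move=> fmu; case: cid => /= h [h1 h2 h3].
  apply: integral_ae_eq => //=.
  + by apply/measurable_EFinP; exact: intble_measurable (density_intble f).
  + by move=> E _ mE; rewrite -h3.
Qed.

End DensityProbability.

(** * Integrability and continuity of the stable characteristic function *)

Section StableCharacteristicFunction.
Context (R : realType).
Notation mu := (@lebesgue_measure R).
Notation Re := complex.Re.
Notation Im := complex.Im.
Implicit Types (a u : R).

(** The sign is taken from the integral, uniformly in alpha, which spares a discussion of the sign
    of Gamma (1 - alpha) cos (pi alpha / 2). On ]-1, 0[ one has 0 < e^x < 1 < 2 pi, so cos (e^x)
    differs from 1 on a set of positive measure. *)
Lemma stable_re_neg a : 0 < a -> a < 2 ->
  \int[mu]_x (jump_re 1 x * expR (- a * x)) < 0.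
Proof.
move=> a0 a2; rewrite ltNge; apply/negP => h.
have i := jump_re_intble 1 a0 a2.
have : {ae mu, forall x, - (jump_re 1 x * expR (- a * x)) = 0}.
  apply: Rint_le0_ae; first exact: intbleN.
    move=> x; rewrite oppr_ge0 mulr_le0_ge0 ?expR_ge0// subr_le0; exact: cos_le1.
  by rewrite RintN// oppr_le0.
case=> A [mA A0 sA].
have : (mu `](-1)%R, 0%R[ <= mu A)%E.
  apply: le_measure; rewrite ?inE//.
  move=> x; rewrite /= in_itv/= => /andP[x1 x0]; apply: sA => /= /eqP.
  rewrite oppr_eq0 mulf_eq0 (gt_eqF (expR_gt0 _)) orbF subr_eq0 mul1r => /eqP.
  have e1 : expR x < 1 by rewrite -expR0 ltr_expR.
  have e0 := expR_gt0 x; move=> /cos_eq1[k ek]; have := pi_ge2 R.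
  have [k0|k0|k0] := ltrgtP k 0.
  - have : k%:~R <= -1 :> R by rewrite -[-1](_ : (-1)%:~R = _)// ler_int; lia.
    by nra.
  - have : 1 <= k%:~R :> R by rewrite -[1](_ : 1%:~R = _)// ler_int; lia.
    by nra.
  - by move: ek e0; rewrite k0 mulr0 => ->; rewrite ltxx.
have -> : mu `](-1)%R, 0%R[ = 1%E.
  transitivity (mu [set` `](-1)%R, 0%R[]) => //; rewrite lebesgue_measure_itv/= lte_fin.
  by rewrite ltrN10 -EFinB sub0r opprK.
by rewrite A0 lee_fin ler10.
Qed.

Definition stable_rate a : R := - (a * \int[mu]_x (jump_re 1 x * expR (- a * x))).

Lemma stable_rate_gt0 a : 0 < a -> a < 2 -> 0 < stable_rate a.
Proof. by move=> a0 a2; rewrite oppr_gt0 pmulr_rlt0// stable_re_neg. Qed.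

Lemma stable_reE a u : 0 < a -> a < 2 ->
  Re (stable_log_charfun a u) = - (stable_rate a * `|u| `^ a).
Proof.
move=> a0 a2; rewrite -stable_exponent//=.
have -> : \int[mu]_x (jump_re u x * expR (- a * x)) =
    \int[mu]_x (jump_re `|u| x * expR (- a * x)).
  by case: (ger0P u) => // _; apply: eq_Rint => x; rewrite jump_re_opp.
have [->|u0] := eqVneq u 0.
  rewrite normr0 powR0 ?gt_eqF// mulr0 oppr0.
  by under eq_Rint do rewrite /jump_re mul0r cos0 subrr mul0r; rewrite Rint0 mulr0.
by rewrite stable_scale_re ?normr_gt0// /stable_rate; ring.
Qed.

Lemma inv1Dsqr_intble : intble mu (fun x => (1 + x ^+ 2)^-1).
Proof.
have p x : 0 < 1 + x ^+ 2 :> R by rewrite ltr_pwDl// sqr_ge0.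
have cn : n%:R @[n --> \oo] --> (+oo : set_system R) by exact: cvgr_idn.
have ca : (@atan R) n%:R @[n --> \oo] --> pi / 2 by exact: (cvg_comp _ _ cn (@cvgy_atan R)).
apply: (@intble_derive R atan _ (- (pi / 2)) (pi / 2)) => //.
- by move=> x; apply: has_derive_val (is_derive1_atan x) _.
- apply: deriv_continuous => x; eexists; apply: deriv_inv; first by rewrite gt_eqF.
  by derivs.
- by move=> x; rewrite invr_ge0 ltW.
- by under eq_fun do rewrite atanN; exact: cvgN.
Qed.

(** With t = a ln |u|, the logarithm of u^2 exp (- k |u|^a) is 2 t / a - k e^t. Its maximum is at
    e^s = 2 / (a k), with value (2 / a)(s - 1); the tangent inequality for exp at s proves the
    bound. *)
Lemma exp_power_le k a u : 0 < k -> 0 < a ->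
  expR (- (k * `|u| `^ a)) <= (1 + expR (2 / a * (ln (2 / (a * k)) - 1))) * (1 + u ^+ 2)^-1.
Proof.
move=> k0 a0; rewrite ler_pdivlMr ?ltr_pwDl ?sqr_ge0// mulrDr mulr1 lerD//.
  by rewrite expR_le1// oppr_le0 mulr_ge0 ?(ltW k0)// powR_ge0.
have [->|u0] := eqVneq u 0; first by rewrite expr0n mulr0 expR_ge0.
have v0 : 0 < `|u| by rewrite normr_gt0.
have -> : u ^+ 2 = expR (2 * ln `|u|) by rewrite expRM_natl lnK ?posrE// sqr_abs.
rewrite -expRD ler_expR /powR gt_eqF//.
set s := ln (2 / (a * k)); set t := a * ln `|u|.
have es : k * expR s = 2 / a.
  rewrite /s lnK ?posrE ?divr_gt0 ?mulr_gt0//; field.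
  by rewrite !gt_eqF.
have -> : k * expR t = 2 / a * expR (t - s).
  rewrite -es -mulrA -expRD; congr (_ * expR _); ring.
have -> : 2 * ln `|u| = 2 / a * t by rewrite /t; field; rewrite gt_eqF.
have := ler_wpM2l (ltW (divr_gt0 (ltr0n R 2) a0)) (expR_ge1Dx (t - s)).
by lra.
Qed.

Lemma exp_power_intble k a : 0 < k -> 0 < a -> intble mu (fun u => expR (- (k * `|u| `^ a))).
Proof.
move=> k0 a0.
apply: (intble_le _ _ (intbleZ (1 + expR (2 / a * (ln (2 / (a * k)) - 1))) inv1Dsqr_intble)).
  apply: (measurableT_comp (@measurable_expR R)).
  apply: measurableT_comp => //; apply: measurable_funM => //.
  exact: (measurableT_comp (measurable_powR a)).
by move=> u; rewrite ger0_norm ?expR_ge0// exp_power_le.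
Qed.

Lemma sgrE u : Num.sg u = neg (- u) - neg u.
Proof.
rewrite !negE oppr_le0; case: sgrP => h; rewrite ?h ?lexx ?subrr//.
- by rewrite subr0.
- by rewrite sub0r.
Qed.

Lemma sgr_measurable : measurable_fun setT (@Num.sg R).
Proof.
rewrite (_ : Num.sg = fun u => neg (- u) - neg u); last by apply/funext => u; rewrite sgrE.
apply: measurable_funB; last exact: neg_measurable.
exact: (measurableT_comp (@neg_measurable R)).
Qed.

Lemma stable_im_measurable a : measurable_fun setT (fun u => Im (stable_log_charfun a u)).
Proof.
have [->|a1] := eqVneq a 1.
  under eq_fun do rewrite stable_log_charfun1/=.
  apply: measurable_funB; first exact: measurable_funM.
  apply: measurable_funM => //; apply: measurable_funM; first exact: sgr_measurable.
  exact: (measurableT_comp (@measurable_ln R)).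
under eq_fun do rewrite stable_log_charfunE//=.
apply: measurable_funM.
  by apply: measurable_funM => //; exact: (measurableT_comp (measurable_powR a)).
apply: measurableT_comp; first exact: continuous_measurable_fun (@continuous_sin R).
by apply: measurable_funM => //; exact: sgr_measurable.
Qed.

Lemma stable_charfun_measurable a : 0 < a -> a < 2 ->
  measurable_fun setT (fun u => Re (cexp (stable_log_charfun a u))) /\
  measurable_fun setT (fun u => Im (cexp (stable_log_charfun a u))).
Proof.
move=> a0 a2; have m : measurable_fun setT (fun u => expR (Re (stable_log_charfun a u))).
  under eq_fun do rewrite stable_reE//.
  exact: intble_measurable (exp_power_intble (stable_rate_gt0 a0 a2) a0).
split; apply: measurable_funM => //; apply: measurableT_comp (stable_im_measurable a).
- exact: continuous_measurable_fun (@continuous_cos R).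
- exact: continuous_measurable_fun (@continuous_sin R).
Qed.

Lemma stable_charfun_intble a : 0 < a -> a < 2 ->
  intble mu (fun u => Re (cexp (stable_log_charfun a u))) /\
  intble mu (fun u => Im (cexp (stable_log_charfun a u))).
Proof.
move=> a0 a2; have [m1 m2] := stable_charfun_measurable a0 a2.
have i := exp_power_intble (stable_rate_gt0 a0 a2) a0.
split; apply: (intble_le _ _ i) => // u; rewrite normrM ger0_norm ?expR_ge0//
  stable_reE// ler_piMr ?expR_ge0//; [exact: cos_norm|exact: sin_norm].
Qed.

Lemma powR_norm_cvg0 a : 0 < a -> (`|u| `^ a) @[u --> (0 : R)] --> (0 : R).
Proof.
move=> a0; apply/cvgr0Pnorm_le => e e0.
apply/nbhs_ballP; exists (e `^ a^-1) => /=; first exact: powR_gt0.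
move=> u; rewrite /ball/= sub0r normrN => h.
rewrite ger0_norm ?powR_ge0// -[leRHS]powRr1 ?(ltW e0)// -(mulVf (lt0r_neq0 a0)) powRrM.
by rewrite ge0_ler_powR ?nnegrE ?powR_ge0 ?(ltW a0)// ltW.
Qed.

(** Gives |u| log |u| -> 0 at the origin, needed for continuity at alpha = 1. For |u| < 1 it is exp
    y >= 1 + y at y = - ln |u| / 2. *)
Lemma norm_sqrt_ln u : `|u| * `|ln `|u| | <= 2 * `|u| `^ 2^-1 + u ^+ 2.
Proof.
have [->|u0] := eqVneq u 0.
  by rewrite normr0 mul0r addr_ge0 ?sqr_ge0// mulr_ge0// powR_ge0.
have v0 : 0 < `|u| by rewrite normr_gt0.
have [h|h] := lerP 0 (ln `|u|).
  rewrite (ger0_norm h) -[u ^+ 2]sqr_abs expr2 ler_wpDl ?mulr_ge0 ?powR_ge0// ler_wpM2l//.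
  by have := expR_ge1Dx (ln `|u|); rewrite lnK ?posrE//; lra.
rewrite (ltr0_norm h) ler_wpDr ?sqr_ge0// /powR gt_eqF//.
have := expR_ge1Dx (- (2^-1 * ln `|u|)); rewrite expRN -{3}(lnK (x := `|u|)) ?posrE//.
have -> : expR (ln `|u|) = expR (2^-1 * ln `|u|) ^+ 2.
  by rewrite -expRM_natl; congr expR; field.
have := expR_gt0 (2^-1 * ln `|u|); move: (expR _) => y y0 hy.
have := ler_wpM2l (ltW (exprn_gt0 2 y0)) hy.
have -> : y ^+ 2 * y^-1 = y by field; rewrite gt_eqF.
by nra.
Qed.

Lemma stable_im_cvg0 a : 0 < a -> a < 2 ->
  Im (stable_log_charfun a u) @[u --> (0 : R)] --> (0 : R).
Proof.
move=> a0 a2; apply/norm_cvg0P.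
have cu : `|u| @[u --> (0 : R)] --> (0 : R).
  by rewrite -[X in _ --> X](normr0 R); exact: norm_continuous.
have [->|a1] := eqVneq a 1.
  pose B u := `|u| * `|1 - euler_gamma R| + (2 * `|u| `^ 2^-1 + `|u| * `|u|).
  have cB : B u @[u --> (0 : R)] --> (0 : R).
    have h : (`|u| `^ 2^-1) @[u --> (0 : R)] --> (0 : R) by apply: powR_norm_cvg0; lra.
    rewrite [X in _ --> X](_ : 0 = 0 * `|1 - euler_gamma R| + (2 * 0 + 0 * 0)); last by ring.
    by apply: cvgD; [exact: cvgMr_tmp|apply: cvgD; [exact: cvgMl_tmp|exact: cvgM]].
  apply: (squeeze_cvgr _ (cvg_cst (0:R)) cB); near=> u; rewrite normr_ge0/=.
  rewrite stable_log_charfun1/= (le_trans (ler_normB _ _))// /B normrM lerD2l.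
  have -> : `|u| * `|u| = u ^+ 2 by rewrite -expr2 sqr_abs.
  apply: le_trans (norm_sqrt_ln u); rewrite !normrM normr_id ler_wpM2l//.
  by rewrite normr_sg ler_piMl//; case: (u == 0).
pose B u := `|Gamma (1 - a)| * `|u| `^ a.
have cB : B u @[u --> (0 : R)] --> (0 : R).
  have h := powR_norm_cvg0 a0.
  by rewrite -[X in _ --> X](mulr0 `|Gamma (1 - a)|); exact: cvgMl_tmp.
apply: (squeeze_cvgr _ (cvg_cst (0:R)) cB); near=> u; rewrite normr_ge0/=.
rewrite stable_log_charfunE//= /B; move: (Gamma _) => G.
by rewrite !normrM (ger0_norm (powR_ge0 _ _)) ler_piMr ?mulr_ge0 ?powR_ge0// sin_norm.
Unshelve. all: end_near. Qed.

Lemma stable_log_charfun_re0 a : 0 < a -> a < 2 -> Re (stable_log_charfun a 0) = 0.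
Proof. by move=> a0 a2; rewrite stable_reE// normr0 powR0 ?gt_eqF// mulr0 oppr0. Qed.

Lemma stable_log_charfun_im0 a : 0 < a -> a < 2 -> Im (stable_log_charfun a 0) = 0.
Proof.
move=> a0 a2; rewrite -stable_exponent//=.
under eq_Rint do rewrite /jump_im !mul0r sin0 subrr mul0r.
by rewrite Rint0 mulr0.
Qed.

Lemma stable_charfun0 a : 0 < a -> a < 2 -> Re (cexp (stable_log_charfun a 0)) = 1.
Proof.
move=> a0 a2; rewrite /= stable_log_charfun_re0// stable_log_charfun_im0//.
by rewrite expR0 cos0 mulr1.
Qed.

Lemma stable_charfun_continuous0 a : 0 < a -> a < 2 ->
  {for 0, continuous (fun u => Re (cexp (stable_log_charfun a u)))}.
Proof.
move=> a0 a2; rewrite /prop_for /continuous_at stable_charfun0// -[X in _ --> X](mulr1 1).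
apply: cvgM.
  rewrite -[X in _ --> X](@expR0 R).
  have h : Re (stable_log_charfun a u) @[u --> (0 : R)] --> (0 : R).
    under eq_fun do rewrite stable_reE//.
    have h := powR_norm_cvg0 a0.
    have : - (stable_rate a * `|u| `^ a) @[u --> (0 : R)] --> - (stable_rate a * 0).
      by apply: cvgN; exact: cvgMl_tmp.
    by rewrite mulr0 oppr0.
  exact: (cvg_comp _ _ h (@continuous_expR R 0)).
rewrite -[X in _ --> X](@cos0 R).
exact: (cvg_comp _ _ (stable_im_cvg0 a0 a2) (@continuous_cos R 0)).
Qed.

End StableCharacteristicFunction.

Lemma sqr_Rint_le d (T : measurableType d) (R : realType) (P : probability T R) (Y : T -> R) :
  intble P Y -> intble P (fun t => Y t ^+ 2) ->
  (\int[P]_t Y t) ^+ 2 <= \int[P]_t (Y t ^+ 2).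
Proof.
move=> iY iY2; set e := \int[P]_t Y t.
have i1 := intbleZ (2 * e) iY.
have i2 : intble P (fun=> e ^+ 2) by exact: (@intble_bounded _ _ _ P _ `|e ^+ 2|).
have : 0 <= \int[P]_t (Y t ^+ 2 - 2 * e * Y t + e ^+ 2).
  by apply: Rint_ge0 => t; have := sqr_ge0 (Y t - e); rewrite sqrrB; lra.
rewrite RintD//; last exact: intbleB.
by rewrite RintB// RintZ// Rint_cst_prob -/e; lra.
Qed.

Section HalfLineIndicator.
Context (R : realType).
Implicit Types x : R.

Lemma neg_ge0 x : 0 <= neg x. Proof. by rewrite negE ler0n. Qed.
Lemma neg_le1 x : neg x <= 1. Proof. by rewrite negE lern1; case: (_ <= _). Qed.
Lemma neg_npos x : x <= 0 -> neg x = 1. Proof. by rewrite negE => ->. Qed.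
Lemma neg_pos x : 0 < x -> neg x = 0. Proof. by rewrite negE leNgt => ->. Qed.

End HalfLineIndicator.

Lemma prob_half_line d (T : measurableType d) (R : realType) (P : probability T R)
  (Y : T -> R) (x : R) : measurable_fun setT Y ->
  P (Y @^-1` `]-oo, x]%classic) = (\int[P]_t neg (Y t - x))%:E.
Proof.
move=> mY; have mA : measurable (Y @^-1` `]-oo, x]%classic).
  by rewrite -[X in measurable X]setTI; apply: mY => //; exact: measurable_itv.
rewrite -Rint_fin; last first.
  apply: (@intble_bounded _ _ _ P _ 1) => [|t].
    by apply: (measurableT_comp (@neg_measurable R)); exact: measurable_funB.
  by rewrite ger0_norm ?neg_ge0 ?neg_le1.
rewrite -(setIT (Y @^-1` _)) -integral_indic//; apply: eq_integral => t _; congr EFin.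
rewrite negE indicE subr_le0; congr (_%:R); congr nat_of_bool.
by apply/idP/idP => [/set_mem|h]; rewrite ?inE/= in_itv.
Qed.

(** * Centering of the rows and passage to the limit *)

Section StableLimit.
Context (R : realType).
Context (d0 : measure_display) (T0 : measurableType d0) (P0 : probability T0 R).
Variable X : {RV P0 >-> R}.
Hypothesis hfin : forall t : R, 0 <= t -> ('M_P0 X t < +oo)%E.
Hypothesis hnd : ~ degenerate X.
Hypothesis hnl : ~ lattice X.
Context (d : measure_display) (T : measurableType d) (P : probability T R).
Variable Xs : nat -> nat -> {RV P >-> R}.
Hypothesis hind : independent (fun k : nat * nat => Xs k.1 k.2).
Hypothesis hcopy : forall (i j : nat) (B : set R), measurable B ->
  distribution P (Xs i j) B = distribution P0 X B.
Variables (c alpha : R) (N : nat -> nat).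
Hypotheses (a0 : 0 < alpha) (a2 : alpha < 2) (c_gt0 : 0 < c).
Hypothesis hN : expR (- c * n%:R) * (N n)%:R @[n --> \oo] --> (1 : R).
Notation phi := (log_mgf X).
Hypothesis hc : c = alpha * derive1 phi alpha - phi alpha.

Notation mu := (@lebesgue_measure R).
Notation b := (scale_exponent phi alpha).
Notation W := (rowshift X Xs alpha).
Notation Re := complex.Re.
Notation Im := complex.Im.

Lemma decay_limit (g : R -> R) (x0 : R) : measurable_fun setT g ->
  exp_decay (fun x => g x * expR (- alpha * x)) ->
  (forall x, x != x0 -> {for x, continuous g}) ->
  (N n.+1)%:R * \int[P]_t g (W n.+1 t) @[n --> \oo] -->
  alpha * \int[mu]_x (g x * expR (- alpha * x)).
Proof.
move=> mg /exp_decay_ker[B hB] cg.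
exact: (local_limit hfin hnd hnl hind hcopy a0 hN hc mg hB cg).
Qed.

Lemma rows_cvgy : (\forall n \near \oo, (0 < N n.+1)%N) /\
  (N n.+1)%:R^-1 @[n --> \oo] --> (0 : R).
Proof.
have h : expR (- c * n.+1%:R) * (N n.+1)%:R @[n --> \oo] --> (1 : R).
  by rewrite (cvg_shiftS (fun n => expR (- c * n%:R) * (N n)%:R)).
have p : \forall n \near \oo, (0 < N n.+1)%N.
  have : \forall n \near \oo, 0 < expR (- c * n.+1%:R) * (N n.+1)%:R by exact: (cvgr_gt _ h).
  by apply: filterS => n; rewrite pmulr_rgt0 ?expR_gt0// ltr0n.
split=> //.
have e : expR (- (c * n.+1%:R)) @[n --> \oo] --> (0 : R).
  by have := @expR_nat_cvg0 R c c_gt0; rewrite -(cvg_shiftS (fun n => expR (- (c * n%:R)))).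
have : expR (- (c * n.+1%:R)) * (expR (- c * n.+1%:R) * (N n.+1)%:R)^-1
    @[n --> \oo] --> (0 * 1^-1 : R).
  by apply: cvgM => //; apply: cvgV.
rewrite mul0r; apply: cvg_trans; apply: near_eq_cvg; apply: filterS p => n n0.
rewrite mulNr; have : (N n.+1)%:R != 0 :> R by rewrite pnatr_eq0 -lt0n.
have := expR_gt0 (- (c * n.+1%:R)); move: (expR _) ((N n.+1)%:R) => x y x0 y0.
by field; rewrite y0 gt_eqF.
Qed.

Lemma exp_shift_intble (a : R) n : 0 <= a -> intble P (fun t => expR (a * W n t)).
Proof.
move=> h; have [i _] := rowsum_mgf hfin hind hcopy 0 n h.
have := intbleZ (expR (- (a * b n))) i; congr intble; apply/funext => t.
by rewrite /rowshift -expRD; congr expR; ring.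
Qed.

Let mW n : measurable_fun setT (W n). Proof. exact: rowshift_measurable. Qed.

Lemma exp1_shift_intble n : intble P (fun t => expR (W n t)).
Proof. by have := exp_shift_intble n ler01; under eq_fun do rewrite mul1r. Qed.

Lemma neg_shift_measurable (K : R) : measurable_fun setT (fun x : R => neg (x - K)).
Proof. by apply: (measurableT_comp (@neg_measurable R)); exact: measurable_funB. Qed.

Lemma stable_comp_ge0 x : 0 <= stable_comp alpha x.
Proof. by rewrite /stable_comp; case: ifP => // _; case: ifP => // _; exact: neg_ge0. Qed.

Lemma stable_comp_le1 x : stable_comp alpha x <= 1.
Proof. by rewrite /stable_comp; case: ifP => // _; case: ifP => // _; exact: neg_le1. Qed.

Definition row_comp n : R := \int[P]_t (expR (W n t) * stable_comp alpha (W n t)).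

Lemma row_comp_intble n : intble P (fun t => expR (W n t) * stable_comp alpha (W n t)).
Proof.
under eq_fun do rewrite mulrC.
apply: (intbleM (M := 1)); last exact: exp1_shift_intble.
  exact: (measurableT_comp (@stable_comp_measurable R alpha)).
by move=> t; rewrite ger0_norm ?stable_comp_ge0 ?stable_comp_le1.
Qed.

Lemma row_comp_ge0 n : 0 <= row_comp n.
Proof. by apply: Rint_ge0 => t; rewrite mulr_ge0 ?expR_ge0 ?stable_comp_ge0. Qed.

Definition low_square (K x : R) : R := expR (2 * x) * neg (x - K).

(** An exponent strictly below alpha, such that e^(theta x) dominates e^x times the compensator
    above the level K <= 0. For alpha > 1 the compensator is 1 and the exponent must be 1; for alpha
    <= 1 the product is at most 1. *)
Let theta : R := if 1 < alpha then 1 else 0.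

Definition high_part (K x : R) : R := expR (theta * x) * (1 - neg (x - K)).

Let theta_ge0 : 0 <= theta. Proof. by rewrite /theta; case: ifP. Qed.
Let theta_lt : theta < alpha. Proof. by rewrite /theta; case: ifP. Qed.

Lemma comp_split (K x : R) : K <= 0 ->
  expR x * stable_comp alpha x <= expR x * neg (x - K) + high_part K x.
Proof.
move=> K0; rewrite /high_part; have [h|h] := lerP x K.
  rewrite neg_npos ?subr_le0// subrr mulr0 addr0 ler_wpM2l ?expR_ge0//.
  exact: stable_comp_le1.
rewrite neg_pos ?subr_gt0// subr0 mulr0 add0r mulr1 /theta /stable_comp.
have [a1|a1|a1] := ltgtP alpha 1.
- by rewrite mulr0 expR_ge0.
- by rewrite mulr1 mul1r.
rewrite mul0r expR0; have [x0|x0] := lerP x 0; last by rewrite neg_pos// mulr0.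
by rewrite neg_npos// mulr1 expR_le1.
Qed.

Lemma half_exp_decay (K : R) : K <= 0 ->
  exp_decay (fun x => expR ((2 - alpha) * x) * neg (x - K)).
Proof.
move=> K0; have p : 0 < 2 - alpha by rewrite subr_gt0.
apply: (@exp_decay_intro R _ 1 _ 1 p) => // x x0.
  by rewrite mul1r ger0_norm ?mulr_ge0 ?expR_ge0 ?neg_ge0// ler_piMr ?expR_ge0 ?neg_le1.
have [h|h] := lerP x K.
  have -> : x = 0 by apply/le_anti; rewrite x0 (le_trans h).
  by rewrite !mulr0 expR0 mulr1 mul1r ger0_norm ?neg_ge0 ?neg_le1.
by rewrite neg_pos ?subr_gt0// mulr0 normr0 mulr_ge0 ?expR_ge0.
Qed.

Lemma low_square_limit (K : R) : K <= 0 ->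
  (N n.+1)%:R * \int[P]_t low_square K (W n.+1 t) @[n --> \oo] -->
  alpha * (expR ((2 - alpha) * K) * \int[mu]_x (expR ((2 - alpha) * x) * neg x)).
Proof.
move=> K0; have p : 0 < 2 - alpha by rewrite subr_gt0.
have E (x : R) : low_square K x * expR (- alpha * x) = expR ((2 - alpha) * x) * neg (x - K).
  by rewrite /low_square mulrAC -expRD; congr (expR _ * _); ring.
have mn : measurable_fun setT (fun x : R => expR ((2 - alpha) * x) * neg x).
  apply: measurable_funM; last exact: neg_measurable.
  exact: continuous_measurable_fun (@expM_continuous R _).
have in0 : intble mu (fun x => expR ((2 - alpha) * x) * neg x).
  apply: exp_decay_intble => //.
  by have := half_exp_decay (lexx 0); under eq_fun do rewrite subr0.
have [_ e] := Rint_shift (- K) in0.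
have -> : expR ((2 - alpha) * K) * \int[mu]_x (expR ((2 - alpha) * x) * neg x) =
    \int[mu]_x (low_square K x * expR (- alpha * x)).
  have [i' _] := Rint_shift (- K) in0; rewrite -e -RintZ//; apply: eq_Rint => x.
  by rewrite E mulrA -expRD; congr (expR _ * _); ring.
apply: (@decay_limit _ K).
- apply: measurable_funM; last exact: neg_shift_measurable.
  exact: continuous_measurable_fun (@expM_continuous R _).
- by under eq_fun do rewrite E; exact: half_exp_decay.
- move=> x xK; apply: cvgM; first exact: expM_continuous.
  have cn : {for x - K, continuous (@neg R)} by apply: neg_continuous; rewrite subr_eq0.
  apply: (@cvg_comp _ _ _ (fun y => y - K) (@neg R) _ _ _ _ cn).
  by apply: cvgB; [exact: cvg_id|exact: cvg_cst].
Qed.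

Lemma high_part_limit (K : R) : K <= 0 -> exists l : R,
  (N n.+1)%:R * \int[P]_t high_part K (W n.+1 t) @[n --> \oo] --> l.
Proof.
move=> K0; eexists; have p : 0 < alpha - theta by rewrite subr_gt0.
apply: (@decay_limit _ K).
- apply: measurable_funM.
    exact: continuous_measurable_fun (@expM_continuous R _).
  by apply: measurable_funB => //; exact: neg_shift_measurable.
- have E (x : R) : high_part K x * expR (- alpha * x) =
      expR (- (alpha - theta) * x) * (1 - neg (x - K)).
    by rewrite /high_part mulrAC -expRD; congr (expR _ * _); ring.
  have n1 (x : R) : 0 <= 1 - neg (x - K) <= 1.
    by have := neg_ge0 (x - K); have := neg_le1 (x - K); lra.
  (* On []K, 0]], where the left branch does not vanish, this constant bounds e^(- (alpha - theta +
     1) x). *)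
  apply: (@exp_decay_intro R _ (expR ((alpha - theta + 1) * - K)) 1 (alpha - theta)) => // x x0.
    rewrite E; have [h|h] := lerP x K.
      by rewrite neg_npos ?subr_le0// subrr mulr0 normr0 mulr_ge0 ?expR_ge0.
    rewrite ger0_norm ?mulr_ge0 ?expR_ge0//; last by have /andP[] := n1 x.
    apply: (@le_trans _ _ (expR (- (alpha - theta) * x))).
      by rewrite ler_piMr ?expR_ge0//; have /andP[] := n1 x.
    by rewrite -expRD ler_expR; nra.
  rewrite E ger0_norm ?mulr_ge0 ?expR_ge0//; last by have /andP[] := n1 x.
  apply: (@le_trans _ _ (expR (- (alpha - theta) * x))).
    by rewrite ler_piMr ?expR_ge0//; have /andP[] := n1 x.
  rewrite ler_peMl ?expR_ge0// -expR0 ler_expR mulr_ge0 ?oppr_ge0//.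
  by rewrite addr_ge0 ?(ltW p).
- move=> x xK; apply: cvgM; first exact: expM_continuous.
  apply: cvgB; first exact: cvg_cst.
  have cn : {for x - K, continuous (@neg R)} by apply: neg_continuous; rewrite subr_eq0.
  apply: (@cvg_comp _ _ _ (fun y => y - K) (@neg R) _ _ _ _ cn).
  by apply: cvgB; [exact: cvg_id|exact: cvg_cst].
Qed.

(** The mean a_n is split at the level K. For the part below K the square of the mean is at most the
    mean of the square, which the local limit controls since 2 > alpha. The part above K has a mean
    of order 1 / N_n, so N_n times its square is written as a bounded square divided by N_n. *)
Lemma row_comp_sqr_le (K : R) n : K <= 0 ->
  (N n)%:R * row_comp n ^+ 2 <= 2 * ((N n)%:R * \int[P]_t low_square K (W n t)) +
    2 * (((N n)%:R * \int[P]_t high_part K (W n t)) ^+ 2 * (N n)%:R^-1).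
Proof.
move=> K0; set G := \int[P]_t high_part K (W n t).
have mneg : measurable_fun setT (fun t => neg (W n t - K)).
  exact: (measurableT_comp (@neg_shift_measurable K)).
have bneg t : `|neg (W n t - K)| <= 1 by rewrite ger0_norm ?neg_ge0 ?neg_le1.
have i1 : intble P (fun t => expR (W n t) * neg (W n t - K)).
  under eq_fun do rewrite mulrC.
  by apply: (intbleM (M := 1)) => //; exact: exp1_shift_intble.
have i2 : intble P (fun t => low_square K (W n t)).
  rewrite /low_square; under eq_fun do rewrite mulrC.
  by apply: (intbleM (M := 1)) => //; exact: exp_shift_intble.
have i3 : intble P (fun t => high_part K (W n t)).
  rewrite /high_part; under eq_fun do rewrite mulrC.
  apply: (intbleM (M := 1)); last exact: exp_shift_intble.
    exact: measurable_funB.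
  by move=> t; have := neg_ge0 (W n t - K); have := neg_le1 (W n t - K); rewrite ler_norml; lra.
set p := \int[P]_t (expR (W n t) * neg (W n t - K)).
have h1 : row_comp n <= p + G.
  rewrite -RintD//; apply: Rint_le; [exact: row_comp_intble|exact: intbleD|] => t.
  exact: comp_split.
have E t : (expR (W n t) * neg (W n t - K)) ^+ 2 = low_square K (W n t).
  rewrite /low_square exprMn expRM_natl; congr (_ * _).
  by have [h|h] := lerP (W n t - K) 0; rewrite ?(neg_npos h) ?(neg_pos h) ?expr1n ?expr0n.
have h2 : p ^+ 2 <= \int[P]_t low_square K (W n t).
  rewrite -(eq_Rint _ E); apply: sqr_Rint_le => //.
  by under eq_fun do rewrite E.
have h3 : row_comp n ^+ 2 <= 2 * p ^+ 2 + 2 * G ^+ 2.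
  have := row_comp_ge0 n; have : 0 <= (p - G) ^+ 2 by exact: sqr_ge0.
  by move: (row_comp n) h1 => r; nra.
have -> : ((N n)%:R * G) ^+ 2 * (N n)%:R^-1 = (N n)%:R * G ^+ 2.
  have [->|n0] := eqVneq ((N n)%:R : R) 0; first by rewrite !mul0r expr0n mul0r.
  by field.
move: ((N n)%:R : R) (ler0n R (N n)) => k k0.
by have := ler_wpM2l k0 h2; have := ler_wpM2l k0 h3; lra.
Qed.

(** As n grows, the bound of [row_comp_sqr_le] tends to a constant times e^((2 - alpha) K), because
    the high part vanishes; this is arbitrarily small for K near minus infinity. *)
Lemma row_comp_sqr_cvg0 : (N n.+1)%:R * row_comp n.+1 ^+ 2 @[n --> \oo] --> (0 : R).
Proof.
have [_ cN] := rows_cvgy.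
apply/cvgr0Pnorm_le => e e0.
pose J := \int[mu]_x (expR ((2 - alpha) * x) * neg x).
have p : 0 < 2 - alpha by rewrite subr_gt0.
have : 2 * (alpha * (expR (- ((2 - alpha) * k%:R)) * J)) @[k --> \oo] --> (0 : R).
  have := @expR_nat_cvg0 R _ p => h.
  rewrite [X in _ --> X](_ : 0 = 2 * (alpha * (0 * J))); last by rewrite mul0r !mulr0.
  by apply: cvgMl_tmp; apply: cvgMl_tmp; exact: cvgMr_tmp.
move=> cK.
have : \forall k \near \oo, 2 * (alpha * (expR (- ((2 - alpha) * k%:R)) * J)) < e.
  exact: (cvgr_lt _ cK).
(* The level K = - k is fixed here, before n tends to infinity. *)
case=> k _ /(_ k (leqnn k)) hk.
have K0 : - k%:R <= 0 :> R by rewrite oppr_le0.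
have c1 := low_square_limit K0; have [l c2] := high_part_limit K0.
have c3 : 2 * ((N n.+1)%:R * \int[P]_t low_square (- k%:R) (W n.+1 t)) +
    2 * (((N n.+1)%:R * \int[P]_t high_part (- k%:R) (W n.+1 t)) ^+ 2 * (N n.+1)%:R^-1)
    @[n --> \oo] --> 2 * (alpha * (expR ((2 - alpha) * - k%:R) * J)) + 2 * (l ^+ 2 * 0).
  apply: cvgD; first exact: cvgMl_tmp.
  by apply: cvgMl_tmp; apply: cvgM => //; exact: (cvgM c2 c2).
have hl : 2 * (alpha * (expR ((2 - alpha) * - k%:R) * J)) + 2 * (l ^+ 2 * 0) < e.
  by rewrite !mulr0 addr0 mulrN.
have : \forall n \near \oo, 2 * ((N n.+1)%:R * \int[P]_t low_square (- k%:R) (W n.+1 t)) +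
    2 * (((N n.+1)%:R * \int[P]_t high_part (- k%:R) (W n.+1 t)) ^+ 2 * (N n.+1)%:R^-1) < e.
  exact: (cvgr_lt _ c3 _ hl).
apply: filterS => n /ltW; apply: le_trans.
apply: le_trans (row_comp_sqr_le n.+1 K0).
by rewrite ger0_norm// mulr_ge0 ?sqr_ge0.
Qed.

Lemma row_comp_cvg0 : row_comp n.+1 @[n --> \oo] --> (0 : R).
Proof.
have [p _] := rows_cvgy; apply/cvgr0Pnorm_le => e e0.
have /cvgr0Pnorm_le /(_ _ (exprn_gt0 2 e0)) h := row_comp_sqr_cvg0.
near=> n; have n0 : (0 < N n.+1)%N by near: n.
have hn : `|(N n.+1)%:R * row_comp n.+1 ^+ 2| <= e ^+ 2 by near: n.
rewrite ger0_norm ?mulr_ge0 ?row_comp_ge0// in hn.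
have r0 := row_comp_ge0 n.+1; rewrite ger0_norm// -(@ler_sqr R) ?nnegrE ?(ltW e0)//.
by apply: le_trans hn; rewrite ler_peMl ?sqr_ge0// ler1n.
Unshelve. all: end_near. Qed.

Definition row_char n u : R[i] :=
  cexpect P (fun=> 1) (fun t => u * (expR (W n t) - row_comp n)).

Let i1 : intble P (fun=> 1). Proof. exact: (@intble_bounded _ _ _ P _ `|1|). Qed.

Let mexpW n : measurable_fun setT (fun t => expR (W n t)).
Proof. exact: (measurableT_comp (@measurable_expR R)). Qed.

Let mphase n u : measurable_fun setT (fun t => u * (expR (W n t) - row_comp n)).
Proof. by apply: measurable_funM => //; exact: measurable_funB. Qed.

Lemma row_char_le1 n u : Normc.normc (row_char n u) <= 1.
Proof.
rewrite -[leRHS](Rint_cst_prob P 1); apply: normc_cexpect_le => //.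
Qed.

(** With q = u a_n the characteristic function is (1 + J1 + i (J2 + q)) e^(- i q): the compensator
    subtracted in [jump_im] has mean q, which is added back, and the phase e^(- i q) is the
    centering. *)
Lemma row_charE n u : let q := u * row_comp n in
  let J1 := \int[P]_t jump_re u (W n t) in
  let J2 := \int[P]_t jump_im alpha u (W n t) in
  Re (row_char n u) = (J1 + 1) * cos q + (J2 + q) * sin q /\
  Im (row_char n u) = (J2 + q) * cos q - (J1 + 1) * sin q.
Proof.
move=> q J1 J2.
have mu1 : measurable_fun setT (fun t => u * expR (W n t)) by exact: measurable_funM.
have ic : intble P (fun t => cos (u * expR (W n t))).
  apply: (@intble_bounded _ _ _ P _ 1) => [|t]; last exact: cos_norm.
  by apply: measurableT_comp mu1; exact: continuous_measurable_fun (@continuous_cos R).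
have is' : intble P (fun t => sin (u * expR (W n t))).
  apply: (@intble_bounded _ _ _ P _ 1) => [|t]; last exact: sin_norm.
  by apply: measurableT_comp mu1; exact: continuous_measurable_fun (@continuous_sin R).
have e1 : J1 + 1 = \int[P]_t cos (u * expR (W n t)).
  by rewrite /J1 /jump_re RintB// Rint_cst_prob subrK.
have e2 : J2 + q = \int[P]_t sin (u * expR (W n t)).
  have iq := intbleZ u (row_comp_intble n).
  rewrite /q /J2 -(RintZ u (row_comp_intble n)) -RintD//.
    by apply: eq_Rint => t; rewrite /jump_im -mulrA subrK.
  rewrite /jump_im; apply: intbleB => //.
  by move: iq; congr intble; apply/funext => t; rewrite mulrA.
have iZr (f : T -> R) r : intble P f -> intble P (fun t => f t * r).
  by move=> /(intbleZ r); under eq_fun do rewrite mulrC.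
rewrite /row_char /cexpect /= e1 e2; split.
  rewrite -!RintZr// -RintD; [|exact: iZr..].
  by apply: eq_Rint => t; rewrite mul1r mulrBr cosB.
rewrite -!RintZr// -RintB; [|exact: iZr..].
by apply: eq_Rint => t; rewrite mul1r mulrBr sinB; ring.
Qed.

(** N_n J1 and N_n J2 converge by the local limit. Apart from them, the centering leaves cos q - 1 +
    q sin q and q cos q - sin q, in which the terms of first order in q cancel; N_n q^2 -> 0 removes
    them. *)
Lemma row_char_cvg u :
  (N n.+1)%:R * (Re (row_char n.+1 u) - 1) @[n --> \oo] --> Re (stable_log_charfun alpha u) /\
  (N n.+1)%:R * Im (row_char n.+1 u) @[n --> \oo] --> Im (stable_log_charfun alpha u).
Proof.
rewrite -stable_exponent// ![Re (Complex _ _)]/= ![Im (Complex _ _)]/=.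
pose q n := u * row_comp n.+1.
pose J1 n := \int[P]_t jump_re u (W n.+1 t).
pose J2 n := \int[P]_t jump_im alpha u (W n.+1 t).
set l1 := alpha * _; set l2 := alpha * _.
have c1 : (N n.+1)%:R * J1 n @[n --> \oo] --> l1.
  apply: (@decay_limit _ 0); last by move=> x _; exact: jump_re_continuous.
    exact: continuous_measurable_fun (@jump_re_continuous R u).
  exact: jump_re_decay.
have c2 : (N n.+1)%:R * J2 n @[n --> \oo] --> l2.
  apply: (@decay_limit _ 0); last by move=> x; exact: jump_im_continuous.
    exact: jump_im_measurable.
  exact: jump_im_decay.
have cq : q n @[n --> \oo] --> (0 : R).
  by rewrite -[X in _ --> X](mulr0 u); apply: cvgMl_tmp; exact: row_comp_cvg0.
have cq2 : (N n.+1)%:R * q n ^+ 2 @[n --> \oo] --> (0 : R).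
  rewrite -[X in _ --> X](mulr0 (u ^+ 2)).
  apply: cvg_ext (cvgMl_tmp row_comp_sqr_cvg0) => n; rewrite /q; ring.
have ccos : cos (q n) @[n --> \oo] --> (1 : R).
  by rewrite -[X in _ --> X](@cos0 R); exact: (cvg_comp _ _ cq (@continuous_cos R 0)).
have csin : sin (q n) @[n --> \oo] --> (0 : R).
  by rewrite -[X in _ --> X](@sin0 R); exact: (cvg_comp _ _ cq (@continuous_sin R 0)).
have small (r : nat -> R) : (forall n, `|r n| <= 2 * q n ^+ 2) ->
    (N n.+1)%:R * r n @[n --> \oo] --> (0 : R).
  move=> hr; have cb : 2 * ((N n.+1)%:R * q n ^+ 2) @[n --> \oo] --> (0 : R).
    by rewrite -[X in _ --> X](mulr0 2); exact: cvgMl_tmp.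
  apply/norm_cvg0P; apply: (squeeze_cvgr _ (cvg_cst (0:R)) cb); apply: nearW => n.
  by rewrite normr_ge0/= normrM ger0_norm// mulrCA ler_wpM2l.
split.
  have s1 : (N n.+1)%:R * (cos (q n) - 1 + q n * sin (q n)) @[n --> \oo] --> (0 : R).
    apply: small => n; apply: (le_trans (ler_normD _ _)); rewrite normrM distrC.
    have h1 := cosB_norm_le (q n); have h2 := sin_norm_le (q n).
    have := ler_wpM2l (normr_ge0 (q n)) h2; rewrite -expr2 sqr_abs.
    by have := sqr_ge0 (q n); lra.
  rewrite [X in _ --> X](_ : l1 = l1 * 1 + l2 * 0 + 0); last by ring.
  apply: cvg_ext (cvgD (cvgD (cvgM c1 ccos) (cvgM c2 csin)) s1) => n.
  by have [-> _] := row_charE n.+1 u; rewrite -/(q n) -/(J1 n) -/(J2 n) ?fctE/=; ring.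
have s2 : (N n.+1)%:R * (q n * cos (q n) - sin (q n)) @[n --> \oo] --> (0 : R).
  apply: small => n.
  have -> : q n * cos (q n) - sin (q n) = - (q n * (1 - cos (q n))) - (sin (q n) - q n) by ring.
  apply: (le_trans (ler_normB _ _)); rewrite normrN normrM.
  have h1 := cos_lipschitz 0 (q n); rewrite cos0 sub0r normrN in h1.
  have := ler_wpM2l (normr_ge0 (q n)) h1; rewrite -expr2 sqr_abs.
  by have := sin_taylor2 (q n); lra.
rewrite [X in _ --> X](_ : l2 = l2 * 1 - l1 * 0 + 0); last by ring.
apply: cvg_ext (cvgD (cvgB (cvgM c2 ccos) (cvgM c1 csin)) s2) => n.
by have [_ ->] := row_charE n.+1 u; rewrite -/(q n) -/(J1 n) -/(J2 n) ?fctE/=; ring.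
Qed.

Definition row_jumps n t : R := \sum_(i < N n) (expR (rowsum Xs i n t - b n) - row_comp n).

Lemma row_jumps_measurable n : measurable_fun setT (row_jumps n).
Proof.
apply: measurable_sum => i; apply: measurable_funB => //.
apply: (measurableT_comp (@measurable_expR R)); apply: measurable_funB => //.
exact: rowsum_measurable.
Qed.

Lemma row_jumps_char n u :
  cexpect P (fun=> 1) (fun t => u * row_jumps n t) = row_char n u ^+ N n.
Proof.
pose h x : R := u * (expR (x - b n) - row_comp n).
have mh : measurable_fun setT h.
  apply: measurable_funM => //; apply: measurable_funB => //.
  by apply: (measurableT_comp (@measurable_expR R)); exact: measurable_funB.
rewrite -(rows_cexpect hind hcopy n (N n) mh); congr cexpect.
by apply/funext => t; rewrite mulr_sumr.
Qed.

Lemma row_jumps_cvg u :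
  Normc.normc (cexpect P (fun=> 1) (fun t => u * row_jumps n.+1 t) -
    cexp (stable_log_charfun alpha u)) @[n --> \oo] --> (0 : R).
Proof.
have [p cN] := rows_cvgy; have [cr ci] := row_char_cvg u.
under eq_fun do rewrite row_jumps_char.
apply: (@cpow_cvg R (fun n => row_char n.+1 u) (fun n => N n.+1)) => // [n|].
  exact: row_char_le1.
by rewrite stable_reE// oppr_le0 mulr_ge0 ?powR_ge0// ltW// stable_rate_gt0.
Qed.

(** Levy's theorem with weights 1 provides a limiting density. Cosine and sine are admissible test
    functions, so uniqueness of limits identifies the characteristic function; so are the indicators
    of half-lines, continuous off one point, which give the distribution functions. *)
Lemma stable_law_limit : exists2 F : probability (measurableTypeR R) R,
  is_stable_law alpha F & cvg_in_distribution P row_jumps F.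
Proof.
pose w (n : nat) (t : T) : R := 1.
pose V n := row_jumps n.+1.
pose C u := Re (cexp (stable_log_charfun alpha u)).
pose S u := Im (cexp (stable_log_charfun alpha u)).
have mV n : measurable_fun setT (V n) by exact: row_jumps_measurable.
have mw n : measurable_fun setT (w n) by exact: measurable_cst.
have w0 n t : 0 <= w n t by exact: ler01.
have iw n : intble P (w n) by exact: i1.
have cC u : wmean P w V n (fun x => cos (u * x)) @[n --> \oo] --> C u.
  apply/cvgrPdist_le => e e0; have /cvgr0Pnorm_le /(_ e e0) := row_jumps_cvg u.
  apply: filterS => n; rewrite ger0_norm ?normc_nneg//; apply: le_trans.
  by rewrite distrC; apply: le_trans (normc_geRe _); rewrite reD reN.
have cS u : wmean P w V n (fun x => sin (u * x)) @[n --> \oo] --> S u.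
  apply/cvgrPdist_le => e e0; have /cvgr0Pnorm_le /(_ e e0) := row_jumps_cvg u.
  apply: filterS => n; rewrite ger0_norm ?normc_nneg//; apply: le_trans.
  by rewrite distrC; apply: le_trans (normc_geIm _); rewrite imD imN.
have [iC iS] := stable_charfun_intble a0 a2.
have c0 := stable_charfun_continuous0 a0 a2.
have [ifd mass] := levy_density_mass mw mV w0 iw cC cS iC iS c0.
have f0 := levy_density_ge0 mw mV w0 iw cC cS iC iS.
rewrite {2}/C stable_charfun0// in mass.
have key (g : R -> R) (a B : R) : measurable_fun setT g -> (forall x, `|g x| <= B) ->
    (forall x, x != a -> {for x, continuous g}) ->
    wmean P w V n g @[n --> \oo] --> \int[density_prob (Density f0 ifd mass)]_x g x.
  move=> mg gB cg; rewrite (Rint_density _ mg gB).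
  exact: (wmean_cvg mw mV w0 iw cC cS iC iS c0 mg gB cg).
exists (density_prob (Density f0 ifd mass)).
  move=> u; rewrite /charfun; apply/eqP; rewrite eq_complex/=; apply/andP; split; apply/eqP.
    apply: (cvg_unique _ _ (cC u)) => //; apply: (key _ 0 1) => [|x|x _].
    - exact: continuous_measurable_fun (@continuous_cosM R u).
    - exact: cos_norm.
    - exact: continuous_cosM.
  apply: (cvg_unique _ _ (cS u)) => //; apply: (key _ 0 1) => [|x|x _].
  - exact: continuous_measurable_fun (@continuous_sinM R u).
  - exact: sin_norm.
  - exact: continuous_sinM.
move=> x _; rewrite -(cvg_shiftS (fun n => P (row_jumps n @^-1` _))).
have : (\int[P]_t neg (V n t - x))%:E @[n --> \oo] -->
    density_prob (Density f0 ifd mass) `]-oo, x]%classic; last first.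
  by apply: cvg_trans; apply: near_eq_cvg; apply: nearW => n; rewrite -prob_half_line.
rewrite (_ : density_prob _ _ = density_prob (Density f0 ifd mass) (id @^-1` `]-oo, x]%classic))//.
rewrite prob_half_line//; apply: cvg_EFin; first exact: nearW.
apply: cvg_ext (key (fun y => neg (y - x)) x 1 _ _ _) => [n||y|y yx].
- by apply: eq_Rint => t; rewrite mul1r.
- exact: neg_shift_measurable.
- by rewrite ger0_norm ?neg_ge0 ?neg_le1.
have cn : {for y - x, continuous (@neg R)} by apply: neg_continuous; rewrite subr_eq0.
apply: (@cvg_comp _ _ _ (fun y => y - x) (@neg R) _ _ _ _ cn).
by apply: cvgB; [exact: cvg_id|exact: cvg_cst].
Qed.

Lemma expR_log_mgf1 n : expR (phi 1 * n%:R) = emoment P0 X 0 1 ^+ n.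
Proof. by rewrite expRM_natr log_mgfE// lnK// posrE mgf_gt0. Qed.

Lemma expR_rowsum_intble i n : intble P (fun t => expR (rowsum Xs i n t)).
Proof.
by have [+ _] := rowsum_mgf hfin hind hcopy i n ler01; under eq_fun do rewrite mul1r.
Qed.

Lemma expR_rowsum_mean i n : \int[P]_t expR (rowsum Xs i n t) = expR (phi 1 * n%:R).
Proof.
have [_] := rowsum_mgf hfin hind hcopy i n ler01; rewrite expR_log_mgf1 => <-.
by apply: eq_Rint => t; rewrite mul1r.
Qed.

Lemma ZsumE n t : Zsum Xs N n t = \sum_(i < N n) expR (rowsum Xs i n t).
Proof. by apply: eq_bigr => i _; rewrite /rowsum expR_sum. Qed.

Lemma Zsum_mean n : 'E_P[Zsum Xs N n]%E = ((N n)%:R * expR (phi 1 * n%:R))%:E.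
Proof.
rewrite unlock; under eq_integral do rewrite ZsumE.
have H k : intble P (fun t => \sum_(i < k) expR (rowsum Xs i n t)) /\
    \int[P]_t (\sum_(i < k) expR (rowsum Xs i n t)) = k%:R * expR (phi 1 * n%:R).
  split; first by apply: intble_sum => i; exact: expR_rowsum_intble.
  elim: k => [|k ih]; first by under eq_Rint do rewrite big_ord0; rewrite Rint0 mul0r.
  under eq_Rint do rewrite big_ord_recr.
  rewrite RintD; first by rewrite ih expR_rowsum_mean -natr1; ring.
    by apply: intble_sum => i; exact: expR_rowsum_intble.
  exact: expR_rowsum_intble.
by have [i e] := H (N n); rewrite (Rint_fin i) e.
Qed.

(** The three cases of A_n are one formula, B_n N_n a_n. By [rate_increasing] the case distinction
    on c against c_1 is that of the compensator on alpha against 1, and W_n <= 0 means S_n <=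
    b_n. *)
Lemma centering_row_comp n :
  centering Xs N phi c alpha n = expR (b n) * ((N n)%:R * row_comp n).
Proof.
have eW t : expR (b n) * expR (W n t) = expR (rowsum Xs 0 n t).
  by rewrite -expRD /rowshift; congr expR; ring.
rewrite /centering /row_comp mulrCA -(RintZ _ (row_comp_intble n)).
under [in RHS]eq_Rint do rewrite mulrA eW.
have [a1|a1|a1] := ltgtP alpha 1.
- have h : c < derive1 phi 1 - phi 1.
    by have := rate_increasing hfin hnd a0 a1; rewrite mul1r hc.
  rewrite [_ < c]ltNge (ltW h) (lt_eqF h)/=.
  under eq_Rint do rewrite /stable_comp a1 mulr0.
  by rewrite Rint0 mulr0.
- have -> : derive1 phi 1 - phi 1 < c.
    by have := rate_increasing hfin hnd ltr01 a1; rewrite mul1r hc.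
  under eq_Rint do rewrite /stable_comp ltNge (ltW a1) (gt_eqF a1) mulr1.
  by rewrite Zsum_mean expR_rowsum_mean.
have -> : c = derive1 phi 1 - phi 1 by rewrite hc a1 mul1r.
rewrite ltxx eqxx; congr (_ * _).
rewrite unlock /Rintegral; congr fine; apply: eq_integral => t _; congr EFin.
rewrite /stable_comp a1 ltxx eqxx negE indicE subr_le0; congr (_ * _%:R); congr nat_of_bool.
by apply/idP/idP => [/set_mem|h]; rewrite ?inE.
Qed.

Lemma normalized_Zsum n t :
  (Zsum Xs N n t - centering Xs N phi c alpha n) / expR (b n) = row_jumps n t.
Proof.
have b0 := expR_gt0 (b n).
rewrite centering_row_comp ZsumE /row_jumps sumrB sumr_const card_ord.
rewrite mulrBl [expR (b n) * _]mulrC mulfK ?gt_eqF//.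
congr (_ - _); last by rewrite mulr_natl.
by rewrite mulr_suml; apply: eq_bigr => i _; rewrite expRB.
Qed.

End StableLimit.

Theorem theorem3 (R : realType)
  (d0 : measure_display) (T0 : measurableType d0) (P0 : probability T0 R)
  (X : {RV P0 >-> R})
  (hfin : forall t : R, 0 <= t -> ('M_P0 X t < +oo)%E)
  (hnd : ~ degenerate X)
  (hnl : ~ lattice X)
  (d : measure_display) (T : measurableType d) (P : probability T R)
  (Xs : nat -> nat -> {RV P >-> R})
  (hind : independent (fun k : nat * nat => Xs k.1 k.2))
  (hcopy : forall (i j : nat) (B : set R), measurable B ->
     distribution P (Xs i j) B = distribution P0 X B)
  (c alpha : R) (N : nat -> nat) :
  let phi := log_mgf X in
  let c2 := 2 * derive1 phi 2 - phi 2 in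
  0 < c -> c < c2 ->
  (expR (- c * n%:R) * (N n)%:R : R) @[n --> \oo] --> (1 : R) ->
  0 < alpha -> alpha < 2 ->
  rate phi (derive1 phi alpha) = c%:E ->
  let Z := Zsum Xs N in
  let A := centering Xs N phi c alpha in
  let B := fun n : nat => expR (scale_exponent phi alpha n) in
  (forall n : nat, ('E_P[Z n])%E = ((N n)%:R * expR (phi 1 * n%:R))%:E) /\
  exists2 F : probability (measurableTypeR R) R,
    is_stable_law alpha F &
    cvg_in_distribution P (fun n w => (Z n w - A n) / B n) F.
Proof.
move=> phi c2 c0 _ hN a0 a2 hrate Z A B.
have hc : c = alpha * derive1 phi alpha - phi alpha.
  by move: hrate; rewrite rate_log_mgf// => -[].
split; first by move=> n; exact: Zsum_mean.
have [F hF cF] := stable_law_limit hfin hnd hnl hind hcopy a0 a2 c0 hN hc.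
exists F => //; rewrite (_ : (fun n w => _) = row_jumps X Xs alpha N)//.
by apply/funext => n; apply/funext => t; exact: normalized_Zsum.
Qed.
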